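(* Let $a\ge1$, $g\ge0$, $n\ge1$ be integers with $(g,n)\ne(0,1)$. Then $$Q^{[a]}_{g,n+1}(\mu_1,\ldots,\mu_n,0)=(\mu_1+\cdots+\mu_n)\,Q^{[a]}_{g,n}(\mu_1,\ldots,\mu_n)$$ for all integers $\mu_1,\ldots,\mu_n$ if $2g-2+n>0$, and for all positive integers $\mu_1,\mu_2$ if $(g,n)=(0,2)$.
   Context: Orbifold Hurwitz numbers. For $g\ge0$, $n\ge1$ and a tuple $\mu=(\mu_1,\ldots,\mu_n)$ of positive integers, put $|\mu|=\sum\mu_i$ and $m=2g-2+n+\frac{|\mu|}{a}$. The orbifold Hurwitz number $H^{[a]}_{g;\mu}$ is the weighted count (weight $1/|\mathrm{Aut}\,\pi|$) of isomorphism classes of connected genus $g$ branched covers $\pi:\Sigma\to\mathbb{P}^1$ with ramification profile $\mu$ over $\infty$, profile $(a,\ldots,a)$ over $0$, and only other ramification simple, over $m$ fixed points; isomorphisms and automorphisms cover the identity of $\mathbb{P}^1$. It is zero unless $a\mid|\mu|$. Set $H^{[a]}_g(\mu)=H^{[a]}_{g;\mu}\,\frac{|\mathrm{Aut}\,\mu|}{m!}$ (zero if $a\nmid|\mu|$), where $\mathrm{Aut}\,\mu$ is the group of permutations leaving the tuple $\mu$ invariant. Define $Q^{[a]}_{g,n}$ on positive integers by $$H^{[a]}_g(\mu_1,\ldots,\mu_n)=a^{1-g+\sum_i\{\mu_i/a\}}\,Q^{[a]}_{g,n}(\mu_1,\ldots,\mu_n)\prod_{i=1}^nC(\mu_i),\qquad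 C(\mu)=\frac{\mu^{\lfloor\mu/a\rfloor}}{\lfloor\mu/a\rfloor!},$$ where $r=\lfloor r\rfloor+\{r\}$ is the decomposition into integer and fractional parts. For $2g-2+n>0$, $Q^{[a]}_{g,n}$ is a quasi-polynomial modulo $a$ (a consequence of the Johnson--Pandharipande--Tseng formula): for each residue class of $(\mu_1,\ldots,\mu_n)$ modulo $a$ it agrees with a polynomial. These polynomials are used to extend $Q^{[a]}_{g,n}$ to all integer arguments, in particular to $0$ (using the polynomial for the residue class $0$). *)

(* Defs.v *)
From HB Require Import structures.
From mathcomp Require Import all_boot all_order all_fingroup all_algebra.
From mathcomp Require Import all_classical all_reals all_analysis.
From mathcomp Require Import complex.
From mathcomp Require mpoly.
Set Implicit Arguments.
Unset Strict Implicit.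
Unset Printing Implicit Defensive.
Import Order.TTheory GRing.Theory Num.Theory.
Import numFieldNormedType.Exports.
Local Open Scope classical_set_scope.
Local Open Scope ring_scope.

(* R[i] is seen as a [numFieldType] because the topology of a numeric field is
   attached to that structure. *)
Definition Cplx (R : realType) : numFieldType := complex R.

Definition P1 (R : realType) : topologicalType :=
  one_point_compactification (Cplx R).

Definition P1pt (R : realType) (z : Cplx R) : P1 R := Some z.
Definition P1infty (R : realType) : P1 R := None.

Definition homeo_on (X Y : topologicalType) (A : set X) (B : set Y)
    (f : X -> Y) : Prop :=
  [/\ set_bij A B f,
      {within A, continuous f}
    & exists2 h : Y -> X,
        {within B, continuous h} & forall x, A x -> h (f x) = x].

Definition unit_disc (R : realType) : set (Cplx R) := [set z | `|z| < 1].

(* In suitable charts at x and at f x, the map f is z |-> z ^+ k. *)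
Definition ramification_index (R : realType) (X : topologicalType)
    (f : X -> P1 R) (x : X) (k : nat) : Prop :=
  (0 < k)%N /\
  exists (U : set X) (V : set (P1 R))
         (phi : X -> Cplx R) (psi : P1 R -> Cplx R),
    [/\ open U /\ U x,
        open V /\ V (f x),
        homeo_on U (@unit_disc R) phi /\ phi x = 0,
        homeo_on V (@unit_disc R) psi /\ psi (f x) = 0
      & forall u, U u -> V (f u) /\ psi (f u) = phi u ^+ k].

(* The fibre over y consists of [size s] distinct points, whose ramification
   indices are the entries of s.  The order of s is immaterial. *)
Definition ramification_profile (R : realType) (X : topologicalType)
    (f : X -> P1 R) (y : P1 R) (s : seq nat) : Prop :=
  exists x : 'I_(size s) -> X,
    [/\ injective x,
        range x = f @^-1` [set y]
      & forall i, ramification_index f (x i) (nth 0%N s i)].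

(* X is partitioned into the open cells Phi i (|v| < 1).  The sup norm makes
   the closed unit ball of 'rV[R]_d a cube, which is homeomorphic to the closed
   d-disc.  On a compact Hausdorff space this is a finite CW structure. *)
Definition cell_structure (R : realType) (X : topologicalType) (N : nat)
    (dim : 'I_N -> nat) (Phi : forall i, 'rV[R]_(dim i) -> X) : Prop :=
  [/\ forall i, {within [set v | `|v| <= 1], continuous (Phi i)},
      forall x, exists i, exists2 v : 'rV[R]_(dim i), `|v| < 1 & Phi i v = x,
      forall i (v w : 'rV[R]_(dim i)),
        `|v| < 1 -> `|w| < 1 -> Phi i v = Phi i w -> v = w,
      forall i j (v : 'rV[R]_(dim i)) (w : 'rV[R]_(dim j)),
        `|v| < 1 -> `|w| < 1 -> Phi i v = Phi j w -> i = j
    & forall i (v : 'rV[R]_(dim i)), `|v| = 1 ->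
        exists2 j, (dim j < dim i)%N &
          exists2 w : 'rV[R]_(dim j), `|w| < 1 & Phi j w = Phi i v].

(* Used for closed connected orientable surfaces only, where genus g means
   Euler characteristic 2 - 2g. *)
Definition has_genus (R : realType) (X : topologicalType) (g : nat) : Prop :=
  exists (N : nat) (dim : 'I_N -> nat) (Phi : forall i, 'rV[R]_(dim i) -> X),
    cell_structure Phi /\ \sum_(i < N) (-1) ^+ dim i = 2 - 2 * g%:Z.

Record cover (R : realType) := Cover {
  total : topologicalType;
  proj : total -> P1 R
}.

Definition branched_cover (R : realType) (X : cover R) : Prop :=
  [/\ compact [set: total X],
      hausdorff_space (total X)
    & forall x, exists k, ramification_index (@proj _ X) x k].

Definition cover_iso (R : realType) (X Y : cover R) (f : total X -> total Y) :
    Prop :=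
  [/\ continuous f,
      (exists h : total Y -> total X,
         [/\ continuous h, cancel f h & cancel h f])
    & forall x, proj (f x) = proj x].

Definition hurwitz_cover (R : realType) (bs : seq (Cplx R)) (a g : nat)
    (mu : seq nat) (X : cover R) : Prop :=
  [/\ branched_cover X,
      connected [set: total X],
      has_genus R (total X) g
    & [/\ ramification_profile (@proj _ X) (P1infty R) mu,
          (exists k, ramification_profile (@proj _ X) (P1pt 0) (nseq k a)),
          (forall z, z \in bs -> exists k,
             ramification_profile (@proj _ X) (P1pt z) (2%N :: nseq k 1%N))
        & forall z, z != 0 -> z \notin bs -> exists k,
             ramification_profile (@proj _ X) (P1pt z) (nseq k 1%N)]].

(* F lists one representative of each isomorphism class, and k i is the order
   of the automorphism group of F i. *)
Definition weighted_count (R : realType) (P : cover R -> Prop) (h : R) : Prop :=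
  exists (N : nat) (F : 'I_N -> cover R) (k : 'I_N -> nat),
    [/\ forall i, P (F i),
        forall i j, (exists f, @cover_iso _ (F i) (F j) f) -> i = j,
        forall X, P X -> exists i f, @cover_iso _ X (F i) f,
        forall i, ([set f | @cover_iso _ (F i) (F i) f] #= `I_(k i))%card
      & h = \sum_(i < N) (k i)%:R^-1].

Section OrbifoldHurwitz.
Variables (R : realType).
(* b m gives the m fixed points carrying the simple ramification. *)
Variable b : forall m, m.-tuple (Cplx R).
Variables (a g n : nat).

Definition num_simple (mu : n.-tuple nat) : nat :=
  (2 * g + n + sumn mu %/ a - 2)%N.

Definition hurwitz_number (mu : n.-tuple nat) : R :=
  xget 0 [set h | weighted_count (hurwitz_cover (b (num_simple mu)) a g mu) h].

Definition tuple_aut (mu : n.-tuple nat) : {pred 'S_n} :=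
  [pred s : 'S_n | [forall i, tnth mu (s i) == tnth mu i]].

Definition hurwitzH (mu : n.-tuple nat) : R :=
  if (a %| sumn mu)%N then
    hurwitz_number mu * (#|tuple_aut mu|%:R / (num_simple mu)`!%:R)
  else 0.

Definition hurwitzC (k : nat) : R := (k ^ (k %/ a))%:R / (k %/ a)`!%:R.

Definition hurwitzQ (mu : n.-tuple nat) : R :=
  hurwitzH mu / (a%:R `^ (1 - g%:R + \sum_(i < n) (tnth mu i %% a)%:R / a%:R)
          * \prod_(i < n) hurwitzC (tnth mu i)).

End OrbifoldHurwitz.

Definition quasi_polynomial (R : realType) (a n : nat)
    (f : n.-tuple int -> R) : Prop :=
  exists p : n.-tuple int -> mpoly.mpoly n R, forall mu : n.-tuple int,
    f mu = mpoly.meval (fun i => (tnth mu i)%:~R)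
             (p (map_tuple (fun k => (k %% a%:Z)%Z) mu)).

Definition quasi_polynomial_extension (R : realType) (a n : nat)
    (f : n.-tuple nat -> R) (fbar : n.-tuple int -> R) : Prop :=
  quasi_polynomial a fbar /\
  forall mu : n.-tuple nat, (forall i, (0 < tnth mu i)%N) ->
    fbar (map_tuple Posz mu) = f mu.

(* Main.v *)
Require Import Defs.
From HB Require Import structures.
From mathcomp Require Import all_boot all_order all_fingroup all_algebra.
From mathcomp Require Import all_classical all_reals all_analysis.
From mathcomp Require Import complex.
From mathcomp Require Import lra ring zify.
From mathcomp Require Import separable.
From mathcomp Require mpoly.
Require Import Defs.
Set Implicit Arguments.
Unset Strict Implicit.
Unset Printing Implicit Defensive.
Import Order.TTheory GRing.Theory Num.Theory.
Import numFieldNormedType.Exports.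
Local Open Scope classical_set_scope.
Local Open Scope ring_scope.

(* A branched cover is rebuilt from its monodromy: cutting the plane along horizontal
   rays from the branch points trivializes it, so covers up to isomorphism are
   transitive tuples of permutations up to conjugation, and H_g(mu) is a count of such
   tuples.  Multiplying by one more transposition gives the cut-and-join recursion.
   In the variable z with x = z e^(-z^a), Lagrange inversion turns a series in x whose
   coefficients are C(nu) times a quasi-polynomial in nu into a rational function of z
   that is regular at infinity, with value minus the polynomial of residue class 0 at
   nu = 0.  Evaluating the cut-and-join equation for (mu, nu) at z = infinity, where the
   unstable terms combine into regular ones, then determines Q(mu, 0) by induction;
   quasi-polynomiality extends the identity from positive to all integer arguments. *)

(** Each point over infinity carries a chosen sheet. This absorbs the automorphism factors and the
    products of ramification indices, so cut-and-join becomes a sum over ordered lists with integer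
    weights. The obstacle lies at [z] = infinity: of the genus 0 series with at most two points over
    infinity, one is [z^a], with a pole, and the other contains [exp(q z^a)], with an essential
    singularity. Subtracting the explicit singular parts [Zu] and [Zv] leaves series regular at
    infinity, and the same subtraction absorbs exactly the terms in which the extra point joins
    another one, so the equation can be rewritten with regular parts only. At infinity its
    right-hand side is [- |mu|] times the cut-and-join sum of [mu] alone, plus [- 2 |mu| h(mu)],
    which comes from cutting an entry into 0 and itself. The latter matches the contribution of the
    one extra point to the number of simple branch points on the left, and the value [- |mu| h(mu)]
    comes out by induction on [2g + n + |mu|]. *)

(** * Sheared coordinates on the plane and neighbourhoods in the projective line *)

Section Coordinates.
Variable R : realType.
Variable lam : R.
Local Notation K := (Cplx R).

(** [rr] and [hh] are coordinates after a shear by [lam]. For a suitable [lam] finitely many given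
    points have pairwise distinct heights [hh], so that the horizontal rays to their right are
    disjoint. *)
Definition rr (z : K) : R := complex.Re (z : complex R).
Definition hh (z : K) : R := complex.Im (z : complex R) + lam * rr z.
Definition mkc (x y : R) : K := Complex x (y - lam * x).

Lemma rr_mkc x y : rr (mkc x y) = x. Proof. by []. Qed.
Lemma hh_mkc x y : hh (mkc x y) = y. Proof. by rewrite /hh /rr/=;lra. Qed.
Lemma mkcK z : mkc (rr z) (hh z) = z.
Proof. by case: z=> a b;rewrite /mkc /hh /rr/=;congr Complex;lra. Qed.

Lemma rrD (u v : K) : rr (u + v) = rr u + rr v.
Proof. by case: u v=> [a b] [c d]. Qed.
Lemma rrN (u : K) : rr (- u) = - rr u.
Proof. by case: u=> [a b]. Qed.
Lemma hhD (u v : K) : hh (u + v) = hh u + hh v.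
Proof. by case: u v=> [a b] [c d];rewrite /hh /rr/=;lra. Qed.
Lemma hhN (u : K) : hh (- u) = - hh u.
Proof. by case: u=> [a b];rewrite /hh /rr/=;lra. Qed.
Lemma rrB (u v : K) : rr (u - v) = rr u - rr v. Proof. by rewrite rrD rrN. Qed.
Lemma hhB (u v : K) : hh (u - v) = hh u - hh v. Proof. by rewrite hhD hhN. Qed.

Lemma rrZ (c : R) (u : K) : rr ((Complex c 0 : K) * u) = c * rr u.
Proof. by case: u=> [a b];rewrite /rr/=;lra. Qed.
Lemma hhZ (c : R) (u : K) : hh ((Complex c 0 : K) * u) = c * hh u.
Proof. by case: u=> [a b];rewrite /hh /rr/=;lra. Qed.

Lemma rr0 : rr 0 = 0. Proof. by []. Qed.
Lemma hh0 : hh 0 = 0. Proof. by rewrite /hh /rr/=;lra. Qed.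

Lemma norm_le_box (u : K) : `|u| <= Complex ((`|rr u| + `|hh u|) * (2 + `|lam|)) 0 :> complex R.
Proof.
case: u=> a b;rewrite /rr /hh/=.
have H : `|Complex a b : complex R| <= Complex (`|a| + `|b|) 0.
rewrite normc_def/= lecR.
have -> : `|a| + `|b| = Num.sqrt ((`|a| + `|b|) ^+ 2).
 by rewrite sqrtr_sqr [RHS]ger0_norm ?addr_ge0.
apply: ler_wsqrtr;rewrite sqrrD !real_normK ?num_real//.
have := mulr_ge0 (normr_ge0 a) (normr_ge0 b);lra.
apply: le_trans H _;rewrite lecR.
have H2 : `|b| <= `|b + lam * a| + `|lam| * `|a|.
by rewrite -normrM;have := ler_normB (b + lam * a) (lam * a);rewrite addrK.
have := mulr_ge0 (normr_ge0 (b + lam * a)) (normr_ge0 lam).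
have := normr_ge0 a;have := normr_ge0 (b + lam * a).
have := mulr_ge0 (normr_ge0 a) (normr_ge0 lam).
nra.
Qed.

Lemma rr_le_norm (u : K) (e : R) : (`|u| : complex R) < Complex e 0 -> `|rr u| < e.
Proof.
case: u=> a b H;rewrite -ltcR;apply: le_lt_trans H.
exact: (normc_ge_Re (Complex a b)).
Qed.

Lemma im_le_norm (u : K) (e : R) : (`|u| : complex R) < Complex e 0 ->
`|complex.Im (u : complex R)| < e.
Proof.
case: u=> a b H;rewrite -ltcR;apply: le_lt_trans H.
rewrite normc_def/= lecR -sqrtr_sqr;apply: ler_wsqrtr.
by rewrite lerDr sqr_ge0.
Qed.

(** The shear and its inverse are Lipschitz with constants depending on [lam], so sheared boxes and
    norm balls define the same neighbourhoods. *)
Lemma nbhs_box (z : K) (W : set K) : nbhs z W <->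
exists2 e : R, 0 < e & forall u, `|rr u - rr z| < e -> `|hh u - hh z| < e -> W u.
Proof.
split.
- move=> /nbhs_ballP[[e e']/= ];rewrite ltcE/= => /andP[/eqP -> e0] H.
have l0 : 0 < 2 + `|lam| by have := normr_ge0 lam;lra.
exists (e / 2 / (2 + `|lam|));first by rewrite !divr_gt0.
move=> u H1 H2;apply: H;rewrite /ball/=.
rewrite distrC;apply: le_lt_trans (norm_le_box _) _.
rewrite ltcR rrB hhB -ltr_pdivlMr//.
have -> : e / (2 + `|lam|) = e / 2 / (2 + `|lam|) + e / 2 / (2 + `|lam|).
 by field;rewrite gt_eqF.
exact: ltrD.
- move=> [e e0 H];apply/nbhs_ballP.
have l0 : 0 < 1 + `|lam| by have := normr_ge0 lam;lra.
exists (Complex (e / (1 + `|lam|)) 0 : K).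
 by rewrite/= ltcR divr_gt0.
move=> u;rewrite /ball/= distrC=> Hu.
have H1 := rr_le_norm Hu;have H2 := im_le_norm Hu.
have e1 : e / (1 + `|lam|) <= e.
 by rewrite ler_pdivrMr// mulrDr mulr1 lerDl mulr_ge0// ltW.
apply: H;first by rewrite -rrB;apply: lt_le_trans H1 _.
rewrite -hhB /hh;apply: le_lt_trans (ler_normD _ _) _.
rewrite normrM -[e](@divfK _ (1 + `|lam|)) ?gt_eqF// mulrDr mulr1.
apply: ltr_leD=> //;rewrite mulrC.
by apply: ler_wpM2r=> //;exact: ltW.
Qed.

Lemma continuous_rr : continuous rr.
Proof.
move=> z W /nbhs_ballP[e/= e0 H];apply/nbhs_box;exists e=> // u H1 _.
by apply: H;rewrite /ball/= distrC.
Qed.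

Lemma continuous_hh : continuous hh.
Proof.
move=> z W /nbhs_ballP[e/= e0 H];apply/nbhs_box;exists e=> // u _ H1.
by apply: H;rewrite /ball/= distrC.
Qed.

Lemma continuous_mkc : continuous (fun xy : R * R=> mkc xy.1 xy.2).
Proof.
move=> [x y] W /nbhs_box [e e0 H].
have : nbhs (x, y) (ball x e `*` ball y e).
by exists (ball x e, ball y e)=> //;split;exact: nbhsx_ballx.
apply: filterS=> -[x' y'] [/= Hx Hy];apply: H;rewrite ?rr_mkc ?hh_mkc/=.
by rewrite distrC.
by rewrite distrC.
Qed.

Definition box (A B : set R) : set K := [set z | A (rr z) /\ B (hh z)].

Lemma open_box A B : open A -> open B -> open (box A B).
Proof.
move=> oA oB;rewrite openE=> z [Az Bz];rewrite /interior.
apply: filterI.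
by apply: (continuous_rr (x:=z));exact: open_nbhs_nbhs.
by apply: (continuous_hh (x:=z));exact: open_nbhs_nbhs.
Qed.

(** The box is a union of crosses: each horizontal slice together with the vertical slice through
    one fixed point. *)
Lemma conn_box A B : is_interval A -> is_interval B -> connected (box A B).
Proof.
move=> iA iB.
have [E|/set0P[z0 [Az0 Bz0]]] := eqVneq (box A B) set0.
by rewrite E;exact: connected0.
have -> : box A B = \bigcup_(y in B)
 ((fun x=> mkc x y) @` A `|` (fun y=> mkc (rr z0) y) @` B).
apply/seteqP;split=> [z [Az Bz]|z [y By] []].
- by exists (hh z)=> //;left;exists (rr z)=> //;rewrite mkcK.
- by move=> [x Ax <-];split;rewrite ?hh_mkc.
- by move=> [y' By' <-];split;rewrite ?hh_mkc.
apply: bigcup_connected.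
by exists z0=> y By;right;exists (hh z0)=> //;rewrite mkcK.
move=> y By;apply: connectedU.
- by exists (mkc (rr z0) y);split;[exists (rr z0)|exists y].
- apply: connected_continuous_connected;first exact/connected_intervalP.
apply: continuous_subspaceT=> x.
by apply: (@continuous_comp _ _ _ (fun x=> (x, y)) (fun xy=> mkc xy.1 xy.2));
 [exact: (cvg_pair cvg_id (cvg_cst _))|exact: continuous_mkc].
- apply: connected_continuous_connected;first exact/connected_intervalP.
apply: continuous_subspaceT=> x.
by apply: (@continuous_comp _ _ _ (fun x=> (rr z0, x)) (fun xy=> mkc xy.1 xy.2));
 [exact: (cvg_pair (cvg_cst _) cvg_id)|exact: continuous_mkc].
Qed.

Lemma compact_cbox (a b c d : R) : compact (box `[a, b] `[c, d]).
Proof.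
have -> : box `[a, b] `[c, d] = (fun xy : R * R=> mkc xy.1 xy.2) @` (`[a, b] `*` `[c, d]).
apply/seteqP;split=> [z [Az Bz]|z [[x y] [/= Ax By] <-]].
 by exists (rr z, hh z)=> //=;rewrite mkcK.
by split;rewrite ?hh_mkc.
apply: continuous_compact.
by apply: continuous_subspaceT=> x;exact: continuous_mkc.
by apply: compact_setX;exact: segment_compact.
Qed.

Lemma hausdorff_Cplx : hausdorff_space K.
Proof. exact: norm_hausdorff. Qed.

Lemma P1_hausdorff : hausdorff_space (P1 R).
Proof.
apply: one_point_compactification_hausdorff;last exact: hausdorff_Cplx.
move=> z _;exists (box `[rr z - 1, rr z + 1] `[hh z - 1, hh z + 1]).
rewrite withinET;apply/nbhs_box;exists 1=> // u.
rewrite !ltr_norml=> /andP[? ?] /andP[? ?];split;rewrite/= in_itv/=;apply/andP;split;lra.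
by split;[exact: compact_cbox|apply: compact_closed;[exact: hausdorff_Cplx|exact: compact_cbox]].
Qed.

Lemma P1_compact : compact [set: P1 R].
Proof. exact: one_point_compactification_compact. Qed.

Lemma nbhs_P1pt (z : K) (W : set (P1 R)) :
nbhs (P1pt z) W <-> nbhs z (fun u=> W (P1pt u)).
Proof. by []. Qed.

(** Both coordinates are bounded on the compact set that a neighbourhood of infinity leaves out;
    conversely closed boxes are compact. *)
Lemma nbhs_P1infty (W : set (P1 R)) : nbhs (P1infty R) W <->
W (P1infty R) /\ exists2 e : R, 0 < e & forall u, e < `|rr u| \/ e < `|hh u| -> W (P1pt u).
Proof.
split.
- move=> HW;split;first exact: nbhs_singleton HW.
have [C [cC _] HC] := HW.
have bnd (g : K -> R) : continuous g -> exists2 e, 0 < e & forall u, C u -> `|g u| <= e.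
 move=> cg;have : compact (g @` C).
  by apply: continuous_compact=> //;exact: continuous_subspaceT.
 move/compact_bounded=> [e [_ He]];exists (`|e| + 1).
  by rewrite ltr_wpDl.
 move=> u Cu;apply: (He (`|e| + 1));last by exists u.
 by rewrite (le_lt_trans (ler_norm _))// ltrDl.
have [e1 e10 H1] := bnd _ continuous_rr.
have [e2 e20 H2] := bnd _ continuous_hh.
exists (e1 + e2);first exact: addr_gt0.
move=> u Hu;apply: HC;left;exists u=> // Cu.
by have := H1 _ Cu;have := H2 _ Cu;case: Hu;lra.
- move=> [W0 [e e0 He]];exists (box `[- e, e] `[- e, e]).
 by split;[exact: compact_cbox|apply: compact_closed;[exact: hausdorff_Cplx|exact: compact_cbox]].
move=> _ [[u/= Hu <-]|->//];apply: He;apply: contrapT=> /not_orP[/negP].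
rewrite -leNgt=> H1 /negP;rewrite -leNgt=> H2;apply: Hu.
by split;rewrite/= in_itv/= -ler_norml.
Qed.

End Coordinates.

(** The target carries no topology: every set of values has a relatively open preimage, so the fibre
    of [g] through [x] is clopen in [U]. Used with labels, orbits or truth values as targets, it
    expresses continuation along connected sets. *)
Lemma connected_lconst (T : topologicalType) (A : Type) (U : set T) (g : T -> A) :
connected U -> (forall x, U x -> \forall y \near x, U y -> g y = g x) ->
forall x y, U x -> U y -> g x = g y.
Proof.
move=> cU lU x y Ux Uy.
have op (P : set A) : exists2 C : set T, open C & U `&` [set z | P (g z)] = U `&` C.
exists (U `&` [set z | P (g z)] `|` ~` U)^°;first exact: open_interior.
apply/seteqP;split=> z.
 move=> [Uz Pz];split=> //;apply: filterS (lU z Uz)=> u Hu.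
 have [Uu|] := pselect (U u);last by right.
 by left;split=> //=;rewrite Hu.
by move=> [Uz /interior_subset[|//]].
suff H : U `&` [set z | g z = g x] = U by move: Uy;rewrite -{1}H=> -[_ ->].
apply: cU.
- by exists x.
- exact: (op [set a | a = g x]).
- have [C oC eC] := op [set a | a <> g x].
exists (~` C);first exact: open_closedC.
apply/seteqP;split=> z [Uz Hz];split=> //.
 by move=> Cz;have : (U `&` C) z by [];rewrite -eC=> -[_];exact.
by apply: contrapT=> H;apply: Hz;have : (U `&` C) z;[rewrite -eC|case].
Qed.

(** * Labellings of the sheets over subsets of the plane *)

Section Labels.
Variables (R : realType) (X : topologicalType) (f : X -> P1 R).
Local Notation K := (Cplx R).

(* The fibres of f near z are identified with I by l, the transport of labels
 from z to a nearby z' being t z'. *)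
Definition lab_at (I : Type) (t : K -> I -> I) (l : X -> I) (z : K) : Prop :=
[/\ forall i, exists2 x, f x = P1pt z & l x = i,
  forall x x', f x = P1pt z -> f x' = P1pt z -> l x = l x' -> x = x'
 & forall x (W : set X), f x = P1pt z -> nbhs x W <->
  exists2 V, nbhs z V &
   forall x' z', V z' -> f x' = P1pt z' -> l x' = t z' (l x) -> W x'].

Definition triv (I : Type) (U : set K) (l : X -> I) : Prop :=
forall z, U z -> lab_at (fun _ i=> i) l z.

Definition loctriv (U : set K) : Prop := forall z, U z ->
exists2 V, nbhs z V & exists d, exists l : X -> 'I_d, triv V l.

Lemma triv_sub I (U V : set K) (l : X -> I) : V `<=` U -> triv U l -> triv V l.
Proof. by move=> VU tU z /VU;exact: tU. Qed.

(** The change of labels [phi] may vary with the base point as long as it intertwines the two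
    transports. This covers a constant renaming as well as the passage to labels that jump across a
    cut. *)
Lemma lab_relabel I I' (t : K -> I -> I) (t' : K -> I' -> I') (l : X -> I) l' (z : K)
 (phi : K -> I -> I') :
(\forall z' \near z, [/\ injective (phi z'),
 forall x', f x' = P1pt z' -> l' x' = phi z' (l x')
 & forall i, phi z' (t z' i) = t' z' (phi z i)]) ->
(forall i', exists i, phi z i = i') ->
lab_at t l z -> lab_at t' l' z.
Proof.
move=> nz sz [h1 h2 h3];have [iz lz _] := nbhs_singleton nz;split.
- move=> i';have [i ei] := sz i';have [x fx lx] := h1 i.
by exists x=> //;rewrite lz// lx.
- by move=> x x' fx fx';rewrite !lz// => /iz;exact: h2.
- move=> x W fx;split=> [/(h3 _ _ fx)|] [V nV HV].
 exists (V `&` [set z' | [/\ injective (phi z'),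
  forall x', f x' = P1pt z' -> l' x' = phi z' (l x')
  & forall i, phi z' (t z' i) = t' z' (phi z i)]]);first exact: filterI.
 move=> x' z' [Vz' [iz' lz' tz']] fx';rewrite lz'// lz// -tz'=> /iz'.
 exact: HV.
apply/h3=> //;exists (V `&` [set z' | [/\ injective (phi z'),
  forall x', f x' = P1pt z' -> l' x' = phi z' (l x')
  & forall i, phi z' (t z' i) = t' z' (phi z i)]]);first exact: filterI.
move=> x' z' [Vz' [iz' lz' tz']] fx' lx';apply: (HV x' z')=> //.
by rewrite lz'// lz// -tz' lx'.
Qed.

Lemma triv_ext I (U : set K) (l l' : X -> I) : open U ->
(forall x z, U z -> f x = P1pt z -> l' x = l x) -> triv U l -> triv U l'.
Proof.
move=> oU e tU z Uz;apply: (@lab_relabel _ _ _ _ l _ _ (fun _ i=> i)) (tU z Uz).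
have := open_nbhs_nbhs (conj oU Uz);apply: filterS=> z' Uz'.
by split=> // x' fx';exact: e fx'.
by move=> i;exists i.
Qed.

Lemma triv_bij I I' (U : set K) (l : X -> I) (phi : I -> I') :
bijective phi -> triv U l -> triv U (phi \o l).
Proof.
move=> [psi pK Kp] tU z Uz.
apply: (@lab_relabel _ _ _ _ l _ _ (fun _=> phi)) (tU z Uz).
by apply: (@filterE _ (nbhs z))=> z';split=> //;exact: can_inj pK.
by move=> i;exists (psi i).
Qed.

(** Follow the point with first label [i] over [W]: its second label is locally constant, hence
    constant, and defines [phi i]. *)
Lemma triv_trans I I' (U V W : set K) (l : X -> I) (l' : X -> I') :
triv U l -> triv V l' -> W `<=` U -> W `<=` V -> connected W -> W !=set0 ->
exists2 phi : I -> I', bijective phi &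
 forall x z, W z -> f x = P1pt z -> l' x = phi (l x).
Proof.
move=> tU tV WU WV cW [z0 Wz0].
have sec i : exists x0 : K -> X, forall z, U z -> f (x0 z) = P1pt z /\ l (x0 z) = i.
have [h0 _ _] := tU z0 (WU _ Wz0);have [y0 _ _] := h0 i.
have [|x0 x0P] := @choice _ _ (fun z x=> U z -> f x = P1pt z /\ l x = i);last by exists x0.
move=> z;have [Uz|nU] := pselect (U z);last by exists y0.
by have [h _ _] := tU z Uz;have [x fx lx] := h i;exists x.
have [x0 x0P] := choice sec.
have W0 i z : W z -> f (x0 i z) = P1pt z by move=> /WU/(x0P i)[].
have W1 i z : W z -> l (x0 i z) = i by move=> /WU/(x0P i)[].
have cst i z : W z -> l' (x0 i z) = l' (x0 i z0).
move=> Wz;apply: (connected_lconst cW (g := fun z=> l' (x0 i z)))=> // {Wz}z Wz.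
have [_ _ h'] := tV z (WV _ Wz).
have nl' : nbhs (x0 i z) (fun x'=> forall z', f x' = P1pt z' -> l' x' = l' (x0 i z)).
 apply/(h' _ _ (W0 i z Wz));exists setT;first exact: filterT.
 by move=> x' z' _ fx' lx' z'' _.
have [_ _ h] := tU z (WU _ Wz).
move/(h _ _ (W0 i z Wz)) : nl'=> [A nA HA].
apply: filterS nA=> z' Az' Wz';apply: (HA (x0 i z') z' Az' (W0 _ _ Wz') _ z' (W0 _ _ Wz')).
by rewrite !W1.
have [_ h2 _] := tU z0 (WU _ Wz0);have [h1' h2' _] := tV z0 (WV _ Wz0).
have xE x z : W z -> f x = P1pt z -> x = x0 (l x) z.
move=> Wz fx;have [_ h _] := tU z (WU _ Wz).
by apply: h=> //;rewrite ?W0 ?W1.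
exists (fun i=> l' (x0 i z0));last first.
by move=> x z Wz fx;rewrite [in LHS](xE x z)// cst.
rewrite -setTT_bijective;split=> //.
- move=> i j _ _/= e;have : x0 i z0 = x0 j z0.
 by apply: h2';rewrite ?W0.
by move=> /(congr1 l);rewrite !W1.
- move=> i' _;have [x fx lx] := h1' i'.
by exists (l x)=> //=;rewrite -xE.
Qed.

Lemma triv_glue I (U V : set K) (l l' : X -> I) : open U -> open V ->
triv U l -> triv V l' ->
(forall x z, U z -> V z -> f x = P1pt z -> l' x = l x) ->
exists l0 : X -> I, triv (U `|` V) l0.
Proof.
move=> oU oV tU tV UV.
pose l0 x := if f x is Some z then (if pselect (U z) then l x else l' x) else l x.
have e1 x z : U z -> f x = P1pt z -> l0 x = l x.
by rewrite /l0=> Uz -> /=;case: pselect.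
have e2 x z : V z -> f x = P1pt z -> l0 x = l' x.
by rewrite /l0=> Vz fx;rewrite fx/=;case: pselect=> // Uz;rewrite (UV _ z).
exists l0=> z [Uz|Vz].
exact: (triv_ext oU e1).
exact: (triv_ext oV e2).
Qed.

Lemma triv_glue_connected (U V : set K) d d' (l : X -> 'I_d) (l' : X -> 'I_d') :
open U -> open V -> connected (U `&` V) -> U `&` V !=set0 ->
triv U l -> triv V l' -> exists l0 : X -> 'I_d, triv (U `|` V) l0.
Proof.
move=> oU oV cUV nUV tU tV.
have [phi bphi pE] := triv_trans tU tV (@subIsetl _ _ _) (@subIsetr _ _ _) cUV nUV.
have [psi pK Kp] := bphi.
have tV' : triv V (psi \o l') by apply: triv_bij tV;exists phi.
apply: (triv_glue oU oV tU tV')=> x z Uz Vz fx/=.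
by rewrite (pE x z)// pK.
Qed.

(* Every label is normalized on H, and two members of the family that meet do so
 along a connected set meeting H. *)
Lemma triv_family (I : Type) (W H : set K) (T : K -> set K) (lH : X -> I) :
open W -> triv H lH ->
(forall z, W z -> [/\ open (T z), T z z, connected (T z `&` H), T z `&` H !=set0
 & exists d, exists l : X -> 'I_d, triv (T z) l]) ->
(forall z w, W z -> W w -> T z `&` T w !=set0 ->
 connected (T z `&` T w) /\ T z `&` T w `&` H !=set0) ->
exists l : X -> I, triv W l.
Proof.
move=> oW tH HT HTT.
have sel z : exists l : X -> I, W z ->
 triv (T z) l /\ forall x w, T z w -> H w -> f x = P1pt w -> l x = lH x.
have [Wz|nW] := pselect (W z);last by exists lH.
have [oT Tz cT nT [d [l tl]]] := HT z Wz.
have [phi bphi pE] := triv_trans tl tH (@subIsetl _ _ _) (@subIsetr _ _ _) cT nT.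
exists (phi \o l)=> _;split;first exact: triv_bij.
by move=> x w Tw Hw fx/=;rewrite (pE x w).
have [L LP] := choice sel.
pose l0 x := if f x is Some z then L z x else lH x.
exists l0=> z Wz;have [tL LE] := LP z Wz;have [oT Tz _ _ _] := HT z Wz.
have oTW : open (T z `&` W) by exact: openI.
apply: (triv_ext oTW (l := L z))=> //;last by apply: triv_sub tL=> w [].
move=> x w [Tw Ww] fx;rewrite /l0 fx/=.
have [tLw LwE] := LP w Ww;have [oTw Tww _ _ _] := HT w Ww.
have [|cT [v [[v1 v2] v3]]] := HTT z w Wz Ww;first by exists w.
have [phi bphi pE] := triv_trans tL tLw (@subIsetl _ _ _) (@subIsetr _ _ _) cT
(ex_intro _ w (conj Tw Tww)).
rewrite (pE x w)//;have [h1 _ _] := tL v v1.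
have [y fy ly] := h1 (L z x).
have := pE y v (conj v1 v2) fy;rewrite ly=> <-.
by rewrite -ly (LE y v)// (LwE y v).
Qed.

(** The supremum of the points reachable from [a] is itself reachable, since the interval around it
    overlaps an earlier one, and it could be exceeded if it were below [b]. This plays the part of a
    Lebesgue number when labels are glued along a segment. *)
Lemma interval_glue (Pr : R -> R -> Prop) (a b : R) : a <= b ->
(forall s t s' t', s <= s' -> t' <= t -> Pr s t -> Pr s' t') ->
(forall s t s' t', s <= s' -> s' < t -> t <= t' -> Pr s t -> Pr s' t' -> Pr s t') ->
(forall u, a <= u <= b -> exists2 e, 0 < e & Pr (u - e) (u + e)) ->
exists2 e, 0 < e & Pr (a - e) (b + e).
Proof.
move=> ab mono glue loc.
pose A : set R := [set u | a <= u <= b /\ exists2 e, 0 < e & Pr (a - e) (u + e)].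
have Aa : A a by split;[rewrite lexx|apply: loc;rewrite lexx].
have hA : has_sup A by split;[exists a|exists b=> u [/andP[]]].
pose c := sup A.
have ac : a <= c by apply: ub_le_sup=> //;exact: hA.2.
have cb : c <= b by apply: ge_sup;[exact: hA.1|move=> u [/andP[]]].
have [ec ec0 Pc] := loc c (introT andP (conj ac cb)).
have [u [/andP[au ub] [e e0 Pu]] cu] := sup_adherent ec0 hA.
have uc : u <= c by apply: ub_le_sup;[exact: hA.2|split;[rewrite au|exists e]].
have [e' e'0 Pc'] : exists2 e', 0 < e' & Pr (a - e') (c + ec).
have [h|h] := leP (a - e) (c - ec).
 exists e=> //;have [h'|h'] := leP (u + e) (c + ec).
  by apply: (glue _ (u + e) (c - ec))=> //;rewrite -/c in cu;lra.
 by apply: mono Pu=> //;exact: ltW.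
by exists e=> //;apply: mono Pc;lra.
have cE : c = b.
apply/eqP;rewrite eq_le cb/= leNgt;apply/negP=> cltb.
suff : A (Num.min b (c + ec / 2)).
 move=> Am;have := ub_le_sup hA.2 Am;rewrite -/c leNgt lt_min cltb/= => /negP;apply.
 lra.
split;first by rewrite le_min ge_min lexx/= ab/=;lra.
exists (Num.min e' (ec / 2));first by rewrite lt_min e'0;lra.
apply: mono Pc'.
 by rewrite lerD2l lerN2 ge_min lexx.
have h1 : Num.min b (c + ec / 2) <= c + ec / 2 by rewrite ge_min lexx orbT.
have h2 : Num.min e' (ec / 2) <= ec / 2 by rewrite ge_min lexx orbT.
lra.
exists (Num.min e' ec);first by rewrite lt_min e'0.
apply: mono Pc'.
by rewrite lerD2l lerN2 ge_min lexx.
by rewrite cE lerD2l ge_min lexx orbT.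
Qed.

Variable lam : R.
Local Notation h := (hh lam).
Local Notation box := (box lam).

Lemma boxI (A B A' B' : set R) :
box A B `&` box A' B' = box (A `&` A') (B `&` B').
Proof. by apply/seteqP;split=> [z [[? ?] [? ?]]|z [[? ?] [? ?]]]. Qed.

Let PB (s t s' t' : R) := exists d, exists l : X -> 'I_d, triv (box `]s, t[ `]s', t'[) l.

Let PB_sub s t s' t' u v u' v' : s <= u -> v <= t -> s' <= u' -> v' <= t' ->
PB s t s' t' -> PB u v u' v'.
Proof.
move=> a1 a2 a3 a4 [d [l tl]];exists d, l;apply: triv_sub tl=> z [].
rewrite/= !in_itv/= => /andP[? ?] /andP[? ?];split;rewrite/= in_itv/=;apply/andP;lra.
Qed.

Let is_intervalII (A B : set R) : is_interval A -> is_interval B -> is_interval (A `&` B).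
Proof.
move=> iA iB x y [Ax Bx] [Ay By] z xzy;split;[exact: iA xzy|exact: iB xzy].
Qed.

Let glueH u v u' v' a b : u <= u' -> u' < v -> v <= v' -> PB u v a b -> PB u' v' a b -> PB u v' a b.
Proof.
move=> h1 h2 h3 [d [l tl]] [d' [l' tl']].
have [ab|ba] := ltP a b;last first.
exists d, l=> z [_];rewrite/= in_itv/= => /andP[? ?];lra.
have oi (x y : R) : open (`]x, y[%classic : set R) by exact: interval_open.
have [||l0 tl0] := triv_glue_connected (open_box (oi u v) (oi a b)) (open_box (oi u' v') (oi a b)) _ _ tl tl'.
- rewrite boxI;apply: conn_box;apply: is_intervalII;exact: interval_is_interval.
- exists (mkc lam ((u' + v) / 2) ((a + b) / 2)).
by split;split;rewrite/= ?hh_mkc in_itv/=;apply/andP;lra.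
exists d, l0;apply: triv_sub tl0=> z [].
rewrite/= !in_itv/= => /andP[? ?] /andP[? ?].
have [?|?] := ltP (rr z) v;[left|right];split;rewrite/= in_itv/=;apply/andP;lra.
Qed.

Let glueV u v u' v' a b : u <= u' -> u' < v -> v <= v' -> PB a b u v -> PB a b u' v' -> PB a b u v'.
Proof.
move=> h1 h2 h3 [d [l tl]] [d' [l' tl']].
have [ab|ba] := ltP a b;last first.
exists d, l=> z [];rewrite/= in_itv/= => /andP[? ?];lra.
have oi (x y : R) : open (`]x, y[%classic : set R) by exact: interval_open.
have [||l0 tl0] := triv_glue_connected (open_box (oi a b) (oi u v)) (open_box (oi a b) (oi u' v')) _ _ tl tl'.
- rewrite boxI;apply: conn_box;apply: is_intervalII;exact: interval_is_interval.
- exists (mkc lam ((a + b) / 2) ((u' + v) / 2)).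
by split;split;rewrite/= ?hh_mkc in_itv/=;apply/andP;lra.
exists d, l0;apply: triv_sub tl0=> z [].
rewrite/= !in_itv/= => /andP[? ?] /andP[? ?].
have [?|?] := ltP (h z) v;[left|right];split;rewrite/= in_itv/=;apply/andP;lra.
Qed.

(** [interval_glue] is applied twice, in height over each abscissa and then in the abscissa. The
    overlaps are boxes, hence connected, so labels can be matched on them. *)
Lemma triv_rectangle (U : set K) (a b c d : R) : a <= b -> c <= d -> loctriv U ->
box `[a, b] `[c, d] `<=` U ->
exists2 e, 0 < e & exists n, exists l : X -> 'I_n,
 triv (box `]a - e, b + e[ `]c - e, d + e[) l.
Proof.
move=> ab cd lU sU.
have row u : a <= u <= b -> exists2 e, 0 < e & PB (u - e) (u + e) (c - e) (d + e).
move=> /andP[au ub].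
have [|||e e0 [e' e'0 Pe]] := @interval_glue (fun s t=> exists2 e, 0 < e & PB (u - e) (u + e) s t) c d cd.
- move=> s t s' t' h1 h2 [e e0 Pe];exists e=> //;apply: PB_sub Pe;lra.
- move=> s t s' t' h1 h2 h3 [e e0 Pe] [e' e'0 Pe'].
 have m1 : Num.min e e' <= e by rewrite ge_min lexx.
 have m2 : Num.min e e' <= e' by rewrite ge_min lexx orbT.
 exists (Num.min e e');first by rewrite lt_min e0.
 apply: (glueV h1 h2 h3);[apply: PB_sub Pe|apply: PB_sub Pe'];lra.
- move=> v /andP[cv vd].
 have [|V nV [n [l tl]]] := lU (mkc lam u v).
  by apply: sU;split;rewrite/= ?hh_mkc in_itv/=;apply/andP.
 have [e e0 He] := (nbhs_box lam _ _).1 nV.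
 exists e=> //;exists e=> //;exists n, l;apply: triv_sub tl=> z.
 rewrite /box/= !in_itv/= => -[/andP[? ?] /andP[? ?]];apply: He;rewrite ?hh_mkc ?rr_mkc ltr_norml.
  by apply/andP;lra.
 by apply/andP;lra.
have m1 : Num.min e e' <= e by rewrite ge_min lexx.
have m2 : Num.min e e' <= e' by rewrite ge_min lexx orbT.
exists (Num.min e e');first by rewrite lt_min e0.
apply: PB_sub Pe;lra.
have [|||e e0 [e' e'0 Pe]] := @interval_glue (fun s t=> exists2 e, 0 < e & PB s t (c - e) (d + e)) a b ab.
- move=> s t s' t' h1 h2 [e e0 Pe];exists e=> //;apply: PB_sub Pe;lra.
- move=> s t s' t' h1 h2 h3 [e e0 Pe] [e' e'0 Pe'].
have m1 : Num.min e e' <= e by rewrite ge_min lexx.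
have m2 : Num.min e e' <= e' by rewrite ge_min lexx orbT.
exists (Num.min e e');first by rewrite lt_min e0.
apply: (glueH h1 h2 h3);[apply: PB_sub Pe|apply: PB_sub Pe'];lra.
- by move=> u /row[e e0 Pe];exists e=> //;exists e.
have m1 : Num.min e e' <= e by rewrite ge_min lexx.
have m2 : Num.min e e' <= e' by rewrite ge_min lexx orbT.
exists (Num.min e e');first by rewrite lt_min e0.
by apply: PB_sub Pe;lra.
Qed.

(** The box may be unbounded, so no single compactness argument applies. Each [z] is reached from
    [z0] through the compact rectangle they span, and all labels are normalized on a small box
    around [z0]. *)
Lemma triv_box (A B : set R) : open A -> open B -> is_interval A -> is_interval B ->
box A B !=set0 -> loctriv (box A B) -> exists n, exists l : X -> 'I_n, triv (box A B) l.
Proof.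
move=> oA oB iA iB [z0 [Az0 Bz0]] lAB.
have [V nV [n [l0 tl0]]] := lAB z0 (conj Az0 Bz0).
have [e0 e00 He0] := (nbhs_box lam _ _).1 nV.
pose H := box (A `&` `]rr z0 - e0, rr z0 + e0[) (B `&` `]h z0 - e0, h z0 + e0[).
have tH : triv H l0.
apply: triv_sub tl0=> z [[_]];rewrite/= in_itv/= => /andP[? ?] [_].
rewrite/= in_itv/= => /andP[? ?];apply: He0;rewrite ltr_norml;apply/andP;lra.
(* [e] is the margin by which the rectangle spanned by [z] and [z0] can be enlarged while keeping a
   labelling. *)
have sel z : exists e, box A B z -> 0 < e /\ PB (Num.min (rr z) (rr z0) - e)
 (Num.max (rr z) (rr z0) + e) (Num.min (h z) (h z0) - e) (Num.max (h z) (h z0) + e).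
have [Hz|] := pselect (box A B z);last by exists 0.
have [||||e ep Pe] := @triv_rectangle (box A B) (Num.min (rr z) (rr z0))
 (Num.max (rr z) (rr z0)) (Num.min (h z) (h z0)) (Num.max (h z) (h z0)).
- by rewrite le_max ge_min lexx.
- by rewrite le_max ge_min lexx.
- exact: lAB.
- move=> w [/= ];rewrite/= !in_itv/= => Hw1 Hw2;split.
  by case: (leP (rr z) (rr z0)) Hw1=> _ /iA;apply=> //;case: Hz.
 by case: (leP (h z) (h z0)) Hw2=> _ /iB;apply=> //;case: Hz.
by exists e.
have [E EP] := choice sel.
pose T z := box (A `&` `]Num.min (rr z) (rr z0) - E z, Num.max (rr z) (rr z0) + E z[)
(B `&` `]Num.min (h z) (h z0) - E z, Num.max (h z) (h z0) + E z[).
have oi (x y : R) : open (`]x, y[%classic : set R) by exact: interval_open.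
have ii (x y : R) : is_interval (`]x, y[%classic : set R) by exact: interval_is_interval.
have z0T z : box A B z -> T z z0.
move=> Hz;have [ez _] := EP z Hz.
have m1 : Num.min (rr z) (rr z0) <= rr z0 by rewrite ge_min lexx orbT.
have m2 : Num.min (h z) (h z0) <= h z0 by rewrite ge_min lexx orbT.
have m3 : rr z0 <= Num.max (rr z) (rr z0) by rewrite le_max lexx orbT.
have m4 : h z0 <= Num.max (h z) (h z0) by rewrite le_max lexx orbT.
by split;split;rewrite//= in_itv/=;apply/andP;lra.
have Tz z : box A B z -> T z z.
move=> Hz;have [ez _] := EP z Hz.
have m1 : Num.min (rr z) (rr z0) <= rr z by rewrite ge_min lexx.
have m2 : Num.min (h z) (h z0) <= h z by rewrite ge_min lexx.
have m3 : rr z <= Num.max (rr z) (rr z0) by rewrite le_max lexx.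
have m4 : h z <= Num.max (h z) (h z0) by rewrite le_max lexx.
by case: Hz=> ? ?;split;split;rewrite//= in_itv/=;apply/andP;lra.
have z0H : H z0 by split;split;rewrite//= in_itv/=;apply/andP;lra.
exists n;apply: (@triv_family _ (box A B) H T l0)=> //.
- exact: open_box.
- move=> z Hz;split.
+ by apply: open_box;apply: openI.
+ exact: Tz.
+ by rewrite boxI;apply: conn_box;do 4 ?[apply: is_intervalII=> //].
+ by exists z0;split=> //;exact: z0T.
+ have [_ [m [l tl]]] := EP z Hz;exists m, l;apply: triv_sub tl.
 by move=> w [[_ ?] [_ ?]].
- move=> z w Hz Hw _;split.
 by rewrite boxI;apply: conn_box;do 4 ?[apply: is_intervalII=> //].
by exists z0;split=> //;split;exact: z0T.
Qed.

End Labels.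

(** * Labels over the complement of the branch points, with jumps across rays *)

Lemma uniform_eps (R : realType) (I : finType) (P : I -> R -> Prop) :
(forall j e e', 0 < e' -> e' <= e -> P j e -> P j e') ->
(forall j, exists2 e, 0 < e & P j e) -> exists2 e, 0 < e & forall j, P j e.
Proof.
move=> mono H;have H' j : exists e, 0 < e /\ P j e by have [e] := H j;exists e.
have [E EP] := choice H'.
have e0 : 0 < \big[Num.min/1]_j E j.
by apply/bigmin_gtP;split=> // j _;have [] := EP j.
exists (\big[Num.min/1]_j E j)=> // j.
by apply: (mono j (E j))=> //;[exact: bigmin_le|have [] := EP j].
Qed.

Section Comb.
Variables (R : realType) (X : topologicalType) (f : X -> P1 R) (lam : R).
Local Notation K := (Cplx R).
Local Notation h := (hh lam).
Local Notation box := (box lam).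
Variables (M : nat) (p : 'I_M -> K).
Hypothesis inj_hp : injective (fun j=> h (p j)).

Definition on_cut (j : 'I_M) (z : K) : bool := (h z == h (p j)) && (rr (p j) < rr z).
Definition cut_of (z : K) : option 'I_M := [pick j | on_cut j z].

Lemma on_cut_inj i j z : on_cut i z -> on_cut j z -> i = j.
Proof.
by move=> /andP[/eqP h1 _] /andP[/eqP h2 _];apply: inj_hp;rewrite -h1 -h2.
Qed.

Lemma cut_ofP j z : on_cut j z -> cut_of z = Some j.
Proof.
move=> cj;rewrite /cut_of;case: pickP=> [i ci|/(_ j)];last by rewrite cj.
by rewrite (on_cut_inj ci cj).
Qed.

(* Crossing the j-th cut downwards changes the label by s j. *)
Definition jump (I : finType) (s : 'I_M -> {perm I}) (z z' : K) (i : I) : I :=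
if cut_of z is Some j then (if h z' < h z then s j i else i) else i.

Lemma isolate (z : K) : exists2 e, 0 < e & forall j,
(`|h (p j) - h z| < e -> h (p j) = h z) /\
(h (p j) = h z -> rr (p j) != rr z -> e <= `|rr (p j) - rr z|).
Proof.
apply: uniform_eps=> [j e e' e0 ee [H1 H2]|j].
split=> [H|H n];first by apply: H1;exact: lt_le_trans ee.
by apply: (le_trans ee);exact: H2.
have [e1|n1] := eqVneq (h (p j)) (h z);last first.
exists `|h (p j) - h z|;first by rewrite normr_gt0 subr_eq0.
by split;[rewrite ltxx|move=> e;rewrite e eqxx in n1].
have [e2|n2] := eqVneq (rr (p j)) (rr z);first by exists 1=> //;split=> //.
by exists `|rr (p j) - rr z|;rewrite ?normr_gt0 ?subr_eq0.
Qed.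

Let W : set K := [set z | forall j, ~~ ((h z == h (p j)) && (rr (p j) <= rr z))].

Let oi (x y : R) : open (`]x, y[%classic : set R). Proof. exact: interval_open. Qed.
Let oiN (y : R) : open (`]-oo, y[%classic : set R). Proof. exact: interval_open. Qed.
Let oiP (y : R) : open (`]y, +oo[%classic : set R). Proof. exact: interval_open. Qed.
Let ii (i : interval R) : is_interval ([set` i] : set R).
Proof. exact: interval_is_interval. Qed.
Let iI (A B : set R) : is_interval A -> is_interval B -> is_interval (A `&` B).
Proof.
move=> iA iB x y [Ax Bx] [Ay By] z xzy;split;[exact: iA xzy|exact: iB xzy].
Qed.
Let iT : is_interval (setT : set R). Proof. by []. Qed.

Let open_W : open W.
Proof.
rewrite openE=> z Wz;have [e e0 He] := isolate z.
apply/(nbhs_box lam);exists e=> // u;rewrite !ltr_norml=> /andP[u1 u2] /andP[u3 u4] j.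
apply/negP=> /andP[/eqP huj ruj];have [H1 H2] := He j.
have E : h (p j) = h z by apply: H1;rewrite -huj ltr_norml;apply/andP.
have := Wz j;rewrite E eqxx/= -ltNge=> zp.
have := H2 E;rewrite gt_eqF// => /(_ isT);rewrite gtr0_norm ?subr_gt0//;lra.
Qed.

Let WB z : W z -> forall j, z != p j.
Proof. by move=> Wz j;apply/eqP=> E;have := Wz j;rewrite E eqxx lexx. Qed.

Hypothesis lf : loctriv f [set z | forall j, z != p j].

Let lfS (U : set K) : U `<=` [set z | forall j, z != p j] -> loctriv f U.
Proof. by move=> UB z /UB;exact: lf. Qed.

(** Each point of the cut plane lies in a half-strip extending left to infinity that avoids the cuts
    and meets the half-plane left of all branch points. Labels are normalized on that half-plane. *)
Lemma triv_comb : exists n, exists l : X -> 'I_n, triv f W l.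
Proof.
pose c := \big[Num.min/0]_j rr (p j).
have cp j : c <= rr (p j) by exact: bigmin_le.
pose H := box `]-oo, c[ setT.
have HB : H `<=` [set z | forall j, z != p j].
move=> z [/= ];rewrite in_itv/= => zc _ j;apply/eqP=> E.
by have := cp j;rewrite -E leNgt zc.
have [|n [lH tH]] := triv_box (@oiN c) openT (@ii _) iT _ (lfS HB).
by exists (mkc lam (c - 1) 0);split=> //;rewrite/= in_itv/=;lra.
have [E EP] := choice (fun z=> let: ex_intro2 e e0 H := isolate z in
ex_intro (fun e=> 0 < e /\ forall j, (`|h (p j) - h z| < e -> h (p j) = h z) /\
(h (p j) = h z -> rr (p j) != rr z -> e <= `|rr (p j) - rr z|)) e (conj e0 H)).
pose T z := box `]-oo, rr z + E z[ `]h z - E z, h z + E z[.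
have TW z : W z -> T z `<=` W.
move=> Wz u [];rewrite/= !in_itv/= => u1 /andP[u3 u4] j.
have [e0 /(_ j)[H1 H2]] := EP z.
apply/negP=> /andP[/eqP huj ruj].
have F : h (p j) = h z by apply: H1;rewrite -huj ltr_norml;apply/andP;lra.
have := Wz j;rewrite F eqxx/= -ltNge=> zp.
have := H2 F;rewrite gt_eqF// => /(_ isT);rewrite gtr0_norm ?subr_gt0//;lra.
have Tz z : T z z.
by have [e0 _] := EP z;split;rewrite/= in_itv/=;[|apply/andP];lra.
exists n;apply: (@triv_family _ _ f _ W H T lH)=> //.
- move=> z Wz;have [e0 _] := EP z;split=> //.
+ exact: open_box.
+ by rewrite boxI;apply: conn_box;apply: iI.
+ have m1 : Num.min c (rr z) <= c by rewrite ge_min lexx.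
 have m2 : Num.min c (rr z) <= rr z by rewrite ge_min lexx orbT.
 exists (mkc lam (Num.min c (rr z) - 1) (h z)).
 by split;split;rewrite//= ?hh_mkc in_itv/=;[| apply/andP | ];lra.
+ apply: triv_box=> //;first by exists z;exact: Tz.
 by apply: lfS=> u /(TW z Wz) /WB.
- move=> z w Wz Ww [v [[v1 v2] [v3 v4]]];split.
 by rewrite boxI;apply: conn_box;apply: iI.
have m1 : Num.min c (rr v) <= c by rewrite ge_min lexx.
have m2 : Num.min c (rr v) <= rr v by rewrite ge_min lexx orbT.
exists (mkc lam (Num.min c (rr v) - 1) (h v)).
move: v1 v2 v3 v4;rewrite/= !in_itv/= => v1 v2 v3 v4.
by split;[split|];split;rewrite//= ?hh_mkc in_itv//=;lra.
Qed.

(** The cut plane fixes the labels off the rays. On the ray to the right of [p j] the label is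
    continued from above, and [s j] records the discrepancy below. A thin enough strip around the
    ray contains no other branch point. *)
Lemma comb_labels : exists n (s : 'I_M -> {perm 'I_n}) (l : X -> 'I_n),
forall z, (forall j, z != p j) -> lab_at f (jump s z) l z.
Proof.
have [n [l0 tl0]] := triv_comb.
have HR j : exists D : R * (X -> 'I_n) * {perm 'I_n},
[/\ 0 < D.1.1, triv f (box `]rr (p j), +oo[ `]h (p j) - D.1.1, h (p j) + D.1.1[) D.1.2
 & forall i, i != j -> D.1.1 <= `|h (p i) - h (p j)|] /\
 (forall x z, rr (p j) < rr z -> `|h z - h (p j)| < D.1.1 -> f x = P1pt z ->
 (h (p j) < h z -> l0 x = D.1.2 x) /\ (h z < h (p j) -> l0 x = D.2 (D.1.2 x))).
have [e e0 He] := isolate (p j).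
have Hi i : i != j -> e <= `|h (p i) - h (p j)|.
 move=> ij;rewrite leNgt;apply/negP=> H.
 by have := (He i).1 H=> /inj_hp /eqP;rewrite (negPf ij).
have BB : box `]rr (p j), +oo[ `]h (p j) - e, h (p j) + e[ `<=` [set z | forall j, z != p j].
 move=> z [/= ];rewrite !in_itv/= andbT=> z1 /andP[z2 z3] i.
 apply/eqP=> E;have [ij|ij] := eqVneq i j.
  by move: z1;rewrite E ij ltxx.
 by have := Hi i ij;rewrite -E leNgt ltr_norml=> /negP;apply;apply/andP;lra.
have [|n' [l' tl']] := triv_box (@oiP (rr (p j))) (@oi (h (p j) - e) (h (p j) + e)) (@ii _) (@ii _) _ (lfS BB).
 exists (mkc lam (rr (p j) + 1) (h (p j))).
 by split;rewrite/= ?hh_mkc in_itv/= ?andbT;[|apply/andP];lra.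
have sW z : rr (p j) < rr z -> `|h z - h (p j)| < e -> h z != h (p j) -> W z.
 move=> z1 z2 z3 i;apply/negP=> /andP[/eqP hi ri].
 have [ij|ij] := eqVneq i j;first by rewrite hi ij eqxx in z3.
 by have := Hi i ij;rewrite -hi leNgt z2.
pose U := box `]rr (p j), +oo[ `]h (p j), h (p j) + e[.
pose D := box `]rr (p j), +oo[ `]h (p j) - e, h (p j)[.
have [||||u bu uE] := @triv_trans _ _ f _ _ W (box `]rr (p j), +oo[ `]h (p j) - e, h (p j) + e[) U l0 l' tl0 tl'.
- move=> z [/= ];rewrite !in_itv/= andbT=> z1 /andP[z2 z3];apply: sW=> //.
  by rewrite ltr_norml;apply/andP;lra.
 by rewrite gt_eqF.
- move=> z [/= ];rewrite !in_itv/= andbT=> z1 /andP[z2 z3];split;rewrite/= in_itv/= ?andbT//.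
 by apply/andP;lra.
- by apply: conn_box.
- exists (mkc lam (rr (p j) + 1) (h (p j) + e / 2)).
 by split;rewrite/= ?hh_mkc in_itv/= ?andbT;[|apply/andP];lra.
have [||||d bd dE] := @triv_trans _ _ f _ _ W (box `]rr (p j), +oo[ `]h (p j) - e, h (p j) + e[) D l0 l' tl0 tl'.
- move=> z [/= ];rewrite !in_itv/= andbT=> z1 /andP[z2 z3];apply: sW=> //.
  by rewrite ltr_norml;apply/andP;lra.
 by rewrite lt_eqF.
- move=> z [/= ];rewrite !in_itv/= andbT=> z1 /andP[z2 z3];split;rewrite/= in_itv/= ?andbT//.
 by apply/andP;lra.
- by apply: conn_box.
- exists (mkc lam (rr (p j) + 1) (h (p j) - e / 2)).
 by split;rewrite/= ?hh_mkc in_itv/= ?andbT;[|apply/andP];lra.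
have [u' uK Ku] := bu;have [d' dK Kd] := bd.
have inj_s : injective (d' \o u) by apply: inj_comp;[exact: can_inj Kd|exact: can_inj uK].
(* [u] and [d] translate labels of the cut plane into those of the strip, above and below the ray.
   The strip is relabelled to agree above, and the composite of [u] with the inverse of [d] remains
   below. *)
exists (e, u' \o l', perm inj_s);split;first split=> //=.
 by apply: triv_bij tl';exists u.
move=> x z z1;rewrite/= ltr_norml=> /andP[z2 z3] fx;split=> z4.
 rewrite (uE x z) ?uK//;split;rewrite/= in_itv/= ?andbT//;apply/andP;lra.
rewrite permE/= Ku (dE x z) ?dK//;split;rewrite/= in_itv/= ?andbT//;apply/andP;lra.
have [D HD] := choice HR.
pose s j := (D j).2;pose e j := (D j).1.1;pose lR j := (D j).1.2.
pose l x := if f x is Some z then (if cut_of z is Some j then lR j x else l0 x) else l0 x.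
exists n, s, l=> z Bz.
have [[j cj]|nc] := pselect (exists j, on_cut j z);last first.
have Wz : W z.
 move=> j;apply/negP=> /andP[/eqP e1 e2];apply: nc;exists j.
 rewrite /on_cut e1 eqxx/= lt_neqAle e2 andbT;apply/eqP=> e3.
 by have := Bz j;rewrite -[z](mkcK lam) -[p j](mkcK lam) e1 e3 eqxx.
have cW u : W u -> cut_of u = None.
 move=> Wu;rewrite /cut_of;case: pickP=> // i /andP[e1 /ltW e2].
 by have := Wu i;rewrite e1 e2.
have -> : jump s z = fun _ i=> i by rewrite /jump cW.
apply: (triv_ext open_W (l := l0))=> // x u Wu fx.
by rewrite /l fx/= cW.
have [[e0 tl Hi] lE] := HD j.
have /andP[/eqP hz rz] := cj.
have oB : open (box `]rr (p j), +oo[ `]h (p j) - e j, h (p j) + e j[) by exact: open_box.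
have Hz : box `]rr (p j), +oo[ `]h (p j) - e j, h (p j) + e j[ z.
by split;rewrite/= in_itv/= ?andbT// hz /e;apply/andP;lra.
apply: (@lab_relabel _ _ _ _ _ _ _ _ _ _ (fun z' i=> if h z' < h z then s j i else i)) (tl z Hz).
have := open_nbhs_nbhs (conj oB Hz);apply: filterS=> u [].
rewrite/= !in_itv/= andbT=> u1 /andP[u2 u3];split.
- by move=> i i';case: (h u < h z)=> //;exact: perm_inj.
- move=> x fx;have := lE x u u1 _ fx;rewrite ltr_norml=> /(_ _)[|U1 U2].
  by apply/andP;rewrite -/(e j);lra.
 rewrite /l fx/=;have [hu|hu|hu] := ltgtP (h u) (h z).
 + rewrite -U2 -?hz//;rewrite /cut_of;case: pickP=> // i /andP[/eqP hi _].
  have [ij|ij] := eqVneq i j;first by rewrite hi ij hz ltxx in hu.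
  by have := Hi i ij;rewrite -hi leNgt ltr_norml=> /negP;case;apply/andP;rewrite -/(e j);lra.
 + rewrite -U1 -?hz//;rewrite /cut_of;case: pickP=> // i /andP[/eqP hi _].
  have [ij|ij] := eqVneq i j;first by rewrite hi ij hz ltxx in hu.
  by have := Hi i ij;rewrite -hi leNgt ltr_norml=> /negP;case;apply/andP;rewrite -/(e j);lra.
 + have cu : on_cut j u by rewrite /on_cut hu hz eqxx u1.
  by rewrite (cut_ofP cu).
- by move=> i;rewrite /jump (cut_ofP cj) ltxx.
by move=> i;exists i;rewrite ltxx.
Qed.

End Comb.

(** * Roots of complex numbers and the power map *)

Section Norm.
Variable R : realType.
Local Notation K := (Cplx R).

(** The norm of a complex number lives in the complex field itself; [nm] is the same modulus as a
    real number. *)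
Definition nm (z : K) : R := complex.Re (`|z| : complex R).

Lemma nmE (z : K) : `|z| = (Complex (nm z) 0 : K).
Proof. by rewrite /nm;rewrite (normc_def (z : complex R)). Qed.

Lemma nm_ge0 z : 0 <= nm z.
Proof. by have := normr_ge0 z;rewrite nmE;rewrite (lecR 0). Qed.

Lemma nmM (u v : K) : nm (u * v) = nm u * nm v.
Proof. by rewrite /nm normrM !nmE/=;lra. Qed.

Lemma nmX (u : K) n : nm (u ^+ n) = nm u ^+ n.
Proof. by elim: n=> [|n IH];[rewrite /nm normr1|rewrite !exprS nmM IH]. Qed.

Lemma nmD (u v : K) : nm (u + v) <= nm u + nm v.
Proof. by have := ler_normD u v;rewrite !nmE lecE/= => /andP[_]. Qed.

Lemma nmN (u : K) : nm (- u) = nm u. Proof. by rewrite /nm normrN. Qed.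

Lemma nmB (u v : K) : nm (u - v) = nm (v - u). Proof. by rewrite -nmN opprB. Qed.

Lemma nm0P (u : K) : (nm u == 0) = (u == 0).
Proof. by rewrite -[RHS]normr_eq0 nmE eq_complex/= eqxx andbT. Qed.

Lemma nm_gt0 (u : K) : (0 < nm u) = (u != 0).
Proof. by rewrite lt_neqAle nm_ge0 andbT eq_sym nm0P. Qed.

Lemma nbhs_nm (z : K) (W : set K) : nbhs z W <->
exists2 e : R, 0 < e & forall u, nm (u - z) < e -> W u.
Proof.
split.
- move=> /nbhs_ballP[[e e']/= ];rewrite ltcE/= => /andP[/eqP -> e0] H.
exists e=> // u Hu;apply: H;rewrite /ball/= distrC nmE.
by rewrite (ltcR (nm (u - z)) e).
- move=> [e e0 H];apply/nbhs_ballP;exists (Complex e 0 : K);first by rewrite/= (ltcR 0 e).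
move=> u;rewrite /ball/= distrC nmE=> Hu;apply: H.
by rewrite -(ltcR (nm (u - z)) e).
Qed.

Lemma unit_disc_nm (z : K) : @unit_disc R z <-> nm z < 1.
Proof. by rewrite /unit_disc/= nmE (ltcR (nm z) 1). Qed.

(** [X^k - c] is coprime to its derivative when [c] is nonzero, so its linear factors over the
    algebraically closed field are distinct. *)
Lemma nth_roots (k : nat) (c : K) : (0 < k)%N -> c != 0 ->
exists r : seq K, [/\ size r = k, uniq r, (forall w, (w ^+ k == c) = (w \in r))
 & forall w, w ^+ k - c = \prod_(x <- r) (w - x)].
Proof.
move=> k0 c0;pose q : {poly complex R} := 'X^k - (c : complex R)%:P.
have sq : size q = k.+1 by rewrite size_XnsubC.
have mq : q \is monic by exact: monicXnsubC.
have [r qE] := closed_field_poly_normal q.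
rewrite (monicP mq) scale1r in qE.
have hq w : w ^+ k - c = \prod_(x <- r) (w - x) :> complex R.
have <- : q.[w] = w ^+ k - c by rewrite !hornerE.
by rewrite qE horner_prod;apply: eq_bigr=> i _;rewrite !hornerE.
exists r;split=> //.
- by have := sq;rewrite qE size_prod_XsubC=> -[].
- rewrite -separable_prod_XsubC -qE /q -alg_polyC.
case: k k0 {q sq mq qE hq} => // n _;rewrite unlock linearB/= derivZ derivC scaler0 subr0.
rewrite derivXn -scaler_nat coprimepZr ?pnatr_eq0//= exprS -scaleNr.
by rewrite coprimep_sym coprimep_addl_mul coprimepZr ?coprimep1 ?oppr_eq0.
- move=> w;rewrite -subr_eq0 [X in X == 0]hq prodf_seq_eq0.
apply/hasP/idP=> [[x xr/= ]|wr];first by rewrite subr_eq0=> /eqP ->.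
by exists w;rewrite//= subrr.
Qed.

(** If all factors had modulus at least [d], the product would have modulus at least
    [d ^ size r]. *)
Lemma root_near (k : nat) (c w : K) (r : seq K) (d : R) : 0 < d ->
(0 < size r)%N -> w ^+ k - c = \prod_(x <- r) (w - x) ->
nm (w ^+ k - c) < d ^+ size r -> exists2 x, x \in r & nm (w - x) < d.
Proof.
move=> d0 r0 -> ;rewrite (big_nth 0)/=.
have -> : nm (\prod_(0 <= i < size r) (w - r`_i)) = \prod_(x <- r) nm (w - x).
rewrite -(big_nth 0 xpredT (fun x=> w - x)).
elim: r {r0} => [|x r IH];first by rewrite !big_nil /nm normr1.
by rewrite !big_cons nmM IH.
move=> H;apply: contrapT=> N;move: H;apply/negP;rewrite -leNgt.
have {}N x : x \in r -> d <= nm (w - x).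
by move=> xr;rewrite leNgt;apply/negP=> ?;apply: N;exists x.
elim: r {r0} N=> [|x r IH] N;first by rewrite big_nil.
rewrite big_cons exprS;apply: ler_pM;[exact: ltW|exact/ltW/exprn_gt0| |].
- by apply: N;rewrite inE eqxx.
- by apply: IH=> y yr;apply: N;rewrite inE yr orbT.
Qed.

Lemma nth_ord_inj (k : nat) (r : seq K) (i j : 'I_k) :
uniq r -> size r = k -> r`_i = r`_j -> i = j.
Proof.
by move=> ur sr /eqP;rewrite nth_uniq ?sr ?ltn_ord// => /eqP/val_inj.
Qed.

Definition pw (k : nat) (w : K) : P1 R := P1pt (w ^+ k).

Lemma separation (r : seq K) : uniq r -> exists2 d : R, 0 < d &
forall x y, x \in r -> y \in r -> nm (x - y) < d -> x = y.
Proof.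
move=> _;elim: r=> [|x r [d d0 IH]];first by exists 1.
have [e e0 He] : exists2 e : R, 0 < e & forall y, y \in r -> nm (x - y) < e -> x = y.
elim: r {IH} => [|y r [e e0 IHe]];first by exists 1.
have [xEy|xy] := eqVneq x y.
 by exists e=> // z;rewrite inE=> /orP[/eqP -> //|/IHe].
exists (Num.min e (nm (x - y)));first by rewrite lt_min e0 nm_gt0 subr_eq0.
move=> z;rewrite inE lt_min=> /orP[/eqP ->|zr /andP[? ?]];first by rewrite ltxx andbF.
exact: IHe.
exists (Num.min d e);first by rewrite lt_min d0.
move=> y z;rewrite !inE lt_min=> /orP[/eqP ->|yr] /orP[/eqP ->|zr] /andP[h1 h2]//.
- exact: He.
- by apply/esym/He=> //;rewrite nmB.
- exact: IH.
Qed.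

Lemma surj_inj (n : nat) (g : 'I_n -> 'I_n) : (forall i, exists j, g j = i) -> injective g.
Proof.
move=> /choice[g' gK].
have ig' : injective g' by exact: can_inj gK.
have [g'' K1 K2] := injF_bij ig'.
by move=> x y E;rewrite -[x]K2 -[y]K2 -[g'' x]gK -[g'' y]gK !K2 E.
Qed.

(* Near z0, each root of X^k - z lies near exactly one root of X^k - z0. *)
Lemma root_labels (k : nat) (z0 : K) (r : seq K) (d : R) : (0 < k)%N -> z0 != 0 ->
size r = k -> uniq r -> (forall w, (w ^+ k == z0) = (w \in r)) ->
(forall w, w ^+ k - z0 = \prod_(x <- r) (w - x)) -> 0 < d ->
(forall x y, x \in r -> y \in r -> nm (x - y) < 3 * d -> x = y) ->
forall z, z != 0 -> nm (z - z0) < d ^+ k ->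
[/\ forall w, w ^+ k = z -> exists2 x, x \in r & nm (w - x) < d,
  forall x, x \in r -> exists2 w, w ^+ k = z & nm (w - x) < d
 & forall w w' x, w ^+ k = z -> w' ^+ k = z -> x \in r -> nm (w - x) < d -> nm (w' - x) < d -> w = w'].
Proof.
move=> k0 z00 sr ur rE rP d0 sep z zn0 zz0.
have A1 w : w ^+ k = z -> exists2 x, x \in r & nm (w - x) < d.
by move=> wz;apply: (@root_near k z0)=> //;rewrite ?sr// wz.
have [r' [sr' ur' rE' rP']] := nth_roots k0 zn0.
have A2 x : x \in r -> exists2 w, w ^+ k = z & nm (w - x) < d.
rewrite -rE=> /eqP xz0.
have [||||w wr' Hw] := @root_near k z x r' d=> //;rewrite ?sr'// ?xz0 1?nmB//.
by exists w;[apply/eqP;rewrite rE'|rewrite nmB].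
split=> // w w' x wz w'z xr wx w'x.
have wr : w \in r' by rewrite -rE' wz.
have wr'' : w' \in r' by rewrite -rE' w'z.
have W (j : 'I_k) : (r'`_j) \in r' by rewrite mem_nth ?sr'.
have B (j : 'I_k) : exists i : 'I_k, nm (r'`_j - r`_i) < d.
have [|y yr Hy] := A1 (r'`_j);first by apply/eqP;rewrite rE'.
have ir : (index y r < k)%N by rewrite -sr index_mem.
by exists (Ordinal ir);rewrite/= nth_index.
have [g gP] := choice B.
have gU (j i : 'I_k) : nm (r'`_j - r`_i) < d -> g j = i.
move=> H;apply: (nth_ord_inj ur sr);apply: sep;rewrite ?mem_nth ?sr//.
have := nmD (r`_(g j) - r'`_j) (r'`_j - r`_i).
have := gP j;rewrite (nmB (r'`_j));rewrite addrA subrK;lra.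
have gi : injective g.
apply: surj_inj=> i;have [|v vz vi] := A2 (r`_i);first by rewrite mem_nth ?sr.
have vr : v \in r' by rewrite -rE' vz.
have iv : (index v r' < k)%N by rewrite -sr' index_mem.
by exists (Ordinal iv);apply: gU;rewrite/= nth_index.
have iw : (index w r' < k)%N by rewrite -sr' index_mem.
have iw' : (index w' r' < k)%N by rewrite -sr' index_mem.
have ix : (index x r < k)%N by rewrite -sr index_mem.
have : Ordinal iw = Ordinal iw'.
apply: gi;rewrite (gU _ (Ordinal ix)) ?(gU (Ordinal iw') (Ordinal ix))//=;rewrite !nth_index//.
by move=> /(congr1 val)/= H;rewrite -[w](nth_index 0 wr) -[w'](nth_index 0 wr'') H.
Qed.

Lemma continuous_exp (k : nat) : continuous (fun w : K=> w ^+ k).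
Proof.
elim: k=> [|k IH].
have -> : (fun w : K=> w ^+ 0) = cst 1 by apply/funext.
exact: cst_continuous.
move=> w;have -> : (fun w : K=> w ^+ k.+1) = (fun w : K=> w * w ^+ k).
by apply/funext=> v;rewrite exprS.
by apply: (@continuousM _ _ (fun w : K=> w) (fun w : K=> w ^+ k));[exact: cvg_id|exact: IH].
Qed.

(** Sheets near [z0] are numbered by the root of [X^k - z0] to which they are close. Taking [d] a
    third of the separation of these roots makes the number unambiguous. *)
Lemma loctriv_pw (k : nat) : (0 < k)%N -> loctriv (pw k) [set z | z != 0].
Proof.
move=> k0 z0/= z00;have [r [sr ur rE rP]] := nth_roots k0 z00.
have [d0 d00 sep0] := separation ur;pose d := d0 / 3.
have dp : 0 < d by rewrite /d;lra.
have sep x y : x \in r -> y \in r -> nm (x - y) < 3 * d -> x = y.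
by move=> xr yr H;apply: sep0=> //;move: H;rewrite /d;lra.
(* This radius keeps 0 out of the neighbourhood and every [k]-th root within [d] of a root over
   [z0]. *)
pose e := Num.min (d ^+ k) (nm z0).
have e0 : 0 < e by rewrite lt_min exprn_gt0// nm_gt0.
pose V : set K := [set z | nm (z - z0) < e].
have VL z : V z -> z != 0 /\ nm (z - z0) < d ^+ k.
rewrite /V/= lt_min=> /andP[? H];split=> //;apply: contraTneq H=> ->.
by rewrite sub0r nmN ltxx.
have nV : nbhs z0 V by apply/nbhs_nm;exists e.
have oV z : V z -> nbhs z V.
move=> Vz;apply/nbhs_nm;exists (e - nm (z - z0));first by rewrite subr_gt0.
move=> u Hu;rewrite /V/=;have := nmD (u - z) (z - z0);rewrite addrA subrK;lra.
pose l w := odflt (Ordinal k0) [pick i : 'I_k | nm (w - r`_i) < d].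
have ri (i : 'I_k) : r`_i \in r by rewrite mem_nth ?sr.
have lU w (i : 'I_k) : nm (w - r`_i) < d -> l w = i.
move=> H;rewrite /l;case: pickP=> [j Hj /=|/(_ i)];last by rewrite H.
apply: (nth_ord_inj ur sr).
apply: sep=> //;have := nmD (r`_j - w) (w - r`_i).
by move: Hj;rewrite (nmB w (r`_j)) addrA subrK;lra.
have lP w z : V z -> w ^+ k = z -> nm (w - r`_(l w)) < d.
move=> Vz wz;have [zn0 zz0] := VL z Vz.
have [A1 _ _] := root_labels k0 z00 sr ur rE rP dp sep zn0 zz0.
have [x xr wx] := A1 w wz;have ix : (index x r < k)%N by rewrite -sr index_mem.
by rewrite (lU w (Ordinal ix))/= ?nth_index.
exists V=> //;exists k, l=> z Vz.
have [zn0 zz0] := VL z Vz.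
have [A1 A2 A3] := root_labels k0 z00 sr ur rE rP dp sep zn0 zz0.
split.
- move=> i;have [w wz wi] := A2 (r`_i) (ri i).
by exists w;[rewrite /pw wz|exact: lU].
- move=> w w' [wz] [w'z] E;apply: (A3 w w' (r`_(l w)))=> //;first exact: lP wz.
by rewrite E;exact: lP w'z.
- move=> w W [wz];split.
 move=> /nbhs_nm[e1 e10 HW];have [r' [sr' ur' rE' rP']] := nth_roots k0 zn0.
 pose d1 := Num.min e1 d.
 have d10 : 0 < d1 by rewrite lt_min e10.
 have d1e : d1 <= e1 by rewrite ge_min lexx.
 have d1d : d1 <= d by rewrite ge_min lexx orbT.
 exists (V `&` [set u | nm (u - z) < d1 ^+ k]).
  by apply: filterI;[exact: oV|apply/nbhs_nm;exists (d1 ^+ k);rewrite ?exprn_gt0].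
 move=> w' z' [Vz' z'z] [w'z'] lw'.
 have [||||v vr' Hv] := @root_near k z w' r' d1=> //;rewrite ?sr'// ?w'z'//.
 have vz : v ^+ k = z by apply/eqP;rewrite rE'.
 apply: HW;suff -> : w = v by exact: lt_le_trans Hv d1e.
 apply: (A3 w v (r`_(l w)))=> //;first exact: lP wz.
 have H1 := lP w' z' Vz' w'z';have H2 := lP v z Vz vz.
 suff -> : l w = l v by [].
 rewrite -lw';apply: (nth_ord_inj ur sr).
 apply: sep=> //;have := nmD (r`_(l w') - w') (w' - r`_(l v)).
 have := nmD (w' - v) (v - r`_(l v));rewrite !addrA !subrK.
 by rewrite (nmB (r`_(l w')) w');lra.
move=> [V' nV' HV'];have cz : nbhs w (fun w'=> V' (w' ^+ k)).
 by apply: (continuous_exp (x := w));rewrite wz.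
have lw := lP w z Vz wz.
have : nbhs w [set w' | nm (w' - r`_(l w)) < d].
 apply/nbhs_nm;exists (d - nm (w - r`_(l w)));first by rewrite subr_gt0.
 by move=> u Hu/=;have := nmD (u - w) (w - r`_(l w));rewrite addrA subrK;lra.
move: cz=> /filterI H /H;apply: filterS=> w' [Vw' lw'].
by apply: (HV' w' (w' ^+ k))=> //;exact: lU.
Qed.

End Norm.

(** * Monodromy of the power map around the origin *)

Lemma porbit_step (T : finType) (s : {perm T}) (x : T) : porbit s (s x) = porbit s x.
Proof.
by apply/eqP;rewrite eq_porbit_mem;have := mem_porbit s 1 x;rewrite expg1.
Qed.

Section Punctured.
Variables (R : realType) (lam : R).
Local Notation K := (Cplx R).
Local Notation h := (hh lam).
Local Notation box := (box lam).

(** The parts left of, below, above and right of the puncture are boxes that cover the rest and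
    overlap in turn. *)
Lemma connected_punctured_box (A B : set R) (z0 : K) : is_interval A -> is_interval B ->
(exists2 a, A a & a < rr z0) -> (exists2 a, A a & rr z0 < a) ->
(exists2 b, B b & b < h z0) -> (exists2 b, B b & h z0 < b) ->
connected (box A B `&` [set z | z != z0]).
Proof.
move=> iA iB [a1 Aa1 a10] [a2 Aa2 a20] [b1 Bb1 b10] [b2 Bb2 b20].
have iI (C D : set R) : is_interval C -> is_interval D -> is_interval (C `&` D).
by move=> iC iD x y [Ax Bx] [Ay By] z xzy;split;[exact: iC xzy|exact: iD xzy].
have ii (i : interval R) : is_interval ([set` i] : set R) by exact: interval_is_interval.
have -> : box A B `&` [set z | z != z0] =
 (box (A `&` `]-oo, rr z0[) B `|` box A (B `&` `]-oo, h z0[)) `|`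
 (box A (B `&` `]h z0, +oo[) `|` box (A `&` `]rr z0, +oo[) B).
apply/seteqP;split=> z.
 move=> [[Az Bz] /eqP zz0].
 have [H|H|E] := ltgtP (rr z) (rr z0).
 - by left;left;do !split.
 - by right;right;do !split;rewrite//= in_itv/= andbT.
 have [H|H|E'] := ltgtP (h z) (h z0).
 - by left;right;do !split.
 - by right;left;do !split;rewrite//= in_itv/= andbT.
 by case: zz0;rewrite -[z](mkcK lam) -[z0](mkcK lam) E E'.
have ne (P : Prop) : (P -> z = z0 -> False) -> P -> z != z0.
 by move=> H p0;apply/eqP;exact: H.
rewrite /box/= !in_itv/= !andbT=> -[[[[? H] ?]|[? [? H]]]|[[? [? H]]|[[? H] ?]]];
by split=> //;apply/eqP=> E;rewrite E ltxx in H.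
apply: connectedU.
- exists (mkc lam a1 b2);split;[left|left];rewrite /box/= ?hh_mkc ?in_itv/= ?andbT//.
- apply: connectedU.
+ exists (mkc lam a1 b1);split;rewrite /box/= ?hh_mkc ?in_itv/= ?andbT//.
+ by apply: conn_box=> //;apply: iI.
+ by apply: conn_box=> //;apply: iI.
- apply: connectedU.
+ exists (mkc lam a2 b2);split;rewrite /box/= ?hh_mkc ?in_itv/= ?andbT//.
+ by apply: conn_box=> //;apply: iI.
+ by apply: conn_box=> //;apply: iI.
Qed.

Lemma lab_near (X : topologicalType) (f : X -> P1 R) I (t : K -> I -> I) (l : X -> I) z x :
lab_at f t l z -> f x = P1pt z ->
\forall x' \near x, exists2 z', f x' = P1pt z' & l x' = t z' (l x).
Proof.
move=> [_ _ H] fx;apply/(H _ _ fx);exists setT;first exact: filterT.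
by move=> x' z' _ fx' lx';exists z'.
Qed.

(** A single cut issuing from 0 suffices. The orbit of the label under the monodromy is locally
    constant on the punctured plane, which is connected, so the monodromy is one cycle of length
    [k]. *)
Lemma power_labels (k : nat) : (0 < k)%N -> exists (s : {perm 'I_k}) (l : K -> 'I_k),
(forall z, z != 0 -> lab_at (@pw R k) (jump lam (fun _ : 'I_1=> 0) (fun _=> s) z) l z) /\
(forall i j, j \in porbit s i).
Proof.
move=> k0;have inj0 : injective (fun j : 'I_1=> h ((fun _=> 0 : K) j)).
by move=> i j _;rewrite !ord1.
have BE : [set z : K | forall j : 'I_1, z != 0] = [set z | z != 0].
by apply/seteqP;split=> z;[move/(_ ord0)|move=> z0 _].
have [|n [s [l Hl]]] := @comb_labels R K (@pw R k) lam 1 (fun _=> 0) inj0.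
by rewrite BE;exact: loctriv_pw.
have sE : s = fun _=> s ord0 by apply/funext=> j;rewrite ord1.
have {}Hl z : z != 0 -> lab_at (@pw R k) (jump lam (fun _ : 'I_1=> 0) (fun _=> s ord0) z) l z.
by move=> z0;rewrite -sE;apply: Hl.
(* The fibre over 1 is counted by labels and by roots of unity. *)
have nk : n = k.
have [r [sr ur rE _]] := nth_roots k0 (oner_neq0 K).
have [h1 h2 _] := Hl 1 (oner_neq0 _).
have r1 (i : 'I_k) : pw k r`_i = P1pt 1.
 by congr Some;apply/eqP;rewrite rE mem_nth ?sr.
have L (i : 'I_n) : exists j : 'I_k, l r`_j = i.
 have [w [/eqP]] := h1 i;rewrite rE=> wr <-.
 have iw : (index w r < k)%N by rewrite -sr index_mem.
 by exists (Ordinal iw);rewrite/= nth_index.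
have [g gK] := choice L.
have N1 := leq_card g (@can_inj _ _ g (fun j : 'I_k=> l r`_j) gK).
have li : injective (fun j : 'I_k=> l r`_j).
 by move=> i j /(h2 _ _ (r1 i) (r1 j));exact: nth_ord_inj.
have N2 := leq_card _ li;rewrite !card_ord in N1 N2.
by apply/eqP;rewrite eqn_leq N1.
subst n;exists (s ord0), l;split=> // i j.
have cP : connected [set w : K | w != 0].
have -> : [set w : K | w != 0] = box setT setT `&` [set w | w != 0].
 by apply/seteqP;split=> w//;case.
apply: connected_punctured_box=> //;
[exists (-1)|exists 1|exists (-1)|exists 1]=> //;rewrite ?rr0 ?hh0;lra.
have loc w : w != 0 -> \forall w' \near w, w' != 0 -> porbit (s ord0) (l w') = porbit (s ord0) (l w).
move=> w0;have wk : w ^+ k != 0 by rewrite expf_neq0.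
apply: filterS (lab_near (Hl _ wk) (erefl (pw k w)))=> w' [z' _ ->] _.
rewrite /jump;case: cut_of=> // _;case: ifP=> // _.
exact: porbit_step.
have [h1 _ _] := Hl 1 (oner_neq0 _).
have [w [wi] <-] := h1 i;have [w' [wj] <-] := h1 j.
have nz v : v ^+ k = 1 :> K -> v != 0.
by move=> E;apply/eqP=> v0;move: E;rewrite v0 expr0n eqn0Ngt k0=> /eqP;rewrite eq_sym oner_eq0.
rewrite -eq_porbit_mem;apply/eqP.
exact: (connected_lconst cP loc (nz _ wj) (nz _ wi)).
Qed.

End Punctured.

(** * Ramification charts, properness and unramified fibres *)

Section Ramification.
Variable R : realType.
Local Notation K := (Cplx R).
Local Notation D := (@unit_disc R).

(** Charts are handled through their inverses: parametrizations by the unit disc that are injective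
    and match neighbourhoods in both directions. *)
Definition openemb (Y : topologicalType) (G : K -> Y) : Prop :=
(forall w w', D w -> D w' -> G w = G w' -> w = w') /\
(forall w (W : set Y), D w -> nbhs (G w) W <-> nbhs w (G @^-1` W)).

Lemma open_unit_disc : open D.
Proof.
rewrite openE=> z /unit_disc_nm z1;apply/nbhs_nm;exists (1 - nm z);first by rewrite subr_gt0.
move=> u Hu;apply/unit_disc_nm;have := nmD (u - z) z;rewrite subrK;lra.
Qed.

Lemma unit_disc0 : D 0.
Proof. by apply/unit_disc_nm;rewrite /nm normr0. Qed.

Lemma homeo_openemb (Y : topologicalType) (U : set Y) (phi : Y -> K) (y : Y) :
open U -> U y -> homeo_on U D phi -> phi y = 0 ->
exists G : K -> Y, [/\ openemb G, G 0 = y, forall w, D w -> U (G w)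
 & (forall w, D w -> phi (G w) = w) /\ (forall u, U u -> G (phi u) = u)].
Proof.
move=> oU Uy [[phiD phiI phiS] cphi [G cG GK]] phi0.
have GU w : D w -> U (G w) /\ phi (G w) = w.
by move=> /phiS[u Uu <-];rewrite GK.
exists G;split;last by split=> // w /GU[].
- split.
 by move=> w w' /GU[_ E] /GU[_ E'] H;rewrite -E -E' H.
move=> w W Dw;have [Uw pw] := GU w Dw;split.
 move=> nW;move: cG;rewrite continuous_open_subspace;last exact: open_unit_disc.
 by move=> /(_ w);rewrite inE=> /(_ Dw);apply.
move=> nW;have : nbhs (G w) (phi @^-1` (G @^-1` W)).
 move: cphi;rewrite continuous_open_subspace// => /(_ (G w));rewrite inE=> /(_ Uw).
 by apply;rewrite pw.
move: (open_nbhs_nbhs (conj oU Uw))=> /filterI H /H.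
by apply: filterS=> u [Uu /=];rewrite GK.
- by rewrite -phi0 GK.
- by move=> w /GU[].
Qed.

Lemma openemb_homeo (Y : topologicalType) (G : K -> Y) : openemb G ->
exists phi : Y -> K, [/\ open (G @` D), homeo_on (G @` D) D phi
 & forall w, D w -> phi (G w) = w].
Proof.
move=> [Gi Gn].
have inv y : exists w, (G @` D) y -> D w /\ G w = y.
have [[w Dw <-]|n] := pselect ((G @` D) y);first by exists w.
by exists 0.
have [phi phiP] := choice inv.
have phiK w : D w -> phi (G w) = w.
move=> Dw;have [|D' E] := phiP (G w);first by exists w.
exact: Gi.
have oGD : open (G @` D).
rewrite openE=> _ [w Dw <-];apply/Gn=> //.
by apply: filterS (open_nbhs_nbhs (conj open_unit_disc Dw))=> v Dv;exists v.
exists phi;split=> //;split.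
- split.
+ by move=> _ [w Dw <-];rewrite/= phiK.
+ move=> x y;rewrite !inE=> -[w Dw <-] [w' Dw' <-];rewrite !phiK//.
 by move=> ->.
+ by move=> w Dw;exists (G w);[exists w|rewrite phiK].
- rewrite continuous_open_subspace// => x;rewrite inE=> -[w Dw <-] W.
rewrite phiK// => nW;apply/Gn=> //.
move: (open_nbhs_nbhs (conj open_unit_disc Dw))=> /filterI H;move/H: nW.
by apply: filterS=> v [Dv Wv]/=;rewrite phiK.
- exists G;last by move=> _ [w Dw <-];rewrite phiK.
rewrite continuous_open_subspace;last exact: open_unit_disc.
by move=> w;rewrite inE=> Dw W;exact: (Gn w W Dw).1.
Qed.

Variables (X : topologicalType) (f : X -> P1 R).

Definition chart_at (x : X) (k : nat) (G : K -> X) (H : K -> P1 R) : Prop :=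
[/\ (0 < k)%N, openemb G, openemb H, G 0 = x /\ H 0 = f x
 & forall w, D w -> f (G w) = H (w ^+ k)].

Lemma unit_discX w k : D w -> (0 < k)%N -> D (w ^+ k).
Proof.
move=> /unit_disc_nm w1 k0;apply/unit_disc_nm;rewrite nmX exprn_ilt1 ?nm_ge0//.
by rewrite -lt0n.
Qed.

Lemma ramificationP x k : ramification_index f x k <-> exists G H, chart_at x k G H.
Proof.
split.
- move=> [k0 [U [V [phi [psi [[oU Ux] [oV Vx] [hU phi0] [hV psi0] H]]]]]].
have [G [eG G0 GU [phiG Gphi]]] := homeo_openemb oU Ux hU phi0.
have [H' [eH H0 HV [psiH Hpsi]]] := homeo_openemb oV Vx hV psi0.
exists G, H';split=> // w Dw;have [Vf Ef] := H _ (GU w Dw).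
by rewrite -[LHS]Hpsi// Ef phiG.
- move=> [G [H [k0 eG eH [G0 H0] fG]]];split=> //.
have [phi [oU hU phiG]] := openemb_homeo eG;have [psi [oV hV psiH]] := openemb_homeo eH.
exists (G @` D), (H @` D), phi, psi;split=> //.
+ by split=> //;exists 0=> //;exact: unit_disc0.
+ by split=> //;exists 0=> //;exact: unit_disc0.
+ by split=> //;rewrite -G0 phiG//;exact: unit_disc0.
+ by split=> //;rewrite -H0 psiH//;exact: unit_disc0.
+ move=> _ [w Dw <-];rewrite fG//.
 by split;[exists (w ^+ k)=> //;exact: unit_discX|rewrite psiH ?phiG//;exact: unit_discX].
Qed.

Lemma ramification_continuous x k : ramification_index f x k -> {for x, continuous f}.
Proof.
move=> /ramificationP[G [H [k0 [_ eG] [_ eH] [G0 H0] fG]]] W.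
rewrite -{1}H0=> /(eH 0 W unit_disc0) nW.
suff : nbhs (G 0) (f @^-1` W) by rewrite G0.
apply/eG;first exact: unit_disc0.
have : nbhs (0 : K) (fun w=> W (H (w ^+ k))).
have/= := @continuous_exp R k 0 (H @^-1` W);rewrite expr0n eqn0Ngt k0.
by move=> /(_ nW).
move: (open_nbhs_nbhs (conj open_unit_disc unit_disc0))=> /filterI E /E.
by apply: filterS=> w [Dw HW];rewrite/= fG.
Qed.

(** A value near [f x], but different from it, has [k] preimages in the first chart. In the second
    chart they are distinct roots of an equation of degree [k']. *)
Lemma ramif_le x k k' : ramification_index f x k -> ramification_index f x k' -> (k <= k')%N.
Proof.
move=> /ramificationP[G [H [k0 [Gi eG] [Hi eH] [G0 H0] fG]]].
move=> /ramificationP[G' [H' [k0' [Gi' eG'] [Hi' eH'] [G0' H0'] fG']]].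
have nD : nbhs (0 : K) D by exact: open_nbhs_nbhs (conj open_unit_disc unit_disc0).
have : nbhs (0 : K) [set w | D w /\ (G' @` D) (G w)].
apply: filterI=> //;apply/eG;first exact: unit_disc0.
rewrite G0 -G0';apply/eG';first exact: unit_disc0.
by apply: filterS nD=> v Dv;exists v.
move=> /nbhs_nm[r r0 Hr].
have : nbhs (0 : K) [set c | [/\ D c, nm c < r ^+ k & (H' @` D) (H c)]].
have n1 : nbhs (0 : K) [set c | nm c < r ^+ k].
 by apply/nbhs_nm;exists (r ^+ k);rewrite ?exprn_gt0// => u;rewrite subr0.
have n2 : nbhs (0 : K) [set c | (H' @` D) (H c)].
 apply/eH;first exact: unit_disc0.
 rewrite H0 -H0';apply/eH';first exact: unit_disc0.
 by apply: filterS nD=> v Dv;exists v.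
by move: nD n1 n2=> /filterI A /A /filterI B /B;apply: filterS=> c [[]].
move=> /nbhs_nm[e e0 He].
pose c : K := Complex (e / 2) 0.
have c0 : c != 0 by rewrite /c eq_complex/= eqxx andbT;apply/eqP;lra.
have nc : nm c < e.
by rewrite /nm normc_def/= expr0n addr0 sqrtr_sqr gtr0_norm;lra.
have [|Dc rc [c' Dc' Hc']] := He c;first by rewrite subr0.
have c'0 : c' != 0.
apply/eqP=> E;move: Hc';rewrite E H0' -H0=> /(Hi _ _ unit_disc0 Dc)/esym/eqP.
by rewrite (negPf c0).
have [s [ss us sE _]] := nth_roots k0 c0;have [s' [ss' us' sE' _]] := nth_roots k0' c'0.
have W (i : 'I_k) : exists j : 'I_k', G' s'`_j = G s`_i.
have /eqP wi : s`_i ^+ k == c by rewrite sE mem_nth ?ss.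
have [|Dw [w' Dw' Ew]] := Hr s`_i.
 rewrite subr0 -(@ltr_pXn2r _ k)// ?nnegrE ?nm_ge0 ?(ltW r0)//.
 by rewrite -nmX wi.
have : w' ^+ k' = c'.
 apply: (Hi' _ _ (unit_discX Dw' k0') Dc').
 by rewrite -fG'// Ew fG// wi Hc'.
move/eqP;rewrite sE'=> w's;have iw : (index w' s' < k')%N by rewrite -ss' index_mem.
by exists (Ordinal iw);rewrite/= nth_index.
have [g gP] := choice W.
suff gi : injective g by have := leq_card g gi;rewrite !card_ord.
move=> i j E;have := gP i;rewrite E gP=> F.
have DD (l : 'I_k) : D s`_l.
have /eqP wi : s`_l ^+ k == c by rewrite sE mem_nth ?ss.
have [|//] := Hr s`_l.
rewrite subr0 -(@ltr_pXn2r _ k)// ?nnegrE ?nm_ge0 ?(ltW r0)//.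
by rewrite -nmX wi.
by apply/esym/(nth_ord_inj us ss);exact: (Gi _ _ (DD _) (DD _) F).
Qed.

Lemma ramif_uniq x k k' : ramification_index f x k -> ramification_index f x k' -> k = k'.
Proof. by move=> H H';apply/eqP;rewrite eqn_leq (ramif_le H H') (ramif_le H' H). Qed.

(** The image under the chart of a small box around 0; removing its centre leaves a punctured box,
    which is connected. *)
Lemma ramif_punctured (lam : R) x k (W : set X) : ramification_index f x k -> nbhs x W ->
exists U : set X, [/\ nbhs x U, U `<=` W, connected (U `&` [set u | u <> x]),
 (U `&` [set u | u <> x]) !=set0 & forall u, U u -> u <> x -> f u <> f x].
Proof.
move=> /ramificationP[G [H [k0 [Gi eG] [Hi eH] [G0 H0] fG]]] nW.
have : nbhs (0 : K) [set w | D w /\ W (G w)].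
apply: filterI;first exact: open_nbhs_nbhs (conj open_unit_disc unit_disc0).
by apply/eG;[exact: unit_disc0|rewrite G0].
move=> /(nbhs_box lam)[e e0 He].
pose B := box lam `]-e, e[ `]-e, e[.
have BD w : B w -> D w /\ W (G w).
rewrite /B /box/= !in_itv/= => -[/andP[? ?] /andP[? ?]].
by apply: He;rewrite ?rr0 ?hh0 subr0 ltr_norml;apply/andP;lra.
have E : G @` B `&` [set u | u <> x] = G @` (B `&` [set w | w != 0]).
apply/seteqP;split=> u.
 move=> [[w Bw <-]/= nx];exists w=> //;split=> //=.
 by apply/eqP=> w0;apply: nx;rewrite w0.
move=> [w [Bw /eqP w0] <-];split;first by exists w.
rewrite/= -G0=> /(Gi _ _ (BD _ Bw).1 unit_disc0);exact: w0.
exists (G @` B);split.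
- rewrite -G0;apply/eG;first exact: unit_disc0.
apply: (@filterS _ _ _ B);first by move=> w Bw;exists w.
apply/(nbhs_box lam);exists e=> // u;rewrite rr0 hh0 !subr0 !ltr_norml=> ? ?.
by split;rewrite/= in_itv.
- by move=> _ [w /BD[_ Ww] <-].
- rewrite E;apply: connected_continuous_connected.
 apply: connected_punctured_box;rewrite ?rr0 ?hh0;try exact: interval_is_interval.
 + by exists (- e / 2);rewrite/= ?in_itv/=;try apply/andP;lra.
 + by exists (e / 2);rewrite/= ?in_itv/=;try apply/andP;lra.
 + by exists (- e / 2);rewrite/= ?in_itv/=;try apply/andP;lra.
 + by exists (e / 2);rewrite/= ?in_itv/=;try apply/andP;lra.
apply: continuous_in_subspaceT=> w;rewrite inE=> -[/BD[Dw _] _] W' nW'.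
exact/eG.
- rewrite E;exists (G (mkc lam (e / 2) 0)), (mkc lam (e / 2) 0)=> //;split.
 by split;rewrite/= ?hh_mkc in_itv/=;apply/andP;lra.
by apply/eqP=> /(congr1 (@rr R));rewrite rr_mkc rr0;lra.
- move=> _ [w /BD[Dw _] <-];rewrite fG// -H0=> wx F;apply: wx.
move: F=> /(Hi _ _ (unit_discX Dw k0) unit_disc0)/eqP.
by rewrite expf_eq0 k0/= => /eqP ->.
Qed.

Lemma nbhs_all (T : topologicalType) (x : T) (I : finType) (P : I -> set T) :
(forall i, nbhs x (P i)) -> nbhs x (fun y=> forall i, P i y).
Proof. by move=> H;exact: (@filter_forall T I P (nbhs x) _ H). Qed.

Lemma hausdorff_sep (T : topologicalType) (x y : T) : hausdorff_space T -> x <> y ->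
exists A B : set T, [/\ nbhs x A, nbhs y B & forall z, A z -> B z -> False].
Proof.
move=> hT xy;apply: contrapT=> N;apply: xy;apply: hT=> A B nA nB.
apply: contrapT=> AB;apply: N;exists A, B;split=> // z Az Bz.
by apply: AB;exists z.
Qed.

(** A continuous map from a compact space to a Hausdorff space is closed, so fibres near the one
    over [y] cannot leave a given neighbourhood of it. *)
Lemma tube (y : P1 R) (O : set X) : compact [set: X] -> continuous f -> open O ->
f @^-1` [set y] `<=` O -> \forall y' \near y, f @^-1` [set y'] `<=` O.
Proof.
move=> cX cf oO fO;have hP1 := @P1_hausdorff R 0.
suff H : forall x, [set: X] x -> \forall x' \near x & y' \near y, f x' = y' -> O x'.
have := (compact_near_coveringP _).1 cX _ (nbhs y) (fun y' x=> f x = y' -> O x) _ H.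
by move=> /(_ _);apply: filterS=> y' H' x fx;exact: (H' x).
move=> x _;have [fxy|fxy] := pselect (f x = y).
exists (O, setT);first by split;[exact: open_nbhs_nbhs (conj oO (fO x fxy))|exact: filterT].
by move=> [x' y'] [].
have [A [B [nA nB AB]]] := hausdorff_sep hP1 fxy.
exists (f @^-1` A, B);first by split=> //;exact: cf.
by move=> [x' y'] [/= Ax' By'] fx';case: (AB y')=> //;rewrite -fx'.
Qed.

Lemma connected_P1 : connected [set: P1 R].
Proof.
have -> : [set: P1 R] = closure (range (@P1pt R)).
apply/seteqP;split=> // -[z|] _;first by apply: subset_closure;exists z.
move=> W /(nbhs_P1infty 0)[_ [e e0 He]];exists (P1pt (mkc 0 (e + 1) 0));split.
 by exists (mkc 0 (e + 1) 0).
by apply: He;left;rewrite rr_mkc gtr0_norm;lra.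
apply: connected_closure;apply: connected_continuous_connected.
have -> : [set: K] = box 0 setT setT by apply/seteqP;split.
exact: conn_box.
by apply: continuous_subspaceT=> x;exact: one_point_compactification_some_continuous.
Qed.

(** Being attained is a locally constant property of [y]: near an attained value the chart provides
    roots, and near a missed one [tube] applies with the empty neighbourhood. The projective line is
    connected. *)
Lemma branched_surjective : compact [set: X] -> [set: X] !=set0 ->
(forall x, exists k, ramification_index f x k) -> forall y, exists x, f x = y.
Proof.
move=> cX [x0 _] ram y.
have cf : continuous f by move=> x;have [k] := ram x;exact: ramification_continuous.
suff <- : (exists x, f x = f x0) = (exists x, f x = y) by exists x0.
apply: (connected_lconst connected_P1 (g := fun y=> exists x, f x = y))=> // {}y _.
have [[x <-]|nx] := pselect (exists x, f x = y).
have [k /ramificationP[G [H [k0 [_ eG] [_ eH] [G0 H0] fG]]]] := ram x.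
have : nbhs (f x) (H @` D).
 rewrite -H0;apply/eH;first exact: unit_disc0.
 by apply: filterS (open_nbhs_nbhs (conj open_unit_disc unit_disc0))=> v Dv;exists v.
apply: filterS=> _ [c Dc <-] _;apply/propext;split=> [_|_];first by exists x.
have [->|c0] := eqVneq c 0;first by exists x;rewrite H0.
have [[|w s] [ss _ sE _]] := nth_roots k0 c0;first by rewrite -ss in k0.
have /eqP wk : w ^+ k == c by rewrite sE mem_head.
exists (G w);rewrite fG ?wk//;move: Dc=> /unit_disc_nm;rewrite -wk nmX=> H1.
apply/unit_disc_nm;rewrite ltNge;apply/negP=> w1.
by move: H1;rewrite ltNge exprn_ege1.
have N : f @^-1` [set y] `<=` set0 by move=> x fx;apply: nx;exists x.
apply: filterS (tube cX cf open0 N)=> y' H' _;apply/propext;split=> [[x fx]|//].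
by case: (H' x fx).
Qed.

(** Charts at the points of the fibre are shrunk until they are disjoint. By [tube] they contain all
    nearby fibres, and the label of a point is the chart in which it lies. *)
Lemma loctriv_unramified (z0 : K) (d : nat) (x : 'I_d -> X) :
compact [set: X] -> hausdorff_space X -> continuous f -> injective x -> (0 < d)%N ->
range x = f @^-1` [set P1pt z0] -> (forall i, ramification_index f (x i) 1) ->
exists2 V, nbhs z0 V & exists d, exists l : X -> 'I_d, triv f V l.
Proof.
move=> cX hX cf xi d0 rx ram.
have [G GP] := choice (fun i=> (ramificationP _ _).1 (ram i)).
have [H {}GP] := choice GP.
have [r r0 rP] : exists2 r, 0 < r & forall ij : 'I_d * 'I_d, r <= 1 /\
 (ij.1 != ij.2 -> forall w w', nm w < r -> nm w' < r -> G ij.1 w <> G ij.2 w').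
apply: uniform_eps=> [ij e e' e'0 ee [e1 He]|[i j]].
 split=> [|n w w' h1 h2];first exact: le_trans e1.
 by apply: He=> //;exact: lt_le_trans ee.
have [->|ij] := eqVneq i j;first by exists 1=> //;rewrite eqxx.
have xij : x i <> x j by move=> /xi/eqP;rewrite (negPf ij).
have [A [B [nA nB AB]]] := hausdorff_sep hX xij.
have [_ [_ eGi] _ [Gi0 _] _] := GP i;have [_ [_ eGj] _ [Gj0 _] _] := GP j.
have nA' : nbhs (0 : K) (G i @^-1` A) by apply/eGi;[exact: unit_disc0|rewrite Gi0].
have nB' : nbhs (0 : K) (G j @^-1` B) by apply/eGj;[exact: unit_disc0|rewrite Gj0].
have /nbhs_nm[e e0 He] : nbhs (0 : K) ((G i @^-1` A) `&` (G j @^-1` B)) by exact: filterI.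
exists (Num.min e 1);first by rewrite lt_min e0 ltr01.
split=> [|_ w w'];first by rewrite ge_min lexx orbT.
rewrite/= !lt_min=> /andP[w1 _] /andP[w2 _] E.
have [A1 _] := He w (eq_ind_r (fun u=> is_true (nm u < e)) w1 (subr0 w)).
have [_ B1] := He w' (eq_ind_r (fun u=> is_true (nm u < e)) w2 (subr0 w')).
by apply: (AB (G i w))=> //;rewrite E.
have r1 : r <= 1 by have [] := rP (Ordinal d0, Ordinal d0).
pose B : set K := [set w | nm w < r].
have BD : B `<=` D by move=> w Bw;apply/unit_disc_nm;exact: lt_le_trans r1.
have oB w : B w -> nbhs w B.
move=> Bw;apply/nbhs_nm;exists (r - nm w);first by rewrite subr_gt0.
by move=> u Hu;rewrite /B/=;have := nmD (u - w) w;rewrite subrK;lra.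
have B0 : B 0 by rewrite /B/= /nm normr0.
have fGH i w : B w -> f (G i w) = H i w.
by move=> /BD Dw;have [_ _ _ _ ->] := GP i;rewrite ?expr1.
have nG i w : B w -> nbhs (G i w) (G i @` B).
move=> Bw;have [_ [_ eG] _ _ _] := GP i;apply/eG;first exact: BD.
by apply: filterS (oB w Bw)=> v Bv;exists v.
pose O := \bigcup_i (G i @` B).
have oO : open O.
rewrite openE=> _ [i _ [w Bw <-]];apply: filterS (nG i w Bw)=> u Hu.
by exists i.
have fO : f @^-1` [set P1pt z0] `<=` O.
rewrite -rx=> _ [i _ <-];exists i=> //;exists 0=> //.
by have [_ _ _ [-> _] _] := GP i.
have V1 := tube cX cf oO fO.
have V2 : \forall y \near P1pt z0, forall i, (H i @` B) y.
apply: nbhs_all=> i.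
have [_ _ [_ eH] [_ H0] _] := GP i.
have -> : P1pt z0 = H i 0.
 by rewrite H0;have : range x (x i) by [];rewrite rx.
apply/eH;first exact: unit_disc0.
by apply: filterS (oB 0 B0)=> v Bv;exists v.
pose VV := [set z | f @^-1` [set P1pt z] `<=` O /\ forall i, (H i @` B) (P1pt z)].
have nVV : nbhs z0 VV by apply: filterI;[exact: V1|exact: V2].
have HB w w' i : B w -> B w' -> H i w = H i w' -> w = w'.
by move=> Bw Bw';have [_ _ [Hi _] _ _] := GP i;apply: Hi;exact: BD.
pose l u := odflt (Ordinal d0) [pick i | `[< (G i @` B) u >]].
have lE i w : B w -> l (G i w) = i.
move=> Bw;rewrite /l;case: pickP=> [j /asboolP[w' Bw' E] /=|/(_ i)/asboolP];last first.
 by case;exists w.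
apply/eqP;apply: contrapT=> /negP ji;have [_ /(_ ji)] := rP (j, i).
by move=> /(_ w' w Bw' Bw).
have lO u : O u -> exists2 w, B w & u = G (l u) w.
by move=> [i _ [w Bw <-]];exists w=> //;rewrite lE.
exists VV°;first exact: nbhs_interior.
exists d, l=> z nz;have [VO VH] := interior_subset nz;split.
- by move=> i;have [w Bw E] := VH i;exists (G i w);rewrite ?fGH ?E ?lE.
- move=> u u' fu fu' E;have [w Bw uE] := lO u (VO u fu);have [w' Bw' uE'] := lO u' (VO u' fu').
rewrite uE uE' -E;congr G;apply: (HB _ _ (l u))=> //.
by rewrite -!fGH// {2}E -uE -uE' fu fu'.
- move=> u W fu;have [w Bw uE] := lO u (VO u fu);split=> [nW|[V' nV' HV']].
 have [_ [_ eG] [_ eH] _ _] := GP (l u).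
 have nW' : nbhs w (G (l u) @^-1` W) by apply/eG;[exact: BD|rewrite -uE].
 have : nbhs (P1pt z) (H (l u) @` (B `&` (G (l u) @^-1` W))).
  rewrite -fu {1}uE fGH//;apply/eH;first exact: BD.
  have : nbhs w (B `&` (G (l u) @^-1` W)) by apply: filterI=> //;exact: oB.
  by apply: filterS=> v Hv;exists v.
 move=> nH;exists (VV° `&` [set z' | (H (l u) @` (B `&` (G (l u) @^-1` W))) (P1pt z')]).
  by apply: filterI=> //;exact: open_nbhs_nbhs (conj (@open_interior _ _) nz).
 move=> u' z' [Vz' [v [Bv Wv] Hv]] fu' lu'.
 have [w' Bw' uE'] := lO u' ((interior_subset Vz').1 u' fu').
 rewrite uE' lu';suff -> : w' = v by [].
 by apply: (HB _ _ (l u))=> //;rewrite Hv -fGH// -lu' -uE' fu'.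
have : nbhs u (f @^-1` [set y | exists2 z', y = P1pt z' & V' z']).
 apply: cf;rewrite fu;apply: filterS nV'=> z' Vz';exists z'=> //.
have : nbhs u (G (l u) @` B) by rewrite {1}uE;exact: nG.
move=> /filterI A /A;apply: filterS=> u' [[w' Bw' <-] [z' fz' Vz']].
by apply: (HV' _ z')=> //;exact: lE.
Qed.

End Ramification.

(** * Transport of labels towards a point of the projective line *)

Section Model.
Variables (R : realType) (lam : R).
Local Notation K := (Cplx R).
Local Notation h := (hh lam).
Variables (M : nat) (p : 'I_M -> K).
Hypothesis srt : forall i j : 'I_M, (i < j)%N -> h (p j) < h (p i).
Variables (d : nat) (s : 'I_M -> {perm 'I_d}).

Lemma inj_hp : injective (fun j=> h (p j)).
Proof.
move=> i j/= E;apply/val_inj/eqP.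
by case: ltngtP=> // /srt;rewrite E ltxx.
Qed.

Lemma hp_ltE i j : (h (p j) < h (p i)) = (i < j)%N.
Proof.
apply/idP/idP=> [H|];last exact: srt.
by rewrite ltnNge;apply/negP;rewrite leq_eqVlt=> /orP[/eqP/val_inj E|/srt];
[move: H;rewrite E ltxx|move/lt_trans/(_ H);rewrite ltxx].
Qed.

(** The points are numbered from the highest to the lowest, so this ordered product is what a label
    undergoes when running downwards far to the right, across all the cuts. [mono_ge z] is the part
    met before the height of [z]. *)
Definition mono_inf : {perm 'I_d} := (\prod_(j < M) s j)%g.
Definition mono_ge (z : K) : {perm 'I_d} := (\prod_(j < M | h z < h (p j)) s j)%g.

Definition mono (y : P1 R) : {perm 'I_d} :=
if y is Some z then (if [pick j | p j == z] is Some j then s j else 1%g) else mono_inf.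

(** Starting the maximum at 0 places the half-plane [rmax < rr] to the right of 0, where the ray
    used at infinity begins. *)
Definition rmax : R := \big[Num.max/0]_j rr (p j).

Lemma rmax_ge0 : 0 <= rmax. Proof. exact: bigmax_ge_id. Qed.
Lemma rr_le_rmax j : rr (p j) <= rmax. Proof. exact: le_bigmax. Qed.

(** [transport y z] turns the name that a sheet has at [y] into its label at a nearby [z]. At
    infinity the names are the labels outside the half-plane [rmax < rr]. Inside it the cuts are
    counted from the top at heights at least 0 and from the bottom at negative heights, which
    concentrates the discrepancy [mono_inf] at height 0. *)
Definition transport (y : P1 R) (z : K) : {perm 'I_d} :=
match y with
| Some z0=> if cut_of lam p z0 is Some j then (if h z < h z0 then s j else 1%g) else 1%g
| None=> if rmax < rr z then
    (if 0 <= h z then mono_ge z else mono_inf^-1 * mono_ge z)%g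
    else 1%g
end.

Lemma trans_ptE z0 z : transport (P1pt z0) z =
if cut_of lam p z0 is Some j then (if h z < h z0 then s j else 1%g) else 1%g.
Proof. by []. Qed.

Lemma trans_infE z : transport (P1infty R) z = if rmax < rr z then
(if 0 <= h z then mono_ge z else mono_inf^-1 * mono_ge z)%g else 1%g.
Proof. by []. Qed.

Lemma jump_transport z z' i : jump lam p s z z' i = transport (P1pt z) z' i.
Proof.
by rewrite /jump /transport/=;case: cut_of=> [j|];[case: ifP|];rewrite ?perm1.
Qed.

Definition center (y : P1 R) : K := if y is Some z then z else 0.

(** The jump [t] across the single ray to the right of [c]: the local model that corrected labels
    have to follow. At infinity [center] makes this ray start at 0. *)
Definition jump1 (c : K) (t : {perm 'I_d}) (z z' : K) : {perm 'I_d} :=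
if [&& h z == h c, rr c < rr z & h z' < h z] then t else 1%g.

Lemma single_jump1 c z z' : jump1 c 1%g z z' = 1%g.
Proof. by rewrite /jump1;case: ifP. Qed.

(** By the ordering, the points strictly above [z] are those of index below [j], so descending past
    the height of [p j] appends [s j] at the end of the product. *)
Lemma mono_above_step z z' j : h z = h (p j) -> h z' < h z ->
(forall i, h z' < h (p i) -> h z <= h (p i)) ->
mono_ge z' = (mono_ge z * s j)%g.
Proof.
move=> hz hz' Hi;rewrite /mono_ge.
pose s' n := if insub n is Some i then s i else 1%g.
have E n : (n <= M)%N -> (\prod_(i < M | (i < n)%N) s i = \prod_(0 <= i < n) s' i)%g.
move=> nM;rewrite (big_ord_narrow nM) big_mkord;apply: eq_bigr=> i _.
by rewrite /s' insubT ?(leq_trans (ltn_ord i))// => H;congr s;apply: val_inj.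
have -> : (\prod_(i < M | h z < h (p i)) s i = \prod_(i < M | (i < j)%N) s i)%g.
by apply: eq_bigl=> i;rewrite hz hp_ltE.
have -> : (\prod_(i < M | h z' < h (p i)) s i = \prod_(i < M | (i < j.+1)%N) s i)%g.
apply: eq_bigl=> i;rewrite ltnS leq_eqVlt -hp_ltE -hz.
apply/idP/idP=> [/Hi|/orP[/eqP/val_inj ->|]].
- by rewrite le_eqVlt=> /orP[/eqP E'|->];rewrite ?orbT//;move: E';rewrite hz=> /inj_hp ->;rewrite eqxx.
- by rewrite -hz.
- exact: lt_trans.
rewrite !E//;last exact: ltnW.
rewrite big_nat_recr//=;congr (_ * _)%g.
by rewrite /s' insubT// => H;congr s;apply: val_inj.
Qed.

Lemma mono_above_const z z' : (forall i, (h z' < h (p i)) = (h z < h (p i))) ->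
mono_ge z' = mono_ge z.
Proof. by move=> H;apply: eq_bigl. Qed.

Lemma near_isolated (z0 : K) : exists2 e, 0 < e & forall z,
`|rr z - rr z0| < e -> `|h z - h z0| < e -> forall j,
 [/\ h z = h (p j) -> h (p j) = h z0,
  (h (p j) = h z0 -> rr (p j) <> rr z0 -> (rr (p j) < rr z) = (rr (p j) < rr z0) /\ rr z <> rr (p j))
  & h (p j) <> h z0 -> (h z < h (p j)) = (h z0 < h (p j))].
Proof.
have [e e0 He] := isolate lam p z0;exists e=> // z.
rewrite !ltr_norml=> /andP[r1 r2] /andP[h1 h2] j;have [H1 H2] := He j;split.
- by move=> E;apply: H1;rewrite -E ltr_norml;apply/andP.
- move=> E /eqP n;have := H2 E n;have [lt|ge] := ltP (rr (p j)) (rr z0).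
 by rewrite ltr0_norm ?subr_lt0// => ?;split;[apply/idP|];lra.
by rewrite ger0_norm ?subr_ge0// => ?;split;[apply/negbTE;rewrite -leNgt|];lra.
- move=> n;have := contra_not H1 n=> /negP;rewrite -leNgt.
have [lt|ge] := ltP (h z0) (h (p j)).
 by rewrite gtr0_norm ?subr_gt0// => ?;apply/idP;lra.
by rewrite ler0_norm ?subr_le0// => ?;apply/negbTE;rewrite -leNgt;lra.
Qed.

Lemma pt_eq (z z' : K) : rr z = rr z' -> h z = h z' -> z = z'.
Proof. by move=> e1 e2;rewrite -[z](mkcK lam) e1 e2 mkcK. Qed.

Lemma mono_ord (z : K) : (forall j, z != p j) -> mono (P1pt z) = 1%g.
Proof.
move=> H;rewrite /mono/=;case: pickP=> // j /eqP E;by have := H j;rewrite E eqxx.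
Qed.

Lemma mono_p j : mono (P1pt (p j)) = s j.
Proof.
rewrite /mono/=;case: pickP=> [i /eqP E|/(_ j)];last by rewrite eqxx.
by congr s;apply: inj_hp;rewrite/= E.
Qed.

Lemma cut_of_none z : (forall j, h z = h (p j) -> rr z <= rr (p j)) -> cut_of lam p z = None.
Proof.
move=> H;rewrite /cut_of;case: pickP=> // j /andP[/eqP /H];by rewrite leNgt=> /negPf ->.
Qed.

(* The labels corrected by [transport] jump only across one ray from the centre,
 where they jump by the local monodromy. *)
Lemma transport_law_pt (z0 : K) : \forall z \near z0, z <> z0 -> (forall j, z != p j) /\
\forall z' \near z, forall i, transport (P1pt z0) z' (jump1 z0 (mono (P1pt z0)) z z' i) =
 transport (P1pt z) z' (transport (P1pt z0) z i).
Proof.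
have [e e0 He] := near_isolated z0;apply/(nbhs_box lam);exists e=> // z r1 h1 zz0.
have zp j : z != p j.
apply/eqP=> E;have [A1 A2 A3] := He z r1 h1 j;apply: zz0.
have hz0 := A1 (congr1 h E).
rewrite E;apply: pt_eq=> //;apply: contrapT=> n.
by have [_] := A2 hz0 n;rewrite E.
split=> //.
have [zl|nzl] := pselect (h z = h z0);last first.
have cz : cut_of lam p z = None.
 by apply: cut_of_none=> j E;have [A1 _ _] := He z r1 h1 j;case: nzl;rewrite E A1.
have S1 z' : jump1 z0 (mono (P1pt z0)) z z' = 1%g.
 by rewrite /jump1;case: eqP.
have : nbhs z [set z' | (h z' < h z0) = (h z < h z0)].
 apply/(nbhs_box lam);exists `|h z - h z0|;first by rewrite normr_gt0 subr_eq0;apply/eqP.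
 move=> u _;rewrite/= ltr_norml=> /andP[];have [?|?] := ltP (h z) (h z0).
  by rewrite ltr0_norm ?subr_lt0// => ? ?;apply/idP;lra.
 by rewrite ger0_norm ?subr_ge0// => ? ?;apply/negbTE;rewrite -leNgt;lra.
by apply: filterS=> z' E i;rewrite S1 perm1 ?trans_ptE ?trans_infE cz E perm1.
have S0 : nbhs z (fun z' : K=> True) by exact: filterT.
case c0: (cut_of lam p z0)=> [j|].
have /andP[/eqP hj rj] : on_cut lam p j z0.
 by move: c0;rewrite /cut_of;case: pickP=> // i ci [<-].
have cz : cut_of lam p z = Some j.
 apply: cut_ofP;first exact: inj_hp.
 have [_ A2 _] := He z r1 h1 j;have [|E _] := A2 (esym hj).
  by move=> E;rewrite E ltxx in rj.
 by rewrite /on_cut zl hj eqxx E.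
have m1 : mono (P1pt z0) = 1%g.
 apply: mono_ord=> i;apply/eqP=> E.
 have : h (p j) = h (p i) by rewrite -hj E.
 by move/inj_hp=> ji;rewrite ji E ltxx in rj.
apply: filterS S0=> z' _ i;rewrite m1 ?trans_ptE ?trans_infE c0 cz zl ltxx perm1.
by rewrite single_jump1 perm1.
have [[j pj]|npj] := pselect (exists j, z0 = p j).
rewrite [in mono _]pj mono_p;apply: filterS S0=> z' _ i.
rewrite ?trans_ptE ?trans_infE c0 !perm1 /jump1;case: ltP=> [rz|rz]/=.
 have cz : cut_of lam p z = Some j.
  apply: cut_ofP;first exact: inj_hp.
  by rewrite /on_cut zl pj eqxx -pj.
 by rewrite zl eqxx/= cz.
rewrite andbF perm1 cut_of_none ?perm1// => i' E';have [A1 _ _] := He z r1 h1 i'.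
have := A1 E';rewrite [h z0](congr1 h pj)=> /inj_hp ->;by rewrite -pj.
have m1 : mono (P1pt z0) = 1%g.
by apply: mono_ord=> i;apply/eqP=> E;apply: npj;exists i.
apply: filterS S0=> z' _ i;rewrite m1 ?trans_ptE ?trans_infE c0 !perm1.
rewrite cut_of_none;last first.
move=> j E;have [A1 A2 _] := He z r1 h1 j;have E0 := A1 E.
have nr : rr (p j) <> rr z0 by move=> E1;apply: npj;exists j;exact: pt_eq.
have [A21 _] := A2 E0 nr;rewrite leNgt A21;apply/negP=> lt.
have : on_cut lam p j z0 by rewrite /on_cut E0 eqxx.
by move/(cut_ofP inj_hp);rewrite c0.
by rewrite single_jump1 !perm1.
Qed.

(** Far out and left of [rmax] no cut is met. To the right, crossing the cut of [p j] appends [s j]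
    to [mono_ge], as it does to labels, and height 0 contributes [mono_inf]. On the line [rr = rmax]
    only heights above or below all branch points occur, where the correction is the identity. *)
Lemma transport_law_inf : exists2 e, 0 < e & forall z, e < `|rr z| \/ e < `|h z| -> (forall j, z != p j) /\
\forall z' \near z, forall i, transport (P1infty R) z' (jump1 0 mono_inf z z' i) =
 transport (P1pt z) z' (transport (P1infty R) z i).
Proof.
have [e e0 He] : exists2 e, 0 < e & forall j, `|rr (p j)| <= e /\ `|h (p j)| <= e.
exists (1 + \sum_j (`|rr (p j)| + `|h (p j)|)).
 by rewrite ltr_wpDr// sumr_ge0// => i _;rewrite addr_ge0.
move=> j;rewrite (bigD1 j)//=.
have := normr_ge0 (rr (p j));have := normr_ge0 (h (p j)).
have : 0 <= \sum_(i < M | i != j) (`|rr (p i)| + `|h (p i)|) by rewrite sumr_ge0// => i _;rewrite addr_ge0.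
lra.
have rme : rmax <= e.
by apply/bigmax_leP;split=> [|j _];[exact: ltW|exact: le_trans (ler_norm _) (He j).1].
exists e=> // z Hz.
have zp j : z != p j.
by apply/eqP=> E;have [] := He j;rewrite -E;case: Hz;lra.
split=> //.
have above z' : h z' > e -> mono_ge z' = 1%g.
move=> H;rewrite /mono_ge big1// => j Hj;exfalso;have [_] := He j;rewrite ler_norml=> /andP[? ?];lra.
have below z' : h z' < - e -> mono_ge z' = mono_inf.
move=> H;rewrite /mono_ge;apply: eq_bigl=> j.
by have [_] := He j;rewrite ler_norml=> /andP[? ?];apply/idP;lra.
have nbh (P : K -> Prop) (eps : R) : 0 < eps -> (forall u, `|rr u - rr z| < eps -> `|h u - h z| < eps -> P u) -> nbhs z P.
by move=> eps0 HP;apply/(nbhs_box lam);exists eps.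
have [rz|rz|rz] := ltgtP (rr z) rmax.
- have cz : cut_of lam p z = None.
 apply: cut_of_none=> j E;have [B1 B2] := He j.
 have {}Hz : e < `|rr z| by case: Hz=> //;rewrite E;lra.
 move: B1;rewrite ler_norml=> /andP[? ?].
 have : rr z < - e by case: (lerP 0 (rr z)) Hz=> [?|?];[rewrite ger0_norm//|rewrite ltr0_norm//];lra.
 lra.
apply: (nbh _ (rmax - rr z));first by rewrite subr_gt0.
move=> u;rewrite ltr_norml=> /andP[? ?] _ i;rewrite ?trans_ptE ?trans_infE cz.
rewrite [rmax < rr u]ltNge [rmax < rr z]ltNge (ltW rz)/= (_ : rr u <= rmax)/=;last lra.
rewrite !perm1 /jump1;case: and3P=> [[/eqP hz]|_];rewrite ?perm1// rr0.
move=> rz0 _;exfalso;rewrite hh0 in hz;move: Hz;rewrite hz normr0 gtr0_norm//;case;lra.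
- have [E EP Ez] := near_isolated z.
apply: (nbh _ (Num.min E (Num.min (rr z - rmax) (if h z == 0 then 1 else `|h z|)))).
 rewrite !lt_min EP subr_gt0 rz/=;case: ifP=> [//|/negbT ?];by rewrite normr_gt0.
move=> u;rewrite !lt_min=> /and3P[ru1 ru2 _] /and3P[hu1 _ hu2] i.
have ru : rmax < rr u by move: ru2;rewrite ltr_norml=> /andP[? ?];lra.
have step : mono_ge u = (mono_ge z * transport (P1pt z) u)%g.
 rewrite ?trans_ptE ?trans_infE;case cz: (cut_of lam p z)=> [j|].
  have /andP[/eqP hj _] : on_cut lam p j z.
  by move: cz;rewrite /cut_of;case: pickP=> // j' cj [<-].
  case: ltP=> huz.
  apply: mono_above_step=> // j';rewrite leNgt=> H1;apply/negP=> H2.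
  have [_ _ A3] := Ez u ru1 hu1 j'.
  have : h (p j') <> h z by move=> E';rewrite E' ltxx in H2.
  by move/A3;rewrite H1 ltNge (ltW H2).
  rewrite mulg1;apply: mono_above_const=> j'.
  have [_ _ A3] := Ez u ru1 hu1 j';have [E'|n] := eqVneq (h (p j')) (h z).
  by rewrite E' ltxx;apply/negbTE;rewrite -leNgt.
  by apply: A3;apply/eqP.
 rewrite mulg1;apply: mono_above_const=> j'.
 have [_ _ A3] := Ez u ru1 hu1 j';have [E'|n] := eqVneq (h (p j')) (h z);last by apply: A3;apply/eqP.
 have : on_cut lam p j' z by rewrite /on_cut E' eqxx (le_lt_trans (rr_le_rmax j')).
 by move/(cut_ofP inj_hp);rewrite cz.
rewrite -permM.
have -> : transport (P1infty R) z = (if 0 <= h z then mono_ge z else mono_inf^-1 * mono_ge z)%g.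
 by rewrite ?trans_ptE ?trans_infE rz.
have -> : transport (P1infty R) u = (if 0 <= h u then mono_ge u else mono_inf^-1 * mono_ge u)%g.
 by rewrite ?trans_ptE ?trans_infE ru.
rewrite step -[LHS]permM;congr (fun_of_perm _ i);rewrite /jump1 rr0 hh0 (le_lt_trans rmax_ge0 rz)/=.
have [hz|hz] := eqVneq (h z) 0.
 rewrite hz lexx/=;have [hu|hu] := ltP (h u) 0;rewrite ?mul1g//.
 by rewrite !mulgA mulgV mul1g.
rewrite/= mul1g (negPf hz) in hu2 *.
have -> : (0 <= h u) = (0 <= h z).
 move: hu2;rewrite ltr_norml=> /andP[];have [?|?] := leP 0 (h z).
  by rewrite ger0_norm// => ? ?;apply/idP;lra.
 by rewrite ltr0_norm// => ? ?;apply/negbTE;rewrite -ltNge;lra.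
by case: ifP=> _;rewrite ?mulgA.
- have {Hz} : e < h z \/ h z < - e.
 case: Hz;first by rewrite rz ger0_norm ?rmax_ge0//;lra.
 by case: (lerP 0 (h z))=> [?|?];[rewrite ger0_norm//|rewrite ltr0_norm//]=> ?;[left|right];lra.
move=> Hz;have cz : cut_of lam p z = None.
 apply: cut_of_none=> j E;exfalso;have [_] := He j;rewrite -E ler_norml=> /andP[? ?].
 by case: Hz=> ?;lra.
have hz0 : h z != 0 by apply/eqP=> E;case: Hz;rewrite E;lra.
have SJ u : jump1 0 mono_inf z u = 1%g by rewrite /jump1 hh0 (negPf hz0).
have Tz : transport (P1infty R) z = 1%g by rewrite ?trans_ptE ?trans_infE rz ltxx.
have Tu u : transport (P1pt z) u = 1%g by rewrite ?trans_ptE ?trans_infE cz.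
case: Hz=> Hz.
 apply: (nbh _ (h z - e));first by rewrite subr_gt0.
 move=> u _;rewrite ltr_norml=> /andP[? ?] i;rewrite SJ Tz Tu !perm1.
 have ue : e < h u by lra.
 rewrite ?trans_ptE ?trans_infE above// (_ : 0 <= h u);last lra.
 by case: ifP=> _;rewrite perm1.
apply: (nbh _ (- e - h z));first by rewrite subr_gt0.
move=> u _;rewrite ltr_norml=> /andP[? ?] i;rewrite SJ Tz Tu !perm1.
have ue : h u < - e by lra.
rewrite ?trans_ptE ?trans_infE below// leNgt (_ : h u < 0)/=;last lra.
by rewrite mulVg;case: ifP=> _;rewrite perm1.
Qed.

End Model.

(** * The model cover attached to a tuple of permutations *)

Section Representatives.
Variable d : nat.

(** What [pick] returns depends on the orbit only, so this chooses one element in each cycle and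
    replaces a quotient type. *)
Definition orbit_rep (t : {perm 'I_d}) (i : 'I_d) : 'I_d :=
odflt i [pick j in porbit t i].

Lemma orbit_rep_in t i : porbit t (orbit_rep t i) = porbit t i.
Proof.
rewrite /orbit_rep;case: pickP=> [j ji /=|//].
by apply/eqP;rewrite eq_porbit_mem.
Qed.

Lemma orbit_repE t i j : porbit t i = porbit t j -> orbit_rep t i = orbit_rep t j.
Proof.
move=> E;rewrite /orbit_rep E;case: pickP=> [//|/(_ j)].
by rewrite porbit_id.
Qed.

Lemma porbit1 (i : 'I_d) : porbit 1 i = [set i]%SET.
Proof.
apply/setP=> j;rewrite inE;apply/porbitP/eqP=> [[n ->]|->];first by rewrite expg1n perm1.
by exists 0%N;rewrite expg0 perm1.
Qed.

Lemma porbit1_inj (i j : 'I_d) : porbit 1 i = porbit 1 j -> i = j.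
Proof. by rewrite !porbit1=> /setP/(_ i);rewrite !inE eqxx=> /esym/eqP. Qed.

Lemma porbit_invstep (T : finType) (t : {perm T}) (x : T) : porbit t ((t^-1)%g x) = porbit t x.
Proof. by rewrite -{2}[x](permKV t) porbit_step. Qed.
End Representatives.

Section ModelTopology.
Variables (R : realType) (lam : R).
Local Notation K := (Cplx R).
Local Notation h := (hh lam).
Variables (M : nat) (p : 'I_M -> K).
Variable srt : forall i j : 'I_M, (i < j)%N -> h (p j) < h (p i).
Variables (d : nat) (s : 'I_M -> {perm 'I_d}).

(* A point over y is an orbit of the local monodromy at y, given by its representative. *)
Definition model of (forall i j : 'I_M, (i < j)%N -> h (p j) < h (p i)) : Type :=
{x : P1 R * 'I_d | orbit_rep (mono p s x.1) x.2 == x.2}.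
Local Notation X := (model srt).

HB.instance Definition _ := gen_eqMixin X.
HB.instance Definition _ := gen_choiceMixin X.

Definition prj (x : X) : P1 R := (sval x).1.
Definition lbl (x : X) : 'I_d := (sval x).2.

Lemma mk_subproof y i : orbit_rep (mono p s y) (orbit_rep (mono p s y) i) == orbit_rep (mono p s y) i.
Proof. by apply/eqP/orbit_repE;exact: orbit_rep_in. Qed.

Definition mk y i : X := exist (fun x : P1 R * 'I_d=> orbit_rep (mono p s x.1) x.2 == x.2)
(y, orbit_rep (mono p s y) i) (mk_subproof y i).

Lemma prj_mk y i : prj (mk y i) = y. Proof. by []. Qed.
Lemma lbl_mk y i : porbit (mono p s y) (lbl (mk y i)) = porbit (mono p s y) i.
Proof. exact: orbit_rep_in. Qed.

Lemma model_eq (x x' : X) : prj x = prj x' ->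
porbit (mono p s (prj x)) (lbl x) = porbit (mono p s (prj x)) (lbl x') -> x = x'.
Proof.
case: x x'=> [[y i]/= e] [[y' i']/= e'];rewrite /prj /lbl/= => yy';subst y'=> E.
have ii' : i = i' by rewrite -(eqP e) -(eqP e') (orbit_repE E).
by subst i';congr exist;exact: bool_irrelevance.
Qed.

Lemma mk_prj_lbl x : mk (prj x) (lbl x) = x.
Proof. by apply: model_eq=> //;rewrite orbit_rep_in. Qed.

Definition trans (y y' : P1 R) : {perm 'I_d} :=
if y' is Some z then transport lam p s y z else 1%g.

(* The orbit at y to which the label of a nearby point x belongs. *)
Definition cls (y : P1 R) (x : X) : {set 'I_d} :=
porbit (mono p s y) ((trans y (prj x))^-1%g (lbl x)).

Lemma transE y z : trans y (P1pt z) = transport lam p s y z.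
Proof. by []. Qed.

Lemma trans_refl y : trans y y = 1%g.
Proof. by case: y=> //= z;rewrite /transport;case: cut_of=> // j;rewrite ltxx. Qed.

Lemma cls_refl x : cls (prj x) x = porbit (mono p s (prj x)) (lbl x).
Proof. by rewrite /cls trans_refl invg1 perm1. Qed.

Definition model_nbhs (x : X) : set_system X := [set W | exists2 V, nbhs (prj x) V &
forall x', V (prj x') -> cls (prj x) x' = cls (prj x) x -> W x'].

(** The transport laws at finite points and at infinity, combined over the projective line. *)
Lemma law (y : P1 R) : \forall y' \near y, y' <> y -> exists2 z, y' = P1pt z &
mono p s y' = 1%g /\ \forall z' \near z, forall i,
 transport lam p s y z' (jump1 lam (center y) (mono p s y) z z' i) =
 transport lam p s (P1pt z) z' (transport lam p s y z i).
Proof.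
case: y=> [z0|].
have : nbhs (P1pt z0) [set y' | exists2 z, y' = P1pt z & (z <> z0 -> (forall j, z != p j) /\
\forall z' \near z, forall i, transport lam p s (P1pt z0) z'
 (jump1 lam z0 (mono p s (P1pt z0)) z z' i) =
 transport lam p s (P1pt z) z' (transport lam p s (P1pt z0) z i))].
 apply/nbhs_P1pt;apply: filterS (transport_law_pt srt s z0)=> z Hz.
 by exists z.
apply: filterS=> _ [z -> Hz] zz0;have [|zp H] := Hz;first by move=> E;apply: zz0;rewrite E.
by exists z=> //;split=> //;exact: mono_ord.
have [e e0 He] := transport_law_inf srt s;apply/(nbhs_P1infty lam);split=> //.
exists e=> // u Hu _;have [up H] := He u Hu.
by exists u=> //;split=> //;exact: mono_ord.
Qed.

Let model_filter (x : X) : ProperFilter (model_nbhs x).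
Proof.
split;first by move=> [V nV] /(_ x (nbhs_singleton nV) erefl).
split.
- by exists setT=> //;exact: filterT.
- move=> A B [V nV HV] [V' nV' HV'];exists (V `&` V');first exact: filterI.
by move=> x' [V1 V2] E;split;[exact: HV|exact: HV'].
- by move=> A B AB [V nV HV];exists V=> // x' V1 E;apply: AB;exact: HV.
Qed.

Let model_singleton (x : X) (A : set X) : model_nbhs x A -> A x.
Proof. by move=> [V nV];apply=> //;exact: nbhs_singleton. Qed.

Lemma porbit_single_jump c (t : {perm 'I_d}) z z' i :
porbit t (jump1 lam c t z z' i) = porbit t i.
Proof. by rewrite /jump1;case: ifP=> _;rewrite ?perm1 ?porbit_step. Qed.

(** This is the axiom that turns the filters into a topology. The transport law rewrites a label
    carried back to [x'] as one carried back to [x], up to one application of the monodromy, which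
    stays within the orbit. *)
Let model_nbhs_nbhs (x : X) (A : set X) : model_nbhs x A -> model_nbhs x (model_nbhs^~ A).
Proof.
move=> [V nV HV];exists (V° `&` [set y' | y' <> prj x -> exists2 z, y' = P1pt z &
mono p s y' = 1%g /\ \forall z' \near z, forall i,
 transport lam p s (prj x) z' (jump1 lam (center (prj x)) (mono p s (prj x)) z z' i) =
 transport lam p s (P1pt z) z' (transport lam p s (prj x) z i)]).
by apply: filterI;[exact: nbhs_interior|exact: law].
move=> x' [Vx' Hx'] E;have [xx'|xx'] := pselect (prj x' = prj x).
suff -> : x' = x by exists V.
apply: model_eq=> //;move: E;rewrite cls_refl xx'=> <-.
by rewrite /cls -xx' trans_refl invg1 perm1.
have [z zE [m1 Hz]] := Hx' xx';exists (V° `&` [set y | exists2 z', y = P1pt z' &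
forall i, transport lam p s (prj x) z' (jump1 lam (center (prj x)) (mono p s (prj x)) z z' i) =
 transport lam p s (P1pt z) z' (transport lam p s (prj x) z i)]).
apply: filterI;first exact: open_nbhs_nbhs (conj (@open_interior _ _) Vx').
rewrite zE;apply/nbhs_P1pt;apply: filterS Hz=> z' Hz';by exists z'.
move=> x'' [/interior_subset Vx'' [z'' z''E Hz'']] E';apply: HV=> //;rewrite -E.
move: E';rewrite cls_refl /cls m1 zE z''E !transE=> /porbit1_inj E'.
have lE : lbl x'' = transport lam p s (P1pt z) z'' (lbl x') by rewrite -E' permKV.
have := Hz'' ((transport lam p s (prj x) z)^-1%g (lbl x'));rewrite permKV=> key.
by rewrite lE -key permK porbit_single_jump.
Qed.

HB.instance Definition _ := hasNbhs.Build X model_nbhs.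
HB.instance Definition _ := @Nbhs_isNbhsTopological.Build X
model_filter model_singleton model_nbhs_nbhs.

Lemma model_nbhsE (x : X) (W : set X) : nbhs x W <-> exists2 V, nbhs (prj x) V &
forall x', V (prj x') -> cls (prj x) x' = cls (prj x) x -> W x'.
Proof. by []. Qed.

Lemma prj_continuous : continuous prj.
Proof. by move=> x W nW;apply/model_nbhsE;exists W. Qed.

Lemma cls_mk y i : cls y (mk y i) = porbit (mono p s y) i.
Proof. by rewrite -{1}[y](prj_mk y i) cls_refl lbl_mk. Qed.

Lemma model_hausdorff : hausdorff_space X.
Proof.
move=> x x' cl;have [E|n] := pselect (prj x = prj x');last first.
have [A [B [nA nB AB]]] := hausdorff_sep (@P1_hausdorff R lam) n.
have [||u [Au Bu]] := cl (prj @^-1` A) (prj @^-1` B);try exact: prj_continuous.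
by case: (AB (prj u)).
apply: model_eq=> //.
have [||u [Au Bu]] := cl [set u | cls (prj x) u = cls (prj x) x] [set u | cls (prj x') u = cls (prj x') x'].
- by apply/model_nbhsE;exists setT=> //;exact: filterT.
- by apply/model_nbhsE;exists setT=> //;exact: filterT.
by rewrite -!cls_refl -Au E Bu cls_refl.
Qed.

(** Compactness lifts from the projective line because each fibre is finite: the neighbourhoods of
    the points over [y] are intersected over the [d] labels. *)
Lemma model_compact : compact [set: X].
Proof.
apply/compact_near_coveringP=> I F P FF H.
suff HP : forall y, [set: P1 R] y -> \forall y' \near y & i \near F, forall x', prj x' = y' -> P i x'.
have := (compact_near_coveringP _).1 (@P1_compact R) _ F (fun i y'=> forall x', prj x' = y' -> P i x') FF HP.
by apply: filterS=> i Hi x' _;exact: (Hi (prj x')).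
move=> y _.
have HW (j : 'I_d) : exists VA : set (P1 R) * set I, [/\ nbhs y VA.1, F VA.2 &
 forall x' i, VA.1 (prj x') -> cls y x' = porbit (mono p s y) j -> VA.2 i -> P i x'].
have [[W A] [/= /model_nbhsE[V nV HV] FA] HWA] := H (mk y j) Logic.I.
exists (V, A);split=> //= x' i Vx' Ex' Ai;apply: (HWA (x', i));split=> //=.
by apply: HV;rewrite// cls_mk.
have [VA HVA] := choice HW.
exists ([set y' | forall j, (VA j).1 y'], [set i | forall j, (VA j).2 i]).
split;first by apply: nbhs_all=> j;have [] := HVA j.
by apply: filter_forall=> j;have [] := HVA j.
move=> [y' i] [/= Hy' Hi] x' px'.
have [_ _ Hj] := HVA ((trans y (prj x'))^-1%g (lbl x')).
by apply: Hj=> //;rewrite px';exact: Hy'.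
Qed.

Lemma model_lab z : mono p s (P1pt z) = 1%g -> lab_at prj (jump lam p s z) lbl z.
Proof.
move=> m1;split.
- by move=> i;exists (mk (P1pt z) i)=> //;apply: porbit1_inj;rewrite -m1 lbl_mk.
- by move=> x x' px px' E;apply: model_eq;rewrite ?px ?px' ?E.
- move=> x W px;rewrite model_nbhsE px;split=> -[V nV HV].
 exists (fun u=> V (P1pt u))=> // x' z' Vz' px' lx';apply: HV;first by rewrite px'.
 rewrite -{2}px cls_refl px /cls px' m1 transE lx' jump_transport permK//.
exists [set y | exists2 z', y = P1pt z' & V z'].
 by apply/nbhs_P1pt;apply: filterS nV=> u Vu;exists u.
move=> x' [z' px' Vz'] E;apply: (HV x' z')=> //.
move: E;rewrite -{2}px cls_refl px /cls px' m1 transE=> /porbit1_inj <-.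
by rewrite jump_transport permKV.
Qed.

End ModelTopology.

(** * Charts of the model and its ramification indices *)

Lemma perm_pow_eq (T : finType) (u : {perm T}) (x : T) (n m : nat) :
((u ^+ n)%g x = (u ^+ m)%g x) <-> n = m %[mod #|porbit u x|].
Proof.
set k := #|porbit u x|.
have k0 : (0 < k)%N by rewrite /k card_gt0;apply/set0Pn;exists x;rewrite porbit_id.
have red q : (u ^+ q)%g x = (u ^+ (q %% k))%g x.
rewrite {1}(divn_eq q k) expgD permM mulnC expgM.
suff -> : ((u ^+ k) ^+ (q %/ k))%g x = x by [].
elim: (q %/ k)%N=> [|a IH];first by rewrite expg0 perm1.
by rewrite expgSr permM IH permX iter_porbit.
split=> [|E];last by rewrite red E -red.
rewrite red [RHS]red=> E;apply/eqP.
have ut := uniq_traject_porbit u x.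
rewrite -(nth_uniq x _ _ ut) ?size_traject ?ltn_mod//.
by rewrite !nth_traject ?ltn_mod// -!permX E.
Qed.

(** Two cycles of equal length are matched power by power from chosen base points. Thus [th] moves
    the cycle of the power map onto an orbit of the local monodromy. *)
Lemma cycle_conj (d k : nat) (t : {perm 'I_d}) (i0 : 'I_d) (s' : {perm 'I_k}) :
k = #|porbit t i0| -> (forall i j, j \in porbit s' i) ->
exists th : 'I_k -> 'I_d, [/\ injective th, forall j, th (s' j) = t (th j)
 & forall i, i \in porbit t i0 <-> exists j, th j = i].
Proof.
move=> kE tr;have k0 : (0 < k)%N.
by rewrite kE card_gt0;apply/set0Pn;exists i0;rewrite porbit_id.
pose j0 : 'I_k := Ordinal k0.
have kE' : #|porbit s' j0| = k.
by rewrite -[RHS]card_ord;apply: eq_card=> j;rewrite tr.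
have key n m : (s' ^+ n)%g j0 = (s' ^+ m)%g j0 <-> (t ^+ n)%g i0 = (t ^+ m)%g i0.
by rewrite !perm_pow_eq kE' -kE.
have N j : exists n, j = (s' ^+ n)%g j0 by apply/porbitP;exact: tr.
have [n nP] := choice N.
exists (fun j=> (t ^+ n j)%g i0);split.
- by move=> j j' /key;rewrite -!nP.
- move=> j;rewrite -permM -expgSr;apply/key.
by rewrite -nP {1}(nP j) expgSr permM.
- move=> i;split=> [/porbitP[m ->]|[j <-]];last by rewrite mem_porbit.
by exists ((s' ^+ m)%g j0);apply/key;rewrite -nP.
Qed.

Section ModelCharts.
Variables (R : realType) (lam : R).
Local Notation K := (Cplx R).
Local Notation D := (@unit_disc R).
Local Notation h := (hh lam).
Variables (M : nat) (p : 'I_M -> K).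
Variable srt : forall i j : 'I_M, (i < j)%N -> h (p j) < h (p i).
Variables (d : nat) (s : 'I_M -> {perm 'I_d}).
Local Notation X := (model s srt).
Local Notation J0 := (fun t=> jump lam (fun _ : 'I_1=> (0 : K)) (fun _=> t)).

Lemma jump_single k (th : 'I_k -> 'I_d) (s' : {perm 'I_k}) (t : {perm 'I_d}) (c : K) (e : R) (z z' : K) j :
0 < e -> (forall j, th (s' j) = t (th j)) ->
th (J0 s' z z' j) = jump1 lam c t (c + (Complex e 0 : K) * z) (c + (Complex e 0 : K) * z') (th j).
Proof.
move=> e0 Hth;rewrite /jump1 !hhD !rrD !hhZ !rrZ.
have -> : (h c + e * h z == h c) = (h z == 0).
by rewrite -subr_eq0 addrAC subrr add0r mulf_eq0 gt_eqF.
rewrite ltrDl ltrD2l ltr_pM2l// pmulr_rgt0//.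
rewrite /jump /cut_of /on_cut;case: pickP=> [i|/(_ ord0)].
by rewrite hh0 rr0=> /andP[-> ->]/=;case: ifP=> _;rewrite ?perm1.
by rewrite hh0 rr0 andbA=> -> /=;rewrite perm1.
Qed.

Lemma continuous_affine (c E : K) : continuous (fun v : K=> c + E * v).
Proof.
move=> v;apply: (@continuousD _ _ _ (cst c) (fun v=> E * v));first exact: cst_continuous.
by apply: (@continuousM _ _ (cst E) (fun v=> v));[exact: cst_continuous|exact: cvg_id].
Qed.

Lemma continuous_affineV (c E : K) : continuous (fun z : K=> (z - c) / E).
Proof.
have -> : (fun z : K=> (z - c) / E) = (fun z=> - c / E + E^-1 * z).
by apply/funext=> z;rewrite mulrBl addrC mulNr (mulrC E^-1).
exact: continuous_affine.
Qed.

Lemma nbhs_homeo (a b : K -> K) (w : K) (W : set K) :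
{for w, continuous a} -> {for a w, continuous b} -> b (a w) = w ->
(\forall u \near a w, a (b u) = u) -> nbhs (a w) W <-> nbhs w (a @^-1` W).
Proof.
move=> ca cb ba ab;split=> [|nW];first exact: ca.
have : nbhs (a w) (b @^-1` (a @^-1` W)) by apply: cb;rewrite ba.
by move: ab=> /filterI H /H;apply: filterS=> u [/= ->].
Qed.

Definition law_at (y y' : P1 R) : Prop := exists2 z, y' = P1pt z &
mono p s y' = 1%g /\ \forall z' \near z, forall i,
 transport lam p s y z' (jump1 lam (center y) (mono p s y) z z' i) =
 transport lam p s (P1pt z) z' (transport lam p s y z i).

(** The chart is a power map of degree [k], the size of the orbit of [x]: [v] goes to the point over
    [H (v^k)] whose sheet is the label of [iota v] for the power map, moved by [th]. With [iota] the
    identity at finite points and the inversion at infinity, one proof serves both. *)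
Lemma model_chart (x : X) (e : R) (iota : K -> K) (H : K -> P1 R) :
0 < e -> openemb H -> H 0 = prj x ->
(forall v, v != 0 -> H v = P1pt (center (prj x) + (Complex e 0 : K) * iota v)) ->
(forall v, v != 0 -> [/\ iota v != 0, iota (iota v) = v & {for v, continuous iota}]) ->
(forall v n, iota (v ^+ n) = iota v ^+ n) ->
(forall v, D v -> v != 0 -> law_at (prj x) (H v)) ->
ramification_index (@prj _ _ _ _ srt _ s) x #|porbit (mono p s (prj x)) (lbl x)|.
Proof.
set y := prj x;set t := mono p s y;set i0 := lbl x;set k := #|porbit t i0|.
set c := center y;move=> e0 eH H0 HE iP iX HL.
have [Hi Hn] := eH.
have k0 : (0 < k)%N.
by rewrite card_gt0;apply/set0Pn;exists i0;rewrite porbit_id.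
have [s' [l' [Hl' tr']]] := power_labels lam k0.
have [th [thi thE thP]] := cycle_conj (erefl k) tr'.
have HN v : D v -> v != 0 -> D (v ^+ k) /\ v ^+ k != 0.
by move=> Dv v0;rewrite expf_neq0//;split=> //;exact: unit_discX.
pose E : K := Complex e 0.
have E0 : E != 0 by rewrite /E eq_complex/= eqxx andbT gt_eqF.
pose G v : X := if v == 0 then x else
mk srt s (H (v ^+ k)) (trans lam p s y (H (v ^+ k)) (th (l' (iota v)))).
have G0 : G 0 = x by rewrite /G eqxx.
have pG v : prj (G v) = H (v ^+ k).
by rewrite /G;case: eqP=> [->|_];rewrite ?prj_mk// expr0n eqn0Ngt k0 H0.
have lG v : D v -> v != 0 -> lbl (G v) = transport lam p s y (c + E * iota (v ^+ k)) (th (l' (iota v))).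
move=> Dv v0;have [Dk vk] := HN v Dv v0;have [z zE [m1 _]] := HL _ Dk vk.
rewrite /G (negPf v0);have := lbl_mk srt s (H (v ^+ k)) (trans lam p s y (H (v ^+ k)) (th (l' (iota v)))).
by rewrite m1=> /porbit1_inj ->;rewrite HE.
have fib z x' : mono p s (P1pt z) = 1%g -> prj x' = P1pt z -> forall x'' : X, prj x'' = P1pt z -> lbl x' = lbl x'' -> x' = x''.
by move=> m1 px' x'' px'' El;apply: model_eq;rewrite ?px' ?px'' ?El.
apply/ramificationP;exists G, H;split=> //.
split.
- move=> w w' Dw Dw' GE.
have kk : w ^+ k = w' ^+ k.
 by apply: Hi;[exact: unit_discX|exact: unit_discX|rewrite -!pG GE].
have [w0|w0] := eqVneq w 0.
 by apply/esym/eqP;move: kk;rewrite w0 expr0n eqn0Ngt k0=> /esym/eqP;rewrite expf_eq0 k0.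
have w'0 : w' != 0.
 by apply: contra_neq w0=> w'0;move/eqP: kk;rewrite w'0 expr0n eqn0Ngt k0 expf_eq0 k0=> /eqP.
have := congr1 (@lbl _ _ _ _ srt _ s) GE;rewrite !lG// kk=> /perm_inj/thi Ell.
have [i0' ii' _] := iP w w0;have [i1' ii1' _] := iP w' w'0.
have zk : iota w ^+ k != 0 by rewrite expf_neq0.
have [_ h2 _] := Hl' _ zk.
rewrite -ii' -ii1';congr iota;apply: h2=> //.
by rewrite /pw -!iX kk.
- move=> w W Dw;have [->|w0] := eqVneq w 0.
 rewrite G0 model_nbhsE -/y cls_refl -/y -/t -/i0;split.
  move=> [V nV HV];have : nbhs (0 : K) (fun v=> V (H (v ^+ k))).
  have/= := @continuous_exp R k 0 (H @^-1` V);rewrite expr0n eqn0Ngt k0;apply.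
  by apply/Hn;[exact: unit_disc0|rewrite H0].
  move: (open_nbhs_nbhs (conj (@open_unit_disc R) (@unit_disc0 R)))=> /filterI A /A.
  apply: filterS=> v [Dv Vv];apply: HV;first by rewrite pG.
  have [->|v0] := eqVneq v 0;first by rewrite G0 cls_refl.
  have [Dk vk] := HN v Dv v0.
  rewrite /cls pG HE// transE lG// permK;apply/eqP;rewrite eq_porbit_mem.
  by apply/thP;exists (l' (iota v)).
 move=> nW;have : nbhs (0 : K) (D `&` (G @^-1` W)).
  by apply: filterI=> //;exact: open_nbhs_nbhs (conj (@open_unit_disc R) (@unit_disc0 R)).
 move=> /nbhs_nm[r r0 Hr].
 have nk : nbhs (0 : K) [set v | D v /\ nm v < r ^+ k].
  apply: filterI;first exact: open_nbhs_nbhs (conj (@open_unit_disc R) (@unit_disc0 R)).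
  by apply/nbhs_nm;exists (r ^+ k);rewrite ?exprn_gt0// => u;rewrite subr0.
 exists (H @` [set v | D v /\ nm v < r ^+ k]).
  rewrite -/y -H0;apply/Hn;first exact: unit_disc0.
  by apply: filterS nk=> v Hv;exists v.
 move=> x' [v [Dv vr] Hv] Ecls.
 have [v0|v0] := eqVneq v 0.
  have -> : x' = x.
  have px' : prj x' = y by rewrite -Hv v0 H0.
  apply: model_eq=> //;rewrite px' -/t -/i0 -Ecls /cls px' trans_refl invg1 perm1//.
  by have [|_] := Hr 0;rewrite ?subr0 /nm ?normr0//= G0.
 have zn0 : iota v != 0 by have [] := iP v v0.
 have : (transport lam p s y (c + E * iota v))^-1%g (lbl x') \in porbit t i0.
  by rewrite -eq_porbit_mem -Ecls /cls -Hv HE.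
 move=> /thP[j jE];have [h1 _ _] := Hl' _ zn0;have [u [uk] lu] := h1 j.
 have u0 : u != 0 by apply: contra_neq zn0=> u0;rewrite -uk u0 expr0n eqn0Ngt k0.
 have [iu0 iiu _] := iP u u0;have [_ iiv _] := iP v v0.
 have vk : iota u ^+ k = v by rewrite -iX uk iiv.
 have [|Du WGu] := Hr (iota u).
  by rewrite subr0 -(@ltr_pXn2r _ k)// ?nnegrE ?nm_ge0 ?(ltW r0)// -nmX vk.
 suff -> : x' = G (iota u) by [].
 have [z zE [m1 _]] := HL v Dv v0.
 have zE' : P1pt z = P1pt (c + E * iota v) by rewrite -zE HE.
 rewrite zE in m1;apply: (fib z)=> //;rewrite ?pG ?vk -?zE//.
 by rewrite lG// vk iiu lu jE permKV.
(* Away from the centre the model and the power map are compared: neighbourhoods on both sides are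
   described by labels, and [JJ] identifies their jumps. *)
have [u0 iu _] := iP w w0;set u := iota w in u0 iu *.
have [Dk wk] := HN w Dw w0.
have [z zE [m1 Lz]] := HL _ Dk wk;rewrite zE in m1.
have {zE} zE : z = c + E * u ^+ k.
 by have : P1pt z = P1pt (c + E * u ^+ k);[rewrite -zE HE// iX|case].
have zk0 : u ^+ k != 0 by rewrite expf_neq0.
have pw_ : prj (G w) = P1pt z by rewrite pG HE// iX zE.
have [_ _ hm] := @model_lab _ lam _ p srt _ s z m1.
have [_ _ hp] := Hl' _ zk0.
have lw : lbl (G w) = transport lam p s y z (th (l' u)) by rewrite lG// iX -zE.
have JJ z' : transport lam p s y (c + E * z') (jump1 lam c t z (c + E * z') (th (l' u))) =
 transport lam p s y (c + E * z') (th (J0 s' (u ^+ k) z' (l' u))).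
 by rewrite zE;congr (fun_of_perm _ _);rewrite (@jump_single _ th s' t c e).
rewrite (hm _ _ pw_);split=> [[V nV HV]|nW].
 have n1 : nbhs w (fun v=> V (c + E * iota v ^+ k) /\
  forall i, transport lam p s y (c + E * iota v ^+ k) (jump1 lam c t z (c + E * iota v ^+ k) i) =
  transport lam p s (P1pt z) (c + E * iota v ^+ k) (transport lam p s y z i)).
  have : nbhs z [set z' | V z' /\ forall i, transport lam p s y z' (jump1 lam c t z z' i) =
   transport lam p s (P1pt z) z' (transport lam p s y z i)] by exact: filterI.
  rewrite zE=> nz;have ck : {for w, continuous (fun v=> iota v ^+ k)}.
  by have [_ _ ci] := iP w w0;exact: (continuous_comp ci (@continuous_exp R k _)).
  have ca : {for w, continuous (fun v=> c + E * iota v ^+ k)}.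
  exact: (continuous_comp ck (@continuous_affine c E _)).
  exact: (ca _ nz).
 have n2 : nbhs w (fun v=> v != 0 /\ D v).
  apply: filterI;last exact: open_nbhs_nbhs (conj (@open_unit_disc R) Dw).
  apply/nbhs_nm;exists (nm w);first by rewrite nm_gt0.
  by move=> v;apply: contraTneq=> ->;rewrite sub0r nmN ltxx.
 have n3 : nbhs w (fun v=> l' (iota v) = J0 s' (u ^+ k) (iota v ^+ k) (l' u)).
  have [_ _ ci] := iP w w0.
  have nB : nbhs (iota w) (fun u'=> l' u' = J0 s' (u ^+ k) (u' ^+ k) (l' u)).
  by apply: filterS (lab_near (Hl' _ zk0) (erefl (pw k u)))=> u' [z' [<-]] ->.
  exact: (ci _ nB).
 move: n1 n2 n3=> /filterI A /A /filterI B /B;apply: filterS=> v [[[Vv Lv] [v0 Dv]] lv].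
 apply: (HV _ (c + E * iota v ^+ k))=> //.
  by have [Dvk vk] := HN v Dv v0;rewrite pG HE// iX.
 by rewrite lG// iX lv -JJ Lv lw jump_transport.
have nW' : nbhs u (fun u'=> [/\ W (G (iota u')), D (iota u') & iota u' != 0]).
 have [_ _ ci] := iP u u0.
 suff nB : nbhs (iota u) [set v | [/\ W (G v), D v & v != 0]] by exact: (ci _ nB).
 rewrite iu;have nD := open_nbhs_nbhs (conj (@open_unit_disc R) Dw).
 have nz : nbhs w [set v | v != 0].
  apply/nbhs_nm;exists (nm w);first by rewrite nm_gt0.
  by move=> v;apply: contraTneq=> ->;rewrite sub0r nmN ltxx.
 by move: nW nD nz=> /filterI A /A /filterI B /B;apply: filterS=> v [[]].
have [V' nV' HV'] := (hp u _ (erefl (pw k u))).1 nW'.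
have nz0 : nbhs (u ^+ k) [set v | v != 0].
 apply/nbhs_nm;exists (nm (u ^+ k));first by rewrite nm_gt0.
 by move=> v;apply: contraTneq=> ->;rewrite sub0r nmN ltxx.
exists ([set z' | forall i, transport lam p s y z' (jump1 lam c t z z' i) =
   transport lam p s (P1pt z) z' (transport lam p s y z i)] `&`
   [set z' | V' ((z' - c) / E) /\ (z' - c) / E != 0]).
 apply: filterI=> //.
 have cd : {for z, continuous (fun z'=> (z' - c) / E)}.
  exact: continuous_affineV.
 suff nB : nbhs ((z - c) / E) [set v | V' v /\ v != 0] by exact: (cd _ nB).
 rewrite zE addrAC subrr add0r mulrAC divff// mul1r;exact: filterI.
move=> x' z' [Lz' [Vz' zc0]] px' lx'.
set zc := (z' - c) / E in Vz' zc0.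
have z'E : z' = c + E * zc by rewrite /zc mulrC divfK// addrC subrK.
have [h1 _ _] := Hl' _ zc0;have [u' [u'k] lu'] := h1 (J0 s' (u ^+ k) zc (l' u)).
have [|WG Du' iu0] := HV' u' zc Vz' _ lu';first by rewrite /pw u'k.
have u'0 : u' != 0 by apply: contra_neq zc0=> u00;rewrite -u'k u00 expr0n eqn0Ngt k0.
have [_ iiu' _] := iP u' u'0.
have ik : iota (iota u' ^+ k) = zc by rewrite iX iiu'.
have [Dk' ik0] := HN _ Du' iu0.
suff -> : x' = G (iota u') by [].
have [z2 z2E [m2 _]] := HL _ Dk' ik0.
have z2' : P1pt z2 = P1pt z' by rewrite -z2E HE// ik z'E.
rewrite z2E z2' in m2;apply: (fib z')=> //.
 by rewrite pG HE// ik z'E.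
rewrite lG// ik iiu' lu' -JJ -z'E Lz' lx' lw jump_transport//.
Qed.

Lemma nbhs_infty_nm (W : set (P1 R)) : nbhs (P1infty R) W <->
W (P1infty R) /\ exists2 e : R, 0 < e & forall u, e < nm u -> W (P1pt u).
Proof.
rewrite (nbhs_P1infty 0);split=> -[W0 [e e0 He]];split=> //.
exists (4 * e + 1)=> [|u Hu];first lra.
apply: He;apply: contrapT=> /not_orP[/negP];rewrite -leNgt=> H1 /negP;rewrite -leNgt=> H2.
have := norm_le_box 0 u;rewrite nmE (lecR (nm u)) normr0 addr0;lra.
exists e=> // u Hu;apply: He;case: Hu=> Hu;rewrite ltNge;apply/negP=> Hn.
have := @rr_le_norm R u `|rr u|;rewrite nmE (ltcR (nm u))=> H.
by have := H (le_lt_trans Hn Hu);rewrite ltxx.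
have := @im_le_norm R u `|hh 0 u|;rewrite nmE (ltcR (nm u))=> H.
by have := H (le_lt_trans Hn Hu);rewrite /hh mul0r addr0 ltxx.
Qed.

Lemma nm_real (e : R) : 0 <= e -> nm (Complex e 0 : K) = e.
Proof. by move=> e0;rewrite /nm normc_def/= expr0n addr0 sqrtr_sqr ger0_norm. Qed.

Lemma nmV (v : K) : v != 0 -> nm v^-1 = (nm v)^-1.
Proof.
move=> v0;have := nmM v v^-1;rewrite divff// /nm normr1/= => E.
have nv : nm v != 0 by rewrite nm0P.
by apply: (mulfI nv);rewrite divff// -/(nm v) E.
Qed.

(** At a finite point the base chart is a small disc; at infinity it is [v -> E / v], with [E] so
    large that the image of the punctured disc lies where the transport law holds. *)
Lemma model_ramification (x : X) :
ramification_index (@prj _ _ _ _ srt _ s) x #|porbit (mono p s (prj x)) (lbl x)|.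
Proof.
have := law srt s (prj x);case yE : (prj x)=> [z0|].
move=> /(nbhs_P1pt z0)/nbhs_nm[e e0 He];pose E : K := Complex e 0.
have E0 : E != 0 by rewrite /E eq_complex/= eqxx andbT gt_eqF.
rewrite -[Some z0]yE;apply: (@model_chart x e id (fun v=> P1pt (z0 + E * v)))=> //.
- split.
  by move=> w w' _ _ [/addrI/(mulfI E0)].
 move=> w W _;rewrite nbhs_P1pt.
 apply: (@nbhs_homeo (fun v=> z0 + E * v) (fun z=> (z - z0) / E)).
 + exact: continuous_affine.
 + exact: continuous_affineV.
 + by rewrite addrAC subrr add0r mulrAC divff// mul1r.
 + by apply: (@filterE _ (nbhs _))=> u;rewrite mulrC divfK// addrC subrK.
- by rewrite mulr0 addr0 yE.
- by move=> v _;rewrite yE.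
- by move=> v v0;split=> //;exact: cvg_id.
- move=> v /unit_disc_nm v1 v0;rewrite yE;apply: He.
  rewrite addrAC subrr add0r nmM nm_real ?(ltW e0)// -[ltRHS]mulr1 ltr_pM2l//.
 by move=> [/eqP];rewrite -subr_eq0 addrAC subrr add0r mulf_eq0 (negPf E0) (negPf v0).
move=> /nbhs_infty_nm[_ [e e0 He]];pose E : K := Complex (e + 1) 0.
have e1 : 0 < e + 1 by lra.
have nE : nm E = e + 1 by rewrite nm_real// ltW.
have E0 : E != 0 by rewrite -nm_gt0 nE.
pose H (v : K) : P1 R := if v == 0 then P1infty R else P1pt (E / v).
have H0 : H 0 = P1infty R by rewrite /H eqxx.
have HE v : v != 0 -> H v = P1pt (E / v) by rewrite /H=> /negPf ->.
have EE v : v != 0 -> E / v != 0 by move=> v0;rewrite mulf_neq0// invr_eq0.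
have EV v : v != 0 -> E / (E / v) = v by move=> v0;rewrite invf_div mulrC divfK.
have cE (v : K) : v != 0 -> {for v, continuous (fun v : K=> E / v)}.
move=> v0;apply: (@continuousM _ _ (cst E) (fun v : K=> v^-1));first exact: cst_continuous.
exact: inv_continuous.
have cI (v : K) : v != 0 -> {for v, continuous (fun v : K=> v^-1)} by move=> v0;exact: inv_continuous.
have nz (w : K) : w != 0 -> nbhs w [set v | v != 0].
move=> w0;apply/nbhs_nm;exists (nm w);first by rewrite nm_gt0.
by move=> v;apply: contraTneq=> ->;rewrite sub0r nmN ltxx.
rewrite -[None]yE;apply: (@model_chart x (e + 1) (fun v=> v^-1) H)=> //.
- split.
 move=> w w' _ _;have [->|w0] := eqVneq w 0;have [->|w'0] := eqVneq w' 0;rewrite ?H0 ?HE//.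
 by move=> [/(congr1 (fun v=> E / v))];rewrite !EV.
move=> w W _;have [->|w0] := eqVneq w 0.
 rewrite H0 nbhs_infty_nm;split.
  move=> [W0 [r r0 Hr]];apply/nbhs_nm;exists ((e + 1) / r);first by rewrite divr_gt0.
  move=> v;rewrite subr0=> Hv;have [->|v0] := eqVneq v 0;first by rewrite/= H0.
  rewrite/= HE//;apply: Hr;rewrite nmM nmV// nE ltr_pdivlMr ?nm_gt0//.
  by rewrite mulrC -ltr_pdivlMr.
 move=> nW;split;first by have := nbhs_singleton nW;rewrite/= H0.
 have /nbhs_nm[r r0 Hr] := nW;exists ((e + 1) / r);first by rewrite divr_gt0.
 move=> u Hu;have u0 : u != 0 by rewrite -nm_gt0;apply: lt_trans Hu;rewrite divr_gt0.
 have := Hr (E / u);rewrite subr0/= HE ?EE// EV//;apply.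
 by rewrite nmM nmV// nE ltr_pdivrMr ?nm_gt0// mulrC -ltr_pdivrMr.
rewrite HE// nbhs_P1pt.
have -> : nbhs w (H @^-1` W) <-> nbhs w ((fun v=> E / v) @^-1` (fun u=> W (P1pt u))).
 have n0 := nz w w0;split;move: n0=> /filterI A /A;apply: filterS=> v [/= v0];
 by rewrite /H (negPf v0).
apply: (@nbhs_homeo (fun v=> E / v) (fun v=> E / v));try exact: cE;rewrite ?EV//.
 by apply: cE;exact: EE.
by apply: filterS (nz _ (EE w w0))=> u;exact: EV.
- by rewrite yE.
- by move=> v v0;rewrite HE// yE/= add0r.
- by move=> v v0;rewrite invr_eq0 invrK;split=> //;exact: cI.
- by move=> v n;rewrite exprVn.
- move=> v /unit_disc_nm v1 v0;rewrite yE HE//;apply: He=> //.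
rewrite nmM nmV// nE ltr_pdivlMr ?nm_gt0//.
have : e * nm v <= e by rewrite -[leRHS]mulr1 ler_pM2l// ltW.
lra.
Qed.

End ModelCharts.

(** * Locally constant functions on a labelled cover *)

Section Labelled.
Variables (R : realType) (lam : R).
Local Notation K := (Cplx R).
Local Notation h := (hh lam).
Local Notation box := (box lam).
Variables (M : nat) (p : 'I_M -> K).
Hypothesis srt : forall i j : 'I_M, (i < j)%N -> h (p j) < h (p i).
Variables (d : nat) (s : 'I_M -> {perm 'I_d}).
Variables (X : topologicalType) (f : X -> P1 R) (l : X -> 'I_d).

Definition ordinary (z : K) : Prop := forall j, z != p j.
Hypothesis HL : forall z, ordinary z -> lab_at f (jump lam p s z) l z.

Local Notation tr := (transport lam p s).
Local Notation mo := (mono p s).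
Local Notation trn := (trans lam p s).

(** The analogue of [cls] for any cover labelled with these jumps: the orbit at [y] to which a
    nearby point [u] belongs. *)
Definition xcls (y : P1 R) (u : X) : {set 'I_d} := porbit (mo y) ((trn y (f u))^-1%g (l u)).

Definition good (y : P1 R) (z : K) : Prop := ordinary z /\ \forall z' \near z, forall i,
 tr y z' (jump1 lam (center y) (mo y) z z' i) = tr (P1pt z) z' (tr y z i).

Lemma near_good (y : P1 R) : \forall y' \near y, y' <> y -> exists2 z, y' = P1pt z & good y z.
Proof.
case: y=> [z0|].
have : nbhs (P1pt z0) [set y' | exists2 z, y' = P1pt z & (z <> z0 -> good (P1pt z0) z)].
 by apply/nbhs_P1pt;apply: filterS (transport_law_pt srt s z0)=> z Hz;exists z.
by apply: filterS=> _ [z -> Hz] zz0;exists z=> //;apply: Hz=> E;apply: zz0;rewrite E.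
have [e e0 He] := transport_law_inf srt s;apply/(nbhs_P1infty lam);split=> //.
by exists e=> // u Hu _;exists u=> //;exact: He.
Qed.

Lemma good_lab y z x : good y z -> f x = P1pt z -> \forall x' \near x, exists2 z', f x' = P1pt z' &
(tr y z')^-1%g (l x') = jump1 lam (center y) (mo y) z z' ((tr y z)^-1%g (l x)).
Proof.
move=> [oz Lz] fx;have [_ _ H] := HL oz;apply/(H _ _ fx).
exists [set z' | forall i, tr y z' (jump1 lam (center y) (mo y) z z' i) = tr (P1pt z) z' (tr y z i)]=> //.
move=> x' z' Lz' fx' lx';exists z'=> //.
by rewrite lx' jump_transport -[l x](permKV (tr y z)) -Lz' permK permKV.
Qed.

Lemma xcls_lconst y z x : good y z -> f x = P1pt z -> \forall x' \near x, xcls y x' = xcls y x.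
Proof.
move=> gz fx;apply: filterS (good_lab gz fx)=> x' [z' fx' E].
by rewrite /xcls fx fx' !transE E porbit_single_jump.
Qed.

Section Transport.
Variables (y : P1 R) (T : Type) (g : X -> T) (V : set K).
Hypothesis Vgood : forall z, V z -> good y z.
Hypothesis gV : forall x z, V z -> f x = P1pt z -> \forall x' \near x, g x' = g x.

(** A coherent choice [mu] of corrected labels over [Q] selects a point in each fibre, and [g] is
    locally constant along this section. *)
Lemma piece_const (Q : set K) (mu : K -> 'I_d) : connected Q -> Q `<=` V ->
(forall z, Q z -> \forall z' \near z, Q z' -> mu z' = jump1 lam (center y) (mo y) z z' (mu z)) ->
forall x x' z z', Q z -> Q z' -> f x = P1pt z -> f x' = P1pt z' ->
l x = tr y z (mu z) -> l x' = tr y z' (mu z') -> g x = g x'.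
Proof.
move=> cQ QV muP x x' z z' Qz Qz' fx fx' lx lx'.
have sec v : exists u, Q v -> f u = P1pt v /\ l u = tr y v (mu v).
have [Qv|] := pselect (Q v);last by exists x.
have [ov _] := Vgood (QV v Qv);have [h1 _ _] := HL ov.
by have [u fu lu] := h1 (tr y v (mu v));exists u.
have [S SP] := choice sec.
have SE u v : Q v -> f u = P1pt v -> l u = tr y v (mu v) -> u = S v.
move=> Qv fu lu;have [fS lS] := SP v Qv;have [ov _] := Vgood (QV v Qv).
by have [_ h2 _] := HL ov;apply: h2;rewrite ?fS ?lS.
rewrite (SE x z)// (SE x' z')//.
apply: (connected_lconst cQ (g := fun v=> g (S v)))=> // {x x' z z' Qz Qz' fx fx' lx lx'} z Qz.
have [fS lS] := SP z Qz;have [oz Lz] := Vgood (QV z Qz).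
have [_ _ H] := HL oz;have [V' nV' HV'] := (H _ _ fS).1 (gV (QV z Qz) fS).
have := muP z Qz;move: nV' Lz=> /filterI A /A /filterI B /B.
apply: filterS=> z' [[Vz' Lz'] mz'] Qz';have [fS' lS'] := SP z' Qz'.
by apply: (HV' _ z')=> //;rewrite lS' lS (mz' Qz') Lz' jump_transport.
Qed.

(* Four boxes around the centre, consecutive ones overlapping. *)
Lemma transport_const_boxes (AU BU AL BL AD BD AR BR : set R) :
let c := center y in
[/\ is_interval AU, is_interval BU, is_interval AL & is_interval BL] ->
[/\ is_interval AD, is_interval BD, is_interval AR & is_interval BR] ->
[/\ box AU BU `<=` V, box AL BL `<=` V, box AD BD `<=` V & box AR BR `<=` V] ->
[/\ forall b, BU b -> h c < b, forall a, AL a -> a < rr c, forall b, BD b -> b < h c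
 & forall a, AR a -> rr c < a] ->
[/\ box AU BU `&` box AL BL !=set0, box AL BL `&` box AD BD !=set0,
  box AR BR `&` box AD BD !=set0 & box AU BU `&` box AR BR !=set0] ->
forall x x' z z', (box AU BU `|` box AL BL `|` (box AD BD `|` box AR BR)) z ->
 (box AU BU `|` box AL BL `|` (box AD BD `|` box AR BR)) z' ->
 f x = P1pt z -> f x' = P1pt z' -> xcls y x = xcls y x' -> g x = g x'.
Proof.
set t := mo y=> c [iAU iBU iAL iBL] [iAD iBD iAR iBR] [UV LV DV RV] [Uc Lc Dc Rc].
move=> [[zUL [U1 L1]] [zLD [L2 D2]] [zRD [R3 D3]] [zUR [U4 R4]]].
have cstU m : forall z, box AU BU z -> \forall z' \near z, box AU BU z' -> m = jump1 lam c t z z' m.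
move=> z [_ /Uc Hz];apply: (@filterE _ (nbhs z))=> z' _.
by rewrite /jump1 [h z == _]gt_eqF//= perm1.
have cstD m : forall z, box AD BD z -> \forall z' \near z, box AD BD z' -> m = jump1 lam c t z z' m.
move=> z [_ /Dc Hz];apply: (@filterE _ (nbhs z))=> z' _.
by rewrite /jump1 [h z == _]lt_eqF//= perm1.
have cstL m : forall z, box AL BL z -> \forall z' \near z, box AL BL z' -> m = jump1 lam c t z z' m.
move=> z [/Lc Hz _];apply: (@filterE _ (nbhs z))=> z' _.
by rewrite /jump1 [rr c < _]ltNge (ltW Hz)/= andbF perm1.
pose mR m z := if h z < h c then t m else m.
have cstR m : forall z, box AR BR z -> \forall z' \near z, box AR BR z' -> mR m z' = jump1 lam c t z z' (mR m z).
move=> z [/Rc Hz _];rewrite /mR /jump1 Hz/=.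
have [hz|hz|hz] := ltgtP (h z) (h c).
- apply/(nbhs_box lam);exists (h c - h z);first by rewrite subr_gt0.
 move=> u _;rewrite ltr_norml=> /andP[_ ?] _;rewrite (_ : h u < h c) ?perm1//;lra.
- apply/(nbhs_box lam);exists (h z - h c);first by rewrite subr_gt0.
 move=> u _;rewrite ltr_norml=> /andP[? _] _;rewrite ltNge (_ : h c <= h u) ?perm1//;lra.
- by apply: (@filterE _ (nbhs z))=> z' _;rewrite hz;case: ifP;rewrite ?perm1.
have GU m := piece_const (@conn_box R lam AU BU iAU iBU) UV (mu := fun=> m) (cstU m).
have GD m := piece_const (@conn_box R lam AD BD iAD iBD) DV (mu := fun=> m) (cstD m).
have GL m := piece_const (@conn_box R lam AL BL iAL iBL) LV (mu := fun=> m) (cstL m).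
have GR m := piece_const (@conn_box R lam AR BR iAR iBR) RV (mu := mR m) (cstR m).
have pt z m : V z -> exists2 u, f u = P1pt z & l u = tr y z m.
by move=> /Vgood[oz _];have [h1 _ _] := HL oz;exact: h1.
(* the value of g on sheet m, read off in the upper box *)
have ptU m : exists u, f u = P1pt zUL /\ l u = tr y zUL m.
by have [u fu lu] := pt zUL m (UV _ U1);exists u.
have [uu HU] := choice ptU.
pose gam m := g (uu m).
have VU m x z : box AU BU z -> f x = P1pt z -> l x = tr y z m -> g x = gam m.
by move=> Uz fx lx;have [a b] := HU m;exact: (GU m x (uu m) z zUL).
have VL m x z : box AL BL z -> f x = P1pt z -> l x = tr y z m -> g x = gam m.
by move=> Uz fx lx;have [a b] := HU m;exact: (GL m x (uu m) z zUL).
have VD m x z : box AD BD z -> f x = P1pt z -> l x = tr y z m -> g x = gam m.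
move=> Uz fx lx;have [u fu lu] := pt zLD m (LV _ L2).
by rewrite -(VL m u zLD)//;exact: (GD m x u z zLD).
have VR m x z : box AR BR z -> f x = P1pt z -> l x = tr y z (mR m z) -> g x = gam m.
move=> Uz fx lx;have [u fu lu] := pt zUR m (UV _ U4).
rewrite -(VU m u zUR)//;apply: (GR m x u z zUR)=> //.
by rewrite /mR ltNge (ltW (Uc _ U4.2)).
(* Only the right-hand box meets the ray. Its lower part, where the corrected label is [t m],
   overlaps the lower box, and its upper part, with label [m], overlaps the upper one. *)
have gt m : gam (t m) = gam m.
have [u fu lu] := pt zRD (t m) (RV _ R3).
rewrite -(VD (t m) u zRD)// (VR m u zRD)//.
by rewrite /mR (Dc _ D3.2).
have gorb m m' : porbit t m = porbit t m' -> gam m = gam m'.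
move=> /eqP;rewrite eq_porbit_mem=> /porbitP[n ->].
by elim: n=> [|n IH];rewrite ?expg0 ?perm1// expgSr permM gt.
have val x z : (box AU BU `|` box AL BL `|` (box AD BD `|` box AR BR)) z -> f x = P1pt z ->
 exists2 m, xcls y x = porbit t m & g x = gam m.
move=> Hz fx;pose m0 := (tr y z)^-1%g (l x).
have lx : l x = tr y z m0 by rewrite permKV.
have cx : xcls y x = porbit t m0 by rewrite /xcls fx.
case: Hz=> [[]|[]] Hz.
- by exists m0=> //;exact: (VU m0 x z).
- by exists m0=> //;exact: (VL m0 x z).
- by exists m0=> //;exact: (VD m0 x z).
- have [hz|hz] := boolP (h z < h c).
  exists ((t^-1)%g m0);first by rewrite cx porbit_invstep.
  by apply: (VR _ x z)=> //;rewrite /mR hz permKV.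
 by exists m0=> //;apply: (VR _ x z)=> //;rewrite /mR (negPf hz).
move=> x x' z z' Hz Hz' fx fx' E.
have [m cm ->] := val x z Hz fx;have [m' cm' ->] := val x' z' Hz' fx'.
by apply: gorb;rewrite -cm -cm'.
Qed.
End Transport.

(** Four boxes surround [y], around a finite point or near infinity, so points of one orbit are
    joined through the sheets. In other words, over a punctured neighbourhood of [y] a piece of the
    cover cannot split an orbit of the local monodromy. *)
Lemma transport_const (y : P1 R) (T : Type) (g : X -> T) :
(\forall y' \near y, y' <> y -> forall x, f x = y' -> \forall x' \near x, g x' = g x) ->
exists2 V, nbhs y V & forall x x', V (f x) -> V (f x') -> f x <> y -> f x' <> y ->
 xcls y x = xcls y x' -> g x = g x'.
Proof.
move=> Hg;pose W := [set y' | y' <> y -> exists2 z, y' = P1pt z & good y z /\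
forall x, f x = y' -> \forall x' \near x, g x' = g x].
have nW : nbhs y W.
move: (near_good y) Hg=> /filterI A /A;apply: filterS=> y' [H1 H2] ny.
by have [z zE gz] := H1 ny;exists z=> //;split=> //;exact: H2.
pose V : set K := [set z | good y z /\ forall x, f x = P1pt z -> \forall x' \near x, g x' = g x].
have V1 z : V z -> good y z by case.
have V2 x z : V z -> f x = P1pt z -> \forall x' \near x, g x' = g x by move=> [_ H];exact: H.
have WV z : W (P1pt z) -> P1pt z <> y -> V z by move=> Wz nz;have [_ [<-]] := Wz nz.
have ii (i : interval R) : is_interval ([set` i] : set R) by exact: interval_is_interval.
case: y @W nW @V V1 V2 WV {Hg} => [z0|] W nW V V1 V2 WV.
have /(nbhs_box lam)[e e0 He] : nbhs z0 (fun z=> W (P1pt z)) by exact/nbhs_P1pt.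
have BV z : `|rr z - rr z0| < e -> `|h z - h z0| < e -> z <> z0 -> V z.
 by move=> r1 h1 nz;apply: WV;[exact: He|move=> [E];exact: nz].
have ne z : z = z0 -> rr z = rr z0 /\ h z = h z0 by move=> ->.
have key := @transport_const_boxes (P1pt z0) T g V V1 V2
 `]rr z0 - e, rr z0 + e[ `]h z0, h z0 + e[ `]rr z0 - e, rr z0[ `]h z0 - e, h z0 + e[ `]rr z0 - e, rr z0 + e[ `]h z0 - e, h z0[ `]rr z0, rr z0 + e[ `]h z0 - e, h z0 + e[ _ _ _ _ _.
exists [set y' | exists2 z, y' = P1pt z & `|rr z - rr z0| < e /\ `|h z - h z0| < e].
 by apply/nbhs_P1pt/(nbhs_box lam);exists e=> // u r1 h1;exists u.
have cov z : `|rr z - rr z0| < e -> `|h z - h z0| < e -> z <> z0 ->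
 (box `]rr z0 - e, rr z0 + e[ `]h z0, h z0 + e[ `|` box `]rr z0 - e, rr z0[ `]h z0 - e, h z0 + e[ `|` (box `]rr z0 - e, rr z0 + e[ `]h z0 - e, h z0[ `|` box `]rr z0, rr z0 + e[ `]h z0 - e, h z0 + e[)) z.
 rewrite !ltr_norml=> /andP[r1 r2] /andP[h1 h2] zz0.
 have [H|H|E] := ltgtP (rr z) (rr z0).
 - left;right;split;rewrite/= in_itv/=;apply/andP;lra.
 - right;right;split;rewrite/= in_itv/=;apply/andP;lra.
 have [H|H|E'] := ltgtP (h z) (h z0).
 - right;left;split;rewrite/= in_itv/=;apply/andP;lra.
 - left;left;split;rewrite/= in_itv/=;apply/andP;lra.
 - by case: zz0;exact: pt_eq E E'.
move=> x x' [z fx [r1 h1]] [z' fx' [r1' h1']] nx nx' E.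
apply: (key _ _ _ _ _ x x' z z')=> //.
- split;move=> u []/=;rewrite !in_itv/= => /andP[? ?] /andP[? ?];apply: BV;
  rewrite ?ltr_norml;try (apply/andP;lra);move=> /ne[];lra.
- by split=> u;rewrite/= in_itv/= => /andP[].
- split.
 + exists (mkc lam (rr z0 - e / 2) (h z0 + e / 2)).
  by split;split;rewrite/= ?hh_mkc in_itv/=;apply/andP;lra.
 + exists (mkc lam (rr z0 - e / 2) (h z0 - e / 2)).
  by split;split;rewrite/= ?hh_mkc in_itv/=;apply/andP;lra.
 + exists (mkc lam (rr z0 + e / 2) (h z0 - e / 2)).
  by split;split;rewrite/= ?hh_mkc in_itv/=;apply/andP;lra.
 + exists (mkc lam (rr z0 + e / 2) (h z0 + e / 2)).
  by split;split;rewrite/= ?hh_mkc in_itv/=;apply/andP;lra.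
- by apply: cov=> // zz;apply: nx;rewrite fx zz.
- by apply: cov=> // zz;apply: nx';rewrite fx' zz.
have [_ [e e0 He]] := (nbhs_P1infty lam W).1 nW.
have BV z : e < `|rr z| \/ e < `|h z| -> V z by move=> H;apply: WV=> //;exact: He.
have key := @transport_const_boxes (P1infty R) T g V V1 V2
 setT `]e, +oo[ `]-oo, - e[ setT setT `]-oo, - e[ `]e, +oo[ setT _ _ _ _ _.
exists [set y' | y' = P1infty R \/ exists2 z, y' = P1pt z & e < `|rr z| \/ e < `|h z|].
by apply/(nbhs_P1infty lam);split;[left|exists e=> // u Hu;right;exists u].
have cov z : e < `|rr z| \/ e < `|h z| ->
 (box setT `]e, +oo[ `|` box `]-oo, - e[ setT `|` (box setT `]-oo, - e[ `|` box `]e, +oo[ setT)) z.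
have sp (a : R) : e < `|a| -> a < - e \/ e < a.
 by case: (lerP 0 a)=> ?;[rewrite ger0_norm//|rewrite ltr0_norm//];move=> ?;[right|left];lra.
move=> [] /sp[] H.
- by left;right;split;rewrite//= in_itv.
- by right;right;split;rewrite//= in_itv/= andbT.
- by right;left;split;rewrite//= in_itv.
- by left;left;split;rewrite//= in_itv/= andbT.
move=> x x' [//|[z fx Hz]] [//|[z' fx' Hz']] _ _ E.
apply: (key _ _ _ _ _ x x' z z')=> //;try exact: cov.
- split;move=> u [];rewrite/= in_itv/= ?andbT=> H1 H2;apply: BV.
+ by right;rewrite gtr0_norm//;lra.
+ by left;rewrite ltr0_norm//;lra.
+ by right;rewrite ltr0_norm//;lra.
+ by left;rewrite gtr0_norm//;lra.
- by split=> u;rewrite/= in_itv/= ?andbT ?hh0 ?rr0;lra.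
- split.
+ exists (mkc lam (- e - 1) (e + 1)).
 by split;split;rewrite//= ?hh_mkc in_itv/= ?andbT;lra.
+ exists (mkc lam (- e - 1) (- e - 1)).
 by split;split;rewrite//= ?hh_mkc in_itv/= ?andbT;lra.
+ exists (mkc lam (e + 1) (- e - 1)).
 by split;split;rewrite//= ?hh_mkc in_itv/= ?andbT;lra.
+ exists (mkc lam (e + 1) (e + 1)).
 by split;split;rewrite//= ?hh_mkc in_itv/= ?andbT;lra.
Qed.

(* The complement of the closed cuts: horizontal lines run left without meeting a cut. *)
Definition comb : set K := [set z | forall j, ~~ ((h z == h (p j)) && (rr (p j) <= rr z))].

Lemma comb_ordinary z : comb z -> ordinary z.
Proof. by move=> Wz j;apply/eqP=> E;have := Wz j;rewrite E eqxx lexx. Qed.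

(** Horizontal segments to the left join every point to a half-plane free of branch points. *)
Lemma connected_comb : connected comb.
Proof.
pose c := \big[Num.min/0]_j rr (p j) - 1.
have cp j : c < rr (p j).
have : c + 1 <= rr (p j) by rewrite /c subrK;exact: bigmin_le.
lra.
have -> : comb = \bigcup_(z in comb) (box `]-oo, Num.max (rr z) c] [set h z] `|` box `]-oo, c] setT).
apply/seteqP;split=> [z Hz|z [w Hw] [[/= z1 z2]|[/= z1 _]]].
- by exists z=> //;left;split=> //=;rewrite in_itv/= le_max lexx.
- move=> j;apply/negP=> /andP[/eqP hj rj];have := Hw j;rewrite -z2 hj eqxx/= -ltNge=> lt.
 by move: z1;rewrite in_itv/= leNgt gt_max (lt_le_trans lt rj) (lt_le_trans (cp j) rj).
- move=> j;apply/negP=> /andP[/eqP hj rj];move: z1;rewrite in_itv/= leNgt.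
 by rewrite (lt_le_trans (cp j) rj).
have iN (y : R) : is_interval ([set` `]-oo, y]] : set R) by exact: interval_is_interval.
apply: bigcup_connected.
by exists (mkc lam c 0)=> z _;right;split;rewrite//= in_itv/= lexx.
move=> z Hz;apply: connectedU.
- exists (mkc lam c (h z));by split;split;rewrite//= ?hh_mkc ?in_itv//= ?le_max ?lexx ?orbT.
- apply: conn_box=> // x y/= -> -> u /andP[? ?];apply/eqP;rewrite eq_le;exact/andP.
- exact: conn_box.
Qed.

Lemma cut_of_comb z : comb z -> cut_of lam p z = None.
Proof. by move=> Hz;apply: cut_of_none=> j E;have := Hz j;rewrite E eqxx/= leNgt negbK=> /ltW. Qed.

(** Labels do not jump on the cut plane, so each label names a section over this connected set. *)
Lemma comb_const (T : Type) (g : X -> T) :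
(forall z x, comb z -> f x = P1pt z -> \forall x' \near x, g x' = g x) ->
forall x x' z z', comb z -> comb z' -> f x = P1pt z -> f x' = P1pt z' -> l x = l x' -> g x = g x'.
Proof.
move=> Hg x x' z z' Hz Hz' fx fx' E.
have sec v : exists u, comb v -> f u = P1pt v /\ l u = l x.
have [Qv|] := pselect (comb v);last by exists x.
by have [h1 _ _] := HL (comb_ordinary Qv);have [u fu lu] := h1 (l x);exists u.
have [S SP] := choice sec.
have SE u v : comb v -> f u = P1pt v -> l u = l x -> u = S v.
move=> Qv fu lu;have [fS lS] := SP v Qv.
by have [_ h2 _] := HL (comb_ordinary Qv);apply: h2;rewrite ?fS ?lS.
rewrite (SE x z)// (SE x' z')//.
apply: (connected_lconst connected_comb (g := fun v=> g (S v)))=> // v Hv.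
have [fS lS] := SP v Hv;have [_ _ H] := HL (comb_ordinary Hv).
have [V' nV' HV'] := (H _ _ fS).1 (Hg _ _ Hv fS).
apply: filterS nV'=> v' Vv' Hv';have [fS' lS'] := SP v' Hv'.
by apply: (HV' _ v')=> //;rewrite lS' lS /jump cut_of_comb.
Qed.

End Labelled.

(** * Every branched cover is isomorphic to a model *)

Section Pieces.
Variables (R : realType) (X : topologicalType) (f : X -> P1 R).
Local Notation K := (Cplx R).
Hypothesis hX : hausdorff_space X.

Lemma compact_ball (r : R) : compact [set w : K | nm w <= r].
Proof.
apply: (@subclosed_compact _ _ (box 0 `[- r, r] `[- r, r]));last 1 first.
- move=> w/= Hw;split;rewrite/= in_itv/= -ler_norml.
 by rewrite leNgt;apply/negP=> lt;have := @rr_le_norm R w `|rr w|;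
  rewrite nmE (ltcR (nm w))=> /(_ (le_lt_trans Hw lt));rewrite ltxx.
rewrite leNgt;apply/negP=> lt;have := @im_le_norm R w `|hh 0 w|.
rewrite nmE (ltcR (nm w))=> /(_ (le_lt_trans Hw lt)).
by rewrite /hh mul0r addr0 ltxx.
- rewrite -[X in closed X]setCK;apply: open_closedC;rewrite openE=> w/= /negP.
rewrite -ltNge=> Hw;apply/nbhs_nm;exists (nm w - r);first by rewrite subr_gt0.
move=> u Hu/=;apply/negP;rewrite -ltNge.
by have := nmD (w - u) u;rewrite subrK nmB;lra.
- exact: compact_cbox.
Qed.

(** Inside a chart the image of the disc of radius 1/2 is open and that of the closed disc is
    compact, hence closed; over values of modulus below [r ^ k] the two agree, so [A] is clopen
    there. It isolates [x] in its fibre. *)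
Lemma clopen_piece x k : ramification_index f x k ->
exists (V : set (P1 R)) (A : set X), [/\ nbhs (f x) V, A x,
 forall u, V (f u) -> \forall u' \near u, A u' = A u
 & forall u, f u = f x -> A u -> u = x].
Proof.
move=> /ramificationP[G [H [k0 [Gi eG] [Hi eH] [G0 H0] fG]]].
pose r : R := 1 / 2;have r0 : 0 < r by rewrite /r;lra. have r1 : r < 1 by rewrite /r;lra.
have BD w : nm w <= r -> unit_disc w by move=> ?;apply/unit_disc_nm;lra.
pose A := G @` [set w | nm w < r];pose C := G @` [set w | nm w <= r].
have cC : closed C.
apply: compact_closed=> //;apply: continuous_compact;last exact: compact_ball.
by apply: continuous_in_subspaceT=> w;rewrite inE=> /BD Dw W;exact: (eG w W Dw).1.
have rk w : (nm (w ^+ k) < r ^+ k) = (nm w < r).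
by rewrite nmX ltr_pXn2r// ?nnegrE ?nm_ge0// ltW.
exists (H @` [set c | unit_disc c /\ nm c < r ^+ k]), A;split.
- rewrite -H0;apply/eH;first exact: unit_disc0.
have : nbhs (0 : K) [set c | unit_disc c /\ nm c < r ^+ k].
 apply: filterI;first exact: open_nbhs_nbhs (conj (@open_unit_disc R) (@unit_disc0 R)).
 by apply/nbhs_nm;exists (r ^+ k);rewrite ?exprn_gt0// => u;rewrite subr0.
by apply: filterS=> c Hc;exists c.
- by exists 0=> //=;rewrite /nm normr0.
- move=> u [c [Dc cr] Hc];have [Au|nAu] := pselect (A u).
 have : nbhs u A.
  case: Au=> w Hw <-;apply/eG;first by apply: BD;exact: ltW.
  have : nbhs w [set w | nm w < r].
  apply/nbhs_nm;exists (r - nm w);first by rewrite subr_gt0.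
  by move=> v Hv/=;have := nmD (v - w) w;rewrite subrK;lra.
  by apply: filterS=> v Hv;exists v.
 by apply: filterS=> u' Au';apply/propext.
have nCu : ~ C u.
 move=> [w Hw uE];apply: nAu;exists w=> //=;have Dw := BD w Hw.
 move: Hc;rewrite -uE fG// => /(Hi _ _ Dc (unit_discX Dw k0)) E.
 by rewrite -rk -E.
have : nbhs u (~` C) by apply: open_nbhs_nbhs;split=> //;exact: closed_openC.
apply: filterS=> u' nC;apply/propext;split=> // -[w Hw wE].
by case: nC;exists w=> //=;exact: ltW.
- move=> u fu [w Hw uE];have Dw : unit_disc w by apply: BD;exact: ltW.
move: fu;rewrite -uE fG// -H0=> /(Hi _ _ (unit_discX Dw k0) (@unit_disc0 R))/eqP.
by rewrite expf_eq0 k0/= => /eqP ->;rewrite G0.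
Qed.

Lemma punctured_meets (lam : R) x k N : ramification_index f x k -> nbhs x N ->
exists u, [/\ N u, u <> x & f u <> f x].
Proof.
move=> ram nN;have [U [nU UN _ [u [Uu ux]] Hf]] := ramif_punctured lam ram nN.
by exists u;split;[exact: UN|exact: ux|exact: Hf].
Qed.

End Pieces.

Lemma P1_nonisolated (R : realType) (y : P1 R) (V : set (P1 R)) : nbhs y V ->
exists2 z, V (P1pt z) & P1pt z <> y.
Proof.
case: y=> [z0 /(nbhs_box 0)[e e0 He]|/(nbhs_P1infty 0)[_ [e e0 He]]].
exists (mkc 0 (rr z0 + e / 2) (hh 0 z0)).
 apply: He;rewrite ?hh_mkc ?rr_mkc ?subrr ?normr0//.
 by rewrite addrAC subrr add0r gtr0_norm;lra.
by move=> [] /(congr1 (@rr R));rewrite rr_mkc;lra.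
exists (mkc 0 (e + 1) 0)=> //;apply: He;left;rewrite rr_mkc gtr0_norm;lra.
Qed.

Section Classify.
Variables (R : realType) (lam : R).
Local Notation K := (Cplx R).
Local Notation h := (hh lam).
Variables (M : nat) (p : 'I_M -> K).
Variable srt : forall i j : 'I_M, (i < j)%N -> h (p j) < h (p i).
Variables (X : topologicalType) (f : X -> P1 R).
Hypotheses (cX : compact [set: X]) (hX : hausdorff_space X) (nX : [set: X] !=set0).
Hypothesis ram : forall x, exists k, ramification_index f x k.
Hypothesis unram : forall z, ordinary p z -> exists k, ramification_profile f (P1pt z) (nseq k 1%N).

Let cf : continuous f.
Proof. by move=> x;have [k] := ram x;exact: ramification_continuous. Qed.

Lemma loctriv_ordinary : loctriv f [set z | ordinary p z].
Proof.
move=> z oz;have [k [x [xi rx Hx]]] := unram oz.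
apply: (loctriv_unramified (x := x))=> //.
have [u fu] := branched_surjective cX nX ram (P1pt z).
have : range x u by rewrite rx.
by move=> [i _ _];exact: leq_ltn_trans (leq0n i) (ltn_ord i).
move=> i;have := Hx i;rewrite nth_nseq;case: ifP=> //.
by have := ltn_ord i;rewrite {2}size_nseq=> ->.
Qed.

(** At a branch point the comparison map is defined through nearby ordinary points. It is a
    continuous injection of a compact space into a Hausdorff space, and its image is closed and
    dense. *)
Lemma cover_model : exists (d : nat) (s : 'I_M -> {perm 'I_d}) (Psi : X -> model s srt),
[/\ continuous Psi, forall x, prj (Psi x) = f x &
 exists2 Phi, continuous Phi & cancel Psi Phi /\ cancel Phi Psi].
Proof.
have [d [s [l HL]]] := comb_labels (inj_hp srt) loctriv_ordinary.
exists d, s.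
(* A small punctured neighbourhood of [x] in the cover is connected, so the labels in it, carried
   back to [f x], share one orbit. *)
have orbit_at (x : X) : exists i : 'I_d, exists2 U : set X, nbhs x U & forall u, U u -> u <> x -> f u <> f x /\
 exists2 z, f u = P1pt z & good lam p s (f x) z /\ xcls lam p s f l (f x) u = porbit (mono p s (f x)) i.
have [k rk] := ram x;have ng := cf (near_good srt s (f x)).
have [U [nU UN cU [u0 U0] Hf]] := ramif_punctured lam rk ng.
exists ((trans lam p s (f x) (f u0))^-1%g (l u0));exists U=> // u Uu ux.
have fux := Hf u Uu ux;have [z fu gz] := UN u Uu fux.
split=> //;exists z=> //;split=> //.
rewrite -[RHS]/(xcls lam p s f l (f x) u0).
apply: (connected_lconst cU)=> // {u0 U0 u Uu ux fux z fu gz} u [Uu ux].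
have [z fu gz] := UN u Uu (Hf u Uu ux).
by apply: filterS (xcls_lconst HL gz fu).
have [io ioP] := choice orbit_at.
pose Psi x := mk srt s (f x) (io x).
have Psi_lbl x z : ordinary p z -> f x = P1pt z -> lbl (Psi x) = l x.
move=> oz fx;have m1 := mono_ord s oz.
have [U nU HU] := ioP x;have [k rk] := ram x.
have nl := lab_near (HL z oz) fx.
have [u [[Uu [z' fu lu]] ux fux]] := punctured_meets lam rk (filterI nU nl).
have [_ [z2 fu2 [_ E]]] := HU u Uu ux.
have := lbl_mk srt s (f x) (io x);rewrite -E fx m1 /xcls m1 fu transE lu jump_transport permK.
by rewrite /Psi fx;exact: porbit1_inj.
have cPsi : continuous Psi.
move=> x W /model_nbhsE[V nV HV];have [U nU HU] := ioP x.
have : nbhs x (U `&` (f @^-1` V)) by apply: filterI=> //;exact: cf.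
apply: filterS=> u [Uu Vu];apply: HV=> //.
have [->//|ux] := pselect (u = x).
have [fux [z fu [[oz _] E]]] := HU u Uu ux.
by rewrite cls_mk -E /cls /xcls (Psi_lbl u z).
(* If two points of a fibre had the same orbit, the clopen piece around the first would, by
   [transport_const], contain points near the second, hence the second itself. *)
have iPsi : injective Psi.
move=> x x' E;apply: contrapT=> xx'.
have fxx' : f x = f x' by have := congr1 (@prj _ _ _ _ srt _ s) E.
have Eio : porbit (mono p s (f x)) (io x) = porbit (mono p s (f x)) (io x').
 by rewrite -(lbl_mk srt s (f x) (io x)) -/(Psi x) E /Psi fxx' lbl_mk.
have [k rk] := ram x;have [k' rk'] := ram x'.
have [V [A [nV Ax HA HA']]] := clopen_piece hX rk.
have [|V' nV' HV'] := transport_const srt HL (y := f x) (g := A).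
 by apply: filterS nV=> y' Vy' _ u fu;apply: HA;rewrite fu.
have [U nU HU] := ioP x;have [U' nU' HU'] := ioP x'.
have n1 : nbhs x (fun u=> U u /\ (V' (f u) /\ A u = A x)).
 apply: filterI=> //;apply: filterI;first exact: cf.
 by apply: HA;exact: nbhs_singleton nV.
have n2 : nbhs x' (fun u=> U' u /\ (V' (f u) /\ A u = A x')).
 apply: filterI=> //;apply: filterI;first by apply: cf;rewrite -fxx'.
 by apply: HA;rewrite -fxx';exact: nbhs_singleton nV.
have [u [[Uu [Vu Au]] ux fux]] := punctured_meets lam rk n1.
have [u' [[Uu' [Vu' Au']] ux' fux']] := punctured_meets lam rk' n2.
have [_ [z _ [_ E1]]] := HU u Uu ux;have [_ [z' _ [_ E2]]] := HU' u' Uu' ux'.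
have := HV' u u' Vu Vu' fux;rewrite {1}fxx'=> /(_ fux').
rewrite E1 Eio fxx' -E2=> /(_ erefl);rewrite Au Au'=> AE.
apply: xx';apply/esym;apply: HA';first by rewrite fxx'.
by rewrite -AE.
have clos (F : set X) : closed F -> closed (Psi @` F).
move=> cF;apply: compact_closed;first exact: model_hausdorff.
apply: continuous_compact;first exact: continuous_subspaceT.
exact: subclosed_compact cF cX _.
(* A point outside the closed image would have a neighbourhood disjoint from it, yet over an
   ordinary base point of that neighbourhood every label is attained. *)
have sPsi x : exists u, Psi u = x.
apply: contrapT=> nx.
have cI : closed (Psi @` setT) by apply: clos;exact: closedT.
have : nbhs x (~` (Psi @` setT)).
 apply: open_nbhs_nbhs;split;first exact: closed_openC.
 by move=> [u _ ux];apply: nx;exists u.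
move=> /model_nbhsE[V nV HV].
have [z [Vz gz] zy] := P1_nonisolated (filterI nV (near_good srt s (prj x))).
have [z' [] zz' [oz _]] := gz zy;subst z'.
have [h1 _ _] := HL z oz;have [u fu lu] := h1 (trans lam p s (prj x) (P1pt z) (lbl x)).
apply: (HV (Psi u));last by exists u.
 by rewrite prj_mk fu.
by rewrite cls_refl /cls prj_mk (Psi_lbl u z)// lu fu permK.
have [Phi PhiK] := choice sPsi.
have PsiK : cancel Psi Phi by move=> x;apply: iPsi;rewrite PhiK.
exists Psi;split=> //;exists Phi=> //.
apply/continuous_closedP=> F cF.
have -> : Phi @^-1` F = Psi @` F.
apply/seteqP;split=> x;first by move=> Fx;exists (Phi x).
by move=> [u Fu <-];rewrite/= PsiK.
exact: clos.
Qed.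

End Classify.

(** * Profiles, connectedness and isomorphisms of models *)

Section ModelFacts.
Variables (R : realType) (lam : R).
Local Notation K := (Cplx R).
Local Notation h := (hh lam).
Variables (M : nat) (p : 'I_M -> K).
Variable srt : forall i j : 'I_M, (i < j)%N -> h (p j) < h (p i).
Variable d : nat.
Local Notation X s := (@model R lam M p d s srt).

Definition cycle_type (t : {perm 'I_d}) : seq nat := [seq #|C| | C : {set 'I_d} <- enum (porbits t)].

Lemma perm_eq_map (T1 T2 : eqType) (g : T1 -> T2) (s : seq T2) (t : seq T1) :
perm_eq s (map g t) -> exists2 t', perm_eq t' t & s = map g t'.
Proof.
case: t=> [|x0 t];first by move=> /perm_size/size0nil ->;exists [::].
move=> /(perm_iotaP (g x0))[Is pI ->];rewrite size_map in pI.
exists (map (nth x0 (x0 :: t)) Is).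
by apply/(perm_iotaP x0);exists Is.
rewrite -map_comp;apply/eq_in_map=> i;rewrite (perm_mem pI) mem_iota/= => Hi.
by rewrite -(nth_map x0 (g x0)).
Qed.

(** Points over [y] are the cycles of the local monodromy, with ramification indices their lengths;
    uniqueness of the index forces the list up to order. *)
Lemma model_profile (s : 'I_M -> {perm 'I_d}) (y : P1 R) (mu : seq nat) :
ramification_profile (@prj _ _ _ _ srt _ s) y mu <-> perm_eq mu (cycle_type (mono p s y)).
Proof.
set t := mono p s y.
have rk (x : X s) : prj x = y -> ramification_index (@prj _ _ _ _ srt _ s) x #|porbit t (lbl x)|.
by move=> E;rewrite /t -E;exact: model_ramification.
split.
- move=> [x [xi rx Hx]].
have px i : prj (x i) = y by have : range x (x i) by [];rewrite rx.
have -> : mu = [seq #|C| | C : {set 'I_d} <- [seq porbit t (lbl (x i)) | i : 'I_(size mu) <- enum 'I_(size mu)]].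
 apply: (@eq_from_nth _ 0%N);first by rewrite 2!size_map size_enum_ord.
 move=> i Hi;pose io := Ordinal Hi.
 rewrite (nth_map finset.set0);last by rewrite size_map size_enum_ord.
 rewrite (nth_map io) ?size_enum_ord//.
 rewrite (nth_ord_enum io io);exact: ramif_uniq (Hx io) (rk _ (px io)).
apply: perm_map;apply: uniq_perm;last 1 first.
+ move=> O;apply/mapP/idP=> [[i _ ->]|].
  by rewrite mem_enum;apply/imsetP;exists (lbl (x i)).
 rewrite mem_enum=> /imsetP[j _ ->].
 have : (@prj _ _ _ _ srt _ s @^-1` [set y]) (mk srt s y j) by [].
 rewrite -rx=> -[i _ E];exists i;rewrite ?mem_enum// E -/t.
 by rewrite [RHS]lbl_mk.
+ rewrite map_inj_in_uniq ?enum_uniq// => i j _ _ E;apply: xi.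
 by apply: model_eq;rewrite !px.
+ exact: enum_uniq.
- move=> /perm_eq_map[os pos ->].
have osP (i : 'I_(size [seq #|C| | C : {set 'I_d} <- os])) : exists j, nth finset.set0 os i = porbit t j.
 have : nth finset.set0 os i \in enum (porbits t).
  by rewrite -(perm_mem pos) mem_nth// -(size_map (fun C : {set 'I_d} => #|C|)).
 by rewrite mem_enum=> /imsetP[j _ ->];exists j.
have [j jP] := choice osP;exists (fun i=> mk srt s y (j i));split.
+ move=> i i' E;have : porbit t (lbl (mk srt s y (j i))) = porbit t (lbl (mk srt s y (j i'))) by rewrite E.
 rewrite !lbl_mk -!jP=> /eqP;rewrite nth_uniq -?(size_map (fun C : {set 'I_d} => #|C|))//.
  by move=> /eqP/val_inj.
 by rewrite (perm_uniq pos) enum_uniq.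
+ apply/seteqP;split=> [_ [i _ <-]//|x/= px].
 have : porbit t (lbl x) \in os by rewrite (perm_mem pos) mem_enum;apply/imsetP;exists (lbl x).
 move=> /(nthP finset.set0)[i Hi E];have Hi' : (i < size [seq #|C| | C : {set 'I_d} <- os])%N by rewrite size_map.
 exists (Ordinal Hi')=> //;apply: model_eq;first by rewrite prj_mk px.
 by rewrite prj_mk lbl_mk -/t -jP/= E.
+ move=> i;rewrite (nth_map finset.set0) -?(size_map (fun C : {set 'I_d} => #|C|))// jP.
 by rewrite -(lbl_mk srt s y (j i));exact: rk.
Qed.

Lemma comb_dense (y : P1 R) (V : set (P1 R)) : nbhs y V -> exists z, [/\ V (P1pt z), comb lam p z & P1pt z <> y].
Proof.
case: y=> [z0 /(nbhs_box lam)[e e0 He]|/(nbhs_P1infty lam)[_ [e e0 He]]].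
have [e' e'0 He'] := near_isolated lam p z0.
have m1 : Num.min e e' <= e by rewrite ge_min lexx.
have m2 : Num.min e e' <= e' by rewrite ge_min lexx orbT.
have m0 : 0 < Num.min e e' by rewrite lt_min e0.
pose z := mkc lam (rr z0) (h z0 + Num.min e e' / 2).
have hz : `|h z - h z0| < Num.min e e'.
 by rewrite hh_mkc addrAC subrr add0r gtr0_norm;lra.
have rz : rr z = rr z0 by [].
have hz0 : h z <> h z0 by rewrite hh_mkc;lra.
exists z;split.
- by apply: He;[rewrite rz subrr normr0|exact: lt_le_trans m1].
- move=> j;apply/negP=> /andP[/eqP E _].
 have [|A _ _] := He' z _ (lt_le_trans hz m2) j;first by rewrite rz subrr normr0.
 by apply: hz0;rewrite E A.
- by move=> [zz0];apply: hz0;rewrite zz0.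
pose c := \big[Num.min/0]_j rr (p j).
have cp j : c <= rr (p j) by exact: bigmin_le.
have c0 : c <= 0 by exact: bigmin_le_id.
exists (mkc lam (c - e - 1) 0);split=> //.
by apply: He;left;rewrite rr_mkc ltr0_norm;lra.
move=> j;apply/negP=> /andP[_];rewrite rr_mkc;have := cp j;lra.
Qed.

Lemma model_dense (s : 'I_M -> {perm 'I_d}) (x : X s) (W : set (X s)) : nbhs x W ->
exists x' z, [/\ W x', prj x' = P1pt z & comb lam p z].
Proof.
move=> /model_nbhsE[V nV HV];have [z [Vz cz zy]] := comb_dense nV.
pose x' := mk srt s (P1pt z) (trans lam p s (prj x) (P1pt z) (lbl x)).
exists x', z;split=> //;apply: HV;first by rewrite prj_mk.
have m1 := mono_ord s (comb_ordinary cz).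
rewrite cls_refl /cls prj_mk (_ : lbl x' = trans lam p s (prj x) (P1pt z) (lbl x)) ?permK//.
by apply: porbit1_inj;rewrite -m1 lbl_mk.
Qed.

Lemma model_HL (s : 'I_M -> {perm 'I_d}) z : ordinary p z ->
lab_at (@prj _ _ _ _ srt _ s) (jump lam p s z) (@lbl _ _ _ _ srt _ s) z.
Proof. by move=> oz;apply: model_lab;exact: mono_ord. Qed.

Lemma lbl_lconst_comb (s : 'I_M -> {perm 'I_d}) (x : X s) z : comb lam p z -> prj x = P1pt z ->
\forall x' \near x, lbl x' = lbl x.
Proof.
move=> cz px;apply: filterS (lab_near (model_HL s (comb_ordinary cz)) px)=> x' [z' _ ->].
by rewrite /jump cut_of_comb.
Qed.

Lemma lbl_mkE (s : 'I_M -> {perm 'I_d}) z i : ordinary p z -> lbl (mk srt s (P1pt z) i) = i.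
Proof. by move=> oz;apply: porbit1_inj;rewrite -{1 2}(mono_ord s oz) lbl_mk mono_ord. Qed.

(** Transitivity of the generated group, stated through invariant sets; stability under the [s k]
    includes stability under their inverses since the set is finite. *)
Definition irreducible (s : 'I_M -> {perm 'I_d}) : Prop := forall A : {set 'I_d},
(forall k i, i \in A -> s k i \in A) -> A != finset.set0 -> A = [set: 'I_d]%SET.

Lemma left_of_p_comb j e : 0 < e -> comb lam p (mkc lam (rr (p j) - e) (h (p j))).
Proof.
move=> e0 k;apply/negP=> /andP[];rewrite hh_mkc rr_mkc=> /eqP/(inj_hp srt) <-;lra.
Qed.

(** Over the cut plane the value depends on the label only, and a turn around [p j] identifies the
    values at [i] and [s j i]. Irreducibility leaves one value, and the part over the cut plane is
    dense. *)
Lemma model_const (s : 'I_M -> {perm 'I_d}) (T : Type) (g : X s -> T) : irreducible s ->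
(forall x, \forall x' \near x, g x' = g x) -> forall x x', g x = g x'.
Proof.
move=> irr lg.
have [z0 [_ cz0 _]] := comb_dense (@filterT _ (nbhs (P1infty R)) _).
pose gam i := g (mk srt s (P1pt z0) i).
have gE x z : comb lam p z -> prj x = P1pt z -> g x = gam (lbl x).
move=> cz px;have Hg u (v : X s) : comb lam p u -> prj v = P1pt u -> \forall x' \near v, g x' = g v by [].
apply: (comb_const (@model_HL s) Hg cz cz0 px (prj_mk srt s (P1pt z0) (lbl x))).
by rewrite lbl_mkE//;exact: comb_ordinary.
have step j i : gam i = gam (s j i).
have [|V nV HV] := transport_const srt (@model_HL s) (y := P1pt (p j)) (g := g).
 by apply: (@filterE _ (nbhs _))=> y' _ x _.
have /(nbhs_box lam)[e e0 He] : nbhs (p j) (fun z=> V (P1pt z)) by [].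
pose z := mkc lam (rr (p j) - e / 2) (h (p j)).
have cz : comb lam p z by apply: left_of_p_comb;lra.
have Vz : V (P1pt z).
 apply: He;rewrite ?hh_mkc ?rr_mkc ?subrr ?normr0//.
 by rewrite addrAC subrr add0r normrN gtr0_norm;lra.
have zp : P1pt z <> P1pt (p j).
 by move=> [] /(congr1 (@rr R));rewrite rr_mkc;lra.
have E k : lbl (mk srt s (P1pt z) k) = k by rewrite lbl_mkE//;exact: comb_ordinary.
have cj : cut_of lam p (p j) = None.
 by apply: cut_of_none=> k /(inj_hp srt) ->.
have := HV (mk srt s (P1pt z) i) (mk srt s (P1pt z) (s j i)) Vz Vz zp zp.
rewrite !(gE _ z)// !E;apply.
rewrite /xcls !prj_mk !E (mono_p srt).
by rewrite transE trans_ptE cj invg1 !perm1 porbit_step.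
have cst i k : gam i = gam k.
have : [set k | `[< gam i = gam k >]]%SET = [set: 'I_d]%SET.
 apply: irr=> [j m|];first by rewrite !finset.in_set=> /asboolP E;apply/asboolP;rewrite E.
 by apply/finset.set0Pn;exists i;rewrite finset.in_set;apply/asboolP.
by move/finset.setP/(_ k);rewrite finset.in_set finset.in_setT=> /asboolP.
move=> x x';have [u [z [Hu pu cz]]] := model_dense (lg x).
have [u' [z' [Hu' pu' cz']]] := model_dense (lg x').
by rewrite -Hu -Hu' (gE u z)// (gE u' z').
Qed.

Lemma model_connected_irr (s : 'I_M -> {perm 'I_d}) : irreducible s -> connected [set: X s].
Proof.
move=> irr B [b Bb] [C oC BC] [F cF BF];apply/seteqP;split=> // x _.
have oB : open B by rewrite BC setTI.
have cB : closed B by rewrite BF setTI.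
have -> : B x = B b;last by [].
apply: (model_const (g := B) irr)=> {}x;have [Bx|nB] := pselect (B x).
apply: filterS (open_nbhs_nbhs (conj oB Bx))=> x' Bx';exact/propext.
have : nbhs x (~` B) by apply: open_nbhs_nbhs;split=> //;exact: closed_openC.
by apply: filterS=> x' nB';apply/propext.
Qed.

Lemma mem_perm_inv (A : {set 'I_d}) (t : {perm 'I_d}) :
(forall i, i \in A -> t i \in A) -> forall i, (t i \in A) = (i \in A).
Proof.
move=> H i;have : t @: A = A.
apply/eqP;rewrite eqEcard card_imset ?leqnn ?andbT;last exact: perm_inj.
by apply/fintype.subsetP=> _ /imsetP[k kA ->];exact: H.
by move=> E;rewrite -{1}E mem_imset//;exact: perm_inj.
Qed.

(** Membership of the label in an invariant set is locally constant on the model, because transports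
    and local monodromies are products of the [s j] and their inverses. *)
Lemma model_irr_connected (s : 'I_M -> {perm 'I_d}) : connected [set: X s] -> irreducible s.
Proof.
move=> cX A HA /finset.set0Pn[i0 Ai0].
pose Q (t : {perm 'I_d}) := forall i, (t i \in A) = (i \in A).
have Q1 : Q 1%g by move=> i;rewrite perm1.
have QM t u : Q t -> Q u -> Q (t * u)%g by move=> Qt Qu i;rewrite permM Qu.
have QV t : Q t -> Q (t^-1)%g by move=> Qt i;rewrite -[in RHS](permKV t i) Qt.
have Qs j : Q (s j) by apply: mem_perm_inv=> i;exact: HA.
have Qprod (P : pred 'I_M) : Q (\prod_(j < M | P j) s j)%g by elim/big_ind: _=> // j _.
have Qmono y : Q (mono p s y).
by case: y=> [z|];rewrite /mono;[case: pickP=> // j _|exact: Qprod].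
have Qtr y y' : Q (trans lam p s y y').
case: y'=> [z'|];last exact: Q1.
case: y=> [z|];rewrite /trans /transport;first by case: cut_of=> // j;case: ifP.
by case: ifP=> // _;case: ifP=> _;rewrite /mono_ge /mono_inf;[exact: Qprod|apply: (QM _ _ (QV _ _));exact: Qprod].
have Qorb t i k : Q t -> porbit t i = porbit t k -> (i \in A) = (k \in A).
move=> Qt /eqP;rewrite eq_porbit_mem=> /porbitP[n ->].
by elim: n=> [|n IH];rewrite ?expg0 ?perm1// expgSr permM Qt.
have lg (x : X s) : setT x -> \forall x' \near x, setT x' -> (lbl x' \in A) = (lbl x \in A).
move=> _;apply/model_nbhsE;exists setT;first exact: filterT.
move=> x' _ E _;move: E;rewrite cls_refl /cls=> /(Qorb _ _ _ (Qmono _)) <-.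
by rewrite (QV _ (Qtr _ _)).
have [z0 [_ cz0 _]] := comb_dense (@filterT _ (nbhs (P1infty R)) _).
apply/finset.setP=> i;rewrite finset.in_setT.
have := connected_lconst cX lg (x := mk srt s (P1pt z0) i) (y := mk srt s (P1pt z0) i0).
by rewrite !lbl_mkE ?Ai0;[apply|exact: comb_ordinary|exact: comb_ordinary].
Qed.

Section Conj.
Variables (s : 'I_M -> {perm 'I_d}) (w : {perm 'I_d}).
Let s' j := (s j ^ w)%g.

Lemma prod_conj (P : pred 'I_M) : (\prod_(j < M | P j) s' j = (\prod_(j < M | P j) s j) ^ w)%g.
Proof. by rewrite (big_morph (fun t : {perm 'I_d} => (t ^ w)%g) (fun a b=> conjMg a b w) (conj1g w)). Qed.

Lemma mono_conj y : mono p s' y = (mono p s y ^ w)%g.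
Proof.
case: y=> [z|];rewrite /mono;last exact: prod_conj.
by case: pickP;rewrite ?conj1g.
Qed.

Lemma trans_conj y y' : trans lam p s' y y' = (trans lam p s y y' ^ w)%g.
Proof.
case: y'=> [z'|];last by rewrite conj1g.
case: y=> [z|];rewrite /trans /transport;first by case: cut_of=> [j|];[case: ifP|];rewrite ?conj1g.
case: ifP=> _;last by rewrite conj1g.
by case: ifP=> _;rewrite /mono_ge /mono_inf ?conjMg ?conjVg !prod_conj.
Qed.

Lemma porbit_conj (t : {perm 'I_d}) i k : porbit t i = porbit t k -> porbit (t ^ w)%g (w i) = porbit (t ^ w)%g (w k).
Proof.
move=> /eqP;rewrite eq_porbit_mem=> /porbitP[n ->];apply/eqP;rewrite eq_porbit_mem.
by apply/porbitP;exists n;rewrite -conjXg permJ.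
Qed.

Definition conj_map (x : X s) : X s' := mk srt s' (prj x) (w (lbl x)).

Lemma prj_conj_map x : prj (conj_map x) = prj x. Proof. by []. Qed.

Lemma conj_map_continuous : continuous conj_map.
Proof.
move=> x W /model_nbhsE[V nV HV];apply/model_nbhsE.
exists (V `&` [set y' | y' <> prj x -> exists2 z, y' = P1pt z & good lam p s (prj x) z]).
by apply: filterI=> //;exact: near_good.
move=> x' [Vx' Hx'] E;apply: HV=> //;rewrite cls_mk mono_conj.
have [e|n] := pselect (prj x' = prj x).
rewrite /cls !prj_conj_map e trans_refl invg1 perm1.
have -> : x' = x by apply: model_eq=> //;move: E;rewrite cls_refl /cls e trans_refl invg1 perm1.
by rewrite -mono_conj;exact: lbl_mk.
have [z pz [oz _]] := Hx' n.
rewrite /cls !prj_conj_map {1}/conj_map pz lbl_mkE// trans_conj -conjVg permJ.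
by rewrite mono_conj;apply: porbit_conj;move: E;rewrite cls_refl /cls pz.
Qed.
End Conj.

(** The permutation [w] is read off over one point of the cut plane and describes [Phi] over all of
    it. Comparing both sides of each cut yields the conjugation; agreement elsewhere follows by
    density. *)
Lemma iso_conj (s s' : 'I_M -> {perm 'I_d}) (Phi : X s -> X s') :
continuous Phi -> injective Phi -> (forall x, prj (Phi x) = prj x) ->
exists w : {perm 'I_d}, (forall j, s' j = (s j ^ w)%g) /\
 forall x, Phi x = mk srt s' (prj x) (w (lbl x)).
Proof.
move=> cP iP pP.
have [z0 [_ cz0 _]] := comb_dense (@filterT _ (nbhs (P1infty R)) _).
pose w0 i := lbl (Phi (mk srt s (P1pt z0) i)).
have iw : injective w0.
move=> i k E;have : Phi (mk srt s (P1pt z0) i) = Phi (mk srt s (P1pt z0) k).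
 by apply: model_eq;rewrite ?pP ?prj_mk// -/(w0 i) E.
by move/iP/(congr1 (@lbl _ _ _ _ srt _ s));rewrite !lbl_mkE//;exact: comb_ordinary.
pose w := perm iw;exists w.
have wE x z : comb lam p z -> prj x = P1pt z -> lbl (Phi x) = w (lbl x).
move=> cz px;rewrite permE.
have Hg u (v : X s) : comb lam p u -> prj v = P1pt u -> \forall x' \near v, lbl (Phi x') = lbl (Phi v).
 move=> cu pv;have nB := lbl_lconst_comb cu (etrans (pP v) pv);exact: (cP _ _ nB).
apply: (comb_const (@model_HL s) Hg cz cz0 px (prj_mk srt s (P1pt z0) (lbl x))).
by rewrite lbl_mkE//;exact: comb_ordinary.
have cw j : s' j = (s j ^ w)%g.
apply/permP=> i;rewrite -(permKV w i) permJ;set k := (w^-1)%g i.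
(* A point on the cut of [p j]; [zu] and [zd] are taken just above and just below it. *)
pose z := mkc lam (rr (p j) + 1) (h (p j)).
have oz : ordinary p z.
 move=> m;apply/eqP=> E;have := congr1 h E;rewrite hh_mkc=> /(inj_hp srt) jm.
 by have := congr1 (@rr R) E;rewrite -jm rr_mkc;lra.
have zc : cut_of lam p z = Some j.
 by apply: (cut_ofP (inj_hp srt));rewrite /on_cut hh_mkc rr_mkc eqxx ltrDl ltr01.
pose x := mk srt s (P1pt z) k.
have lx : lbl x = k by exact: lbl_mkE.
have [_ _ H] := model_HL s oz.
have n1 := cP x _ (lab_near (model_HL s' oz) (pP x)).
have [V nV HV] := (H x _ (prj_mk _ _ _ _)).1 n1.
have [e e0 He] := near_isolated lam p z.
have /(nbhs_box lam)[e' e'0 He'] := nV.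
have near (a : R) : `|a| < Num.min e e' -> a != 0 ->
  comb lam p (mkc lam (rr z) (h z + a)) /\ V (mkc lam (rr z) (h z + a)).
 rewrite lt_min=> /andP[a1 a2] a0.
 have r0 : rr (mkc lam (rr z) (h z + a)) - rr z = 0 by rewrite rr_mkc subrr.
 have h0 : h (mkc lam (rr z) (h z + a)) - h z = a by rewrite hh_mkc addrAC subrr add0r.
 split;last by apply: He';rewrite ?r0 ?h0 ?normr0.
 move=> m;apply/negP=> /andP[/eqP E _].
 have [||A _ _] := He (mkc lam (rr z) (h z + a)) _ _ m;rewrite ?r0 ?h0 ?normr0//.
 by move/eqP: a0;apply;have := A E;rewrite -E -h0;lra.
have m0 : 0 < Num.min e e' by rewrite lt_min e0.
pose c := Num.min e e' / 2.
have c0 : 0 < c by rewrite divr_gt0.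
have cm : `|c| < Num.min e e' by rewrite gtr0_norm// /c;lra.
have [] := near c cm (lt0r_neq0 c0).
have [] := near (- c);rewrite ?normrN ?oppr_eq0 ?(lt0r_neq0 c0)//.
set zd := mkc _ _ (_ - c);set zu := mkc _ _ (_ + c)=> cd Vd cu Vu.
have hu : h zu < h z = false by rewrite hh_mkc;apply/negbTE;rewrite -leNgt;lra.
have hd : h zd < h z by rewrite hh_mkc;lra.
have jm (s0 : 'I_M -> {perm 'I_d}) z' m : jump lam p s0 z z' m = if h z' < h z then s0 j m else m.
 by rewrite /jump zc.
have step z' : comb lam p z' -> V z' ->
  w (if h z' < h z then s j k else k) = if h z' < h z then s' j (lbl (Phi x)) else lbl (Phi x).
 move=> cz' Vz'.
 pose x' := mk srt s (P1pt z') (jump lam p s z z' k).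
 have lx' : lbl x' = jump lam p s z z' (lbl x) by rewrite lx lbl_mkE//;exact: comb_ordinary.
 have [z1 + L1] := HV x' z' Vz' (prj_mk _ _ _ _) lx'.
 rewrite pP prj_mk=> -[zz1];rewrite -zz1 jm in L1;rewrite -L1 (wE x' z')// lx' lx jm.
 by [].
have := step zd cd Vd;have := step zu cu Vu;rewrite hu hd=> -> ->.
by [].
have s'E : s' = fun j=> (s j ^ w)%g by apply/funext.
split=> // x;clearbody w;clear w0 iw;subst s'.
rewrite -/(conj_map w x);apply: model_hausdorff.
move=> A B nA nB.
have n1 : nbhs x (fun u=> A (Phi u)) by exact: (cP x _ nA).
have n2 : nbhs x (fun u=> B (conj_map w u)) by exact: (@conj_map_continuous s w x _ nB).
have [x' [z [[Ax' Bx'] px cz]]] := model_dense (filterI n1 n2).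
exists (Phi x');split=> //.
suff -> : Phi x' = conj_map w x' by [].
apply: model_eq;first by rewrite pP.
by rewrite pP px (wE _ z)// /conj_map px lbl_mkE//;exact: comb_ordinary.
Qed.

End ModelFacts.

(** * A cell structure on the model and its Euler characteristic *)

Section SupNorm.
Variable R : realType.

Lemma norm_rV n (v : 'rV[R]_n) : `|v| = mx_norm v. Proof. by []. Qed.

Lemma coord_le_norm n (v : 'rV[R]_n) j : `|v ord0 j| <= `|v|.
Proof. by rewrite norm_rV mx_normrE;apply: (le_bigmax _ (fun ij=> `|v ij.1 ij.2|) (ord0, j)). Qed.

Lemma norm_lt1 n (v : 'rV[R]_n) : (forall j, `|v ord0 j| < 1) -> `|v| < 1.
Proof.
move=> H;rewrite norm_rV mx_normrE;apply/bigmax_ltP;split=> // -[i j] _/=.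
by rewrite (ord1 i).
Qed.

Lemma norm_eq1 n (v : 'rV[R]_n) : `|v| = 1 -> exists j, `|v ord0 j| = 1.
Proof.
move=> E;have : mx_norm v != 0 by rewrite -norm_rV E oner_eq0.
by move=> /mx_norm_neq0[[i j]];rewrite -norm_rV E (ord1 i)=> /= H;exists j.
Qed.
End SupNorm.

Section Quotients.
Variables (R : realType) (lam : R) (T : topologicalType).
Local Notation K := (Cplx R).

Lemma quotient_large (f g : T -> R) (v : T) : {for v, continuous f} -> {for v, continuous g} ->
g v = 0 -> f v <> 0 -> forall e, \forall u \near v, g u != 0 -> e < `|f u / g u|.
Proof.
move=> cf cg g0 f0 e;pose e' := Num.max e 1.
have e'0 : 0 < e' by rewrite lt_max ltr01 orbT.
have F : 0 < `|f v| by rewrite normr_gt0;apply/eqP.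
have n1 : \forall u \near v, `|f v| / 2 < `|f u|.
have /cvgr_dist_lt/(_ (`|f v| / 2)) := cf;move=> /(_ (divr_gt0 F (ltr0Sn _ _))).
by apply: filterS=> u;have := lerB_dist (f v) (f u);lra.
have n2 : \forall u \near v, `|g u| < `|f v| / 2 / e'.
have /cvgr_dist_lt/(_ (`|f v| / 2 / e')) := cg;rewrite g0.
move=> /(_ (divr_gt0 (divr_gt0 F (ltr0Sn _ _)) e'0)).
by apply: filterS=> u;rewrite sub0r normrN.
apply: filterS (filterI n1 n2)=> u [H1 H2] gu.
have gu0 : 0 < `|g u| by rewrite normr_gt0.
rewrite normrM normfV ltr_pdivlMr//;apply: le_lt_trans H1.
apply: (@le_trans _ _ (e' * `|g u|));first by rewrite ler_pM2r// le_max lexx.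
by rewrite mulrC -ler_pdivlMr//;exact: ltW.
Qed.

Lemma affine_continuous (a b : R) (f : T -> R) : continuous f -> continuous (fun u=> a + b * f u).
Proof.
move=> cf u;have c1 : {for u, continuous (fun u=> b * f u)}.
by apply: cvgM;[exact: cst_continuous|exact: cf].
by apply: (@cvgD _ _ _ _ _ (fun=> a) _ a _ _ c1);exact: cst_continuous.
Qed.

(** Coordinates are given as fractions so that one formula reaches infinity where a denominator
    vanishes. Closed cells are thereby parametrized continuously up to their boundary. *)
Definition P1_quot (n1 d1 n2 d2 : T -> R) (v : T) : P1 R :=
if d1 v * d2 v == 0 then P1infty R else P1pt (mkc lam (n1 v / d1 v) (n2 v / d2 v)).

Lemma P1_quot_continuous n1 d1 n2 d2 v : continuous n1 -> continuous d1 -> continuous n2 -> continuous d2 ->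
(d1 v = 0 -> n1 v <> 0) -> (d2 v = 0 -> n2 v <> 0) -> {for v, continuous (P1_quot n1 d1 n2 d2)}.
Proof.
move=> cn1 cd1 cn2 cd2 H1 H2 W;rewrite /P1_quot;case: eqP=> [/eqP|/eqP].
rewrite mulf_eq0=> E /(nbhs_P1infty lam)[Winf [e e0 He]].
have : \forall u \near v, d1 u * d2 u != 0 -> e < `|n1 u / d1 u| \/ e < `|n2 u / d2 u|.
 case/orP: E=> /eqP E.
  apply: filterS (quotient_large (cn1 v) (cd1 v) E (H1 E) e)=> u Hu.
  by rewrite mulf_eq0 negb_or=> /andP[/Hu ? _];left.
 apply: filterS (quotient_large (cn2 v) (cd2 v) E (H2 E) e)=> u Hu.
 by rewrite mulf_eq0 negb_or=> /andP[_ /Hu ?];right.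
apply: filterS=> u Hu/=;case: ifPn=> [_//|/Hu Hu'].
by apply: He;rewrite rr_mkc hh_mkc.
move=> nz /nbhs_P1pt/(nbhs_box lam)[e e0 He].
have := nz;rewrite mulf_eq0 negb_or=> /andP[z1 z2].
have c1 : {for v, continuous (fun u=> n1 u / d1 u)}.
by apply: cvgM;[exact: cn1|apply: cvgV=> //;exact: cd1].
have c2 : {for v, continuous (fun u=> n2 u / d2 u)}.
by apply: cvgM;[exact: cn2|apply: cvgV=> //;exact: cd2].
have c3 : {for v, continuous (fun u=> d1 u * d2 u)}.
by apply: cvgM;[exact: cd1|exact: cd2].
have /cvgr_dist_lt/(_ e e0) N1 := c1;have /cvgr_dist_lt/(_ e e0) N2 := c2.
have N3 : \forall u \near v, d1 u * d2 u != 0 by apply: cvgr_neq0 c3 nz.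
apply: filterS (filterI N1 (filterI N2 N3))=> u [/= h1 [h2 h3]].
rewrite (negPf h3);apply: He;rewrite ?rr_mkc ?hh_mkc distrC//.
Qed.
End Quotients.

Lemma cell_structure_fin (R : realType) (X : topologicalType) (T : finType) (dm : T -> nat)
 (Phi : forall t, 'rV[R]_(dm t) -> X) :
[/\ forall c, {within [set v | `|v| <= 1], continuous (Phi c)},
  forall x, exists c, exists2 v : 'rV[R]_(dm c), `|v| < 1 & Phi c v = x,
  forall c (v w : 'rV[R]_(dm c)), `|v| < 1 -> `|w| < 1 -> Phi c v = Phi c w -> v = w,
  forall c c' (v : 'rV[R]_(dm c)) (w : 'rV[R]_(dm c')),
  `|v| < 1 -> `|w| < 1 -> Phi c v = Phi c' w -> c = c'
 & forall c (v : 'rV[R]_(dm c)), `|v| = 1 -> exists2 c', (dm c' < dm c)%N &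
  exists2 w : 'rV[R]_(dm c'), `|w| < 1 & Phi c' w = Phi c v] ->
exists (N : nat) (dim : 'I_N -> nat) (Psi : forall i, 'rV[R]_(dim i) -> X),
 cell_structure Psi /\ \sum_(i < N) (-1) ^+ dim i = \sum_(c : T) (-1) ^+ dm c :> int.
Proof.
move=> [H1 H2 H3 H4 H5].
pose Psi (i : 'I_#|T|) := Phi (enum_val i).
have ex (P : T -> Prop) c : P c -> exists i : 'I_#|T|, P (enum_val i).
by move=> Pc;exists (enum_rank c);rewrite enum_rankK.
exists #|T|, (fun i=> dm (enum_val i)), Psi;split.
split.
- by move=> i;exact: H1.
- by move=> x;have [c Pc] := H2 x;exact: (ex (fun c=> exists2 v : 'rV[R]_(dm c), `|v| < 1 & Phi c v = x) c Pc).
- by move=> i;exact: H3.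
- by move=> i j v w Hv Hw E;apply: enum_val_inj;exact: H4 E.
- move=> i v Hv;have [c lt Pc] := H5 _ v Hv.
 have [j [Pj1 Pj2]] := ex (fun c=> (dm c < dm (enum_val i))%N /\ exists2 w : 'rV[R]_(dm c), `|w| < 1 &
  Phi c w = Phi (enum_val i) v) c (conj lt Pc).
 by exists j.
by rewrite [RHS](reindex (@enum_val _ T))//;exact/onW_bij/enum_val_bij.
Qed.

Section Cells.
Variables (R : realType) (lam : R).
Local Notation K := (Cplx R).
Local Notation h := (hh lam).
Variables (M : nat) (p : 'I_M -> K).
Hypothesis M0 : (0 < M)%N.
Variable srt : forall i j : 'I_M, (i < j)%N -> h (p j) < h (p i).
Variables (d : nat) (s : 'I_M -> {perm 'I_d}).
Local Notation X := (model s srt).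
Local Notation mk := (mk srt s).

(** The map [v -> (A + B v) / (1 + D v)] parametrizes the heights of strip [k], which lies below
    [p (k - 1)] and above [p k]; the first condition makes it increasing. In [strip_exists], [D] is
    0 for a bounded strip, and -1 or 1 for the top or the bottom one, whose outer end is
    infinite. *)
Definition strip (k : nat) (A B D : R) : Prop :=
[/\ A * D < B /\ -1 <= D <= 1,
  D = -1 -> k = 0%N, D = 1 -> k = M,
  (D <> -1 -> exists2 j : 'I_M, k = j.+1 & (A + B) / (1 + D) = h (p j)) /\
  (D <> 1 -> exists2 j : 'I_M, k = j & (A - B) / (1 - D) = h (p j))
 & forall y, (forall j, y != h (p j)) -> (forall j : 'I_M, (y < h (p j)) = (j < k)%N) ->
  exists2 v, `|v| < 1 & (A + B * v) / (1 + D * v) = y].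

Lemma strip_exists (k : 'I_M.+1) : exists x : R * R * R, strip k x.1.1 x.1.2 x.2.
Proof.
case: k=> -[|k]/= Hk.
pose j0 := Ordinal M0;pose lo := h (p j0).
exists (lo + 1, 1 - lo, -1);split=> /=.
- by split;[lra|apply/andP;split;lra].
- by [].
- by move=> ?;exfalso;lra.
- split=> [|_];first by move=> /(_ erefl).
 by exists j0=> //;rewrite -/lo;field.
move=> y yn H;have lo_y : lo < y.
 by rewrite lt_neqAle eq_sym yn leNgt H.
exists ((y - lo - 1) / (y - lo + 1)).
 by rewrite ltr_norml ltr_pdivlMr ?ltr_pdivrMr;lra.
field;apply/andP;split;lra.
rewrite ltnS in Hk;pose j0 := Ordinal Hk;pose hi := h (p j0).
have [kM|kM] := eqVneq k.+1 M.
exists (hi - 1, hi + 1, 1);split=> /=.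
- by split;[lra|apply/andP;split;lra].
- by move=> ?;exfalso;clear kM;lra.
- by [].
- split=> [_|];last by move=> /(_ erefl).
 by exists j0=> //;rewrite -/hi;field.
move=> y _ H;have y_hi : y < hi by rewrite H.
clear kM;exists ((y - hi + 1) / (hi + 1 - y)).
 by rewrite ltr_norml ltr_pdivlMr ?ltr_pdivrMr;lra.
field;apply/andP;split;lra.
have Hk' : (k.+1 < M)%N by rewrite ltn_neqAle kM.
pose j1 := Ordinal Hk';pose lo := h (p j1).
have lohi : lo < hi by apply: srt.
exists ((lo + hi) / 2, (hi - lo) / 2, 0);split=> /=.
- by split;[lra|apply/andP;split;lra].
- by move=> ?;exfalso;lra.
- by move=> ?;exfalso;lra.
- split=> _;[exists j0=> //|exists j1=> //].
 by rewrite -/hi;field.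
by rewrite -/lo;field.
move=> y yn H;have y_hi : y < hi by rewrite H.
have lo_y : lo < y by rewrite lt_neqAle eq_sym yn leNgt H/= ltnn.
exists ((2 * y - lo - hi) / (hi - lo));last by field;lra.
by rewrite ltr_norml ltr_pdivlMr ?ltr_pdivrMr;lra.
Qed.

Lemma lift_continuous (T : topologicalType) (A : set T) (F : T -> P1 R) (L : T -> 'I_d) :
(forall v, A v -> {for v, continuous F}) ->
(forall v, A v -> \forall u \near v, A u ->
 porbit (mono p s (F v)) ((trans lam p s (F v) (F u))^-1%g (L u)) = porbit (mono p s (F v)) (L v)) ->
{within A, continuous (fun v=> mk (F v) (L v))}.
Proof.
move=> cF HL;apply/subspace_continuousP=> v Av W /model_nbhsE[V nV HV].
have ng : nbhs v (fun u=> F u <> F v -> exists2 z, F u = P1pt z & good lam p s (F v) z).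
exact: (cF v Av _ (near_good srt s (F v))).
have n1 : nbhs v (fun u=> V (F u)) by exact: (cF v Av _ nV).
suff : nbhs v (fun u=> A u -> W (mk (F u) (L u))) by [].
apply: filterS (filterI n1 (filterI ng (HL v Av)))=> u [/= Vu [gu Hu]] Au.
apply: HV;first by rewrite prj_mk.
rewrite cls_mk -(Hu Au) prj_mk.
have [E|n] := pselect (F u = F v).
by rewrite E cls_mk trans_refl invg1 perm1.
have [z Fu [oz _]] := gu n.
by rewrite /cls prj_mk Fu lbl_mkE.
Qed.

Lemma inf_orb z i : rmax p < rr z -> porbit (mono p s (P1infty R)) ((trans lam p s (P1infty R) (P1pt z))^-1%g i) =
porbit (mono p s (P1infty R)) ((mono_ge lam p s z)^-1%g i).
Proof.
move=> rz;rewrite transE trans_infE rz;case: ifP=> // _.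
by rewrite invMg invgK permM porbit_step.
Qed.

(** The product of the jumps across the cuts above strip [k]. Far to the right it relates the labels
    in that strip to the names at infinity. *)
Definition upto (k : nat) : {perm 'I_d} := (\prod_(j < M | (j < k)%N) s j)%g.

Lemma upto0 : upto 0 = 1%g. Proof. by rewrite /upto big_pred0. Qed.
Lemma uptoM : upto M = mono_inf s.
Proof. by apply: eq_bigl=> j;rewrite ltn_ord. Qed.

Lemma mono_above_upto z k : (forall j : 'I_M, (h z < h (p j)) = (j < k)%N) -> mono_ge lam p s z = upto k.
Proof. by move=> H;apply: eq_bigl. Qed.

Lemma mono_above_line z j : h z = h (p j) -> mono_ge lam p s z = upto j.
Proof. by move=> E;apply: mono_above_upto=> i;rewrite E (hp_ltE srt). Qed.

Lemma uptoS (j : 'I_M) : upto j.+1 = (upto j * s j)%g.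
Proof.
have h1 : h (mkc lam 0 (h (p j) - 1)) < h (p j) by rewrite hh_mkc;lra.
(* [c] bounds all heights below that of [p j]; starting the maximum one unit lower covers the lowest
   point. Then [z'] sits between [c] and [p j]. *)
pose c := \big[Num.max/h (p j) - 1]_(i < M | (j < i)%N) h (p i).
have cj : c < h (p j).
apply/bigmax_ltP;split;[lra|by move=> i ji;exact: srt].
pose z' := mkc lam 0 ((c + h (p j)) / 2).
have hz' : h z' < h (p j) by rewrite hh_mkc;lra.
have Hi i : h z' < h (p i) -> h (p j) <= h (p i).
move=> lt;rewrite leNgt;apply/negP=> /[dup] gt;rewrite (hp_ltE srt)=> ji.
have : h (p i) <= c by exact: (le_bigmax_cond _ (fun i=> h (p i))).
by move: lt;rewrite hh_mkc;lra.
have E := mono_above_step srt s (erefl (h (p j))) hz' Hi.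
rewrite -(mono_above_line (erefl (h (p j)))) -E;apply: esym;apply: mono_above_upto=> i.
apply/idP/idP=> [/Hi|].
by rewrite le_eqVlt (hp_ltE srt) ltnS=> /orP[/eqP/(inj_hp srt) ->|/ltnW].
rewrite ltnS leq_eqVlt=> /orP[/eqP/val_inj -> //|ij].
by apply: (lt_trans hz');exact: srt.
Qed.

Lemma cut_of_line z j : h z = h (p j) -> cut_of lam p z = if rr (p j) < rr z then Some j else None.
Proof.
move=> E;case: ifP=> H;first by apply: (cut_ofP (inj_hp srt));rewrite /on_cut E eqxx.
apply: cut_of_none=> i;rewrite E=> /(inj_hp srt) <-;by rewrite leNgt H.
Qed.

(** For the top and bottom strips the correction is the identity or [mono_inf], which stays in the
    orbit. Hence their outer side has a consistent label at infinity. *)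
Lemma inf_orb_upto0M k i : k = 0%N \/ k = M -> porbit (mono p s (P1infty R)) ((upto k)^-1%g i) =
porbit (mono p s (P1infty R)) i.
Proof. by case=> ->;rewrite ?upto0 ?uptoM ?invg1 ?perm1// porbit_invstep. Qed.

Section Face.
Variables (k : nat) (A B D : R).
Hypothesis Hs : strip k A B D.
Local Notation v0 := (fun v : 'rV[R]_2=> v ord0 ord0).
Local Notation v1 := (fun v : 'rV[R]_2=> v ord0 ord_max).

Definition face_pt : 'rV[R]_2 -> P1 R :=
P1_quot lam v0 (fun v=> 1 - `|v0 v|) (fun v=> A + B * v1 v) (fun v=> 1 + D * v1 v).

(** Inside, a face has the constant label [i]. On its upper side, to the right of the branch point,
    the label is the one on the cut, which [s j] takes to the label below. At the right-hand end the
    name at infinity is found by undoing [upto k]; at the left-hand end it is [i]. *)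
Definition face_lbl (i : 'I_d) (v : 'rV[R]_2) : 'I_d :=
if face_pt v is Some z then
 (if v1 v == 1 then (if cut_of lam p z is Some j then (s j)^-1%g i else i) else i)
else if v0 v == 1 then (upto k)^-1%g i else i.

Lemma coords2 (j : 'I_2) : j = ord0 \/ j = ord_max.
Proof. by case: j=> -[|[|//]] Hj;[left|right];exact: val_inj. Qed.

Lemma face_den_ge0 (v : 'rV[R]_2) : `|v| <= 1 -> 0 <= 1 + D * v1 v.
Proof.
have [[_ /andP[D1 D2]] _ _ _ _] := Hs=> /(le_trans (coord_le_norm v ord_max)).
rewrite ler_norml=> /andP[a1 a2];nra.
Qed.

Lemma face_den_eq0 (v : 'rV[R]_2) : `|v| <= 1 -> 1 + D * v1 v = 0 ->
[/\ D = -1, v1 v = 1, k = 0%N & A + B * v1 v <> 0] \/ [/\ D = 1, v1 v = -1, k = M & A + B * v1 v <> 0].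
Proof.
have [[AD /andP[D1 D2]] k0 kM _ _] := Hs=> /(le_trans (coord_le_norm v ord_max)).
rewrite ler_norml=> /andP[a1 a2] E;have [Dm|Dp] := ltP D 0.
have e1 : D = -1 by nra.
have e2 : v1 v = 1 by nra.
by left;split=> //;[exact: k0|rewrite e2;move: AD;rewrite e1;lra].
have e1 : D = 1 by nra.
have e2 : v1 v = -1 by nra.
by right;split=> //;[exact: kM|rewrite e2;move: AD;rewrite e1;lra].
Qed.

Lemma face_pt_continuous v : `|v| <= 1 -> {for v, continuous face_pt}.
Proof.
move=> Hv;apply: P1_quot_continuous.
- exact: coord_continuous.
- have -> : (fun v=> 1 - `|v0 v|) = (fun v=> 1 + (-1) * `|v0 v|) by apply/funext=> u;rewrite mulN1r.
apply: affine_continuous=> u;apply: (@continuous_comp _ _ _ v0 (@Num.norm R R)).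
 exact: coord_continuous.
exact: norm_continuous.
- by apply: affine_continuous;exact: coord_continuous.
- by apply: affine_continuous;exact: coord_continuous.
- by move=> E0 v00;move: E0;rewrite v00 normr0;lra.
- by move=> E;have [[]|[]] := face_den_eq0 Hv E.
Qed.

Lemma face_ptP v : `|v| <= 1 ->
(face_pt v = P1infty R /\ (`|v0 v| = 1 \/ 1 + D * v1 v = 0)) \/
exists2 z, face_pt v = P1pt z & [/\ `|v0 v| < 1, 0 < 1 + D * v1 v,
 rr z = v0 v / (1 - `|v0 v|) & h z = (A + B * v1 v) / (1 + D * v1 v)].
Proof.
move=> Hv;have d0 := face_den_ge0 Hv;have n0 := le_trans (coord_le_norm v ord0) Hv.
rewrite /face_pt /P1_quot;case: eqP=> [/eqP|/eqP];rewrite mulf_eq0.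
by move=> /orP e;left;split=> //;case: e=> /eqP e;[left;lra|right].
rewrite negb_or=> /andP[e1 e2];right;eexists;first by [].
rewrite rr_mkc hh_mkc;split=> //;last by rewrite lt_def e2.
by rewrite lt_neqAle n0 andbT -subr_eq0 -oppr_eq0 opprB.
Qed.

Lemma face_below v z (j : 'I_M) : `|v| <= 1 -> face_pt v = P1pt z -> (j < k)%N -> v1 v < 1 -> h z < h (p j).
Proof.
move=> Hv;have [[-> //]|[z' -> [_ d0 _ hz]] [<-] jk v1v] := face_ptP Hv.
have [[AD /andP[D1 D2]] k0 _ [kD _] _] := Hs.
have [|j' kj' E] := kD;first by move=> /k0 kz;rewrite kz in jk.
have D1' : 0 < 1 + D.
rewrite lt_def;case: eqP=> [E0|_ /=];last lra.
by have kz : k = 0%N by [apply: k0;lra];move: jk;rewrite kz.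
apply: (@lt_le_trans _ _ (h (p j'))).
by rewrite hz -E ltr_pdivrMr// mulrAC ltr_pdivlMr//;nra.
move: jk;rewrite kj' ltnS leq_eqVlt=> /orP[/eqP/val_inj -> //|/srt/ltW//].
Qed.

Lemma face_above v z (j : 'I_M) : `|v| <= 1 -> face_pt v = P1pt z -> (k <= j)%N -> -1 < v1 v -> h (p j) < h z.
Proof.
move=> Hv;have [[-> //]|[z' -> [_ d0 _ hz]] [<-] jk v1v] := face_ptP Hv.
have [[AD /andP[D1 D2]] _ kM [_ kD] _] := Hs.
have [|j' kj' E] := kD;first by move=> /kM kz;move: jk;rewrite kz leqNgt ltn_ord.
have D1' : 0 < 1 - D.
rewrite lt_def;case: eqP=> [E0|_ /=];last lra.
by have kz : k = M by [apply: kM;lra];move: jk;rewrite kz leqNgt ltn_ord.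
apply: (@le_lt_trans _ _ (h (p j'))).
move: jk;rewrite kj' leq_eqVlt=> /orP[/eqP/val_inj -> //|/srt/ltW//].
by rewrite hz -E ltr_pdivrMr// mulrAC ltr_pdivlMr//;nra.
Qed.

Lemma face_top v z : `|v| <= 1 -> face_pt v = P1pt z -> v1 v = 1 -> exists2 j : 'I_M, k = j.+1 & h z = h (p j).
Proof.
move=> Hv;have [[-> //]|[z' -> [_ d0 _ hz]] [<-] v1v] := face_ptP Hv.
have [_ _ _ [kD _] _] := Hs;have [|j kj E] := kD;first by move=> D1;move: d0;rewrite v1v D1;lra.
by exists j=> //;rewrite hz v1v !mulr1 E.
Qed.

Lemma face_bottom v z : `|v| <= 1 -> face_pt v = P1pt z -> v1 v = -1 -> exists2 j : 'I_M, k = j & h z = h (p j).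
Proof.
move=> Hv;have [[-> //]|[z' -> [_ d0 _ hz]] [<-] v1v] := face_ptP Hv.
have [_ _ _ [_ kD] _] := Hs;have [|j kj E] := kD;first by move=> D1;move: d0;rewrite v1v D1;lra.
by exists j=> //;rewrite hz v1v !mulrN1 E.
Qed.

Lemma face_mono_above v z : `|v| <= 1 -> face_pt v = P1pt z -> v1 v < 1 -> mono_ge lam p s z = upto k.
Proof.
move=> Hv Fv v1v;apply: mono_above_upto=> j;apply/idP/idP=> [|jk];last exact: face_below v1v.
rewrite ltNge;apply: contraNT=> kj;rewrite -ltnNge ltnS in kj.
have := le_trans (coord_le_norm v ord_max) Hv;rewrite ler_norml=> /andP[].
rewrite le_eqVlt=> /orP[/eqP E _|lt _];last exact: ltW (face_above Hv Fv kj lt).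
have [j' kj' ->] := face_bottom Hv Fv (esym E).
by rewrite leNgt (hp_ltE srt) -kj' ltnNge kj.
Qed.
(** The corrected labels are compared at each kind of point: upper side, other finite points, right
    end, left end, and the infinite outer side of an extreme strip. *)
Lemma face_lbl_continuous i v : `|v| <= 1 -> \forall u \near v, `|u| <= 1 ->
porbit (mono p s (face_pt v)) ((trans lam p s (face_pt v) (face_pt u))^-1%g (face_lbl i u)) =
porbit (mono p s (face_pt v)) (face_lbl i v).
Proof.
move=> Hv;have cF := face_pt_continuous Hv.
have le1 (u : 'rV[R]_2) j : `|u| <= 1 -> -1 <= u ord0 j <= 1.
by move=> Hu;rewrite -ler_norml;exact: le_trans (coord_le_norm u j) Hu.
have nlt (u : 'rV[R]_2) : `|u| <= 1 -> v1 u <> 1 -> v1 u < 1.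
by move=> Hu n;have /andP[_] := le1 u ord_max Hu;rewrite le_eqVlt=> /orP[/eqP|].
have c1 : {for v, continuous v1} by exact: coord_continuous.
have c0 : {for v, continuous v0} by exact: coord_continuous.
have nlt1 : v1 v < 1 -> \forall u \near v, v1 u < 1 by move=> lt;apply: cvgr_lt c1 _ lt.
have lblinf u : face_pt u = P1infty R -> face_lbl i u = if v0 u == 1 then (upto k)^-1%g i else i.
by rewrite /face_lbl=> ->.
have lblpt u z : face_pt u = P1pt z -> face_lbl i u =
 if v1 u == 1 then (if cut_of lam p z is Some j then (s j)^-1%g i else i) else i.
by rewrite /face_lbl=> ->.
have [[Fv Hinf]|[z Fv [v0lt den rz hz]]] := face_ptP Hv;last first.
have [e e0 He] := near_isolated lam p z.
have nF : nbhs v (fun u=> exists2 z', face_pt u = P1pt z' & `|rr z' - rr z| < e /\ `|h z' - h z| < e).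
 have nB : nbhs (face_pt v) (fun y=> exists2 z', y = P1pt z' & `|rr z' - rr z| < e /\ `|h z' - h z| < e).
  by rewrite Fv;apply/nbhs_P1pt/(nbhs_box lam);exists e=> // u ? ?;exists u.
 exact: (cF _ nB).
have [v1v|/(nlt _ Hv) v1v] := pselect (v1 v = 1).
 have [j kj hzj] := face_top Hv Fv v1v.
 apply: filterS nF=> u [z' Fu [r1 h1]] Hu.
 rewrite Fv Fu transE trans_ptE (lblpt u z' Fu) (lblpt v z Fv) v1v eqxx !(cut_of_line hzj).
 case: eqP=> [v1u|/(nlt _ Hu) v1u].
  have [j' kj' hz'j] := face_top Hu Fu v1u.
  have jj : j' = j by apply: val_inj;apply: succn_inj;rewrite -kj -kj'.
  subst j';rewrite (cut_of_line hz'j) hz'j -hzj ltxx.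
  have [E|n] := eqVneq (rr (p j)) (rr z).
  have Ez : z = p j by apply: (@pt_eq _ lam).
  rewrite (_ : mono p s (P1pt z) = s j);last by rewrite Ez (mono_p srt).
  by rewrite E ltxx invg1 perm1;case: ifP=> _//;rewrite porbit_invstep.
  have [_ A2 _] := He z' r1 h1 j.
  have [|-> _] := A2 (esym hzj);first exact/eqP.
  by case: ifP=> _;rewrite invg1 perm1.
 have lt : h z' < h z by rewrite hzj;apply: (face_below Hu Fu _ v1u);rewrite kj.
 by case: ifP=> _;rewrite ?lt ?invg1 ?perm1.
apply: filterS (filterI nF (nlt1 v1v))=> u [[z' Fu [r1 h1]] v1u] Hu.
rewrite Fv Fu transE trans_ptE (lblpt u z' Fu) (lblpt v z Fv) !lt_eqF//.
rewrite /cut_of;case: pickP=> [j /andP[/eqP hzj _]|_];last by rewrite invg1 perm1.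
suff -> : h z' < h z = false by rewrite invg1 perm1.
apply/negbTE;rewrite -leNgt hzj.
have /andP[v1v' _] := le1 v ord_max Hv;have /andP[v1u' _] := le1 u ord_max Hu.
have kj : (k <= j)%N.
 by rewrite leqNgt;apply/negP=> jk;have := face_below Hv Fv jk v1v;rewrite hzj ltxx.
move: v1u';rewrite le_eqVlt=> /orP[/eqP E|lt];last exact/ltW/(face_above Hu Fu kj lt).
have [j' kj' ->] := face_bottom Hu Fu (esym E).
move: kj;rewrite kj' leq_eqVlt=> /orP[/eqP/val_inj -> //|/srt/ltW//].
have [_ k0 kM _ _] := Hs.
have k0M u : `|u| <= 1 -> 1 + D * v1 u = 0 -> k = 0%N \/ k = M.
by move=> Hu /(face_den_eq0 Hu)[[_ _ -> _]|[_ _ -> _]];[left|right].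
rewrite Fv (lblinf v Fv).
have norm_cont : {for v, continuous (fun u : 'rV[R]_2=> 1 - `|v0 u|)}.
have -> : (fun v=> 1 - `|v0 v|) = (fun v=> 1 + (-1) * `|v0 v|) by apply/funext=> u;rewrite mulN1r.
apply: affine_continuous=> u;apply: (@continuous_comp _ _ _ v0 (@Num.norm R R)).
 exact: coord_continuous.
exact: norm_continuous.
pose e := \big[Num.max/rmax p]_j `|rr (p j)|.
have ep j : `|rr (p j)| <= e by exact: le_bigmax.
have er : rmax p <= e by exact: bigmax_ge_id.
have big : `|v0 v| = 1 -> \forall u \near v, 1 - `|v0 u| != 0 -> e < `|v0 u / (1 - `|v0 u|)|.
move=> v1';apply: (quotient_large c0 norm_cont);first by rewrite v1' subrr.
by move=> E;move: v1';rewrite E normr0;lra.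
have rzE u z : `|u| <= 1 -> face_pt u = P1pt z -> [/\ `|v0 u| < 1, 0 < 1 + D * v1 u & rr z = v0 u / (1 - `|v0 u|)].
by move=> Hu;case: (face_ptP Hu)=> [[-> //]|[z' -> [? ? ? _]] [<-]].
have [E1|n1] := eqVneq (v0 v) 1.
have n0 : \forall u \near v, 0 < v0 u by apply: cvgr_gt c0 _ _;rewrite E1.
apply: filterS (filterI n0 (big _));last by rewrite E1 normr1.
move=> u [u0 Hbig] Hu;case Fu : (face_pt u)=> [z|];last first.
 rewrite (lblinf u Fu) trans_refl invg1 perm1;case: ifPn=> // u1.
 rewrite (inf_orb_upto0M i)//;have [[_ [E|/(k0M u Hu)//]]|[z Fu' _]] := face_ptP Hu;last by rewrite Fu' in Fu.
 by move: u1;rewrite -(gtr0_norm u0) E eqxx.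
have [u1 den rz] := rzE u z Hu Fu.
have d0 : 0 < 1 - `|v0 u| by rewrite subr_gt0.
have rze : e < rr z by rewrite rz -(gtr0_norm (divr_gt0 u0 d0));apply: Hbig;rewrite gt_eqF.
rewrite inf_orb;last exact: le_lt_trans rze.
rewrite (lblpt u z Fu);case: eqP=> [v1u|/(nlt _ Hu) v1u];last by rewrite (face_mono_above Hu Fu v1u).
have [j kj hzj] := face_top Hu Fu v1u.
rewrite (cut_of_line hzj) (mono_above_line hzj) ifT;last first.
 by apply: le_lt_trans rze;apply: le_trans (ep j);exact: ler_norm.
by rewrite kj uptoS invMg permM.
have [E1|n2] := eqVneq (v0 v) (-1).
have n0 : \forall u \near v, v0 u < 0 by apply: cvgr_lt c0 _ _;rewrite E1 ltrN10.
apply: filterS (filterI n0 (big _));last by rewrite E1 normrN1.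
move=> u [u0 Hbig] Hu;case Fu : (face_pt u)=> [z|];last first.
 by rewrite (lblinf u Fu) trans_refl invg1 perm1 lt_eqF//;apply: lt_trans u0 _.
have [u1 den rz] := rzE u z Hu Fu.
have d0 : 0 < 1 - `|v0 u| by rewrite subr_gt0.
have rze : rr z < - e.
 rewrite ltrNr rz -(ltr0_norm (_ : v0 u / (1 - `|v0 u|) < 0));last by rewrite pmulr_llt0// invr_gt0.
 by apply: Hbig;rewrite gt_eqF.
have e0 : 0 <= e by apply: le_trans er;exact: rmax_ge0.
rewrite transE trans_infE ltNge (_ : rr z <= rmax p);last first.
 by apply: (@le_trans _ _ 0);[lra|exact: rmax_ge0].
rewrite invg1 perm1 (lblpt u z Fu) cut_of_none;first by case: ifP.
by move=> j _;have := ep j;rewrite ler_norml=> /andP[];lra.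
have v0lt : `|v0 v| < 1.
rewrite lt_neqAle (le_trans (coord_le_norm v ord0) Hv) andbT.
by rewrite eqr_norml (negPf n1) (negPf n2).
have den : 1 + D * v1 v = 0 by case: Hinf=> // E;rewrite E ltxx in v0lt.
have kk := k0M v Hv den.
have n0 : \forall u \near v, v0 u < 1.
by apply: cvgr_lt c0 _ _;apply: le_lt_trans v0lt;exact: ler_norm.
have n1' : \forall u \near v, `|u| <= 1 -> 1 + D * v1 u <> 0 -> v1 u < 1.
case: (face_den_eq0 Hv den)=> [[D1 v1v _ _]|[_ v1v _ _]].
 by apply: (@filterE _ (nbhs v))=> u Hu n;apply: nlt=> // v1u;apply: n;rewrite v1u D1 mulr1 subrr.
have lt : v1 v < 1 by rewrite v1v;lra.
by apply: filterS (nlt1 lt).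
apply: filterS (filterI n0 n1')=> u [u0 v1u] Hu.
case Fu : (face_pt u)=> [z|];last first.
by rewrite (lblinf u Fu) trans_refl invg1 perm1 !lt_eqF//;apply: le_lt_trans v0lt;exact: ler_norm.
have [u1 denu rz] := rzE u z Hu Fu.
have v1u' : v1 u < 1 by apply: v1u=> // E;rewrite E ltxx in denu.
rewrite (lblpt u z Fu) (lt_eqF v1u').
have [lt|ge] := ltP (rmax p) (rr z);last first.
by rewrite transE trans_infE ltNge ge invg1 perm1.
by rewrite inf_orb// (face_mono_above Hu Fu v1u') inf_orb_upto0M.
Qed.

Lemma face_open v : `|v| < 1 -> exists z, [/\ face_pt v = P1pt z, ordinary p z,
forall j, h z <> h (p j), forall j : 'I_M, (h z < h (p j)) = (j < k)%N & forall i, face_lbl i v = i].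
Proof.
move=> Hv;have Hv' := ltW Hv.
have := le_lt_trans (coord_le_norm v ord0) Hv;rewrite ltr_norml=> /andP[a1 a2].
have := le_lt_trans (coord_le_norm v ord_max) Hv;rewrite ltr_norml=> /andP[b1 b2].
have [[_ [E|E]]|[z Fv _]] := face_ptP Hv'.
- by have := le_lt_trans (coord_le_norm v ord0) Hv;rewrite E ltxx.
- by case: (face_den_eq0 Hv' E)=> [[_ E1 _ _]|[_ E1 _ _]];move: b1 b2;rewrite E1 ltxx.
have hk (j : 'I_M) : (h z < h (p j)) = (j < k)%N /\ h z <> h (p j).
have [jk|kj] := ltnP j k.
 by have lt := face_below Hv' Fv jk b2;split=> // E;rewrite E ltxx in lt.
have lt := face_above Hv' Fv kj b1;split;last by move=> E;rewrite E ltxx in lt.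
by apply/negbTE;rewrite -leNgt ltW.
exists z;split=> //.
- by move=> j;apply/eqP=> E;have [_] := hk j;rewrite E.
- by move=> j;have [] := hk j.
- by move=> j;have [] := hk j.
- by move=> i;rewrite /face_lbl Fv (lt_eqF b2).
Qed.

Lemma face_inj v w : `|v| < 1 -> `|w| < 1 -> face_pt v = face_pt w -> v = w.
Proof.
move=> Hv Hw;have [zv [Fv _ _ _ _]] := face_open Hv;have [zw [Fw _ _ _ _]] := face_open Hw.
have [[]|[z1 E1 [v0lt dv rv hv]]] := face_ptP (ltW Hv);first by rewrite Fv.
have [[]|[z2 E2 [w0lt dw rw hw]]] := face_ptP (ltW Hw);first by rewrite Fw.
rewrite E1 E2=> -[zz];subst z2.
have e0 : v0 v = v0 w.
have nv : 1 - `|v0 v| != 0 by rewrite gt_eqF// subr_gt0.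
have nw : 1 - `|v0 w| != 0 by rewrite gt_eqF// subr_gt0.
move: rw;rewrite rv=> /eqP;rewrite eqr_div// => /eqP.
move: v0lt w0lt;rewrite !ltr_norml=> /andP[x1 x2] /andP[y1 y2].
have [vp|vn] := leP 0 (v0 v);have [wp|wn] := leP 0 (v0 w);
 rewrite ?(ger0_norm vp) ?(ltr0_norm vn) ?(ger0_norm wp) ?(ltr0_norm wn);nra.
have e1 : v1 v = v1 w.
move: hw;rewrite hv=> /eqP;rewrite eqr_div ?lt0r_neq0// => /eqP E.
have [[AD _] _ _ _ _] := Hs.
have : (v1 v - v1 w) * (B - A * D) = 0 by nra.
by move/eqP;rewrite mulf_eq0=> /orP[/eqP|/eqP];lra.
by apply/rowP=> j;case: (coords2 j)=> ->.
Qed.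

Lemma face_surj z : (forall j, h z <> h (p j)) -> (forall j : 'I_M, (h z < h (p j)) = (j < k)%N) ->
exists2 v : 'rV[R]_2, `|v| < 1 & face_pt v = P1pt z.
Proof.
move=> nz hk;have [_ _ _ _ surj] := Hs.
have [|y y1 Hy] := surj (h z) _ hk;first by move=> j;apply/eqP.
pose x := rr z / (1 + `|rr z|).
have px : 0 < 1 + `|rr z| by rewrite ltr_pwDl.
have nx : `|x| = `|rr z| / (1 + `|rr z|) by rewrite normrM normfV (gtr0_norm px).
have x1 : `|x| < 1 by rewrite nx ltr_pdivrMr// mul1r ltrDr.
pose v : 'rV[R]_2 := \row_(j < 2) (if j == ord0 then x else y).
have Hv : `|v| < 1 by apply: norm_lt1=> j;rewrite mxE;case: ifP.
exists v=> //;have [[E _]|[z' -> [_ _ rz hz]]] := face_ptP (ltW Hv).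
by have [z' []] := face_open Hv;rewrite E.
congr P1pt;apply: (@pt_eq _ lam).
rewrite rz !mxE eqxx nx /x;field;rewrite (gt_eqF px)/=.
by rewrite addrK oner_eq0.
by rewrite hz !mxE/= Hy.
Qed.

Lemma face_boundary v : `|v| = 1 -> face_pt v = P1infty R \/ exists2 z, face_pt v = P1pt z & exists j, h z = h (p j).
Proof.
move=> Hv;have Hv' : `|v| <= 1 by rewrite Hv.
have [[-> _]|[z Fv [v0lt _ _ _]]] := face_ptP Hv';first by left.
right;exists z=> //;have [j] := norm_eq1 Hv;case: (coords2 j)=> ->;first by move=> E;rewrite E ltxx in v0lt.
move/eqP;rewrite eqr_norml ler01 andbT=> /orP[/eqP E|/eqP E].
by have [i _ Hi] := face_top Hv' Fv E;exists i.
by have [i _ Hi] := face_bottom Hv' Fv E;exists i.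
Qed.

End Face.

Section Edge.
Variables (j : 'I_M) (b : bool).
Local Notation t := (fun v : 'rV[R]_1=> v ord0 ord0).
Let eps : R := if b then 1 else -1.

(** A horizontal half-line from [p j], to the right or left according to [b], with abscissa
    [rr (p j) + eps (1 + t) / (1 - t)]: [t = -1] is the branch point and [t = 1] is infinity. *)
Definition edge_pt : 'rV[R]_1 -> P1 R :=
P1_quot lam (fun v=> (rr (p j) + eps) + (eps - rr (p j)) * t v) (fun v=> 1 + (-1) * t v)
 (fun=> h (p j)) (fun=> 1).

Definition edge_lbl (i : 'I_d) (v : 'rV[R]_1) : 'I_d :=
if edge_pt v is Some _ then i else if b then (upto j)^-1%g i else i.

Lemma eps_sq : eps * eps = 1. Proof. by rewrite /eps;case: b;lra. Qed.

Lemma edge_bounds (v : 'rV[R]_1) : `|v| <= 1 -> -1 <= t v <= 1.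
Proof. by move=> Hv;rewrite -ler_norml;exact: le_trans (coord_le_norm v ord0) Hv. Qed.

Lemma edge_pt_continuous v : `|v| <= 1 -> {for v, continuous edge_pt}.
Proof.
move=> Hv;apply: P1_quot_continuous.
- by apply: affine_continuous;exact: coord_continuous.
- by apply: affine_continuous;exact: coord_continuous.
- exact: cst_continuous.
- exact: cst_continuous.
- by move=> E;have -> : t v = 1 by [lra];rewrite /eps;case: b;lra.
- by move=> /eqP;rewrite oner_eq0.
Qed.

Lemma edge_ptP v : (edge_pt v = P1infty R /\ t v = 1) \/
exists2 z, edge_pt v = P1pt z & [/\ t v <> 1, h z = h (p j) & rr z = rr (p j) + eps * ((1 + t v) / (1 - t v))].
Proof.
rewrite /edge_pt /P1_quot mulr1;case: eqP=> E;first by left;split=> //;lra.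
right;eexists;first by [].
have n1 : t v <> 1 by move=> E';apply: E;rewrite E';lra.
rewrite rr_mkc hh_mkc divr1;split=> //.
by rewrite mulN1r;field;apply/eqP;lra.
Qed.

Lemma edge_lbl_continuous i v : `|v| <= 1 -> \forall u \near v, `|u| <= 1 ->
porbit (mono p s (edge_pt v)) ((trans lam p s (edge_pt v) (edge_pt u))^-1%g (edge_lbl i u)) =
porbit (mono p s (edge_pt v)) (edge_lbl i v).
Proof.
move=> Hv;have cF := edge_pt_continuous Hv.
have [[Fv tv]|[z Fv [tv hz rz]]] := edge_ptP v;last first.
have nF : nbhs v (fun u=> exists z', edge_pt u = P1pt z').
 have nB : nbhs (edge_pt v) (fun y=> exists z', y = P1pt z').
  by rewrite Fv;apply/nbhs_P1pt/(nbhs_box lam);exists 1=> // u _ _;exists u.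
 exact: (cF _ nB).
apply: filterS nF=> u [z' Fu] Hu;rewrite Fv Fu transE trans_ptE /edge_lbl Fv Fu.
have [[E _]|[z'' E [_ hz' _]]] := edge_ptP u;first by rewrite E in Fu.
have zz : z'' = z' by move: Fu;rewrite E=> -[].
have -> : h z' < h z = false by rewrite -zz hz' hz ltxx.
by case: cut_of=> [k|];rewrite invg1 perm1.
pose e := \big[Num.max/rmax p]_j `|rr (p j)|.
have ep k : `|rr (p k)| <= e by exact: le_bigmax.
have er : rmax p <= e by exact: bigmax_ge_id.
have e0 : 0 <= e by apply: le_trans er;exact: rmax_ge0.
have c1 : {for v, continuous t} by exact: coord_continuous.
have nB : \forall u \near v, 1 + (-1) * t u != 0 -> e + e < `|(1 + t u) / (1 + (-1) * t u)|.
have ca : {for v, continuous (fun u=> 1 + (-1) * t u)} by apply: affine_continuous;exact: coord_continuous.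
have cb : {for v, continuous (fun u=> 1 + t u)}.
 have -> : (fun u=> 1 + t u) = (fun u=> 1 + 1 * t u) by apply/funext=> u;rewrite mul1r.
 by apply: affine_continuous;exact: coord_continuous.
by apply: (quotient_large cb ca);rewrite/= tv;lra.
apply: filterS nB=> u Hbig Hu;rewrite Fv.
have lv : edge_lbl i v = if b then (upto j)^-1%g i else i by rewrite /edge_lbl Fv.
have [[Fu tu]|[z Fu [tu hz rz]]] := edge_ptP u.
by rewrite Fu trans_refl invg1 perm1 lv /edge_lbl Fu.
rewrite Fu lv {1}/edge_lbl Fu;have /andP[t1 t2] := edge_bounds Hu.
have d0 : 0 < 1 - t u by rewrite subr_gt0 lt_neqAle t2 andbT;apply/eqP.
have := Hbig;rewrite mulN1r gt_eqF// => /(_ isT).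
rewrite ger0_norm ?divr_ge0 ?(ltW d0)//;last lra.
move=> big;have := ep j;rewrite ler_norml=> /andP[ep1 ep2].
move: rz;rewrite /eps;case: b=> rz.
rewrite inf_orb;last lra.
by rewrite (mono_above_line hz).
rewrite transE trans_infE ltNge (_ : rr z <= rmax p) ?invg1 ?perm1//.
have := rmax_ge0 p;lra.
Qed.

Lemma edge_open v : `|v| < 1 -> exists z, [/\ edge_pt v = P1pt z, ordinary p z, h z = h (p j),
(rr (p j) < rr z) = b & forall i, edge_lbl i v = i].
Proof.
move=> Hv;have := le_lt_trans (coord_le_norm v ord0) Hv;rewrite ltr_norml=> /andP[a1 a2].
have [[_ E]|[z Fv [tv hz rz]]] := edge_ptP v;first by rewrite E ltxx in a2.
have q0 : 0 < (1 + t v) / (1 - t v) by apply: divr_gt0;lra.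
have rb : (rr (p j) < rr z) = b.
by rewrite rz /eps;case: b;[apply/idP;lra|apply/negbTE;rewrite -leNgt;lra].
exists z;split=> //;last by move=> i;rewrite /edge_lbl Fv.
move=> k;apply/eqP=> E;have kj : k = j by apply: (inj_hp srt);rewrite/= -E hz.
by have := congr1 (@rr R) E;rewrite rz kj /eps;case: b;lra.
Qed.

Lemma edge_inj v w : `|v| < 1 -> `|w| < 1 -> edge_pt v = edge_pt w -> v = w.
Proof.
move=> Hv Hw;have [zv [Fv _ _ _ _]] := edge_open Hv;have [zw [Fw _ _ _ _]] := edge_open Hw.
have [[]|[z1 E1 [v1 _ rv]]] := edge_ptP v;first by rewrite Fv.
have [[]|[z2 E2 [w1 _ rw]]] := edge_ptP w;first by rewrite Fw.
rewrite E1 E2=> -[zz];subst z2.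
have E : (1 + t v) / (1 - t v) = (1 + t w) / (1 - t w).
by move: rv;rewrite rw /eps;case: b;lra.
have n1 : 1 - t v != 0 by apply/eqP;lra.
have n2 : 1 - t w != 0 by apply/eqP;lra.
move/eqP: E;rewrite eqr_div// => /eqP E.
by apply/rowP=> k;rewrite (ord1 k);lra.
Qed.

Lemma edge_surj z : h z = h (p j) -> rr z <> rr (p j) -> (rr (p j) < rr z) = b ->
exists2 v : 'rV[R]_1, `|v| < 1 & edge_pt v = P1pt z.
Proof.
move=> hz nz rb;pose q := eps * (rr z - rr (p j)).
have q0 : 0 < q.
move: rb;rewrite /q /eps;case: b=> [rb|/negbT];first lra.
by rewrite -leNgt le_eqVlt=> /orP[/eqP//|];lra.
pose v : 'rV[R]_1 := \row_(j < 1) ((q - 1) / (q + 1)).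
have tv : t v = (q - 1) / (q + 1) by rewrite mxE.
have Hv : `|v| < 1.
by apply: norm_lt1=> k;rewrite mxE ltr_norml ltr_pdivlMr ?ltr_pdivrMr;lra.
exists v=> //;have [[_ E]|[z' -> [t1 hz' rz]]] := edge_ptP v.
by have := le_lt_trans (coord_le_norm v ord0) Hv;rewrite E normr1 ltxx.
congr P1pt;apply: (@pt_eq _ lam);last by rewrite hz' hz.
have -> : rr z' = rr (p j) + eps * q.
by rewrite rz tv;congr (_ + _ * _);field;apply/andP;split;apply/eqP;lra.
by rewrite /q mulrA eps_sq;lra.
Qed.

Lemma edge_boundary v : `|v| = 1 -> edge_pt v = P1infty R \/ edge_pt v = P1pt (p j).
Proof.
move=> /norm_eq1[k];rewrite (ord1 k)=> /eqP;rewrite eqr_norml ler01 andbT=> /orP[] /eqP E.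
by left;have [[]|[z _ []]] := edge_ptP v.
have E' : t v = -1 := E.
right;have [[_]|[z -> [_ hz rz]]] := edge_ptP v;first by move=> E1;exfalso;lra.
by congr P1pt;apply: (@pt_eq _ lam)=> //;rewrite rz E' subrr mul0r mulr0 addr0.
Qed.
End Edge.

Definition vertex_pt (o : option 'I_M) : P1 R := if o is Some j then P1pt (p j) else P1infty R.

Lemma vertex_pt_inj : injective vertex_pt.
Proof.
move=> [j|] [k|]//= [] E;congr Some;apply: (inj_hp srt);by rewrite/= E.
Qed.

Definition is_vertex (x : option 'I_M * 'I_d) := orbit_rep (mono p s (vertex_pt x.1)) x.2 == x.2.

(** Faces are strips times sheets and edges are half-lines times sheets, since no branch point lies
    in their interior. Vertices are the points of the model over the branch points and infinity. *)
Definition cell : finType := ('I_M.+1 * 'I_d + ('I_M * bool * 'I_d + {x | is_vertex x}))%type.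

Definition cell_dim (c : cell) : nat :=
match c with inl _=> 2 | inr (inl _)=> 1 | inr (inr _)=> 0 end.

Variable strips : 'I_M.+1 -> R * R * R.
Hypothesis stripsP : forall k : 'I_M.+1, strip k (strips k).1.1 (strips k).1.2 (strips k).2.
Let fpt (k : 'I_M.+1) := face_pt (strips k).1.1 (strips k).1.2 (strips k).2.
Let flbl (k : 'I_M.+1) := face_lbl k (strips k).1.1 (strips k).1.2 (strips k).2.

Definition cell_map (c : cell) : 'rV[R]_(cell_dim c) -> X :=
match c return 'rV[R]_(cell_dim c) -> X with
| inl (k, i)=> fun v=> mk (fpt k v) (flbl k i v)
| inr (inl (j, b, i))=> fun v=> mk (edge_pt j b v) (edge_lbl j b i v)
| inr (inr x)=> fun _=> mk (vertex_pt (sval x).1) (sval x).2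
end.

Arguments cell_map : clear implicits.

Lemma over_vertex (x : X) o : prj x = vertex_pt o -> exists y, cell_map (inr (inr y)) 0 = x.
Proof.
move=> px;have vx : is_vertex (o, lbl x).
by rewrite /is_vertex/= -px;case: x {px} => [[y i]].
by exists (exist (fun x=> is_vertex x) _ vx);rewrite/= -px mk_prj_lbl.
Qed.

Lemma over_line (x : X) z : prj x = P1pt z -> (exists j, h z = h (p j)) ->
(exists y, cell_map (inr (inr y)) 0 = x) \/
exists y, exists2 v, `|v| < 1 & cell_map (inr (inl y)) v = x.
Proof.
move=> px [j hz];have [E|/eqP n] := eqVneq (rr z) (rr (p j)).
by left;apply: (@over_vertex _ (Some j));rewrite px (_ : z = p j)//;exact: (@pt_eq _ lam).
right;have [v Hv Ev] := edge_surj hz n (erefl _).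
exists (j, rr (p j) < rr z, lbl x), v=> //=;have [z' [_ _ _ _ ->]] := edge_open j (rr (p j) < rr z) Hv.
by rewrite Ev -px mk_prj_lbl.
Qed.

Lemma prj_cell_map c v : `|v| < 1 -> match c with
| inl (k, i)=> exists z, [/\ prj (cell_map c v) = P1pt z, forall j, h z <> h (p j),
  forall j : 'I_M, (h z < h (p j)) = (j < k)%N & lbl (cell_map c v) = i]
| inr (inl (j, b, i))=> exists z, [/\ prj (cell_map c v) = P1pt z, h z = h (p j), ordinary p z,
  (rr (p j) < rr z) = b & lbl (cell_map c v) = i]
| inr (inr y)=> prj (cell_map c v) = vertex_pt (sval y).1 /\ lbl (cell_map c v) = (sval y).2
end.
Proof.
case: c v=> [[k i]|[[[j b] i]|[y vy]]] v Hv/=.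
- have [z [Fz oz nz hz lz]] := face_open (stripsP k) Hv;exists z;split=> //.
by rewrite /flbl lz /fpt Fz lbl_mkE.
- have [z [Fz oz hz bz lz]] := edge_open j b Hv;exists z;split=> //.
by rewrite lz Fz lbl_mkE.
- by split=> //;rewrite /lbl/=;exact: eqP.
Qed.

Lemma model_cells :
[/\ forall c, {within [set v | `|v| <= 1], continuous (cell_map c)},
  forall x, exists c, exists2 v : 'rV[R]_(cell_dim c), `|v| < 1 & cell_map _ v = x,
  forall c (v w : 'rV[R]_(cell_dim c)), `|v| < 1 -> `|w| < 1 -> cell_map _ v = cell_map _ w -> v = w,
  forall c c' (v : 'rV[R]_(cell_dim c)) (w : 'rV[R]_(cell_dim c')),
  `|v| < 1 -> `|w| < 1 -> cell_map _ v = cell_map _ w -> c = c'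
 & forall c (v : 'rV[R]_(cell_dim c)), `|v| = 1 -> exists2 c', (cell_dim c' < cell_dim c)%N &
  exists2 w : 'rV[R]_(cell_dim c'), `|w| < 1 & cell_map _ w = cell_map _ v].
Proof.
have n0 (n : nat) : `|0 : 'rV[R]_n| < 1 by rewrite normr0 ltr01.
have vert (x : X) o : prj x = vertex_pt o -> exists y, exists2 w : 'rV[R]_0, `|w| < 1 & cell_map (inr (inr y)) w = x.
by move=> /over_vertex[y E];exists y, 0.
split.
- case=> [[k i]|[[[j b] i]|y]]/=.
+ apply: lift_continuous=> v Hv;first exact: (face_pt_continuous (stripsP k)).
 exact: (face_lbl_continuous (stripsP k)).
+ by apply: lift_continuous=> v Hv;[exact: edge_pt_continuous|exact: edge_lbl_continuous].
+ by apply: continuous_subspaceT;exact: cst_continuous.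
- move=> x;case px : (prj x)=> [z|];last first.
 by have [y [w ? ?]] := vert x None px;exists (inr (inr y)), w.
have [/(over_line px)[[y E]|[y [v ? ?]]]|nz] := pselect (exists j, h z = h (p j)).
+ by exists (inr (inr y)), 0.
+ by exists (inr (inl y)), v.
(* The strip containing [z] is found by counting the branch points above it; the sorting makes these
   an initial segment of the indices. *)
pose k := #|[set j : 'I_M | h z < h (p j)]%SET|.
have kM : (k < M.+1)%N by rewrite ltnS -[leqRHS](card_ord M) max_card.
have hk (j : 'I_M) : (h z < h (p j)) = (j < k)%N.
 have below n : (n <= M)%N -> #|[set i : 'I_M | (i < n)%N]%SET| = n.
  move=> nM;rewrite -sum1_card (eq_bigl (fun i : 'I_M=> (i < n)%N))=> [|i];last by rewrite finset.in_set.
  by rewrite (big_ord_narrow nM) sum1_card card_ord.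
 apply/idP/idP=> [lt|].
  rewrite -(below j.+1)//;apply/subset_leq_card/fintype.subsetP=> i;rewrite !finset.in_set ltnS leq_eqVlt.
  by move=> /orP[/eqP/val_inj -> //|/srt];exact: lt_trans.
 apply: contraTT=> nlt;rewrite -leqNgt -(below j (ltnW (ltn_ord j))).
 apply/subset_leq_card/fintype.subsetP=> i;rewrite !finset.in_set=> lt.
 by rewrite ltnNge;apply: contra nlt;rewrite leq_eqVlt=> /orP[/eqP/val_inj -> //|/srt/(lt_trans lt)].
have [v Hv Fv] := face_surj (stripsP (Ordinal kM)) (fun j E=> nz (ex_intro _ j E)) hk.
exists (inl (Ordinal kM, lbl x)), v=> //=.
have [z' [_ _ _ _ lz]] := face_open (stripsP (Ordinal kM)) Hv.
by rewrite /flbl lz /fpt Fv (_ : P1pt z = prj x)// mk_prj_lbl.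
- case=> [[k i]|[[[j b] i]|y]] v w Hv Hw E;have E' : prj (cell_map _ v) = prj (cell_map _ w) by rewrite E.
+ exact: (face_inj (stripsP k) Hv Hw E').
+ exact: (edge_inj Hv Hw E').
+ exact: etrans (thinmx0 v) (esym (thinmx0 w)).
- move=> c c' v w /prj_cell_map + /prj_cell_map + E;rewrite E.
case: c v E=> [[k i]|[[[j b] i]|y]] v E;case: c' w E=> [[k' i']|[[[j' b'] i']|y']] w E//.
+ move=> [z [-> _ hk ->]] [z' [[<-] _ hk' ->]];congr (inl (_, _));apply: val_inj=> /=.
 apply/eqP;rewrite eqn_leq;apply/andP;split.
  rewrite leqNgt;apply/negP=> lt;have lt' := leq_trans lt (leq_ord k).
  by have := hk (Ordinal lt');rewrite hk'/= lt ltnn.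
 rewrite leqNgt;apply/negP=> lt;have lt' := leq_trans lt (leq_ord k').
 by have := hk (Ordinal lt');rewrite hk'/= lt ltnn.
+ by move=> [z [-> nz _ _]] [z' [[<-] hz _ _ _]];case: (nz j').
+ move=> [z [-> nz _ _]] [];case: (sval y').1=> // j [zz];case: (nz j);by rewrite zz.
+ by move=> [z' [-> hz _ _ _]] [z [[<-] nz _ _]];case: (nz j).
+ move=> [z [-> hz oz <- ->]] [z' [[<-] hz' _ <- ->]].
 have -> : j = j' by apply: (inj_hp srt);rewrite/= -hz hz'.
 by [].
+ move=> [z [-> _ oz _ _]] [];case: (sval y').1=> // k [zz];have := oz k;by rewrite zz eqxx.
+ move=> [-> _] [z [+ nz _ _]];case: (sval y).1=> // j [zz];case: (nz j);by rewrite zz.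
+ move=> [-> _] [z [+ _ oz _ _]];case: (sval y).1=> // k [zz];have := oz k;by rewrite zz eqxx.
+ move=> [-> ->] [/vertex_pt_inj e1 e2];congr (inr (inr _));apply: val_inj.
 by move: e1 e2;case: y {E v} => [[? ?] ?];case: y' {w} => [[? ?] ?]/= -> ->.
- case=> [[k i]|[[[j b] i]|y]] v Hv.
+ have [Fv|[z Fv lz]] := face_boundary (stripsP k) Hv.
  by have [y Hy] := vert (cell_map _ v) None Fv;exists (inr (inr y)).
 have [[y E]|[y Hy]] := over_line (x := cell_map _ v) Fv lz.
  by exists (inr (inr y))=> //;exists 0.
 by exists (inr (inl y)).
+ have [Fv|Fv] := edge_boundary j b Hv.
  by have [y Hy] := vert (cell_map _ v) None Fv;exists (inr (inr y)).
 by have [y Hy] := vert (cell_map _ v) (Some j) Fv;exists (inr (inr y)).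
+ by move: Hv;rewrite (thinmx0 v : v = 0) normr0=> /eqP;rewrite eq_sym oner_eq0.
Qed.

Lemma card_orbit_reps (t : {perm 'I_d}) : #|[set i | orbit_rep t i == i]%SET| = #|porbits t|.
Proof.
have inj : {in [set i | orbit_rep t i == i]%SET &, injective (porbit t)}.
move=> i j;rewrite !finset.in_set=> /eqP Ei /eqP Ej E.
by rewrite -Ei -Ej;exact: orbit_repE.
rewrite -(card_in_imset inj);congr #|pred_of_set _|;apply/finset.setP=> O;apply/imsetP/imsetP.
by move=> [i _ ->];exists i.
move=> [i _ ->];exists (orbit_rep t i);last by rewrite orbit_rep_in.
by rewrite finset.in_set;apply/eqP/orbit_repE;exact: orbit_rep_in.
Qed.

(** Faces and edges contribute [(M + 1) d - 2 M d], and there is one vertex for each cycle over each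
    branch point and over infinity. *)
Lemma cell_euler : \sum_(c : cell) (-1) ^+ cell_dim c =
(\sum_(j < M) #|porbits (s j)|)%N%:Z + #|porbits (mono_inf s)|%:Z + d%:Z - (M * d)%N%:Z :> int.
Proof.
rewrite big_sumType big_sumType/= !expr0.
rewrite expr1 expr2 mulN1r opprK !sumr_const !card_prod !card_ord card_bool.
have -> : #|{: {x | is_vertex x}}| = (\sum_(j < M) #|porbits (s j)| + #|porbits (mono_inf s)|)%N.
transitivity (\sum_(x | is_vertex x) 1)%N;first by rewrite card_sig -sum1_card.
transitivity (\sum_(o : option 'I_M) \sum_(i < d | is_vertex (o, i)) 1)%N.
 by rewrite pair_big_dep/=;apply: eq_bigl=> -[].
have E o : (\sum_(i < d | is_vertex (o, i)) 1)%N = #|porbits (mono p s (vertex_pt o))|.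
 by rewrite -card_orbit_reps sum1dep_card;congr #|pred_of_set _|;apply/finset.setP=> i;rewrite !finset.in_set.
rewrite (eq_bigr _ (fun o _=> E o)).
rewrite (bigD1 None)//= addnC;congr (_ + _)%N.
rewrite (reindex_omap Some id);last by case.
by apply: eq_big=> [j|j _];[rewrite/= eqxx|rewrite [vertex_pt _]/(P1pt (p j)) (mono_p srt)].
rewrite mulNrn !natz mulSn mulnAC.
by move: (\sum_(j < M) _)%N #|porbits (mono_inf s)| (M * d)%N=> u v w;lia.
Qed.

End Cells.

Lemma model_genus (R : realType) (lam : R) M (p : 'I_M -> Cplx R) (M0 : (0 < M)%N)
(srt : forall i j : 'I_M, (i < j)%N -> hh lam (p j) < hh lam (p i)) d (s : 'I_M -> {perm 'I_d}) g :
(\sum_(j < M) #|porbits (s j)|)%N%:Z + #|porbits (mono_inf s)|%:Z + d%:Z - (M * d)%N%:Z = 2 - 2 * g%:Z ->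
has_genus R (model s srt) g.
Proof.
move=> E;have [strips stripsP] := choice (strip_exists M0 srt).
have [N [dim [Phi [HPhi Hsum]]]] := cell_structure_fin (model_cells srt s stripsP).
exists N, dim, Phi;split=> //.
by rewrite Hsum (cell_euler M0 srt) E.
Qed.

Lemma card_eq_bij (T U : Type) (A : set T) (B : set U) (f : T -> U) : (forall x, A x -> B (f x)) ->
{in A &, injective f} -> (forall y, B y -> exists2 x, A x & f x = y) -> (A #= B)%card.
Proof.
move=> AB fi fs;have -> : B = f @` A.
by apply/seteqP;split=> [y /fs[x Ax <-]|_ [x Ax <-]];[exists x|exact: AB].
by apply: card_esym;exact: inj_card_eq.
Qed.

(** * Isomorphism classes and automorphism groups of covers *)

Section CoverGroupoid.
Variable R : realType.
Implicit Types X Y Z : cover R.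

Lemma cover_iso_inv X Y f : @cover_iso R X Y f ->
exists g, [/\ @cover_iso R Y X g, cancel f g & cancel g f].
Proof.
move=> [cf [g [cg fg gf]] pf];exists g;split=> //;split=> //;first by exists f.
by move=> y;rewrite -{2}(gf y) pf.
Qed.

Lemma cover_iso_comp X Y Z f g : @cover_iso R X Y f -> @cover_iso R Y Z g -> @cover_iso R X Z (g \o f).
Proof.
move=> [cf [f' [cf' ff' f'f]] pf] [cg [g' [cg' gg' g'g]] pg];split.
- by move=> x;apply: continuous_comp;[exact: cf|exact: cg].
- exists (f' \o g');split.
+ by move=> x;apply: continuous_comp;[exact: cg'|exact: cf'].
+ exact: can_comp.
+ exact: can_comp.
- by move=> x/=;rewrite pg pf.
Qed.

Lemma aut_card X Y : (exists f, @cover_iso R X Y f) ->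
([set f | @cover_iso R X X f] #= [set f | @cover_iso R Y Y f])%card.
Proof.
move=> [f If];have [g [Ig fg gf]] := cover_iso_inv If.
apply: (card_eq_bij (f := fun u : total X -> total X=> (f \o u \o g : total Y -> total Y))).
- by move=> u/= Iu;exact: cover_iso_comp (cover_iso_comp Ig Iu) If.
- move=> u v _ _ E;apply/funext=> x;have := congr1 (fun w=> w (f x)) E.
by rewrite/= fg=> /(can_inj fg).
- move=> v/= Iv;exists (g \o v \o f);first exact: cover_iso_comp (cover_iso_comp If Iv) Ig.
by apply/funext=> y/=;rewrite !gf.
Qed.

(** Two systems of representatives are in bijection, and isomorphic covers have equipotent
    automorphism groups. Any one computation therefore determines the Hurwitz number. *)
Lemma weighted_count_unique (P : cover R -> Prop) (x y : R) :
weighted_count P x -> weighted_count P y -> x = y.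
Proof.
move=> [N [F [k [FP Finj Fsur Fk ->]]]] [N' [F' [k' [FP' Finj' Fsur' Fk' ->]]]].
have [si siP] := choice (fun i=> Fsur' _ (FP i)).
have [ti tiP] := choice (fun i=> Fsur _ (FP' i)).
have st : cancel ti si.
move=> j;have [f If] := tiP j;have [g Ig] := siP (ti j).
have [h [Ih _ _]] := cover_iso_inv (cover_iso_comp If Ig).
by apply: Finj';exists h.
have ts : cancel si ti.
move=> j;have [f If] := siP j;have [g Ig] := tiP (si j).
have [h [Ih _ _]] := cover_iso_inv (cover_iso_comp If Ig).
by apply: Finj;exists h.
rewrite [RHS](reindex si);last by exists ti=> i _.
apply: eq_bigr=> i _;congr (_%:R^-1).
have := card_eq_trans (card_eq_trans (card_esym (Fk i)) (aut_card (siP i))) (Fk' (si i)).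
by move/card_eq_II.
Qed.
End CoverGroupoid.

Section Transfer.
Variables (R : realType) (X Y : topologicalType) (f : X -> P1 R) (g : Y -> P1 R).
Variables (h : X -> Y) (h' : Y -> X).
Hypotheses (ch : continuous h) (ch' : continuous h') (hK : cancel h h') (hK' : cancel h' h).
Hypothesis fg : forall x, g (h x) = f x.

Lemma homeo_on_comp (T : topologicalType) (U : set Y) (V : set T) (phi : Y -> T) :
homeo_on U V phi -> homeo_on (h @^-1` U) V (phi \o h).
Proof.
move=> [[phim phii phis] cphi [psi cpsi psiK]];split.
- split.
+ by move=> x Ux;exact: phim.
+ move=> x y;rewrite !inE=> Ux Uy E;apply: (can_inj hK);apply: phii=> //;rewrite inE.
  exact: Ux.
 exact: Uy.
+ by move=> v /phis[y Uy <-];exists (h' y)=> /=;rewrite hK'.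
- apply/subspace_continuousP=> x Ux;have /subspace_continuousP/(_ _ Ux) c := cphi.
move=> W nW;have nW' : nbhs (h x) (fun y=> U y -> W (phi y)) by exact: (c _ nW).
by have : nbhs x (fun u=> U (h u) -> W (phi (h u))) by exact: (ch nW').
- exists (h' \o psi);last by move=> x Ux/=;rewrite psiK.
apply/subspace_continuousP=> v Vv;have /subspace_continuousP/(_ _ Vv) c := cpsi.
move=> W nW;have nW' : nbhs (psi v) (fun y=> W (h' y)) by exact: (ch' nW).
by have : nbhs v (fun u=> V u -> W (h' (psi u))) by exact: (c _ nW').
Qed.

Lemma ramification_transfer x k : ramification_index g (h x) k -> ramification_index f x k.
Proof.
move=> [k0 [U [V [phi [psi [[oU Ux] [oV Vx] [hU phi0] [hV psi0] Huv]]]]]];split=> //.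
exists (h @^-1` U), V, (phi \o h), psi;split.
- by split=> //;apply: open_comp=> // y _;exact: ch.
- by rewrite -fg.
- by split=> //;exact: homeo_on_comp.
- by rewrite -fg.
- by move=> u Uu;rewrite -fg;exact: Huv.
Qed.

Lemma profile_transfer y mu : ramification_profile g y mu -> ramification_profile f y mu.
Proof.
move=> [x [xi rx Hx]];exists (h' \o x);split.
- by apply: inj_comp=> //;exact: can_inj hK'.
- apply/seteqP;split.
 move=> _ [i _ <-]/=;rewrite -fg hK'.
 have : range x (x i) by exists i.
 by rewrite rx.
move=> u/= fu;have : (g @^-1` [set y]) (h u) by rewrite/= fg.
by rewrite -rx=> -[i _ E];exists i=> //=;rewrite E hK.
- by move=> i;apply: ramification_transfer;rewrite/= hK'.
Qed.
End Transfer.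

Section ModelCovers.
Variables (R : realType) (lam : R).
Local Notation K := (Cplx R).
Local Notation h := (hh lam).
Variables (M : nat) (p : 'I_M -> K).
Variable srt : forall i j : 'I_M, (i < j)%N -> h (p j) < h (p i).
Variable d : nat.

Definition model_cover (s : 'I_M -> {perm 'I_d}) : cover R := @Cover R (model s srt) (@prj _ _ _ _ srt _ s).

(** The map [conj_map], with the target tuple left free so that the conjugation can be a
    hypothesis. *)
Definition relabel (s s' : 'I_M -> {perm 'I_d}) (w : {perm 'I_d}) (x : model s srt) : model s' srt :=
mk srt s' (prj x) (w (lbl x)).

Lemma relabel_continuous s s' w : (forall j, s' j = (s j ^ w)%g) -> continuous (@relabel s s' w).
Proof.
move=> E;have -> : s' = fun j=> (s j ^ w)%g by exact/funext.
exact: conj_map_continuous.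
Qed.

Lemma relabelK s s' w : (forall j, s' j = (s j ^ w)%g) -> cancel (@relabel s s' w) (@relabel s' s w^-1%g).
Proof.
move=> E x;have E' j : s j = (s' j ^ w^-1)%g by rewrite E conjgK.
have monoE y : mono p s y = (mono p s' y ^ w^-1)%g.
by rewrite -mono_conj;congr mono;exact/funext.
apply: model_eq;rewrite ?prj_mk// {1}/relabel lbl_mk monoE -[in RHS](permK w (lbl x)).
by apply: porbit_conj;exact: lbl_mk.
Qed.

Lemma relabel_iso s s' w : (forall j, s' j = (s j ^ w)%g) ->
@cover_iso R (model_cover s) (model_cover s') (@relabel s s' w).
Proof.
move=> E;have E' j : s j = (s' j ^ w^-1)%g by rewrite E conjgK.
split;[exact: relabel_continuous| |by []].
exists (@relabel s' s w^-1%g);split;[exact: relabel_continuous|exact: relabelK|].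
by have := relabelK E';rewrite invgK.
Qed.

Lemma model_isoP s s' f : @cover_iso R (model_cover s) (model_cover s') f ->
exists2 w, (forall j, s' j = (s j ^ w)%g) & f = @relabel s s' w.
Proof.
move=> [cf [f' [_ ff' _]] pf];have [w [E fE]] := iso_conj cf (can_inj ff') pf.
by exists w=> //;apply/funext.
Qed.

Definition conj_stab (s : 'I_M -> {perm 'I_d}) : {set {perm 'I_d}} :=
[set w | [forall j, (s j ^ w)%g == s j]]%SET.

(** Automorphisms are relabellings, and over a point of the cut plane distinct permutations are seen
    to give distinct relabellings. *)
Lemma model_aut s : ([set f | @cover_iso R (model_cover s) (model_cover s) f] #= `I_#|conj_stab s|)%card.
Proof.
have e1 : (`I_#|conj_stab s| #= [set w : {perm 'I_d} | w \in conj_stab s])%card.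
apply: (card_eq_bij (f := fun n=> nth 1%g (enum (conj_stab s)) n)).
- by move=> n/= Hn;rewrite -mem_enum mem_nth// -cardE.
- move=> n m;rewrite !inE/= => Hn Hm /eqP;rewrite nth_uniq ?enum_uniq -?cardE// => /eqP//.
- move=> w/=;rewrite -mem_enum=> /(nthP 1%g)[n Hn <-];exists n=> //=.
 by rewrite cardE.
have e2 : ([set w : {perm 'I_d} | w \in conj_stab s] #= [set f | @cover_iso R (model_cover s) (model_cover s) f])%card.
apply: (card_eq_bij (f := @relabel s s)).
- by move=> w/=;rewrite finset.in_set=> /forallP H;apply: relabel_iso=> j;rewrite (eqP (H j)).
- move=> w w' _ _ E;apply/permP=> i.
 have [z0 [_ cz0 _]] := comb_dense lam p (@filterT _ (nbhs (P1infty R)) _).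
 have := congr1 (fun f=> lbl (f (mk srt s (P1pt z0) i))) E.
 by rewrite /relabel prj_mk !lbl_mkE//;exact: comb_ordinary.
- move=> f/= /model_isoP[w E ->];exists w=> //=;rewrite finset.in_set.
 by apply/forallP=> j;rewrite -E.
exact: card_esym (card_eq_trans e1 e2).
Qed.
End ModelCovers.

(** * Generic heights and the Hurwitz number as a count of monodromy tuples *)

Section GenericOrder.
Variable R : realType.
Local Notation K := (Cplx R).

(** Two points with different first coordinates have equal heights for one slope only. The sum of
    the absolute values of these slopes, plus 1, exceeds them all. *)
Lemma generic_slope (zs : seq K) : exists lam : R, forall u v, u \in zs -> v \in zs -> hh lam u = hh lam v -> u = v.
Proof.
pose bad := [seq - (hh 0 u.1 - hh 0 u.2) / (rr u.1 - rr u.2) | u <- [seq (u, v) | u <- zs, v <- zs]].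
have Hbig : forall x, x \in bad -> x < \sum_(y <- bad) `|y| + 1.
elim: bad=> [//|y bad IH] x;rewrite inE big_cons=> /orP[/eqP ->|/IH].
 have : 0 <= \sum_(y <- bad) `|y| by apply: sumr_ge0.
 by have := ler_norm y;lra.
by have := normr_ge0 y;lra.
exists (\sum_(y <- bad) `|y| + 1)=> u v Hu Hv.
have hE lam w : hh lam w = hh 0 w + lam * rr w by rewrite /hh;lra.
rewrite [hh _ u]hE [hh _ v]hE=> E.
have [rE|n] := eqVneq (rr u) (rr v).
by apply: (@pt_eq _ 0)=> //;move: E;rewrite rE=> /addIr.
have : - (hh 0 u - hh 0 v) / (rr u - rr v) \in bad.
by apply: map_f (allpairs_f _ Hu Hv).
move/Hbig;set c := _ + 1 in E *;have nz : rr u - rr v != 0 by rewrite subr_eq0.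
have -> : - (hh 0 u - hh 0 v) / (rr u - rr v) = c.
by apply: (mulIf nz);rewrite divfK//;lra.
by rewrite ltxx.
Qed.

Lemma generic_order (zs : seq K) : uniq zs -> exists (lam : R) (p : 'I_(size zs) -> K),
(forall i j : 'I_(size zs), (i < j)%N -> hh lam (p j) < hh lam (p i)) /\
forall z, z \in zs <-> exists j, p j = z.
Proof.
move=> uz;have [lam Hl] := generic_slope zs.
pose r (u v : K) := hh lam v <= hh lam u.
pose ps := sort r zs;exists lam, (fun i=> nth 0 ps i).
have sz : size ps = size zs by rewrite size_sort.
split.
move=> i j ij;have tr : transitive r by move=> a b c/= h1 h2;exact: le_trans h2 h1.
have tot : ssrbool.total r by move=> a b;exact: le_total.
have Hij : r (nth 0 ps i) (nth 0 ps j).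
 by apply: (sorted_ltn_nth tr)=> //;rewrite ?inE ?sz ?ltn_ord//;exact: sort_sorted.
rewrite lt_neqAle (Hij : hh lam _ <= hh lam _) andbT;apply/eqP=> E.
have mem k : (k < size zs)%N -> nth 0 ps k \in zs by move=> Hk;rewrite -(mem_sort r) mem_nth ?sz.
have := Hl _ _ (mem _ (ltn_ord j)) (mem _ (ltn_ord i)) E.
move/eqP;rewrite nth_uniq ?sz ?sort_uniq// => /eqP ji;by rewrite ji ltnn in ij.
move=> z;split=> [|[j <-]];last by rewrite -(mem_sort r) mem_nth ?sz.
rewrite -(mem_sort r)=> /(nthP 0)[i Hi <-];rewrite sz in Hi.
by exists (Ordinal Hi).
Qed.
End GenericOrder.

Section CycleTypes.
Variable d : nat.
Implicit Types t : {perm 'I_d}.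

Lemma size_cycle_type t : size (cycle_type t) = #|porbits t|.
Proof. by rewrite size_map -cardE. Qed.

Lemma sumn_cycle_type t : sumn (cycle_type t) = d.
Proof.
rewrite sumnE big_map -[RHS](card_ord d) -sum1_card big_enum/=.
rewrite [RHS](partition_big (porbit t) (mem (porbits t)))=> [|i _];last exact: imset_f.
apply: eq_bigr=> B /imsetP[j _ ->];rewrite -sum1_card;apply: eq_bigl=> i.
by rewrite/= eq_porbit_mem.
Qed.

Lemma cycle_type1 : cycle_type (1%g : {perm 'I_d}) = nseq d 1%N.
Proof.
have H : all (pred1 1%N) (cycle_type (1%g : {perm 'I_d})).
by apply/allP=> k /mapP[B];rewrite mem_enum=> /imsetP[i _ ->] ->;rewrite porbit1 cards1.
have S := sumn_cycle_type 1%g;move/all_pred1P: H=> E.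
by move: S;rewrite E sumn_nseq mul1n=> ->.
Qed.

Lemma perm_nseq_cycle_type a k t : perm_eq (nseq k a) (cycle_type t) -> (#|porbits t| * a)%N = d.
Proof.
move=> E;rewrite -size_cycle_type -(perm_size E) size_nseq -[RHS](sumn_cycle_type t) -(perm_sumn E) sumn_nseq.
by rewrite mulnC.
Qed.

Lemma perm_transp_cycle_type k t : perm_eq (2%N :: nseq k 1%N) (cycle_type t) -> (#|porbits t|).+1 = d.
Proof.
move=> E;rewrite -size_cycle_type -(perm_size E)/= size_nseq -[RHS](sumn_cycle_type t) -(perm_sumn E)/= sumn_nseq.
by rewrite mul1n add2n.
Qed.
End CycleTypes.

Section HurwitzCount.
Variables (R : realType) (bs : seq (Cplx R)) (a g : nat) (mu : seq nat).
Hypotheses (ha : (0 < a)%N) (ub : uniq bs) (b0 : 0 \notin bs).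
Hypotheses (mu0 : (0 < sumn mu)%N) (adiv : (a %| sumn mu)%N).
Hypothesis Hm : (size bs + 2 = 2 * g + size mu + sumn mu %/ a)%N.
Variables (lam : R) (M : nat) (p : 'I_M -> Cplx R) (j0 : 'I_M).
Hypothesis HM : M = (size bs).+1.
Variable srt : forall i j : 'I_M, (i < j)%N -> hh lam (p j) < hh lam (p i).
Hypothesis pP : forall z, z \in 0 :: bs <-> exists j, p j = z.
Hypothesis pj0 : p j0 = 0.

Definition valid d (s : 'I_M -> {perm 'I_d}) : Prop :=
[/\ exists k, perm_eq (nseq k a) (cycle_type (s j0)),
  forall j, j != j0 -> exists k, perm_eq (2%N :: nseq k 1%N) (cycle_type (s j)),
  perm_eq mu (cycle_type (mono_inf s)) & irreducible s].

Let p_neq0 j : j != j0 -> p j \in bs.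
Proof.
move=> jj;have /pP : exists k, p k = p j by exists j.
rewrite inE=> /orP[/eqP E|//];move: jj;apply: contraNT=> _;apply/eqP.
by apply: (inj_hp srt);rewrite/= E pj0.
Qed.

Lemma valid_cover d (s : 'I_M -> {perm 'I_d}) : valid s -> hurwitz_cover bs a g mu (model_cover srt s).
Proof.
move=> [[k0 E0] Etr Einf irr].
have dE : d = sumn mu by rewrite -(sumn_cycle_type (mono_inf s)) (perm_sumn Einf).
split.
- by split;[exact: model_compact|exact: model_hausdorff|move=> x;eexists;exact: model_ramification].
- exact: model_connected_irr.
(* Riemann-Hurwitz: the Euler characteristic is [d / a + size mu - size bs], and [Hm] turns it into
   [2 - 2 g]. *)
- apply: model_genus;first by rewrite HM.
rewrite -size_cycle_type -(perm_size Einf) (bigD1 j0)//=.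
have e0 : #|porbits (s j0)| = (sumn mu %/ a)%N.
 have := perm_nseq_cycle_type E0;move: #|porbits (s j0)| => v vd.
 by rewrite -dE -vd mulnK.
have d1 j : j != j0 -> #|porbits (s j)| = d.-1.
 by move=> /Etr[k /perm_transp_cycle_type];move: #|_| => v vd;rewrite -vd.
rewrite (eq_bigr (fun=> d.-1))=> [|j jj];last exact: d1.
rewrite sum_nat_const cardC1 card_ord e0 HM/=.
have d0 : (0 < d)%N by rewrite dE.
move: Hm;case: d d0 {s E0 Etr Einf irr e0 d1} dE=> // d' _ dE.
move: (sumn mu %/ a)%N (size mu) (size bs)=> u v w E;rewrite/= mulSn mulnS;nia.
- split.
+ exact/(model_profile srt s (P1infty R)).
+ exists k0;apply/(model_profile srt s (P1pt 0));by rewrite -pj0 (mono_p srt).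
+ move=> z zb;have [|j pj] := (pP z).1;first by rewrite inE zb orbT.
 have jj : j != j0 by apply: contraNneq b0=> jE;rewrite -pj0 -jE pj.
 have [k Ek] := Etr j jj;exists k;apply/(model_profile srt s).
 by rewrite -pj (mono_p srt).
+ move=> z z0 zb;exists d;apply/(model_profile srt s).
 rewrite mono_ord ?cycle_type1// => j;apply/eqP=> E.
 have := (pP z).2 (ex_intro _ j (esym E));by rewrite inE (negPf z0) (negPf zb).
Qed.

(** [cover_model] supplies the tuple, the profiles are transferred along the isomorphism, and the
    number of sheets is read off over infinity. *)
Lemma cover_valid (X : cover R) : hurwitz_cover bs a g mu X ->
exists (s : 'I_M -> {perm 'I_(sumn mu)}), valid s /\ exists f, @cover_iso R X (model_cover srt s) f.
Proof.
move=> [[cX hX ram] conX _ [Pinf [k0 P0] Ptr Pun]].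
have nX : [set: total X] !=set0.
have [x _] := Pinf;have Hs : (0 < size mu)%N by case: mu mu0.
by exists (x (Ordinal Hs)).
have un z : ordinary p z -> exists k, ramification_profile (@proj _ X) (P1pt z) (nseq k 1%N).
move=> oz;have nz : ~ z \in 0 :: bs by move/pP=> [j E];have := oz j;rewrite E eqxx.
by apply: Pun;apply/negP=> Hz;apply: nz;rewrite inE Hz ?orbT.
have [d [s [Psi [cPsi pPsi [Phi cPhi [K1 K2]]]]]] := cover_model srt cX hX nX ram un.
have prof y nu : ramification_profile (@proj _ X) y nu -> perm_eq nu (cycle_type (mono p s y)).
move=> H;apply/(model_profile srt s).
by apply: (profile_transfer cPhi cPsi K2 K1 _ H)=> x;rewrite -pPsi K2.
have Einf := prof _ _ Pinf.
have dE : sumn mu = d by rewrite (perm_sumn Einf) sumn_cycle_type.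
subst d;exists s;split;last first.
by exists Psi;split=> //;exists Phi.
split=> //.
- by exists k0;have := prof _ _ P0;rewrite -pj0 (mono_p srt).
- move=> j /p_neq0/Ptr[k Hk];exists k;have := prof _ _ Hk;by rewrite (mono_p srt).
- apply: (@model_irr_connected _ _ _ _ srt).
have -> : [set: model s srt] = Psi @` [set: total X].
 by apply/seteqP;split=> // x _;exists (Phi x).
by apply: connected_continuous_connected=> //;exact: continuous_subspaceT.
Qed.
Lemma valid_iso d (s s' : 'I_M -> {perm 'I_d}) f :
@cover_iso R (model_cover srt s) (model_cover srt s') f -> valid s -> valid s'.
Proof.
move=> [cf [f' [cf' K1 K2]] pf] [[k0 E0] Etr Einf irr].
have tr y nu : perm_eq nu (cycle_type (mono p s y)) -> perm_eq nu (cycle_type (mono p s' y)).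
move=> /(model_profile srt s) H;apply/(model_profile srt s').
by apply: (profile_transfer cf' cf K2 K1 _ H)=> x;have := pf (f' x);rewrite K2=> E;exact: esym E.
have trj j nu : perm_eq nu (cycle_type (s j)) -> perm_eq nu (cycle_type (s' j)).
by have := tr (P1pt (p j)) nu;rewrite !(mono_p srt).
split.
- by exists k0;exact: trj.
- by move=> j /Etr[k Ek];exists k;exact: trj.
- exact: (tr (P1infty R)).
- apply: (@model_irr_connected _ _ _ _ srt).
have -> : [set: model s' srt] = f @` [set: model s srt].
 by apply/seteqP;split=> // x _;exists (f' x).
apply: connected_continuous_connected;last exact: continuous_subspaceT.
exact: model_connected_irr.
Qed.

Local Notation d := (sumn mu).
Local Notation tuples := {ffun 'I_M -> {perm 'I_d}}.

Definition valid_set : {set tuples} := [set s : tuples | `[< valid s >]]%SET.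

Definition conj_tuple (s : tuples) (w : {perm 'I_d}) : tuples := [ffun j=> (s j ^ w)%g].

Lemma conj_tuple1 : conj_tuple^~ 1%g =1 id.
Proof. by move=> s;apply/ffunP=> j;rewrite ffunE conjg1. Qed.

Lemma conj_tupleM s : act_morph conj_tuple s.
Proof. by move=> w w';apply/ffunP=> j;rewrite !ffunE conjgM. Qed.

Definition conj_action := TotalAction conj_tuple1 conj_tupleM.

(** Isomorphism classes are the orbits of simultaneous conjugation and automorphism groups are its
    stabilizers, so a class contributes the size of its orbit divided by [d!]. *)
Lemma hurwitz_count : weighted_count (hurwitz_cover bs a g mu) (#|valid_set|%:R / (d`!)%:R : R).
Proof.
pose orb (s : tuples) := orbit conj_action [set: {perm 'I_d}]%G s.
pose Os := orb @: valid_set.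
have repP (i : 'I_#|Os|) : exists s : tuples, valid s /\ enum_val i = orb s.
have /imsetP[s Vs ->] := enum_valP i;exists s;split=> //.
by move: Vs;rewrite finset.in_set=> /asboolP.
have [rep Hrep] := choice repP.
have isoE (s s' : tuples) : (exists f, @cover_iso R (model_cover srt s) (model_cover srt s') f) <-> orb s = orb s'.
split.
 move=> [f /model_isoP[w E _]];apply/esym/orbit_in_eqP;[exact: finset.subsetT| ].
 by apply/imsetP;exists w;rewrite ?finset.in_setT//;apply/ffunP=> j;rewrite/= ffunE -E.
move=> E;have : s' \in orb s by rewrite E orbit_refl.
move=> /imsetP[w _ E'];exists (@relabel _ _ _ _ srt _ s s' w);apply: relabel_iso=> j;by rewrite E'/= ffunE.
exists #|Os|, (fun i=> model_cover srt (rep i)), (fun i=> #|conj_stab (rep i)|);split.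
- by move=> i;apply: valid_cover;have [] := Hrep i.
- by move=> i j /isoE;have [_ <-] := Hrep i;have [_ <-] := Hrep j;exact: enum_val_inj.
- move=> X /cover_valid[s [Vs [f If]]].
pose s1 : tuples := [ffun j=> s j].
have s1E : s1 = s :> ('I_M -> _) by apply/funext=> j;rewrite ffunE.
have Os1 : orb s1 \in Os by apply/imset_f;rewrite finset.in_set s1E;exact/asboolP.
exists (enum_rank_in Os1 (orb s1)).
have [_ E] := Hrep (enum_rank_in Os1 (orb s1));rewrite enum_rankK_in// in E.
have := (isoE _ _).2 E;rewrite s1E=> -[g' Ig'].
by exists (g' \o f);exact: cover_iso_comp If Ig'.
- by move=> i;exact: model_aut.
- have orbk i : (#|conj_stab (rep i)|%:R^-1 : R) = #|(enum_val i : {set tuples})|%:R / (d`!)%:R.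
 have [_ ->] := Hrep i.
 have : (#|orb (rep i)| * #|conj_stab (rep i)|)%N = (d`!)%N.
  rewrite -[in RHS](card_ord d) -cardsT -card_perm.
  rewrite (_ : conj_stab (rep i) = 'C_[set: {perm 'I_d}]%G[rep i | conj_action]%g :> {set _}).
  rewrite card_orbit_stab;apply: eq_card=> w;rewrite finset.in_setT;apply/esym/fintype.subsetP.
  by move=> x;rewrite finset.in_setT.
  apply/finset.setP=> w;rewrite !finset.in_set/= finset.sub1set finset.in_set;apply/forallP/eqP.
  by move=> H;apply/ffunP=> j;rewrite ffunE;apply/eqP;exact: H.
  by move=> E j;have := congr1 (fun t : tuples=> t j) E;rewrite/= ffunE=> ->.
 set x := #|orb _|;set y := #|conj_stab _| => E.
 have y0 : (y%:R : R) != 0.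
  by rewrite pnatr_eq0;apply: contraTneq (fact_gt0 d)=> y0;rewrite -E y0 muln0.
 have x0 : (x%:R : R) != 0.
  by rewrite pnatr_eq0;apply: contraTneq (fact_gt0 d)=> x0;rewrite -E x0.
 by rewrite -E natrM;field;rewrite x0 y0.
rewrite (eq_bigr _ (fun i _=> orbk i)) -mulr_suml;congr (_ / _).
rewrite -natr_sum;congr (_%:R).
transitivity (\sum_(B in Os) #|(B : {set tuples})|)%N;last by rewrite [LHS]big_enum_val.
apply: esym;rewrite acts_sum_card_orbit//;apply/actsP=> w _ s.
have H (u : tuples) v : u \in valid_set -> conj_tuple u v \in valid_set.
 rewrite !finset.in_set=> /asboolP Vu;apply/asboolP;apply: (valid_iso _ Vu).
 by apply: (@relabel_iso _ _ _ _ srt _ _ _ v)=> j;rewrite ffunE.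
apply/idP/idP=> [/(H _ w^-1%g)|];last exact: H.
by rewrite -[conj_tuple _ _]/(conj_action _ _)/= -conj_tupleM mulgV conj_tuple1.
Qed.
End HurwitzCount.

(** * Cycles of a permutation multiplied by a transposition *)

Section Transpositions.
Local Open Scope nat_scope.
Variable I : finType.
Implicit Types (t : {perm I}) (x y z : I).

Lemma iter_neq t x i : 0 < i < #|porbit t x| -> iter i t x != x.
Proof.
move=> /andP[i0 iL];have := uniq_traject_porbit t x.
case E : #|porbit t x| iL=> [//|L] iL;rewrite/= => /andP[+ _].
apply: contraNneq=> Ei;apply/trajectP;exists i.-1;first by rewrite prednK.
by rewrite -iterSr prednK.
Qed.

Lemma iter_in_porbit t x i : iter i t x \in porbit t x.
Proof. by rewrite -permX mem_porbit. Qed.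

Lemma porbit_ind t x (A : {set I}) : x \in A -> (forall z, z \in A -> t z \in A) -> porbit t x \subset A.
Proof.
move=> xA H;apply/fintype.subsetP=> _ /porbitP[n ->].
by elim: n=> [|n IH];rewrite ?expg0 ?perm1// expgSr permM;exact: H.
Qed.

Lemma porbitE t x z : (porbit t x == porbit t z) = (z \in porbit t x).
Proof. by rewrite eq_sym eq_porbit_mem. Qed.

(** From [x] the product follows the old cycle; the step that would return to [x] leads to [y]
    instead, and after the cycle of [y] the path is sent back to [x]. *)
Lemma porbit_mul_tperm t x y : y \notin porbit t x ->
[/\ porbit (t * tperm x y)%g x = (porbit t x :|: porbit t y)%SET,
  porbit (t * tperm x y)%g y = (porbit t x :|: porbit t y)%SET
 & forall z, z \notin (porbit t x :|: porbit t y)%SET -> porbit (t * tperm x y)%g z = porbit t z].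
Proof.
move=> yx;set u := (t * tperm x y)%g;set V := (_ :|: _)%SET.
have uE z : u z = tperm x y (t z) by rewrite permM.
have xy : x != y by apply: contraNneq yx=> <-;exact: porbit_id.
have half x' y' : (x' == x) && (y' == y) || (x' == y) && (y' == x) -> y' \notin porbit t x' ->
 (forall i, i < #|porbit t x'| -> iter i u x' = iter i t x') /\ iter #|porbit t x'| u x' = y'.
move=> Hxy nyx.
have tE : tperm x y = tperm x' y'.
 by case/orP: Hxy=> /andP[/eqP -> /eqP ->]//;rewrite tpermC.
have H i : i < #|porbit t x'| -> iter i u x' = iter i t x'.
 elim: i=> [//|i IH] Hi;rewrite !iterS (IH (ltnW Hi)) uE -iterS tE tpermD//.
  by rewrite eq_sym iter_neq.
 by apply: contraNneq nyx=> ->;exact: iter_in_porbit.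
split=> //;have L0 : 0 < #|porbit t x'| by apply/card_gt0P;exists x';exact: porbit_id.
rewrite -(prednK L0) iterS H ?prednK// uE -iterS prednK// iter_porbit tE;exact: tpermL.
have [Hx Ex] := half x y (@introT _ _ orP (or_introl (introT andP (conj (eqxx x) (eqxx y))))) yx.
have xny : x \notin porbit t y by rewrite -porbitE eq_sym porbitE.
have [Hy Ey] := half y x (@introT _ _ orP (or_intror (introT andP (conj (eqxx y) (eqxx x))))) xny.
have eqxy : porbit u x = porbit u y by apply/eqP;rewrite porbitE -Ex;exact: iter_in_porbit.
have sub x' : (forall i, i < #|porbit t x'| -> iter i u x' = iter i t x') -> porbit t x' \subset porbit u x'.
move=> H;apply/fintype.subsetP=> z;rewrite porbit_traject=> /trajectP[i Hi ->].
by rewrite -H//;exact: iter_in_porbit.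
have VE : porbit u x = V.
apply/eqP;rewrite finset.eqEsubset;apply/andP;split;last first.
 by rewrite finset.subUset (sub x Hx) eqxy (sub y Hy).
apply: porbit_ind;first by rewrite finset.in_setU porbit_id.
move=> z;rewrite !finset.in_setU uE=> Hz.
have [||_ _] := tpermP x y (t z);first by rewrite porbit_id orbT.
 by rewrite porbit_id.
by rewrite -!porbitE !porbit_step !porbitE.
split=> //;first by rewrite -eqxy.
move=> z;rewrite finset.in_setU negb_or=> /andP[zx zy].
have H i : iter i u z = iter i t z.
elim: i=> [//|i IH];rewrite !iterS IH uE -iterS tpermD//.
 by apply: contraNneq zx=> ->;rewrite -porbitE eq_sym porbitE iter_in_porbit.
by apply: contraNneq zy=> ->;rewrite -porbitE eq_sym porbitE iter_in_porbit.
by apply/finset.setP=> w;apply/porbitP/porbitP=> -[i ->];exists i;rewrite !permX H.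
Qed.

(** The step that would reach [y] is redirected to [x], so the cycle closes after [j] steps. The
    length of the other piece follows from [porbit_mul_tperm], as a second multiplication restores
    [t]. *)
Lemma porbit_cut t x j : 0 < j < #|porbit t x| -> let y := iter j t x in
[/\ y \notin porbit (t * tperm x y)%g x, #|porbit (t * tperm x y)%g x| = j
 & #|porbit (t * tperm x y)%g y| = #|porbit t x| - j].
Proof.
move=> /andP[j0 jL] y;set u := (t * tperm x y)%g.
have uE z : u z = tperm x y (t z) by rewrite permM.
have inj i k : i < #|porbit t x| -> k < #|porbit t x| -> iter i t x = iter k t x -> i = k.
move=> Hi Hk E;have := uniq_traject_porbit t x;move/uniqP=> /(_ x i k).
by rewrite !finset.inE size_traject !nth_traject//;exact.
have H i : i < j -> iter i u x = iter i t x.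
elim: i=> [//|i IH] Hi;rewrite !iterS (IH (ltnW Hi)) uE -iterS tpermD//.
 by rewrite eq_sym iter_neq//= (ltn_trans Hi).
apply/eqP=> /(inj _ _ jL (ltn_trans Hi jL)) E;by rewrite E ltnn in Hi.
have Ej : iter j u x = x by rewrite -(prednK j0) iterS H ?prednK// uE -iterS prednK// tpermR.
have trE : traject u x j = traject t x j.
apply: (@eq_from_nth _ x);rewrite !size_traject// => i Hi.
by rewrite !nth_traject// H.
have OE : porbit u x =i traject t x j.
move=> z;rewrite -trE;apply/idP/trajectP=> [|[i _ ->]];last exact: iter_in_porbit.
move=> /porbitP[i ->];rewrite permX;exists (i %% j);first by rewrite ltn_mod.
rewrite {1}(divn_eq i j) addnC iterD;congr iter.
by elim: (i %/ j)=> [//|q IH];rewrite mulSn iterD IH.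
have Ut : uniq (traject t x j).
by have := uniq_traject_porbit t x;rewrite -(subnKC (ltnW jL)) trajectD cat_uniq=> /andP[].
have yn : y \notin porbit u x.
rewrite OE;apply/trajectP=> -[i Hi /(inj _ _ jL (ltn_trans Hi jL)) E];by rewrite E ltnn in Hi.
have cx : #|porbit u x| = j by rewrite (eq_card OE) (card_uniqP Ut) size_traject.
split=> //;have [Ex _ _] := porbit_mul_tperm yn.
have tE : (u * tperm x y = t)%g by rewrite /u -mulgA tperm2 mulg1.
rewrite tE in Ex;rewrite Ex finset.cardsU (_ : (_ :&: _)%SET = finset.set0) ?cards0 ?subn0 ?cx ?addKn//.
apply/finset.setP=> z;rewrite finset.in_setI finset.in_set0;apply/negP=> /andP[zx zy].
move: yn;rewrite -porbitE=> /negP;apply.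
by move: zx zy;rewrite -!porbitE=> /eqP -> /eqP ->.
Qed.

Lemma sum_porbit_iter t x (F : I -> nat) : \sum_(y | (y \in porbit t x) && (y != x)) F y =
\sum_(1 <= j < #|porbit t x|) F (iter j t x).
Proof.
have U := uniq_traject_porbit t x.
have L0 : 0 < #|porbit t x| by apply/card_gt0P;exists x;exact: porbit_id.
transitivity (\sum_(y <- traject t x #|porbit t x| | y != x) F y).
rewrite -[RHS]big_filter big_uniq ?filter_uniq//=;apply: eq_bigl=> y.
by rewrite mem_filter porbit_traject andbC.
rewrite -(prednK L0)/= in U *;rewrite big_cons eqxx/=.
case/andP: U=> xn _;rewrite big_seq_cond.
rewrite (eq_bigl (fun y=> y \in traject t (t x) #|porbit t x|.-1))=> [|y];last first.
by apply: andb_idr=> yt;apply/eqP=> E;move/negP: xn;apply;rewrite -{1}E.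
rewrite -big_seq big_add1/= big_mkord.
rewrite (big_nth x) size_traject big_mkord;apply: eq_bigr=> i _.
by rewrite (set_nth_default (t x)) ?size_traject// nth_traject// -iterSr.
Qed.
End Transpositions.

(** * Permutations with rooted cycles and the combinatorial cut-and-join step *)

(** Sums over [sel] and [splits] replace sums over an index and over the subsets of indices of the
    list; repeated entries are kept apart by their positions. *)
Fixpoint sel (T : Type) (s : seq T) : seq (T * seq T) :=
if s is k :: s' then (k, s') :: [seq (x.1, k :: x.2) | x <- sel s'] else [::].

Fixpoint splits (T : Type) (s : seq T) : seq (seq T * seq T) :=
if s is k :: s' then [seq (k :: x.1, x.2) | x <- splits s'] ++ [seq (x.1, k :: x.2) | x <- splits s']
else [:: ([::], [::])].

Section Rootings.
Local Open Scope nat_scope.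
Variable I : finType.
Implicit Types (t u : {perm I}) (x y z : I) (U : {set I}) (mu : seq nat).

(* The number of ways to choose roots, one in each cycle of t outside U, such that
 the successive lengths of the rooted cycles are the entries of mu. *)
Fixpoint rootings t U mu : nat :=
if mu is k :: mu' then \sum_(x | (x \notin U) && (#|porbit t x| == k)) rootings t (U :|: porbit t x)%SET mu'
else (U == [set: I]%SET).

Definition stable t U := forall x z, z \in porbit t x -> (z \in U) = (x \in U).

Lemma stable0 t : stable t finset.set0.
Proof. by move=> x z _;rewrite !finset.in_set0. Qed.

Lemma stableU t U x : stable t U -> stable t (U :|: porbit t x)%SET.
Proof.
by move=> st y z yz;rewrite !finset.in_setU (st y z yz) -!porbitE;move: yz;rewrite -porbitE=> /eqP ->.
Qed.

Lemma rootings_eq t u U mu : stable t U -> (forall x, x \notin U -> porbit t x = porbit u x) ->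
rootings t U mu = rootings u U mu.
Proof.
elim: mu U=> [//|k mu IH] U st H/=;apply: eq_big=> [x|x /andP[xU _]].
by case xU : (x \in U)=> //=;rewrite H// xU.
rewrite (H x xU);rewrite -IH -?(H x xU)//;first exact: stableU.
by move=> y;rewrite finset.in_setU negb_or=> /andP[yU _];exact: H.
Qed.

(** The cycle of [y] is rooted by exactly one entry of the list. That entry equals its length and
    leaves as many choices of a root. *)
Lemma rootings_mark t U mu y : stable t U -> y \notin U ->
rootings t U mu = \sum_(x <- sel mu) (x.1 == #|porbit t y|) * x.1 * rootings t (U :|: porbit t y)%SET x.2.
Proof.
elim: mu U=> [|k mu IH] U st yU/=.
rewrite big_nil;case: eqP=> // E;by rewrite E finset.in_setT in yU.
rewrite big_cons big_map/= (bigID (fun x=> x \in porbit t y))/=;congr (_ + _).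
transitivity (\sum_(x in porbit t y) (k == #|porbit t y|) * rootings t (U :|: porbit t y)%SET mu).
 rewrite [LHS]big_mkcond [RHS]big_mkcond;apply: eq_bigr=> x _.
 case yx : (x \in porbit t y);last by rewrite andbF.
 have E : porbit t y = porbit t x by apply/eqP;rewrite porbitE.
 rewrite andbT (st y x yx) yU/= -E eq_sym;by case: eqP;rewrite ?mul1n ?mul0n.
by rewrite sum_nat_const -mulnA;case: eqP=> [->|];rewrite ?mul1n ?mul0n ?muln0.
transitivity (\sum_(x | (x \notin U) && (#|porbit t x| == k) && (x \notin porbit t y))
 \sum_(z <- sel mu) (z.1 == #|porbit t y|) * z.1 * rootings t (U :|: porbit t y :|: porbit t x)%SET z.2).
apply: eq_bigr=> x /andP[_ xy];rewrite (IH _ (stableU _ st)).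
 by apply: eq_bigr=> z _;congr (_ * rootings _ _ _);rewrite finset.setUAC.
by rewrite finset.in_setU negb_or yU -porbitE eq_sym porbitE.
rewrite exchange_big;apply: eq_bigr=> z _;rewrite -big_distrr/=;congr (_ * _).
apply: eq_bigl=> x;rewrite finset.in_setU negb_or -!andbA;congr (_ && _);exact: andbC.
Qed.

(** Two cycles are marked in turn. The others are not affected by the transposition, so the
    remaining rootings may be counted in the product. *)
Lemma rootings_join t x y mu : y \notin porbit t x ->
rootings t finset.set0 mu = \sum_(p <- sel mu) \sum_(q <- sel p.2)
 (p.1 == #|porbit t x|) * (q.1 == #|porbit t y|) * (p.1 * q.1) *
  rootings (t * tperm x y)%g (porbit t x :|: porbit t y)%SET q.2.
Proof.
move=> yx;have [_ _ H] := porbit_mul_tperm yx.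
rewrite (rootings_mark _ (@stable0 t) (y := x)) ?finset.in_set0//.
apply: eq_bigr=> p _;rewrite finset.set0U (rootings_mark _ _ (y := y))//;last first.
by rewrite -[porbit t x]finset.set0U;apply: stableU;exact: stable0.
rewrite big_distrr/=;apply: eq_bigr=> q _.
rewrite (@rootings_eq t (t * tperm x y)%g);first by ring.
by apply: stableU;rewrite -[porbit t x]finset.set0U;apply: stableU;exact: stable0.
by move=> z /H.
Qed.

Lemma rootings_cut t x y mu : y \notin porbit t x ->
rootings (t * tperm x y)%g finset.set0 mu = \sum_(p <- sel mu)
 (p.1 == #|porbit t x| + #|porbit t y|) * p.1 * rootings t (porbit t x :|: porbit t y)%SET p.2.
Proof.
move=> yx;have [Ex _ H] := porbit_mul_tperm yx.
rewrite (rootings_mark _ (@stable0 _) (y := x)) ?finset.in_set0// Ex finset.set0U.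
have disj : #|(porbit t x :|: porbit t y)%SET| = #|porbit t x| + #|porbit t y|.
rewrite finset.cardsU (_ : (_ :&: _)%SET = finset.set0) ?cards0 ?subn0//.
apply/finset.setP=> z;rewrite finset.in_setI finset.in_set0;apply/negP=> /andP[zx zy].
move: yx;rewrite -porbitE=> /negP;apply.
by move: zx zy;rewrite -!porbitE=> /eqP -> /eqP ->.
rewrite disj;apply: eq_bigr=> p _;congr (_ * _);apply: rootings_eq=> //.
by rewrite -[X in stable _ X]finset.set0U -Ex;apply: stableU;exact: stable0.
Qed.

(** The element at distance [j] from [x] on its cycle cuts off a piece of length [j], so prescribed
    lengths single out one [y], provided they add up to the length of the cycle. *)
Lemma sum_join_sizes t x k k' : 0 < k -> 0 < k' ->
\sum_(y | (y \in porbit t x) && (y != x))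
 (k == #|porbit (t * tperm x y)%g x|) * (k' == #|porbit (t * tperm x y)%g y|) = (#|porbit t x| == k + k').
Proof.
move=> k0 k'0;rewrite (sum_porbit_iter t x (fun y=> (k == #|porbit (t * tperm x y)%g x|) * (k' == #|porbit (t * tperm x y)%g y|))).
transitivity (\sum_(1 <= j < #|porbit t x|) (j == k) * (k' == #|porbit t x| - k)).
apply: eq_big_nat=> j Hj;have [_ -> ->] := porbit_cut Hj.
by rewrite eq_sym;case: eqP=> [->|];rewrite ?mul1n.
rewrite -big_distrl/=;case: (ltnP k #|porbit t x|)=> kL;last first.
rewrite big_nat big1=> [|j /andP[_ jL]];last by rewrite ltn_eqF// (leq_trans jL).
by rewrite mul0n ltn_eqF// (leq_ltn_trans kL)// -{1}[k]addn0 ltn_add2l.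
have -> : \sum_(1 <= j < #|porbit t x|) (j == k) = 1.
transitivity (\sum_(1 <= j < #|porbit t x| | j == k) 1);last by rewrite big_nat1_eq k0 kL.
by rewrite [RHS]big_mkcond;apply: eq_bigr=> j _;case: eqP.
rewrite mul1n;congr (nat_of_bool _);apply/eqP/eqP;lia.
Qed.
End Rootings.

Section Components.
Local Open Scope nat_scope.
Variable I : finType.
Implicit Types (t s : {perm I}) (l : seq (I * I)) (x y z : I) (S A : {set I}).

Definition prodp s l : {perm I} := foldr (fun xy t=> (t * tperm xy.1 xy.2)%g) s l.

Definition invar s l A : Prop :=
(forall x, (s x \in A) = (x \in A)) /\ (forall xy, xy \in l -> (xy.1 \in A) = (xy.2 \in A)).

(** An orbit of the group generated by [s] and the transpositions of the pairs in [l], encoded as a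
    minimal nonempty invariant set. *)
Definition component s l S : bool := `[< [/\ S != finset.set0, invar s l S &
forall A, A \subset S -> A != finset.set0 -> invar s l A -> A = S] >].

Lemma invar_cons s x y l A : invar s ((x, y) :: l) A <-> invar s l A /\ (x \in A) = (y \in A).
Proof.
split=> [[H1 H2]|[[H1 H2] xy]].
split;last by apply: (H2 (x, y));rewrite finset.inE eqxx.
by split=> // z zl;apply: H2;rewrite finset.inE zl orbT.
by split=> // z;rewrite finset.inE=> /orP[/eqP ->|/H2].
Qed.

Lemma invar_setC s l A : invar s l A -> invar s l (~: A)%SET.
Proof. by move=> [H1 H2];split=> [x|z /H2];rewrite !finset.in_setC ?H1// => ->. Qed.

Lemma invar_setI s l A S : invar s l A -> invar s l S -> invar s l (A :&: S)%SET.
Proof. by move=> [H1 H2] [H3 H4];split=> [x|z zl];rewrite !finset.in_setI ?H1 ?H3// (H2 z zl) (H4 z zl). Qed.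

Lemma invar_setU s l A S : invar s l A -> invar s l S -> invar s l (A :|: S)%SET.
Proof. by move=> [H1 H2] [H3 H4];split=> [x|z zl];rewrite !finset.in_setU ?H1 ?H3// (H2 z zl) (H4 z zl). Qed.

Lemma invar_setT s l : invar s l [set: I]%SET.
Proof. by split=> *;rewrite !finset.in_setT. Qed.

Lemma invar_prodp s l A : invar s l A -> forall x, (prodp s l x \in A) = (x \in A).
Proof.
elim: l=> [[H _]//|[x y] l IH] /invar_cons[/IH H xy] z/=.
by rewrite permM -[RHS]H;case: tpermP=> [->|->|];rewrite ?xy.
Qed.

Lemma invar_stable s l A : invar s l A -> stable (prodp s l) A.
Proof.
move=> /invar_prodp H x z /porbitP[n ->];elim: n=> [|n IH];first by rewrite expg0 perm1.
by rewrite expgSr permM H.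
Qed.

Definition hull s l x : {set I} := [set z | `[< forall A, invar s l A -> x \in A -> z \in A >]]%SET.

Lemma hullP s l x z : reflect (forall A, invar s l A -> x \in A -> z \in A) (z \in hull s l x).
Proof. by rewrite finset.in_set;exact: asboolP. Qed.

Lemma hull_invar s l x : invar s l (hull s l x).
Proof.
split=> [z|[u v] uv];apply/hullP/hullP=> H A iA xA;have [H1 H2] := iA.
- by rewrite -H1;exact: H.
- by rewrite H1;exact: H.
- by rewrite -(H2 _ uv);exact: H.
- by rewrite (H2 _ uv);exact: H.
Qed.

Lemma hull_id s l x : x \in hull s l x. Proof. exact/hullP. Qed.

Lemma hull_component s l x : component s l (hull s l x).
Proof.
apply/asboolP;split.
- by apply/finset.set0Pn;exists x;exact: hull_id.
- exact: hull_invar.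
move=> A sA /finset.set0Pn[z zA] iA;apply/eqP;rewrite finset.eqEsubset sA/=.
have [xA|xA] := boolP (x \in A).
by apply/fintype.subsetP=> w /hullP;exact.
have /fintype.subsetP/(_ z zA)/hullP := sA.
move=> /(_ _ (invar_setC iA));rewrite !finset.in_setC zA=> /(_ xA).
by [].
Qed.

Lemma componentI s l S A x : component s l S -> component s l A -> x \in S -> x \in A -> S = A.
Proof.
move=> /asboolP[_ iS mS] /asboolP[_ iA mA] xS xA.
have ne : (S :&: A)%SET != finset.set0 by apply/finset.set0Pn;exists x;rewrite finset.in_setI xS.
have e1 := mS _ (finset.subsetIl S A) ne (invar_setI iS iA).
by rewrite -(mA _ (finset.subsetIr S A) ne (invar_setI iS iA)) e1.
Qed.

(** With [x] and [y] linked, the action is transitive either because it was so before, or because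
    the orbit of [x] and its complement, which contains [y], were the only two orbits. *)
Lemma component_cons s l x y : component s ((x, y) :: l) [set: I]%SET =
component s l [set: I]%SET + \sum_(S : {set I} | (x \in S) && (y \notin S)) component s l S * component s l (~: S)%SET :> nat.
Proof.
have [cT|ncT] := boolP (component s l [set: I]%SET).
rewrite big1=> [|S /andP[xS yS]];last first.
 case cS : (component s l S)=> //;have E := componentI cT cS (finset.in_setT x) xS.
 by rewrite -E finset.in_setT in yS.
have [//|] := boolP (component s ((x, y) :: l) _);case/negP.
move/asboolP: cT=> [n0 _ m];apply/asboolP;split=> //;first exact: invar_setT.
by move=> A sA nA /invar_cons[iA _];exact: m.
rewrite add0n;have hx := hull_component s l x;have /asboolP[_ ix mx] := hx.
have [yx|yx] := boolP (y \in hull s l x).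
rewrite big1=> [|S /andP[xS yS]];last first.
 case cS : (component s l S)=> //;move: yS;by rewrite -(componentI hx cS (hull_id s l x) xS) yx.
have [/asboolP[n0 _ m]|//] := boolP (component s ((x, y) :: l) _).
case/negP: ncT;rewrite -(m (hull s l x))//.
- by apply/finset.set0Pn;exists x;exact: hull_id.
- by apply/invar_cons;split=> //;rewrite yx hull_id.
rewrite (bigD1 (hull s l x)) ?hull_id//= big1=> [|S /andP[/andP[xS yS] nS]];last first.
case cS : (component s l S)=> //;by rewrite (componentI hx cS (hull_id s l x) xS) eqxx in nS.
rewrite hx mul1n addn0;congr (nat_of_bool _);apply/asboolP/asboolP.
- move=> [n0 _ m];split.
+ by apply/finset.set0Pn;exists y;rewrite finset.in_setC.
+ exact: invar_setC.
move=> A sA nA iA;apply/eqP;rewrite finset.eqEsubset sA/=;apply/fintype.subsetP=> z zH.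
have disj u : u \in A -> u \notin hull s l x by move=> uA;have /fintype.subsetP/(_ u uA) := sA;rewrite finset.in_setC.
have [yA|yA] := boolP (y \in A).
 have E : (A :|: hull s l x)%SET = [set: I]%SET.
  apply: m=> //.
  by apply/finset.set0Pn;exists x;rewrite finset.in_setU hull_id orbT.
  by apply/invar_cons;split;[exact: invar_setU|rewrite !finset.in_setU yA hull_id orbT].
 have := finset.in_setT z;rewrite -E finset.in_setU;move: zH;rewrite finset.in_setC=> /negPf ->;by rewrite orbF.
have E : A = [set: I]%SET.
 apply: m=> //.
 apply/invar_cons;split=> //;rewrite (negPf yA);apply/negbTE/negP=> /disj;by rewrite hull_id.
by rewrite E finset.in_setT in yA.
- move=> [_ iC mC];split.
+ by apply/finset.set0Pn;exists x;rewrite finset.in_setT.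
+ exact: invar_setT.
move=> A _ nA /invar_cons[iA xyA].
have full B : invar s l B -> x \in B -> y \in B -> B = [set: I]%SET.
 move=> iB xB yB;apply/finset.setP=> z;rewrite finset.in_setT.
 have [/hullP/(_ B iB xB)//|zH] := boolP (z \in hull s l x).
 have E : (B :&: ~: hull s l x)%SET = (~: hull s l x)%SET.
  apply: mC;[exact: finset.subsetIr| |exact: invar_setI].
  by apply/finset.set0Pn;exists y;rewrite finset.in_setI yB finset.in_setC.
 have : z \in (~: hull s l x)%SET by rewrite finset.in_setC.
 by rewrite -E finset.in_setI=> /andP[].
have [xA|xA] := boolP (x \in A);first by apply: full=> //;rewrite -xyA.
have E : (~: A)%SET = [set: I]%SET.
 by apply: full;[exact: invar_setC|rewrite finset.in_setC|rewrite finset.in_setC -xyA].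
have /finset.set0Pn[z zA] := nA;have := finset.in_setT z;by rewrite -E finset.in_setC zA.
Qed.

Lemma component_cons_orbit s l x y : y \in porbit (prodp s l) x ->
component s ((x, y) :: l) [set: I]%SET = component s l [set: I]%SET.
Proof.
move=> yx;apply: asbool_equiv_eq;split=> -[n0 _ m];split=> //;try exact: invar_setT.
by move=> A sA nA iA;apply: m=> //;apply/invar_cons;split=> //;rewrite (invar_stable iA yx).
by move=> A sA nA /invar_cons[iA _];exact: m.
Qed.

Definition split_roots t S al be mu : nat :=
\sum_(x | (x \in S) && (#|porbit t x| == al)) \sum_(y | (y \notin S) && (#|porbit t y| == be))
 rootings t (porbit t x :|: porbit t y)%SET mu.

(** If the pair lies in one cycle of [t], the product has two cycles where [t] has their union, and
    transitivity is unaffected: two entries of [mu] are merged. If it meets two cycles of [t], one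
    entry is split, and these two cycles may lie in different components, which yields the terms
    indexed by [S]. *)
Lemma cut_and_join s l mu : let t := prodp s l in
\sum_(xy : I * I | xy.1 != xy.2)
 component s (xy :: l) [set: I]%SET * rootings (prodp s (xy :: l)) finset.set0 mu =
\sum_(p <- sel mu) \sum_(q <- sel p.2) p.1 * q.1 *
 (component s l [set: I]%SET * rootings t finset.set0 (p.1 + q.1 :: q.2)) +
\sum_(p <- sel mu) p.1 * \sum_(al < p.1)
 (component s l [set: I]%SET * rootings t finset.set0 (nat_of_ord al :: p.1 - al :: p.2) +
  \sum_(S : {set I}) component s l S * component s l (~: S)%SET * split_roots t S al (p.1 - al) p.2).
Proof.
move=> t;set c := component s l _;rewrite (bigID (fun xy=> xy.2 \in porbit t xy.1))/=;congr (_ + _).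
- transitivity (\sum_x \sum_(y | (y \in porbit t x) && (y != x))
  c * (\sum_(p <- sel mu) \sum_(q <- sel p.2)
  (p.1 == #|porbit (t * tperm x y)%g x|) * (q.1 == #|porbit (t * tperm x y)%g y|) * (p.1 * q.1) *
   rootings t (porbit t x) q.2)).
 rewrite pair_big_dep/=;apply: eq_big=> [[x y]|[x y]/= /andP[xy yx]];first by rewrite andbC eq_sym.
 rewrite component_cons_orbit//;congr (_ * _);rewrite -/t.
 have /porbitP[j0] := yx;rewrite -porbitE in yx.
 have yT := yx;move: yT;rewrite porbitE porbit_traject=> /trajectP[j jL Ej] _.
 have j0' : 0 < j by rewrite lt0n;apply: contraNneq xy=> j0';rewrite Ej j0'.
 have Hj : 0 < j < #|porbit t x| by rewrite j0'.
 have [] := porbit_cut Hj;rewrite -Ej=> yn _ _.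
 rewrite (rootings_join _ yn);have tE : ((t * tperm x y) * tperm x y = t)%g by rewrite -mulgA tperm2 mulg1.
 have [Ex _ _] := porbit_mul_tperm yn;rewrite tE in Ex.
 by rewrite tE -Ex.
transitivity (\sum_x \sum_(p <- sel mu) \sum_(q <- sel p.2) p.1 * q.1 * (c * ((#|porbit t x| == p.1 + q.1) * rootings t (porbit t x) q.2))).
 apply: eq_bigr=> x _;rewrite -big_distrr/= exchange_big big_distrr/=;apply: eq_bigr=> p _.
 rewrite exchange_big big_distrr/=;apply: eq_bigr=> q _.
 rewrite -big_distrl/= -big_distrl/=.
 case: (posnP p.1)=> [->|p0];first by rewrite !(muln0, mul0n).
 case: (posnP q.1)=> [->|q0];first by rewrite !(muln0, mul0n).
 rewrite sum_join_sizes//;ring.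
rewrite exchange_big;apply: eq_bigr=> p _;rewrite exchange_big;apply: eq_bigr=> q _.
rewrite -big_distrr -big_distrr/=;congr (_ * (_ * _)).
rewrite [RHS]big_mkcond;apply: eq_bigr=> x _;rewrite finset.in_set0/= finset.set0U.
by case: eqP;rewrite ?mul1n.
- transitivity (\sum_x \sum_(y | y \notin porbit t x)
 (c + \sum_(S : {set I} | (x \in S) && (y \notin S)) component s l S * component s l (~: S)%SET) *
 \sum_(p <- sel mu) p.1 * \sum_(al < p.1) (#|porbit t x| == al) * (#|porbit t y| == p.1 - al) *
  rootings t (porbit t x :|: porbit t y)%SET p.2).
 rewrite pair_big_dep/=;apply: eq_big=> [[x y]|[x y]/= /andP[xy yx]].
  by apply: andb_idl=> /=;apply: contraNneq=> <-;exact: porbit_id.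
 rewrite component_cons;congr (_ * _);rewrite -/t (rootings_cut _ yx).
 apply: eq_bigr=> p _;rewrite -big_distrl/= mulnA;congr (_ * _).
 rewrite mulnC;congr (_ * _).
 have x0 : 0 < #|porbit t x| by apply/card_gt0P;exists x;exact: porbit_id.
 have y0 : 0 < #|porbit t y| by apply/card_gt0P;exists y;exact: porbit_id.
 have [xp|xp] := ltnP #|porbit t x| p.1.
  rewrite (bigD1 (Ordinal xp))//= eqxx mul1n big1 ?addn0=> [|i /eqP ni].
  by congr (nat_of_bool _);apply/eqP/eqP;lia.
  by case: eqP=> // E;case: ni;apply: val_inj.
 rewrite big1=> [|i _];first by case: eqP=> //;lia.
 by rewrite gtn_eqF// (leq_trans (ltn_ord i)).
pose cc (S : {set I}) := component s l S * component s l (~: S)%SET.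
pose G x y (p : nat * seq nat) (al : nat) := (#|porbit t x| == al) * (#|porbit t y| == p.1 - al) *
 rootings t (porbit t x :|: porbit t y)%SET p.2.
transitivity (\sum_(p <- sel mu) p.1 * \sum_(al < p.1) \sum_x \sum_(y | y \notin porbit t x)
  (c + \sum_(S : {set I} | (x \in S) && (y \notin S)) cc S) * G x y p al).
 transitivity (\sum_x \sum_(p <- sel mu) p.1 * \sum_(al < p.1) \sum_(y | y \notin porbit t x)
  (c + \sum_(S : {set I} | (x \in S) && (y \notin S)) cc S) * G x y p al).
  apply: eq_bigr=> x _.
  under eq_bigr do rewrite big_distrr/=.
  rewrite exchange_big;apply: eq_bigr=> p _;rewrite [in RHS]exchange_big big_distrr/=.
  by apply: eq_bigr=> y _;rewrite mulnCA big_distrr.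
 by rewrite exchange_big;apply: eq_bigr=> p _;rewrite -big_distrr/=;congr (_ * _);rewrite exchange_big.
apply: eq_bigr=> p _;congr (_ * _);apply: eq_bigr=> al _.
transitivity (\sum_x \sum_(y | y \notin porbit t x) c * G x y p al +
  \sum_x \sum_(y | y \notin porbit t x) (\sum_(S : {set I} | (x \in S) && (y \notin S)) cc S) * G x y p al).
 rewrite -big_split;apply: eq_bigr=> x _;rewrite -big_split;apply: eq_bigr=> y _.
 by rewrite mulnDl.
congr (_ + _).
 rewrite big_distrr [RHS]big_mkcond;apply: eq_bigr=> x _;rewrite finset.in_set0 finset.set0U/=.
 rewrite /G;case: eqP=> _;last by rewrite big1=> [//|y _];rewrite !mul0n muln0.
 rewrite -big_distrr/=;congr (_ * _);rewrite [LHS]big_mkcond [RHS]big_mkcond;apply: eq_bigr=> y _.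
 by rewrite mul1n;case: (y \notin _)=> //=;case: eqP;rewrite ?mul1n ?mul0n.
transitivity (\sum_(S : {set I}) \sum_x \sum_(y | (y \notin porbit t x) && ((x \in S) && (y \notin S))) cc S * G x y p al).
 rewrite [RHS]exchange_big;apply: eq_bigr=> x _.
 under eq_bigr do rewrite big_distrl/=.
 exact: exchange_big_dep.
apply: eq_bigr=> S _;rewrite -/(cc S).
case: (posnP (cc S))=> [->|cS];first by rewrite mul0n big1=> [//|x _];rewrite big1.
have st : stable t S.
 move: cS;rewrite /cc;case cS : (component s l S)=> // _;have /asboolP[_ iS _] := cS.
 exact: invar_stable.
rewrite /split_roots big_distrr [RHS]big_mkcond;apply: eq_bigr=> x _.
rewrite -big_distrr/=;case xS : (x \in S)=> /=;last by rewrite big_pred0 ?muln0// => y;rewrite andbF.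
rewrite /G;case: eqP=> _;last by rewrite big1 ?muln0// => y _;rewrite !mul0n.
congr (_ * _);rewrite [LHS]big_mkcond [RHS]big_mkcond;apply: eq_bigr=> y _.
case yS : (y \in S);rewrite ?andbF//= andbT.
have -> : y \notin porbit t x by apply/negP=> /st;rewrite xS yS.
by rewrite mul1n;case: eqP;rewrite ?mul1n ?mul0n.
Qed.
End Components.

(** * Weighted sums over tuples of transpositions and their invariance under bijections *)

Section TupleSums.
Local Open Scope nat_scope.

Lemma sum_tuple_cons (T : finType) m (P : pred (seq T)) (F : seq T -> nat) :
\sum_(l : m.+1.-tuple T | P l) F l = \sum_(c : T) \sum_(l : m.-tuple T | P (c :: l)) F (c :: l).
Proof.
rewrite pair_big_dep/= (reindex (fun cl : T * m.-tuple T=> cons_tuple cl.1 cl.2))//=.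
exists (fun l : m.+1.-tuple T=> (thead l, behead_tuple l))=> [[c l] _|l _]/=.
by rewrite theadE;congr (_, _);apply: val_inj.
by apply: val_inj;rewrite/= [in RHS](tuple_eta l).
Qed.

Lemma sum_tuple0 (T : finType) (P : pred (seq T)) (F : seq T -> nat) :
\sum_(l : 0.-tuple T | P l) F l = P [::] * F [::].
Proof.
rewrite (eq_bigl (fun l : 0.-tuple T=> P [::]))=> [|l];last by rewrite tuple0.
rewrite (eq_bigr (fun=> F [::]))=> [|l _];last by rewrite tuple0.
case: (P [::]);last by rewrite big_pred0 ?mul0n.
by rewrite sum_nat_const card_tuple expn0.
Qed.
End TupleSums.

Section Weights.
Local Open Scope nat_scope.
Variables (I : finType) (a : nat).

Definition all_cycles (t : {perm I}) := [forall x, #|porbit t x| == a].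
Definition proper_pairs (l : seq (I * I)) := all (fun xy=> xy.1 != xy.2) l.

(** Transpositions are given by ordered pairs, so each tuple of them occurs [2 ^ m] times. *)
Definition weight m (G : {perm I} -> seq (I * I) -> nat) : nat :=
\sum_(s | all_cycles s) \sum_(l : m.-tuple (I * I) | proper_pairs l) G s l.

Lemma weightS m G : weight m.+1 G = weight m (fun s l=> \sum_(xy : I * I | xy.1 != xy.2) G s (xy :: l)).
Proof.
apply: eq_bigr=> s _;rewrite (sum_tuple_cons _ proper_pairs).
rewrite [RHS]exchange_big/= [RHS]big_mkcond;apply: eq_bigr=> xy _/=.
by case: ifP=> H/=;[|rewrite big_pred0].
Qed.

Lemma eq_weight m (G G' : {perm I} -> seq (I * I) -> nat) : (forall s l, all_cycles s -> proper_pairs l -> G s l = G' s l) ->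
weight m G = weight m G'.
Proof. by move=> H;apply: eq_bigr=> s Hs;apply: eq_bigr=> l Hl;exact: H. Qed.

Lemma weightD m G G' : weight m (fun s l=> G s l + G' s l) = weight m G + weight m G'.
Proof. by rewrite -big_split;apply: eq_bigr=> s _;rewrite -big_split. Qed.

Lemma weightM m c G : weight m (fun s l=> c * G s l) = c * weight m G.
Proof. by rewrite big_distrr;apply: eq_bigr=> s _;rewrite big_distrr. Qed.

Lemma weight_sum m (T : Type) (r : seq T) (G : T -> {perm I} -> seq (I * I) -> nat) :
weight m (fun s l=> \sum_(i <- r) G i s l) = \sum_(i <- r) weight m (G i).
Proof. by rewrite exchange_big;apply: eq_bigr=> s _;rewrite exchange_big. Qed.

Definition rooted_count m mu : nat :=
weight m (fun s l=> component s l [set: I]%SET * rootings (prodp s l) finset.set0 mu).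

Definition split_count m S al be mu : nat :=
weight m (fun s l=> component s l S * component s l (~: S)%SET * split_roots (prodp s l) S al be mu).

(** The head of the list is the last transposition multiplied; [cut_and_join] sums over it. *)
Lemma rooted_count_rec m mu : rooted_count m.+1 mu =
\sum_(p <- sel mu) \sum_(q <- sel p.2) p.1 * q.1 * rooted_count m (p.1 + q.1 :: q.2) +
\sum_(p <- sel mu) p.1 * \sum_(al < p.1)
 (rooted_count m (nat_of_ord al :: p.1 - al :: p.2) + \sum_(S : {set I}) split_count m S al (p.1 - al) p.2).
Proof.
rewrite /rooted_count weightS.
etransitivity;first by apply: eq_weight=> s l _ _;exact: cut_and_join.
rewrite weightD !weight_sum;congr (_ + _);apply: eq_bigr=> p _.
by rewrite weight_sum;apply: eq_bigr=> q _;rewrite weightM.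
rewrite weightM weight_sum;congr (_ * _);apply: eq_bigr=> al _.
by rewrite weightD weight_sum.
Qed.
End Weights.

Section Embedding.
Local Open Scope nat_scope.
Variables (J I : finType) (f : J -> I).
Hypothesis fi : injective f.

Lemma porbit_emb (t : {perm J}) (u : {perm I}) x : (forall x, u (f x) = f (t x)) ->
porbit u (f x) = (f @: porbit t x)%SET.
Proof.
move=> H;have E n : (u ^+ n)%g (f x) = f ((t ^+ n)%g x).
by elim: n=> [|n IH];rewrite ?expg0 ?perm1// !expgSr !permM IH H.
apply/finset.setP=> z;apply/porbitP/imsetP=> [[n ->]|[_ /porbitP[n ->] ->]].
by exists ((t ^+ n)%g x)=> //;exact: mem_porbit.
by exists n.
Qed.

Lemma card_porbit_emb (t : {perm J}) (u : {perm I}) x : (forall x, u (f x) = f (t x)) ->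
#|porbit u (f x)| = #|porbit t x|.
Proof. by move=> H;rewrite (porbit_emb x H) card_imset. Qed.

Lemma component_emb (s : {perm J}) l (s' : {perm I}) l' (S : {set J}) :
(forall A : {set J}, invar s' l' (f @: A)%SET <-> invar s l A) ->
component s' l' (f @: S)%SET = component s l S.
Proof.
move=> H;apply: asbool_equiv_eq;split=> -[n0 iS m];split;try exact/H.
- by apply: contraNneq n0=> ->;rewrite imset0.
- move=> A sA nA iA;apply: (imset_inj fi);apply: m;[exact: imsetS| |exact/H].
by apply: contraNneq nA=> /eqP;rewrite imset_eq0.
- by rewrite imset_eq0.
- move=> A sA nA iA;have E : A = (f @: (f @^-1: A))%SET.
 apply/finset.setP=> z;apply/idP/imsetP=> [zA|[x xA ->]];last by move: xA;rewrite finset.inE.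
 have /fintype.subsetP/(_ z zA)/imsetP[x _ zE] := sA;exists x=> //;by rewrite finset.inE -zE.
rewrite E (_ : (f @^-1: A)%SET = S)//;apply: m.
+ apply/fintype.subsetP=> x;rewrite finset.inE=> fA.
 by have /fintype.subsetP/(_ _ fA) := sA;rewrite mem_imset.
+ by apply: contraNneq nA=> E';rewrite E E' imset0.
+ by apply/H;rewrite -E.
Qed.
End Embedding.

Section Transport.
Local Open Scope nat_scope.
Variables (J I : finType) (f : J -> I) (f' : I -> J).
Hypotheses (K1 : cancel f f') (K2 : cancel f' f).

Lemma ptr_inj (t : {perm J}) : injective (fun x=> f (t (f' x))).
Proof. by move=> x y /(can_inj K1)/perm_inj/(can_inj K2). Qed.

Definition ptr (t : {perm J}) : {perm I} := perm (@ptr_inj t).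

Lemma ptrE t x : ptr t (f x) = f (t x). Proof. by rewrite permE K1. Qed.

Lemma ptr_bij : bijective ptr.
Proof.
have inj' (u : {perm I}) : injective (fun x=> f' (u (f x))).
by move=> x y /(can_inj K2)/perm_inj/(can_inj K1).
exists (fun u=> perm (@inj' u))=> t;apply/permP=> x;rewrite !permE/= ?permE.
by rewrite !K1.
by rewrite !K2.
Qed.

Let f2 (xy : J * J) := (f xy.1, f xy.2).

Lemma prodp_ptr s l : prodp (ptr s) (map f2 l) = ptr (prodp s l).
Proof.
elim: l=> [//|[x y] l IH]/=;rewrite IH;apply/permP=> z;rewrite -[z]K2 permM !ptrE permM.
by rewrite inj_tperm//;exact: can_inj K1.
Qed.

Lemma invar_ptr s l (A : {set J}) : invar (ptr s) (map f2 l) (f @: A)%SET <-> invar s l A.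
Proof.
have fi := can_inj K1.
split=> -[H1 H2];split.
- by move=> x;have := H1 (f x);rewrite ptrE !mem_imset.
- by move=> xy xyl;have := H2 (f2 xy) (map_f _ xyl);rewrite/= !mem_imset.
- by move=> x;rewrite -[x]K2 ptrE !mem_imset.
- by move=> _ /mapP[xy xyl ->]/=;rewrite !mem_imset//;exact: H2.
Qed.

Lemma component_ptr s l (S : {set J}) : component (ptr s) (map f2 l) (f @: S)%SET = component s l S.
Proof. by apply: component_emb=> [|A];[exact: can_inj K1|exact: invar_ptr]. Qed.

Lemma sum_f (P : pred I) (F : I -> nat) : \sum_(x | P x) F x = \sum_(x | P (f x)) F (f x).
Proof. by rewrite (reindex f)//;exists f'=> x _. Qed.

Lemma rootings_ptr t (U : {set J}) mu : rootings (ptr t) (f @: U)%SET mu = rootings t U mu.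
Proof.
have fi := can_inj K1;elim: mu U=> [|k mu IH] U/=.
congr (nat_of_bool _);apply/eqP/eqP=> [E|->].
 by apply/finset.setP=> x;rewrite finset.in_setT -(mem_imset _ _ fi) E finset.in_setT.
by apply/finset.setP=> x;rewrite finset.in_setT -[x]K2 mem_imset ?finset.in_setT.
rewrite sum_f;apply: eq_big=> [x|x _].
by rewrite mem_imset// (card_porbit_emb fi x (ptrE t)).
by rewrite (porbit_emb x (ptrE t)) -imsetU IH.
Qed.

Lemma split_roots_ptr t (S : {set J}) al be mu : split_roots (ptr t) (f @: S)%SET al be mu = split_roots t S al be mu.
Proof.
have fi := can_inj K1;rewrite /split_roots sum_f;apply: eq_big=> [x|x _].
by rewrite mem_imset// (card_porbit_emb fi x (ptrE t)).
rewrite sum_f;apply: eq_big=> [y|y _].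
by rewrite mem_imset// (card_porbit_emb fi y (ptrE t)).
by rewrite !(porbit_emb _ (ptrE t)) -imsetU rootings_ptr.
Qed.

Lemma weight_ptr a m (G : {perm I} -> seq (I * I) -> nat) :
weight a m G = weight a m (fun s l=> G (ptr s) (map f2 l)).
Proof.
rewrite /weight (reindex ptr)/=;last exact/onW_bij/ptr_bij.
apply: eq_big=> [s|s _].
apply/forallP/forallP=> H x;first by rewrite -(card_porbit_emb (can_inj K1) x (ptrE s)) H.
by rewrite -[x]K2 (card_porbit_emb (can_inj K1) _ (ptrE s)) H.
rewrite (reindex (fun l : m.-tuple (J * J)=> map_tuple f2 l))/=;last first.
exists (fun l : m.-tuple (I * I)=> map_tuple (fun xy=> (f' xy.1, f' xy.2)) l)=> l _;apply: val_inj=> /=.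
 by rewrite -map_comp -[RHS]map_id;apply: eq_map=> -[x y];rewrite/= !K1.
by rewrite -map_comp -[RHS]map_id;apply: eq_map=> -[x y];rewrite /f2/= !K2.
apply: eq_bigl=> l;rewrite /proper_pairs all_map;apply: eq_all=> -[x y]/=.
by rewrite (inj_eq (can_inj K1)).
Qed.

Lemma rooted_count_bij a m mu : rooted_count I a m mu = rooted_count J a m mu.
Proof.
rewrite /rooted_count weight_ptr;apply: eq_weight=> s l _ _.
have E : [set: I]%SET = (f @: [set: J])%SET.
by apply/finset.setP=> x;rewrite finset.in_setT -[x]K2 mem_imset ?finset.in_setT//;exact: can_inj K1.
by rewrite E component_ptr prodp_ptr -(imset0 f) rootings_ptr.
Qed.

Lemma split_count_bij a m (S : {set J}) al be mu : split_count a m (f @: S)%SET al be mu = split_count a m S al be mu.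
Proof.
rewrite /split_count weight_ptr;apply: eq_weight=> s l _ _.
have E : (~: (f @: S))%SET = (f @: (~: S))%SET.
by apply/finset.setP=> x;rewrite -[x]K2 finset.in_setC !mem_imset ?finset.in_setC//;exact: can_inj K1.
by rewrite E !component_ptr prodp_ptr split_roots_ptr.
Qed.
End Transport.

(** * Configurations with two components as shuffles of two connected ones *)

Section DisjointSum.
Local Open Scope nat_scope.
Variables (I1 I2 : finType).
Local Notation J := (I1 + I2)%type.

Definition psum_fun (s1 : {perm I1}) (s2 : {perm I2}) (z : J) : J := match z with inl x=> inl (s1 x) | inr y=> inr (s2 y) end.

Lemma psum_inj s1 s2 : injective (psum_fun s1 s2).
Proof. by move=> [x|x] [y|y]//= [] /perm_inj ->. Qed.

Definition psum (s1 : {perm I1}) (s2 : {perm I2}) : {perm J} := perm (@psum_inj s1 s2).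

Lemma psuml s1 s2 x : psum s1 s2 (inl x) = inl (s1 x). Proof. by rewrite permE. Qed.
Lemma psumr s1 s2 y : psum s1 s2 (inr y) = inr (s2 y). Proof. by rewrite permE. Qed.

Definition lpart : {set J} := (inl @: [set: I1])%SET.

Lemma in_lpart z : (z \in lpart) = if z is inl _ then true else false.
Proof. by case: z=> x;apply/imsetP;[exists x|case]. Qed.

Lemma lpartC : (~: lpart)%SET = (inr @: [set: I2])%SET.
Proof.
apply/finset.setP=> -[x|x];rewrite finset.in_setC in_lpart;apply/esym/imsetP;last by exists x.
by case.
Qed.

Lemma psum_surj (s : {perm J}) : (forall z, (s z \in lpart) = (z \in lpart)) -> exists s1 s2, s = psum s1 s2.
Proof.
move=> H.
pose g1 x := if s (inl x) is inl y then y else x.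
pose g2 x := if s (inr x) is inr y then y else x.
have e1 x : s (inl x) = inl (g1 x).
by have := H (inl x);rewrite /g1 !in_lpart;case: (s (inl x)).
have e2 x : s (inr x) = inr (g2 x).
by have := H (inr x);rewrite /g2 !in_lpart;case: (s (inr x)).
have i1 : injective g1.
by move=> x y E;have /perm_inj[] : s (inl x) = s (inl y) by rewrite !e1 E.
have i2 : injective g2.
by move=> x y E;have /perm_inj[] : s (inr x) = s (inr y) by rewrite !e2 E.
exists (perm i1), (perm i2);apply/permP=> -[x|x];first by rewrite psuml permE e1.
by rewrite psumr permE e2.
Qed.

Lemma sum_psum (F : {perm J} -> nat) : (forall s, F s != 0 -> forall z, (s z \in lpart) = (z \in lpart)) ->
\sum_s F s = \sum_s1 \sum_s2 F (psum s1 s2).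
Proof.
move=> H;pose h (u : {perm I1} * {perm I2}) := psum u.1 u.2.
have hi : injective h.
move=> [s1 s2] [t1 t2] E;congr (_, _);apply/permP=> x.
 by have := congr1 (fun s : {perm J} => s (inl x)) E;rewrite /h/= !psuml=> -[].
by have := congr1 (fun s : {perm J} => s (inr x)) E;rewrite /h/= !psumr=> -[].
rewrite pair_big/= (bigID (mem (h @: [set: {perm I1} * {perm I2}])%SET))/= addnC big1 ?add0n.
rewrite big_imset/=;last by move=> u v _ _;exact: hi.
by apply: eq_bigl=> u;rewrite finset.in_setT.
move=> s Hs;apply/eqP;apply: contraNT Hs=> /H/psum_surj[s1 [s2 ->]].
by apply/imsetP;exists (s1, s2);rewrite ?finset.in_setT.
Qed.

Definition same_side (xy : J * J) : bool :=
match xy with (inl _, inl _) | (inr _, inr _)=> true | _=> false end.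
Definition lefts (l : seq (J * J)) : seq (I1 * I1) :=
pmap (fun xy=> if xy is (inl x, inl y) then Some (x, y) else None) l.
Definition rights (l : seq (J * J)) : seq (I2 * I2) :=
pmap (fun xy=> if xy is (inr x, inr y) then Some (x, y) else None) l.

Lemma sum_same_side (F : J * J -> nat) : \sum_(c | same_side c) F c =
\sum_(c : I1 * I1) F (inl c.1, inl c.2) + \sum_(c : I2 * I2) F (inr c.1, inr c.2).
Proof.
transitivity (\sum_z \sum_(w | same_side (z, w)) F (z, w)).
by rewrite pair_big_dep/=;apply: eq_big=> [[]|[]].
rewrite big_sumType/=;congr (_ + _);rewrite -(pair_bigA _ (fun x y=> F (_ x, _ y)))/=;apply: eq_bigr=> x _.
by rewrite big_sumType/= [X in _ + X]big_pred0 ?addn0.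
by rewrite big_sumType/= big_pred0.
Qed.

(** A list of pairs, each within one side, interleaves [j] pairs of the first side with [m - j] of
    the second. The binomial coefficient arises by Pascal's rule, according to the side of the
    head. *)
Lemma sum_shuffle m (H : seq (I1 * I1) -> seq (I2 * I2) -> nat) :
\sum_(l : m.-tuple (J * J) | all same_side l) H (lefts l) (rights l) =
\sum_(j < m.+1) 'C(m, j) * \sum_(l1 : j.-tuple (I1 * I1)) \sum_(l2 : (m - j).-tuple (I2 * I2)) H l1 l2.
Proof.
elim: m H=> [|m IH] H.
rewrite (sum_tuple0 (all same_side) (fun l=> H (lefts l) (rights l))) mul1n big_ord1 bin0 mul1n.
rewrite (sum_tuple0 xpredT (fun l=> \sum_(l2 : 0.-tuple (I2 * I2)) H l l2)) mul1n.
by rewrite (sum_tuple0 xpredT (fun l=> H [::] l)) mul1n.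
rewrite (sum_tuple_cons _ (all same_side) (fun l=> H (lefts l) (rights l))).
transitivity (\sum_(c | same_side c) \sum_(l : m.-tuple (J * J) | all same_side l) H (lefts (c :: l)) (rights (c :: l))).
rewrite [RHS]big_mkcond;apply: eq_bigr=> c _/=;case: (same_side c)=> //=;by rewrite big_pred0.
rewrite sum_same_side/=.
under eq_bigr do rewrite (IH (fun l1 l2=> H (_ :: l1) l2)).
under [X in _ + X]eq_bigr do rewrite (IH (fun l1 l2=> H l1 (_ :: l2))).
rewrite exchange_big [X in _ + X]exchange_big/=.
pose S j k := \sum_(l1 : j.-tuple (I1 * I1)) \sum_(l2 : k.-tuple (I2 * I2)) H l1 l2.
have e1 (j : 'I_m.+1) : \sum_(c : I1 * I1) 'C(m, j) * (\sum_(l1 : j.-tuple (I1 * I1)) \sum_(l2 : (m - j).-tuple (I2 * I2)) H ((c.1, c.2) :: l1) l2) = 'C(m, j) * S j.+1 (m - j).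
rewrite -big_distrr/=;congr (_ * _);rewrite /S.
rewrite (sum_tuple_cons _ xpredT (fun l=> \sum_(l2 : (m - j).-tuple (I2 * I2)) H l l2)).
by apply: eq_bigr=> -[].
have e2 (j : 'I_m.+1) : \sum_(c : I2 * I2) 'C(m, j) * (\sum_(l1 : j.-tuple (I1 * I1)) \sum_(l2 : (m - j).-tuple (I2 * I2)) H l1 ((c.1, c.2) :: l2)) = 'C(m, j) * S j (m - j).+1.
rewrite -big_distrr/=;congr (_ * _);rewrite /S exchange_big;apply: eq_bigr=> l1 _.
by rewrite (sum_tuple_cons _ xpredT (fun l=> H l1 l));apply: eq_bigr=> -[].
rewrite (eq_bigr _ (fun j _=> e1 j)) (eq_bigr _ (fun j _=> e2 j)).
change (\sum_(j < m.+1) 'C(m, j) * S j.+1 (m - j) + \sum_(j < m.+1) 'C(m, j) * S j (m - j).+1 =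
\sum_(j < m.+2) 'C(m.+1, j) * S j (m.+1 - j)).
rewrite [RHS]big_ord_recl bin0 subn0/=.
under [X in _ = _ + X]eq_bigr do rewrite /bump leq0n add1n binS mulnDl subSS.
rewrite big_split/= addnA [LHS]addnC;congr (_ + _).
rewrite [LHS]big_ord_recl bin0 subn0;congr (_ + _).
rewrite [RHS]big_ord_recr/= bin_small// mul0n addn0;apply: eq_bigr=> j _.
by rewrite /bump leq0n add1n subnSK.
Qed.
End DisjointSum.

Section DisjointCounts.
Local Open Scope nat_scope.
Variables (I1 I2 : finType).
Local Notation J := (I1 + I2)%type.
Local Notation lpart := (lpart I1 I2).

Let il : injective (@inl I1 I2). Proof. by move=> x y []. Qed.
Let ir : injective (@inr I1 I2). Proof. by move=> x y []. Qed.

Lemma prodp_psum s1 s2 (l : seq (J * J)) : all (@same_side I1 I2) l ->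
prodp (psum s1 s2) l = psum (prodp s1 (lefts l)) (prodp s2 (rights l)).
Proof.
elim: l=> [//|[[x|x] [y|y]] l IH]//= /IH ->;apply/permP=> -[z|z];rewrite permM ?psuml ?psumr ?permM.
- by rewrite [RHS](inj_tperm _ _ _ il).
- by rewrite tpermD.
- by rewrite tpermD.
- by rewrite [RHS](inj_tperm _ _ _ ir).
Qed.

Lemma component_psuml s1 s2 (l : seq (J * J)) : all (@same_side I1 I2) l ->
component (psum s1 s2) l lpart = component s1 (lefts l) [set: I1]%SET.
Proof.
move=> ss;apply: (component_emb il)=> A.
elim: l ss=> [_|[[x|x] [y|y]] l IH]//=.
- split=> -[H1 H2];split=> //.
 by move=> x;have := H1 (inl x);rewrite psuml !mem_imset.
move=> [x|x];rewrite ?psuml ?psumr ?mem_imset//.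
by apply/imsetP/imsetP=> -[].
- move=> /IH{}IH;rewrite !invar_cons IH !mem_imset//.
- move=> /IH{}IH;rewrite invar_cons IH;split=> [[]//|H];split=> //.
by apply/imsetP/imsetP=> -[].
Qed.

Lemma component_psumr s1 s2 (l : seq (J * J)) : all (@same_side I1 I2) l ->
component (psum s1 s2) l (~: lpart)%SET = component s2 (rights l) [set: I2]%SET.
Proof.
move=> ss;rewrite lpartC;apply: (component_emb ir)=> A.
elim: l ss=> [_|[[x|x] [y|y]] l IH]//=.
- split=> -[H1 H2];split=> //.
 by move=> x;have := H1 (inr x);rewrite psumr !mem_imset.
move=> [x|x];rewrite ?psuml ?psumr ?mem_imset//.
by apply/imsetP/imsetP=> -[].
- move=> /IH{}IH;rewrite invar_cons IH;split=> [[]//|H];split=> //.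
by apply/imsetP/imsetP=> -[].
- move=> /IH{}IH;rewrite !invar_cons IH !mem_imset//.
Qed.

Definition setsum (U1 : {set I1}) (U2 : {set I2}) : {set J} :=
[set z | match z with inl x=> x \in U1 | inr y=> y \in U2 end]%SET.

Lemma porbit_psuml (t1 : {perm I1}) (t2 : {perm I2}) x :
porbit (psum t1 t2) (inl x) = setsum (porbit t1 x) finset.set0.
Proof.
rewrite (porbit_emb (t := t1))=> [|y];last exact: psuml.
apply/finset.setP=> -[z|z];rewrite finset.in_set ?mem_imset// finset.in_set0.
by apply/imsetP=> -[].
Qed.

Lemma porbit_psumr (t1 : {perm I1}) (t2 : {perm I2}) x :
porbit (psum t1 t2) (inr x) = setsum finset.set0 (porbit t2 x).
Proof.
rewrite (porbit_emb (t := t2))=> [|y];last exact: psumr.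
apply/finset.setP=> -[z|z];rewrite finset.in_set ?mem_imset// finset.in_set0.
by apply/imsetP=> -[].
Qed.

Lemma setsumU A1 A2 B1 B2 : (setsum A1 A2 :|: setsum B1 B2)%SET = setsum (A1 :|: B1)%SET (A2 :|: B2)%SET.
Proof. by apply/finset.setP=> -[z|z];rewrite !(finset.in_setU, finset.in_set). Qed.

Lemma rootings_psum (t1 : {perm I1}) (t2 : {perm I2}) U1 U2 mu :
rootings (psum t1 t2) (setsum U1 U2) mu =
\sum_(r <- splits mu) rootings t1 U1 r.1 * rootings t2 U2 r.2.
Proof.
elim: mu U1 U2=> [|k mu IH] U1 U2/=.
rewrite big_seq1/= mulnb;congr (nat_of_bool _);apply/eqP/andP=> [E|[/eqP -> /eqP ->]].
 split;apply/eqP/finset.setP=> z;rewrite finset.in_setT.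
  by have := finset.in_setT (inl z : J);rewrite -E finset.in_set.
 by have := finset.in_setT (inr z : J);rewrite -E finset.in_set.
by apply/finset.setP=> -[z|z];rewrite finset.in_set !finset.in_setT.
rewrite big_cat !big_map/= big_sumType/=;congr (_ + _).
under [RHS]eq_bigr do rewrite big_distrl/=.
rewrite exchange_big;apply: eq_big=> [x|x _].
 by rewrite finset.in_set (card_porbit_emb il (t := t1))// => y;exact: psuml.
by rewrite porbit_psuml setsumU finset.setU0 IH.
under [RHS]eq_bigr do rewrite big_distrr/=.
rewrite exchange_big;apply: eq_big=> [x|x _].
by rewrite finset.in_set (card_porbit_emb ir (t := t2))// => y;exact: psumr.
by rewrite porbit_psumr setsumU finset.setU0 IH.
Qed.

Lemma split_roots_psum (t1 : {perm I1}) (t2 : {perm I2}) al be mu :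
split_roots (psum t1 t2) lpart al be mu =
\sum_(r <- splits mu) rootings t1 finset.set0 (al :: r.1) * rootings t2 finset.set0 (be :: r.2).
Proof.
rewrite /split_roots big_sumType/= [X in _ + X]big_pred0 ?addn0=> [|y];last by rewrite in_lpart.
transitivity (\sum_(x | #|porbit t1 x| == al) \sum_(y | #|porbit t2 y| == be)
 \sum_(r <- splits mu) rootings t1 (porbit t1 x) r.1 * rootings t2 (porbit t2 y) r.2).
apply: eq_big=> [x|x _].
 by rewrite in_lpart (card_porbit_emb il (t := t1))// => y;exact: psuml.
rewrite big_sumType/= big_pred0 ?add0n=> [|y];last by rewrite in_lpart.
apply: eq_big=> [y|y _].
 by rewrite in_lpart (card_porbit_emb ir (t := t2))// => z;exact: psumr.
by rewrite porbit_psuml porbit_psumr setsumU finset.setU0 finset.set0U rootings_psum.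
under eq_bigr do rewrite exchange_big.
rewrite exchange_big;apply: eq_bigr=> r _/=.
rewrite big_distrl;apply: eq_big=> [x|x _];first by rewrite finset.in_set0.
rewrite big_distrr;apply: eq_big=> [y|y _];first by rewrite finset.in_set0.
by rewrite !finset.set0U.
Qed.

Lemma all_cycles_psum a (s1 : {perm I1}) (s2 : {perm I2}) :
all_cycles a (psum s1 s2) = all_cycles a s1 && all_cycles a s2.
Proof.
have e1 x : #|porbit (psum s1 s2) (inl x)| = #|porbit s1 x|.
by rewrite (card_porbit_emb il (t := s1))// => y;exact: psuml.
have e2 x : #|porbit (psum s1 s2) (inr x)| = #|porbit s2 x|.
by rewrite (card_porbit_emb ir (t := s2))// => y;exact: psumr.
apply/forallP/andP=> [H|[/forallP H1 /forallP H2] [x|x]];last 2 first.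
- by rewrite e1.
- by rewrite e2.
by split;apply/forallP=> x;rewrite -?e1 -?e2.
Qed.

Lemma proper_pairs_sides (l : seq (J * J)) : all (@same_side I1 I2) l ->
proper_pairs l = proper_pairs (lefts l) && proper_pairs (rights l).
Proof.
elim: l=> [//|[[x|x] [y|y]] l IH]//= /IH ->;rewrite ?(inj_eq il) ?(inj_eq ir) ?andbA//.
by rewrite [X in X && _]andbC.
Qed.

(** Invariance of [lpart] forces [s] to preserve the sides and every pair to stay within one of
    them, so all data decompose and only the order of the transpositions is interleaved. *)
Lemma split_count_sum a m al be mu : split_count a m lpart al be mu =
\sum_(j < m.+1) 'C(m, j) * \sum_(r <- splits mu)
 rooted_count I1 a j (al :: r.1) * rooted_count I2 a (m - j) (be :: r.2).
Proof.
pose G (s : {perm J}) l := component s l lpart * component s l (~: lpart)%SET * split_roots (prodp s l) lpart al be mu.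
have G0 s l : G s l != 0 -> invar s l lpart.
by rewrite /G;case c1 : (component s l lpart)=> // _;have /asboolP[] := c1.
have invside s l : invar s l lpart -> all (@same_side I1 I2) l.
by move=> [_ H];apply/allP=> -[[x|x] [y|y]] /H;rewrite ?in_lpart.
rewrite /split_count /weight -/G.
pose W1 s1 l1 := proper_pairs l1 * (component s1 l1 [set: I1]%SET : nat).
pose W2 s2 l2 := proper_pairs l2 * (component s2 l2 [set: I2]%SET : nat).
pose H (s1 : {perm I1}) (s2 : {perm I2}) l1 l2 := W1 s1 l1 * W2 s2 l2 *
\sum_(r <- splits mu) rootings (prodp s1 l1) finset.set0 (al :: r.1) * rootings (prodp s2 l2) finset.set0 (be :: r.2).
transitivity (\sum_(s : {perm J}) all_cycles a s * \sum_(l : m.-tuple (J * J) | all (@same_side I1 I2) l) proper_pairs l * G s l).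
rewrite [LHS]big_mkcond;apply: eq_bigr=> s _;case: (all_cycles a s);rewrite ?mul1n ?mul0n//.
rewrite [LHS]big_mkcond [RHS]big_mkcond;apply: eq_bigr=> l _.
case: (proper_pairs l);rewrite ?mul1n ?mul0n;last by case: ifP.
case: ifPn=> // nss;apply/eqP;apply: contraNT nss=> /G0;exact: invside.
rewrite sum_psum=> [|s];last first.
rewrite muln_eq0 negb_or=> /andP[_];rewrite sum_nat_eq0=> /forallPn[l];rewrite negb_imply=> /andP[_].
by rewrite muln_eq0 negb_or=> /andP[_ /G0[]].
transitivity (\sum_(s1 | all_cycles a s1) \sum_(s2 | all_cycles a s2)
 \sum_(l : m.-tuple (J * J) | all (@same_side I1 I2) l) H s1 s2 (lefts l) (rights l)).
rewrite [RHS]big_mkcond;apply: eq_bigr=> s1 _.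
transitivity (\sum_s2 (all_cycles a s1 && all_cycles a s2) * \sum_(l : m.-tuple (J * J) | all (@same_side I1 I2) l) H s1 s2 (lefts l) (rights l)).
 apply: eq_bigr=> s2 _;rewrite all_cycles_psum;congr (_ * _);apply: eq_bigr=> l ss.
 rewrite /G component_psuml// component_psumr// prodp_psum// split_roots_psum proper_pairs_sides//.
 by rewrite /H /W1 /W2 -mulnb;ring.
case: (all_cycles a s1)=> /=;last by rewrite big1.
by rewrite [RHS]big_mkcond;apply: eq_bigr=> s2 _;case: (all_cycles a s2);rewrite ?mul1n ?mul0n.
under eq_bigr do under eq_bigr do rewrite (sum_shuffle m (H _ _)).
under eq_bigr do rewrite exchange_big/=.
rewrite exchange_big;apply: eq_bigr=> j _/=.
under eq_bigr do rewrite -big_distrr/=.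
rewrite -big_distrr/=;congr (_ * _).
pose R1 s1 l1 (r : seq nat * seq nat) := W1 s1 l1 * rootings (prodp s1 l1) finset.set0 (al :: r.1).
pose R2 s2 l2 (r : seq nat * seq nat) := W2 s2 l2 * rootings (prodp s2 l2) finset.set0 (be :: r.2).
have e1 r : rooted_count I1 a j (al :: r.1) = \sum_(s1 | all_cycles a s1) \sum_(l1 : j.-tuple (I1 * I1)) R1 s1 l1 r.
apply: eq_bigr=> s1 _;rewrite [LHS]big_mkcond;apply: eq_bigr=> l1 _.
by rewrite /R1 /W1;case: (proper_pairs l1);rewrite ?mul1n ?mul0n.
have e2 r : rooted_count I2 a (m - j) (be :: r.2) = \sum_(s2 | all_cycles a s2) \sum_(l2 : (m - j).-tuple (I2 * I2)) R2 s2 l2 r.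
apply: eq_bigr=> s2 _;rewrite [LHS]big_mkcond;apply: eq_bigr=> l2 _.
by rewrite /R2 /W2;case: (proper_pairs l2);rewrite ?mul1n ?mul0n.
under [RHS]eq_bigr do rewrite e1 e2 big_distrl/=.
rewrite [RHS]exchange_big;apply: eq_bigr=> s1 _/=.
under [RHS]eq_bigr do rewrite big_distrr/=.
rewrite [RHS]exchange_big;apply: eq_bigr=> s2 _/=.
under [RHS]eq_bigr do rewrite big_distrl/=.
rewrite [RHS]exchange_big;apply: eq_bigr=> l1 _/=.
under [RHS]eq_bigr do rewrite big_distrr/=.
rewrite [RHS]exchange_big;apply: eq_bigr=> l2 _/=.
rewrite /H big_distrr/=;apply: eq_bigr=> r _;rewrite /R1 /R2;ring.
Qed.
End DisjointCounts.

(** * The recursion for counts that depend on cardinalities only *)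

Section Recursion.
Local Open Scope nat_scope.
Variable a : nat.

Definition rcount d m mu : nat := rooted_count 'I_d a m mu.

Lemma rooted_count_card (I : finType) m mu : rooted_count I a m mu = rcount #|I| m mu.
Proof. by apply: (rooted_count_bij (f := enum_val) (f' := enum_rank));[exact: enum_valK|exact: enum_rankK]. Qed.

(** [S] and its complement are replaced by a disjoint sum of two types and then by ordinals of the
    same sizes. *)
Lemma split_count_card d (S : {set 'I_d}) m al be mu : split_count a m S al be mu =
\sum_(j < m.+1) 'C(m, j) * \sum_(r <- splits mu)
 rcount #|S| j (al :: r.1) * rcount (d - #|S|) (m - j) (be :: r.2).
Proof.
pose I1 : finType := {x : 'I_d | x \in S};pose I2 : finType := {x : 'I_d | x \notin S}.
have c1 : #|I1| = #|S| by rewrite card_sig;apply: eq_card=> x;rewrite finset.inE.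
have c2 : #|I2| = d - #|S|.
transitivity #|(~: S)%SET|;first by rewrite card_sig;apply: eq_card=> x;rewrite !finset.inE.
by have := finset.cardsC S;rewrite card_ord;lia.
pose f (z : I1 + I2) : 'I_d := match z with inl u=> val u | inr u=> val u end.
have fi : injective f.
move=> [x|x] [y|y]/= E;try by congr (_ _);apply: val_inj.
 by case: x y E=> [x xS] [y ny]/= E;exfalso;move: ny;rewrite -E xS.
by case: x y E=> [x nx] [y yS]/= E;exfalso;move: nx;rewrite E yS.
have [|f' K1 K2] := inj_card_bij fi;first by rewrite card_sum c1 c2 card_ord subnKC// -[leqRHS](card_ord d) max_card.
have ES : S = (f @: lpart I1 I2)%SET.
apply/finset.setP=> x;apply/idP/imsetP=> [xS|[[u|u]]].
- by exists (inl (exist (fun x=> x \in S) x xS));rewrite ?in_lpart.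
- by move=> _ ->;exact: valP.
- by rewrite in_lpart.
rewrite {1}ES (split_count_bij K1 K2) split_count_sum.
by apply: eq_bigr=> j _;congr (_ * _);apply: eq_bigr=> r _;rewrite !rooted_count_card c1 c2.
Qed.

Lemma sum_by_card d (F : nat -> nat) : \sum_(S : {set 'I_d}) F #|S| = \sum_(k < d.+1) 'C(d, k) * F k.
Proof.
rewrite (partition_big (fun S : {set 'I_d} => inord #|S| : 'I_d.+1) xpredT)//=;apply: eq_bigr=> k _.
rewrite (eq_bigl (fun S : {set 'I_d} => #|S| == k))=> [|S];last first.
have Sd : #|S| < d.+1 by rewrite ltnS -[leqRHS](card_ord d) max_card.
by rewrite -val_eqE/= inordK.
rewrite (eq_bigr (fun=> F k))=> [|S /eqP -> //].
by have := card_draws 'I_d k;rewrite card_ord cardsE sum_nat_const=> ->.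
Qed.

Lemma rcountS d m mu : rcount d m.+1 mu =
\sum_(p <- sel mu) \sum_(q <- sel p.2) p.1 * q.1 * rcount d m (p.1 + q.1 :: q.2) +
\sum_(p <- sel mu) p.1 * \sum_(al < p.1)
 (rcount d m (nat_of_ord al :: p.1 - al :: p.2) +
 \sum_(k < d.+1) 'C(d, k) * \sum_(j < m.+1) 'C(m, j) * \sum_(r <- splits p.2)
  rcount k j (nat_of_ord al :: r.1) * rcount (d - k) (m - j) (p.1 - al :: r.2)).
Proof.
rewrite /rcount rooted_count_rec;congr (_ + _);apply: eq_bigr=> p _;congr (_ * _).
apply: eq_bigr=> al _;congr (_ + _).
apply: etrans (sum_by_card d (fun k=> \sum_(j < m.+1) 'C(m, j) * \sum_(r <- splits p.2)
rcount k j (nat_of_ord al :: r.1) * rcount (d - k) (m - j) (p.1 - al :: r.2))).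
by apply: eq_bigr=> S _;rewrite split_count_card.
Qed.
End Recursion.

(** * Rooted counts compared with monodromy tuples *)

Section RootingsCount.
Local Open Scope nat_scope.

(** The product of the factorials of the multiplicities: each entry contributes the number of its
    occurrences from its position on. *)
Fixpoint autn (mu : seq nat) : nat := if mu is k :: mu' then count_mem k (k :: mu') * autn mu' else 1.

Variable d : nat.
Implicit Types (t : {perm 'I_d}) (U : {set 'I_d}).

Definition outer t U : {set {set 'I_d}} := [set C in porbits t | [disjoint C & U]]%SET.
Definition outer_sizes t U : seq nat := [seq #|C| | C : {set 'I_d} <- enum (outer t U)].

Lemma outer_mem t U x : stable t U -> (porbit t x \in outer t U) = (x \notin U).
Proof.
move=> st;rewrite finset.in_set imset_f//=;apply/pred0P/idP=> [H|xU y /=].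
by have := H x;rewrite/= porbit_id/= => ->.
by apply/negbTE/negP=> /andP[/st -> xU'];rewrite xU' in xU.
Qed.

Lemma outer_sizesU t U x : stable t U -> x \notin U ->
perm_eq (#|porbit t x| :: outer_sizes t (U :|: porbit t x)%SET) (outer_sizes t U).
Proof.
move=> st xU;rewrite -[_ :: _]/([seq #|C| | C : {set 'I_d} <- porbit t x :: enum (outer t (U :|: porbit t x)%SET)]).
apply: perm_map;apply: uniq_perm;rewrite/= ?enum_uniq ?andbT//.
by rewrite mem_enum outer_mem;[rewrite finset.in_setU porbit_id orbT|exact: stableU].
move=> C;rewrite seq.inE !mem_enum;apply/orP/idP=> [[/eqP ->|]|CU].
- by rewrite outer_mem.
- rewrite !finset.in_set=> /andP[/[dup] CP /imsetP[y _ ->] H];rewrite imset_f//=.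
by apply: disjointWr H;exact: finset.subsetUl.
have CP : C \in porbits t by move: CU;rewrite finset.in_set=> /andP[].
have /imsetP[y _ Cy] := CP;subst C;rewrite outer_mem// in CU.
have [E|n] := eqVneq (porbit t y) (porbit t x);[by left|right].
rewrite outer_mem;last exact: stableU.
by rewrite finset.in_setU negb_or CU -porbitE eq_sym.
Qed.

(** An entry is matched with one of the remaining cycles of its length and with a root in it. The
    first choices multiply to [autn mu], the second to the product of the entries. *)
Lemma rootings_count t U mu : stable t U ->
rootings t U mu = perm_eq mu (outer_sizes t U) * (autn mu * \prod_(k <- mu) k).
Proof.
elim: mu U=> [|k mu IH] U st/=.
rewrite big_nil !muln1;congr (nat_of_bool _);apply/eqP/idP=> [UT|].
 suff -> : outer_sizes t U = [::] by [].
 rewrite /outer_sizes (_ : outer t U = finset.set0) ?enum_set0//.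
 apply/finset.setP=> C;rewrite finset.in_set0;apply/negbTE/negP=> CU.
 have /imsetP[y _ Cy] : C \in porbits t by move: CU;rewrite finset.in_set=> /andP[].
 by move: CU;rewrite Cy outer_mem// UT finset.in_setT.
rewrite perm_sym=> /perm_nilP;rewrite /outer_sizes=> /(congr1 size);rewrite size_map/= -cardE=> /cards0_eq E.
by apply/finset.setP=> x;rewrite finset.in_setT;apply/negPn;rewrite -(outer_mem _ st) E finset.in_set0.
transitivity (\sum_(x | (x \notin U) && (#|porbit t x| == k)) perm_eq (k :: mu) (outer_sizes t U) * (autn mu * \prod_(i <- mu) i)).
apply: eq_bigr=> x /andP[xU /eqP ok];rewrite IH;last exact: stableU.
congr (nat_of_bool _ * _);have H := outer_sizesU st xU;rewrite ok in H.
by rewrite -(perm_cons k);apply/idP/idP=> E;[exact: perm_trans E H|rewrite perm_sym in H;exact: perm_trans E H].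
have [P|_] := boolP (perm_eq _ _);last by rewrite big1=> [//|x _];rewrite mul0n.
rewrite !mul1n sum_nat_const big_cons.
suff -> : #|[pred x | (x \notin U) && (#|porbit t x| == k)]| = k * count_mem k (k :: mu) by rewrite/=;ring.
rewrite (seq.permP P) /outer_sizes count_map -sum1_card.
rewrite (partition_big (porbit t) (mem [set C in outer t U | #|C| == k]%SET))/=;last first.
by move=> x /andP[xU kx];rewrite finset.in_set outer_mem// xU.
rewrite (eq_bigr (fun=> k))=> [|C];last first.
rewrite finset.in_set=> /andP[CU /eqP Ck].
have /imsetP[y _ Cy] : C \in porbits t by move: CU;rewrite finset.in_set=> /andP[].
rewrite -{2}Ck -sum1_card;apply: eq_bigl=> x;rewrite Cy;subst C;rewrite outer_mem// in CU.
rewrite [RHS](_ : _ = (x \in porbit t y))// -eq_porbit_mem;apply: andb_idl=> /eqP E.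
by rewrite !seq.inE/= E Ck eqxx andbT -(outer_mem x st) E outer_mem.
rewrite sum_nat_const mulnC;congr (_ * _);rewrite cardE -size_filter;apply: perm_size.
apply: uniq_perm;[exact: enum_uniq|exact: filter_uniq (enum_uniq _)|move=> C].
by rewrite [LHS]mem_enum [RHS]mem_filter [X in _ && X]mem_enum finset.in_set andbC.
Qed.

Lemma rootings0 t mu : rootings t finset.set0 mu = perm_eq mu (cycle_type t) * (autn mu * \prod_(k <- mu) k).
Proof.
rewrite rootings_count;last exact: stable0.
have E : outer t finset.set0 = porbits t.
apply/finset.setP=> C;rewrite finset.in_set;apply: andb_idr=> _.
by apply/pred0P=> x/=;rewrite finset.in_set0 andbF.
by rewrite /outer_sizes E.
Qed.
End RootingsCount.

Section TupleAut.
Local Open Scope nat_scope.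

(** Symmetries are sorted by the image [j] of the first index. Composition with the transposition of
    the first index and [j] reduces to symmetries fixing the first index, that is, to one index
    less. *)
Lemma card_fun_aut n (f : 'I_n -> nat) :
#|[pred s : 'S_n | [forall i, f (s i) == f i]]| = autn [seq f i | i <- enum 'I_n].
Proof.
elim: n f=> [|n IH] f.
rewrite (_ : enum 'I_0 = [::])/=;last by apply: size0nil;rewrite size_enum_ord.
rewrite (eq_card (B := pred1 (1%g : 'S_0))) ?card1// => s;rewrite !seq.inE/=.
have -> : s = 1%g by apply/permP=> -[].
by rewrite eqxx;apply/forallP=> -[].
rewrite enum_ordSl/= -sum1_card.
rewrite (partition_big (fun s : 'S_n.+1=> s ord0) (fun j=> f j == f ord0))/=;last by move=> s /forallP;exact.
rewrite (eq_bigr (fun=> autn [seq f i | i <- map (lift ord0) (enum 'I_n)]))=> [|j /eqP fj].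
rewrite sum_nat_const;congr (_ * _).
rewrite -[RHS]/(count_mem (f ord0) [seq f i | i <- ord0 :: map (lift ord0) (enum 'I_n)]) -enum_ordSl count_map cardE.
by rewrite -size_filter enumT.
rewrite -map_comp -IH -sum1_card.
have fT i : f (tperm ord0 j i) = f i by case: tpermP=> [->|->|].
rewrite (reindex_inj (mulIg (tperm ord0 j)))/=.
pose ul (s : 'S_n.+1) k := odflt k (unlift (s ord0) (s (lift ord0 k))).
have ulK (s : 'S_n.+1) k : lift (s ord0) (ul s k) = s (lift ord0 k).
rewrite /ul;have : s ord0 != s (lift ord0 k) by rewrite (inj_eq perm_inj) neq_lift.
by case/unlift_some=> k' -> ->.
have inj_ul (s : 'S_n.+1) : injective (ul s).
by move=> k k' E;apply: (@lift_inj _ ord0);apply: (@perm_inj _ s);rewrite -!ulK E.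
rewrite (reindex_onto (lift_perm ord0 ord0) (fun s=> perm (@inj_ul s)))/=;last first.
move=> s /andP[_];rewrite permM=> /eqP/(canRL (tpermK ord0 j));rewrite tpermR=> s0.
apply/permP=> i;case: (unliftP ord0 i)=> [k ->|->];last by rewrite lift_perm_id s0.
by rewrite lift_perm_lift permE -{1}s0 ulK.
apply: eq_bigl=> s.
have -> : perm (@inj_ul (lift_perm ord0 ord0 s)) = s.
apply/permP=> k;rewrite permE /ul lift_perm_id lift_perm_lift.
by rewrite liftK.
rewrite eqxx andbT permM lift_perm_id tpermL eqxx andbT;apply/forallP/forallP=> H i.
by have := H (lift ord0 i);rewrite permM fT lift_perm_lift.
rewrite permM fT;case: (unliftP ord0 i)=> [k ->|->];last by rewrite lift_perm_id.
by rewrite lift_perm_lift;exact: H.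
Qed.

Lemma card_tuple_aut n (mu : n.-tuple nat) : #|tuple_aut mu| = autn mu.
Proof.
rewrite [LHS](card_fun_aut (tnth mu));congr autn.
by rewrite map_tnth_enum.
Qed.
End TupleAut.

Section TranspositionCount.
Local Open Scope nat_scope.
Variable d : nat.
Implicit Types t : {perm 'I_d}.

Definition is_transp t := [exists xy : 'I_d * 'I_d, (xy.1 != xy.2) && (t == tperm xy.1 xy.2)].

Lemma count_pairs t : \sum_(xy : 'I_d * 'I_d | xy.1 != xy.2) (tperm xy.1 xy.2 == t) = 2 * is_transp t.
Proof.
have [/existsP[[x y]/= /andP[xy /eqP ->]]|H] := boolP (is_transp t);last first.
rewrite big1=> [//|[u v]/= uv];apply/eqP;rewrite eqb0;apply: contra H=> /eqP <-.
by apply/existsP;exists (u, v);rewrite/= uv eqxx.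
rewrite -big_mkcondr/= sum1_card.
rewrite (eq_card (B := [set (x, y);(y, x)]%SET))=> [|[u v]];last first.
rewrite !finset.inE/=;apply/andP/orP=> [[/= uv /eqP/= E]|];last first.
 by case=> /eqP[-> ->];rewrite ?xy;split=> //;[rewrite eq_sym|rewrite tpermC].
have := congr1 (fun t : {perm 'I_d} => t u) E;rewrite tpermL.
case: tpermP=> [-> ->|-> ->|_ _ vu];[by left|by right|by rewrite vu eqxx in uv].
by rewrite cards2/= xpair_eqE (negPf xy).
Qed.

Lemma transp_cycle_type t : (exists k, perm_eq (2 :: nseq k 1) (cycle_type t)) <-> is_transp t.
Proof.
split.
- move=> [k E];have : 2 \in cycle_type t by rewrite -(perm_mem E) seq.inE eqxx.
move=> /mapP[C];rewrite mem_enum=> CP C2.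
have /imsetP[x _ Cx] := CP.
have ones D : D \in porbits t -> D != C -> #|D| = 1.
 move=> DP DC;have H : perm_eq (nseq k 1) [seq #|B| | B : {set 'I_d} <- rem C (enum (porbits t))].
  rewrite -(perm_cons 2);apply: (perm_trans E);rewrite {1}C2.
  rewrite -[_ :: [seq _ | _ <- _]]/([seq #|B| | B : {set 'I_d} <- C :: rem C (enum (porbits t))]).
  by apply: perm_map;apply: perm_to_rem;rewrite mem_enum.
 have : #|D| \in [seq #|B| | B : {set 'I_d} <- rem C (enum (porbits t))].
  by apply: map_f;rewrite (mem_rem_uniq _ (enum_uniq _)) seq.inE DC mem_enum.
 by rewrite -(perm_mem H)=> /nseqP[].
have fixp z : #|porbit t z| = 1 -> t z = z.
 by move=> z1;have := iter_porbit t z;rewrite z1.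
have tx : t x != x by apply: (@iter_neq _ t x 1);rewrite -Cx -C2.
have ttx : t (t x) = x by have := iter_porbit t x;rewrite -Cx -C2.
apply/existsP;exists (x, t x);rewrite/= eq_sym tx/=;apply/eqP/permP=> z.
case: tpermP=> [-> //|-> //|zx ztx];apply: fixp;apply: ones;first exact: imset_f.
rewrite Cx eq_sym porbitE porbit_traject -Cx -C2/= !seq.inE negb_or.
by apply/andP;split;apply/eqP.
- move=> /existsP[[x y]/= /andP[xy /eqP tE]].
have yn : y \notin porbit 1 x by rewrite porbit1 finset.in_set1 eq_sym.
have [Ex Ey H] := porbit_mul_tperm yn;rewrite mul1g -tE !porbit1 in Ex Ey H.
have C2 : #|porbit t x| = 2 by rewrite Ex cards2 xy.
exists (size (rem (porbit t x) (enum (porbits t)))).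
have P : perm_eq (enum (porbits t)) (porbit t x :: rem (porbit t x) (enum (porbits t))).
 by apply: perm_to_rem;rewrite mem_enum imset_f.
rewrite perm_sym;apply: (perm_trans (perm_map (fun C : {set 'I_d} => #|C|) P)).
rewrite/= C2 perm_cons;set L := rem _ _.
suff -> : [seq #|C| | C : {set 'I_d} <- L] = nseq (size L) 1 by [].
rewrite -[size L](size_map (fun C : {set 'I_d} => #|C|));apply/all_pred1P/allP=> _ /mapP[C CL ->].
move: CL;rewrite (mem_rem_uniq _ (enum_uniq _)) seq.inE mem_enum=> /andP[nC /imsetP[z _ Cz]].
rewrite Cz in nC *;rewrite H ?porbit1 ?cards1//.
by apply: contra nC=> zz;rewrite eq_sym porbitE Ex.
Qed.

(** Each transposition comes from two ordered pairs, independently at each of the [m] places. *)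
Lemma sum_pairs_ffun m (F : {ffun 'I_m -> {perm 'I_d}} -> nat) :
\sum_(l : m.-tuple ('I_d * 'I_d) | proper_pairs l) F [ffun i=> tperm (tnth l i).1 (tnth l i).2] =
2 ^ m * \sum_(T : {ffun 'I_m -> {perm 'I_d}} | [forall i, is_transp (T i)]) F T.
Proof.
pose pr (c : 'I_d * 'I_d) := (c.1 != c.2 : nat).
transitivity (\sum_(L : {ffun 'I_m -> 'I_d * 'I_d}) (\prod_i pr (L i)) * F [ffun i=> tperm (L i).1 (L i).2]).
rewrite [RHS](reindex (fun l : m.-tuple ('I_d * 'I_d)=> [ffun i=> tnth l i]))/=;last first.
 exists (fun L : {ffun 'I_m -> 'I_d * 'I_d} => [tuple L i | i < m])=> [l _|L _].
  by apply: eq_from_tnth=> i;rewrite tnth_mktuple ffunE.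
 by apply/ffunP=> i;rewrite ffunE tnth_mktuple.
rewrite big_mkcond;apply: eq_bigr=> l _.
have -> : \prod_i pr ([ffun i=> tnth l i] i) = proper_pairs l.
 rewrite (eq_bigr (fun i=> pr (tnth l i)))=> [|i _];last by rewrite ffunE.
 have [/all_tnthP H|/allPn[c cl nc]] := boolP (proper_pairs l).
  by rewrite big1=> [//|i _];rewrite /pr H.
 by have /tnthP[i ci] := cl;rewrite (bigD1 i)//= /pr -ci (negPf nc).
case: (proper_pairs l);rewrite ?mul1n ?mul0n//;congr F;apply/ffunP=> i;by rewrite !ffunE.
transitivity (\sum_(L : {ffun 'I_m -> 'I_d * 'I_d}) \sum_(T : {ffun 'I_m -> {perm 'I_d}})
 (\prod_i (pr (L i) * (tperm (L i).1 (L i).2 == T i))) * F T).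
apply: eq_bigr=> L _;rewrite (bigD1 [ffun i=> tperm (L i).1 (L i).2])//= [X in _ + X]big1 ?addn0=> [|T nT].
 congr (_ * _);apply: eq_bigr=> i _;by rewrite ffunE eqxx muln1.
have /forallPn[i ni] : ~~ [forall i, tperm (L i).1 (L i).2 == T i].
 by apply: contra nT=> /forallP H;apply/eqP/ffunP=> i;rewrite ffunE (eqP (H i)).
by rewrite (bigD1 i)//= (negPf ni) muln0.
rewrite exchange_big big_distrr [RHS]big_mkcond/=;apply: eq_bigr=> T _.
rewrite -big_distrl/= -(bigA_distr_bigA (fun i c=> pr c * (tperm c.1 c.2 == T i))).
have E i : \sum_(c : 'I_d * 'I_d) pr c * (tperm c.1 c.2 == T i) = 2 * is_transp (T i).
rewrite -count_pairs [RHS]big_mkcond;apply: eq_bigr=> c _;rewrite /pr.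
by case: (c.1 != c.2);rewrite ?mul1n ?mul0n.
rewrite (eq_bigr _ (fun i _=> E i));case: ifPn=> [/forallP H|/forallPn[i ni]].
rewrite (eq_bigr (fun=> 2))=> [|i _];last by rewrite H.
by rewrite prod_nat_const card_ord.
by rewrite (bigD1 i)//= (negPf ni) !muln0 !mul0n.
Qed.
End TranspositionCount.

Section ValidCount.
Local Open Scope nat_scope.
Variables (a d m : nat) (j0 : 'I_m.+1).
Local Notation P := {perm 'I_d}.
Variable mu : seq nat.

(** Monodromy tuples follow the heights of the branch points, with 0 at position [j0], while the
    recursion puts the permutation over 0 first. Moving it to the front conjugates the entries it
    passes and keeps the product. The reversal matches [prodp], which multiplies by the head of its
    list last. *)
Definition insert_perm (sT : P * {ffun 'I_m -> P}) : {ffun 'I_m.+1 -> P} :=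
[ffun j=> if unlift j0 j is Some i then
 (if i < j0 then (sT.2 (rev_ord i) ^ sT.1^-1)%g else sT.2 (rev_ord i)) else sT.1].

Lemma insert_perm0 sT : insert_perm sT j0 = sT.1.
Proof. by rewrite ffunE unlift_none. Qed.

Lemma insert_permS sT i : insert_perm sT (lift j0 i) =
if i < j0 then (sT.2 (rev_ord i) ^ sT.1^-1)%g else sT.2 (rev_ord i).
Proof. by rewrite ffunE liftK. Qed.

Lemma insert_perm_bij : bijective insert_perm.
Proof.
apply: inj_card_bij=> [[s T] [s' T'] E|].
have Es : s = s' by have := congr1 (fun f : {ffun 'I_m.+1 -> P} => f j0) E;rewrite !insert_perm0.
subst s';congr (_, _);apply/ffunP=> i.
have := congr1 (fun f : {ffun 'I_m.+1 -> P} => f (lift j0 (rev_ord i))) E;rewrite !insert_permS/= !rev_ordK.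
by case: ifP=> // _ /conjg_inj.
by rewrite card_prod !card_ffun !card_ord expnS.
Qed.

Lemma insert_perm_prod s T : (\prod_j insert_perm (s, T) j = s * \prod_i T (rev_ord i))%g.
Proof.
pose T' i : P := if insub i is Some k then T (rev_ord k) else 1%g.
have T'E (i : 'I_m) : T' i = T (rev_ord i) by rewrite /T' valK.
pose s' j : P := if j < j0 then (T' j ^ s^-1)%g else if j == j0 then s else T' j.-1.
have s'E (j : 'I_m.+1) : insert_perm (s, T) j = s' j.
rewrite /s';case: (unliftP j0 j)=> [i ->|->];last by rewrite insert_perm0 ltnn eqxx.
rewrite insert_permS/= -T'E/= /bump;case: (ltnP i j0)=> ij.
 by rewrite (_ : false + i = i)// ij.
by rewrite (_ : true + i = i.+1)// ltnNge leqW//= gtn_eqF// ltnS.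
rewrite (eq_bigr _ (fun j _=> s'E j)) -(big_mkord xpredT s').
rewrite (eq_bigr _ (fun i _=> esym (T'E i))) -(big_mkord xpredT T').
have jm : j0 <= m by rewrite -ltnS.
rewrite (@big_cat_nat _ _ _ j0)//=;last exact: leqW.
rewrite [in RHS](@big_cat_nat _ _ _ j0)//=.
have -> : (\prod_(j0 <= i < m.+1) s' i = s * \prod_(j0 <= i < m) T' i)%g.
rewrite big_ltn ?ltnS// big_add1/=;congr (_ * _)%g;first by rewrite /s' ltnn eqxx.
by apply: eq_big_nat=> i /andP[ij _];rewrite /s' ltnNge leqW//= gtn_eqF// ltnS.
have -> : (\prod_(0 <= i < j0) s' i = (\prod_(0 <= i < j0) T' i) ^ s^-1)%g.
rewrite (big_morph (fun t : P=> (t ^ s^-1)%g) (fun x y=> conjMg x y _) (conj1g _)).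
by apply: eq_big_nat=> i /andP[_ ij];rewrite /s' ij.
by rewrite conjgE invgK !mulgA mulgKV.
Qed.

Lemma all_cycles_type (t : P) : 0 < a -> (exists k, perm_eq (nseq k a) (cycle_type t)) <-> all_cycles a t.
Proof.
move=> a0;split=> [[k E]|/forallP H].
apply/forallP=> x;have : #|porbit t x| \in cycle_type t.
 by apply: (map_f (fun C : {set 'I_d} => #|C|));rewrite mem_enum imset_f.
by rewrite -(perm_mem E)=> /nseqP[->].
exists (size (cycle_type t));suff -> : nseq (size (cycle_type t)) a = cycle_type t by [].
apply/esym/all_pred1P/allP=> _ /mapP[C + ->];rewrite mem_enum=> /imsetP[x _ ->];exact: H.
Qed.

Lemma cycle_type_conj (t w : P) : perm_eq (cycle_type (t ^ w)%g) (cycle_type t).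
Proof.
have inj : injective (fun C : {set 'I_d} => (w @: C)%SET) by apply: imset_inj;exact: perm_inj.
have E : porbits (t ^ w)%g = ((fun C : {set 'I_d} => (w @: C)%SET) @: porbits t)%SET.
have pe x : porbit (t ^ w)%g (w x) = (w @: porbit t x)%SET.
 by apply: porbit_emb=> y;rewrite permJ.
apply/finset.setP=> C;apply/imsetP/imsetP=> [[x _ ->]|[D /imsetP[x _ ->] ->]].
 by exists (porbit t ((w^-1)%g x));[exact: imset_f|rewrite -pe permKV].
by exists (w x).
apply: (@perm_trans _ [seq #|C| | C : {set 'I_d} <- [seq (w @: C)%SET | C : {set 'I_d} <- enum (porbits t)]]).
apply: perm_map;apply: uniq_perm;rewrite ?enum_uniq ?map_inj_uniq ?enum_uniq// => C.
rewrite mem_enum E;apply/imsetP/mapP=> -[D DP ->];exists D=> //;by rewrite ?mem_enum// -mem_enum.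
by rewrite -map_comp (@eq_map _ _ _ (fun C : {set 'I_d} => #|C|))=> [//|C /=];rewrite card_imset//;exact: perm_inj.
Qed.

Lemma is_transp_conj (t w : P) : is_transp (t ^ w)%g = is_transp t.
Proof.
by apply/idP/idP=> /transp_cycle_type[k E];apply/transp_cycle_type;exists k;apply: (perm_trans E);
[|rewrite perm_sym];exact: cycle_type_conj.
Qed.

Lemma irreducible_insert s T : irreducible (insert_perm (s, T)) <->
forall A : {set 'I_d}, (forall i, (s i \in A) = (i \in A)) -> (forall k i, (T k i \in A) = (i \in A)) ->
 A != finset.set0 -> A = [set: 'I_d]%SET.
Proof.
split=> H A.
move=> sA TA;apply: H=> j i;rewrite -[X in _ -> X]/(is_true (_ \in A)).
case: (unliftP j0 j)=> [k ->|->];last by rewrite insert_perm0 sA.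
rewrite insert_permS/=;case: ifP=> _;rewrite ?TA// conjgE invgK !permM.
by rewrite -[in X in _ -> X](sA ((s^-1)%g _)) permKV TA sA.
move=> HA;apply: H.
by apply: mem_perm_inv=> i;have := HA j0 i;rewrite insert_perm0.
move=> k;apply: mem_perm_inv=> i iA.
have sA : forall i, (s i \in A) = (i \in A) by apply: mem_perm_inv=> x;have := HA j0 x;rewrite insert_perm0.
have HK x : x \in A -> (if rev_ord k < j0 then (T k ^ s^-1)%g else T k) x \in A.
by have := HA (lift j0 (rev_ord k)) x;rewrite insert_permS/= rev_ordK.
move: HK;case: ifP=> _ HK;last exact: HK.
have := HK ((s^-1)%g i);rewrite conjgE invgK !permM permKV -(sA ((s^-1)%g i)) permKV=> /(_ iA).
by rewrite -sA permKV.
Qed.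

Lemma prodp_prod n s (l : n.-tuple ('I_d * 'I_d)) :
prodp s l = (s * \prod_(i < n) tperm (tnth l (rev_ord i)).1 (tnth l (rev_ord i)).2)%g.
Proof.
elim: n l=> [|n IH] l;first by rewrite tuple0/= big_ord0 mulg1.
case/tupleP: l=> c l;rewrite [LHS]/= IH big_ord_recr/= mulgA.
have -> : rev_ord ord_max = ord0 :> 'I_n.+1 by apply: val_inj;rewrite/= subnn.
rewrite tnth0;congr (_ * _ * _)%g;apply: eq_bigr=> i _.
have -> : rev_ord (widen_ord (leqnSn n) i) = lift ord0 (rev_ord i) by apply: val_inj;rewrite/= /bump subSn.
by rewrite tnthS.
Qed.

Lemma component_irreducible s (l : m.-tuple ('I_d * 'I_d)) : 0 < d -> component s l [set: 'I_d]%SET =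
`[< forall A : {set 'I_d}, (forall i, (s i \in A) = (i \in A)) ->
  (forall k i, (tperm (tnth l k).1 (tnth l k).2 i \in A) = (i \in A)) ->
  A != finset.set0 -> A = [set: 'I_d]%SET >].
Proof.
move=> d0;apply: asbool_equiv_eq.
have tA (A : {set 'I_d}) x y : (forall i, (tperm x y i \in A) = (i \in A)) <-> (x \in A) = (y \in A).
split=> [H|E i];first by rewrite -(H x) tpermL.
by case: tpermP=> [->|->|].
split=> [[_ _ H] A sA lA nA|H].
apply: H=> //;split=> // c /tnthP[k ->];exact/tA.
split;[|exact: invar_setT|move=> A _ nA [sA lA]].
by apply/finset.set0Pn;exists (Ordinal d0);rewrite finset.in_setT.
by apply: H=> // k;apply/tA;apply: lA;exact: mem_tnth.
Qed.

(** After reordering by [insert_perm], the counts differ by the choices of roots and by the ordered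
    pairs that represent transpositions. *)
Lemma rcount_valid : 0 < a -> 0 < d -> rcount a d m mu = autn mu * (\prod_(k <- mu) k) * 2 ^ m *
#|[set s : {ffun 'I_m.+1 -> P} | `[< valid a mu j0 s >]]%SET|.
Proof.
move=> a0 d0;rewrite -sum1_card (reindex insert_perm)/=;last exact/onW_bij/insert_perm_bij.
pose irr (s : P) (T : {ffun 'I_m -> P}) : bool := `[< forall A : {set 'I_d}, (forall i, (s i \in A) = (i \in A)) ->
 (forall k i, (T k i \in A) = (i \in A)) -> A != finset.set0 -> A = [set: 'I_d]%SET >].
have vE s T : (insert_perm (s, T) \in [set s : {ffun 'I_m.+1 -> P} | `[< valid a mu j0 s >]]%SET) =
 [&& all_cycles a s, [forall i, is_transp (T i)] & perm_eq mu (cycle_type (s * \prod_i T (rev_ord i))%g) && irr s T].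
rewrite finset.in_set;apply/asboolP/and3P.
 move=> [h1 h2 h3 /irreducible_insert h4];split.
 - by apply/(all_cycles_type _ a0);rewrite insert_perm0 in h1.
 - apply/forallP=> i;have := h2 (lift j0 (rev_ord i));rewrite eq_sym neq_lift=> /(_ isT)/transp_cycle_type.
  by rewrite insert_permS/= rev_ordK;case: ifP=> // _;rewrite is_transp_conj.
 - apply/andP;split;last exact/asboolP.
  by rewrite -insert_perm_prod.
move=> [/(all_cycles_type _ a0) h1 /forallP h2 /andP[h3 /asboolP/irreducible_insert h4]];split=> //.
- by rewrite insert_perm0.
- move=> j;case: (unliftP j0 j)=> [i ->|->];last by rewrite eqxx.
 move=> _;apply/transp_cycle_type;rewrite insert_permS/=;case: ifP=> _;by rewrite ?is_transp_conj.
- by rewrite /mono_inf insert_perm_prod.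
transitivity (\sum_(s | all_cycles a s) 2 ^ m * \sum_(T : {ffun 'I_m -> P} | [forall i, is_transp (T i)])
 irr s T * (perm_eq mu (cycle_type (s * \prod_i T (rev_ord i))%g) * (autn mu * \prod_(k <- mu) k))).
apply: eq_bigr=> s _;rewrite -(sum_pairs_ffun (fun T=> irr s T * (perm_eq mu (cycle_type (s * \prod_i T (rev_ord i))%g) * (autn mu * \prod_(k <- mu) k)))).
apply: eq_bigr=> l _;rewrite rootings0 component_irreducible// prodp_prod.
rewrite [in RHS](eq_bigr (fun i=> tperm (tnth l (rev_ord i)).1 (tnth l (rev_ord i)).2))=> [|i _];last by rewrite ffunE.
congr (_ * _);congr nat_of_bool;apply: asbool_equiv_eq;split=> H A sA lA nA;apply: H=> // k i.
 by have := lA k i;rewrite ffunE.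
by have := lA k i;rewrite ffunE.
rewrite -big_distrr/= [RHS]mulnAC [RHS]mulnC [RHS]mulnA;rewrite -[RHS]mulnA;congr (_ * _).
rewrite [RHS]big_distrr/=.
transitivity (\sum_s \sum_T (insert_perm (s, T) \in [set s : {ffun 'I_m.+1 -> P} | `[< valid a mu j0 s >]]%SET) *
 (autn mu * \prod_(k <- mu) k)).
rewrite big_mkcond;apply: eq_bigr=> s _;case: ifPn=> [As|nAs];last first.
 by rewrite big1=> [//|T _];rewrite vE (negPf nAs).
rewrite big_mkcond;apply: eq_bigr=> T _;rewrite vE As/=;case: ifP=> _//=.
by rewrite mulnA mulnb andbC.
rewrite pair_big/= [RHS]big_mkcond;apply: eq_bigr=> -[s T] _/=.
by case: (_ \in _);rewrite ?mul1n ?mul0n ?muln1.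
Qed.
End ValidCount.

(** * Degree, genus and base case of the counts *)

Section CountFacts.
Local Open Scope nat_scope.
Variable a : nat.
Hypothesis a0 : 0 < a.

Lemma autn_perm (mu nu : seq nat) : perm_eq mu nu -> autn mu = autn nu.
Proof.
have cm (k : nat) s t : perm_eq s t -> count_mem k s = count_mem k t by move=> /seq.permP;exact.
elim: {mu}(size mu) {-2}mu (eqxx (size mu)) nu=> [|n IH] [|k mu]// sz nu E.
by move: (perm_size E);case: nu {E}.
have knu : k \in nu by rewrite -(perm_mem E) mem_head.
have E1 : perm_eq nu (k :: rem k nu) := perm_to_rem knu.
have E2 : perm_eq mu (rem k nu) by rewrite -(perm_cons k);exact: perm_trans E E1.
have key s : k \in s -> autn s = count_mem k s * autn (rem k s).
elim: s=> [//|l s IHs];rewrite seq.inE/= ;case: (eqVneq k l)=> [->|kl]/= ks;first by rewrite eqxx.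
rewrite eqxx (IHs ks) add0n count_rem ks/= (negbTE kl) subn0;ring.
rewrite (key nu knu)/= -(IH mu _ (rem k nu))//.
by rewrite (cm k _ _ E1)/= (cm k _ _ E2).
Qed.

Lemma rcount_neq0 d m mu : rcount a d m mu != 0 -> sumn mu = d /\ 0 \notin mu.
Proof.
rewrite /rcount /rooted_count /weight sum_nat_eq0=> /forallPn[s];rewrite negb_imply=> /andP[_].
rewrite sum_nat_eq0=> /forallPn[l];rewrite negb_imply=> /andP[_].
rewrite muln_eq0 negb_or rootings0 muln_eq0 negb_or=> /andP[_ /andP[E _]].
have {}E : perm_eq mu (cycle_type (prodp s l)) by move: E;case: perm_eq.
split;first by rewrite (perm_sumn E) sumn_cycle_type.
rewrite (perm_mem E);apply/negP=> /mapP[C + C0];rewrite mem_enum=> /imsetP[x _ Cx].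
by have := card0_eq (esym C0) x;rewrite Cx porbit_id.
Qed.

Lemma rcount_perm d m mu nu : perm_eq mu nu -> rcount a d m mu = rcount a d m nu.
Proof.
move=> E;apply: eq_weight=> s l _ _;rewrite !rootings0 (autn_perm E) (perm_big _ E)/=.
by congr (_ * (nat_of_bool _ * _));apply/idP/idP=> H;[rewrite perm_sym in E|];exact: perm_trans E H.
Qed.

Lemma component_nil d (s : {perm 'I_d}) x : component s [::] [set: 'I_d]%SET -> porbit s x = [set: 'I_d]%SET.
Proof.
move=> /asboolP[_ _ H];apply: H=> //;first by apply/finset.set0Pn;exists x;exact: porbit_id.
by split=> // y;rewrite -!porbitE porbit_step.
Qed.

Lemma component_nil_orbit d (s : {perm 'I_d}) x : porbit s x = [set: 'I_d]%SET -> component s [::] [set: 'I_d]%SET.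
Proof.
move=> E;apply/asboolP;split;[by apply/finset.set0Pn;exists x;rewrite finset.in_setT|exact: invar_setT|].
move=> A _ /finset.set0Pn[y yA] iA;apply/finset.setP=> z;rewrite finset.in_setT.
have zy : z \in porbit s y.
have : y \in porbit s x by rewrite E finset.in_setT.
by rewrite -!porbitE=> /eqP <-;rewrite porbitE E finset.in_setT.
by rewrite (invar_stable iA zy).
Qed.

Lemma rcount0_neq0 d mu : rcount a d 0 mu != 0 -> d = a /\ mu = [:: a].
Proof.
move=> /[dup] nz;rewrite /rcount /rooted_count /weight sum_nat_eq0=> /forallPn[s];rewrite negb_imply=> /andP[/forallP As].
rewrite (sum_tuple0 _ (fun l=> component s l [set: 'I_d]%SET * rootings (prodp s l) finset.set0 mu))/= mul1n.
rewrite muln_eq0 negb_or rootings0 muln_eq0 negb_or=> /andP[cs /andP[E _]].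
have {}E : perm_eq mu (cycle_type s) by move: E;case: perm_eq.
have {}cs : component s [::] [set: 'I_d]%SET by move: cs;case: component.
have [x _] : exists x : 'I_d, true.
by have /asboolP[/finset.set0Pn[x _] _ _] := cs;exists x.
have Ex := component_nil x cs;have da : d = a by have := As x;rewrite Ex cardsT card_ord=> /eqP.
split=> //;have Pe : porbits s = [set [set: 'I_d]%SET]%SET.
apply/finset.setP=> C;rewrite finset.in_set1;apply/imsetP/eqP=> [[y _ ->]|->];first exact: component_nil.
by exists x.
have {}E : perm_eq mu [:: d].
by apply: (perm_trans E);rewrite /cycle_type Pe enum_set1/= cardsT card_ord.
by rewrite -da;apply: perm_small_eq E.
Qed.

Lemma sel_perm (s : seq nat) x : x \in sel s -> perm_eq s (x.1 :: x.2).
Proof.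
elim: s x=> [//|k s IHs] x/=;rewrite seq.inE=> /orP[/eqP -> //|/mapP[y /IHs E ->]]/=.
rewrite -(perm_cons k) in E;apply: (perm_trans E);exact/permPl/(perm_catCA [:: k] [:: y.1]).
Qed.

Lemma splits_perm (s : seq nat) r : r \in splits s -> perm_eq s (r.1 ++ r.2).
Proof.
elim: s r=> [|k s IHs] r/=;first by rewrite seq.inE=> /eqP ->.
rewrite mem_cat=> /orP[] /mapP[y /IHs E ->]/=;first by rewrite perm_cons.
by rewrite -(perm_cons k) in E;apply: (perm_trans E);rewrite perm_sym perm_catC/= perm_cons perm_catC.
Qed.

(** An arithmetic Riemann-Hurwitz formula, by induction along the recursion: merging two entries
    keeps the genus, splitting one within a connected configuration raises it by 1, and splitting
    into two components adds genera and degrees. *)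
Lemma rcount_genus d m mu : rcount a d m mu != 0 ->
(a %| d) /\ exists g, m + 2 = 2 * g + size mu + d %/ a.
Proof.
elim/ltn_ind: m d mu=> -[|m] IH d mu nz.
by have [-> ->] := rcount0_neq0 nz;rewrite dvdnn divnn a0;split=> //;exists 0.
have [sd _] := rcount_neq0 nz.
move: nz;rewrite rcountS addn_eq0 negb_and=> /orP[|].
- rewrite sum_nat_seq_neq0=> /hasP[p /sel_perm/perm_size pmu /=];rewrite sum_nat_seq_neq0=> /hasP[q /sel_perm/perm_size qp /=].
rewrite muln_eq0 negb_or=> /andP[_ /(IH _ (ltnSn m))[ad [g Eg]]];split=> //;exists g.
by move: Eg pmu qp=> /=;move: (size q.2) (size mu) (size p.2) (d %/ a)=> *;lia.
- rewrite sum_nat_seq_neq0=> /hasP[p /sel_perm/[dup] /perm_sumn psum /perm_size pmu /=];rewrite muln_eq0 negb_or=> /andP[_].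
rewrite sum_nat_seq_neq0=> /hasP[al _ /=];rewrite addn_eq0 negb_and=> /orP[/(IH _ (ltnSn m))[ad [g Eg]]|].
 by split=> //;exists g.+1;move: Eg pmu=> /=;move: (size mu) (size p.2) (d %/ a)=> *;lia.
rewrite sum_nat_seq_neq0=> /hasP[k _ /=];rewrite muln_eq0 negb_or=> /andP[_].
rewrite sum_nat_seq_neq0=> /hasP[j _ /=];rewrite muln_eq0 negb_or=> /andP[_].
rewrite sum_nat_seq_neq0=> /hasP[r /splits_perm/perm_size rp /=];rewrite muln_eq0 negb_or=> /andP[n1 n2].
have jm : j < m.+1 by [].
have jm2 : m - j < m.+1 by rewrite ltnS leq_subr.
have [a1 [g1 E1]] := IH _ jm _ _ n1;have [a2 [g2 E2]] := IH _ jm2 _ _ n2.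
have kd : k <= d by rewrite -ltnS.
split;first by rewrite -(subnKC kd) dvdn_addr.
exists (g1 + g2);have -> : d %/ a = k %/ a + (d - k) %/ a by rewrite -(divnDl _ a1) subnKC.
move: E1 E2 rp pmu jm=> /=;rewrite size_cat.
move: (size r.1) (size r.2) (size p.2) (size mu) (nat_of_ord j) (k %/ a) ((d - k) %/ a)=> *;lia.
Qed.

(** Pairs of an [a]-cycle and a root correspond to permutations [w]: the standard cycle is
    conjugated by [w], and the root is the image of [x0]. *)
Lemma rcount_cycle : rcount a a 0 [:: a] = a`!.
Proof.
pose x0 : 'I_a := Ordinal a0.
pose c : {perm 'I_a} := perm (@ordS_inj a).
have cX i : (i < a) -> val ((c ^+ i)%g x0) = i.
elim: i=> [|i IH] ia;first by rewrite expg0 perm1.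
by rewrite expgSr permM permE/= (IH (ltnW ia)) modn_small.
pose f (w : {perm 'I_a}) : {perm 'I_a} * 'I_a := ((c ^ w)%g, w x0).
have fX (w : {perm 'I_a}) (i : 'I_a) : w i = (((c ^ w) ^+ i)%g (w x0)).
by rewrite -conjXg permJ;congr (w _);apply: val_inj;rewrite cX.
have f_inj : injective f.
by move=> w w' [E1 E2];apply/permP=> i;rewrite fX E1 E2 -fX.
pose A := [set p : {perm 'I_a} * 'I_a | porbit p.1 p.2 == [set: 'I_a]%SET]%SET.
have Af : A = (f @: [set: {perm 'I_a}])%SET.
apply/finset.setP=> -[s x];rewrite finset.in_set/=;apply/eqP/imsetP=> [E|[w _ [-> ->]]].
 have oa : #|porbit s x| = a by rewrite E cardsT card_ord.
 have winj : injective (fun i : 'I_a=> (s ^+ i)%g x).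
  move=> i j/= Eij;apply: val_inj;apply/eqP.
  have := uniq_traject_porbit s x;rewrite oa=> u.
  have si : i < size (traject s x a) by rewrite size_traject.
  have sj : j < size (traject s x a) by rewrite size_traject.
  by rewrite -(nth_uniq x si sj u) !nth_traject// -!permX Eij.
 exists (perm winj);first by rewrite finset.in_setT.
 have w0 : perm winj x0 = x by rewrite permE/= expg0 perm1.
 rewrite /f w0;congr (_, _).
 apply/permP=> y;rewrite -[y](permKV (perm winj));move: (((perm winj)^-1)%g y)=> i.
 rewrite permJ !permE/=;have [ia|ia] := ltnP i.+1 a;first by rewrite modn_small// expgSr permM.
 have -> : i.+1 = a by apply/eqP;rewrite eqn_leq ia andbT.
 rewrite modnn expg0 perm1.
 have -> : s ((s ^+ i)%g x) = (s ^+ i.+1)%g x by rewrite expgSr permM.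
 have -> : i.+1 = #|porbit s x| by rewrite oa;apply/eqP;rewrite eqn_leq ia andbT.
 by rewrite permX iter_porbit.
apply/finset.setP=> y;rewrite finset.in_setT;apply/porbitP;exists ((w^-1)%g y).
by rewrite -fX permKV.
have <- : #|A| = a`! by rewrite Af card_imset// cardsT card_Sn.
rewrite /rcount /rooted_count /weight -sum1_card (eq_bigl (fun p : {perm 'I_a} * 'I_a=> true && (porbit p.1 p.2 == [set: 'I_a]%SET)));last by move=> p;rewrite finset.in_set.
rewrite -(pair_big_dep xpredT (fun (s : {perm 'I_a}) x=> porbit s x == [set: 'I_a]%SET) (fun _ _=> 1))/=.
rewrite big_mkcond/=;apply: eq_bigr=> s _.
have Es x y : porbit s x = [set: 'I_a]%SET -> porbit s y = [set: 'I_a]%SET.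
by move=> /component_nil_orbit;exact: component_nil.
rewrite (sum_tuple0 _ (fun l=> component s l [set: 'I_a]%SET * rootings (prodp s l) finset.set0 [:: a]))/= mul1n.
case: (boolP (component s [::] [set: 'I_a]%SET))=> [cs|ncs].
have Ex x := component_nil x cs.
have -> : all_cycles a s by apply/forallP=> x;rewrite Ex cardsT card_ord.
rewrite mul1n;apply: eq_big=> [x|x _];first by rewrite finset.in_set0/= !Ex cardsT card_ord !eqxx.
by rewrite finset.set0U Ex eqxx.
rewrite mul0n if_same big1// => x /eqP E.
by rewrite (component_nil_orbit E) in ncs.
Qed.
End CountFacts.

(** * Rooted Hurwitz numbers and their cut-and-join equation *)

Local Notation cut_at p al := (nat_of_ord al :: p.1 - al :: p.2)%N.

(** Right-hand side of the cut-and-join equation for rooted numbers. The argument [hp] stands for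
    the numbers of genus one less, zero in genus 0. *)
Local Notation cut_join_sum hp h g mu :=
 (\sum_(p <- sel mu) \sum_(q <- sel p.2) p.1%:R * q.1%:R * h g (p.1 + q.1 :: q.2)%N +
\sum_(p <- sel mu) p.1%:R * \sum_(al < p.1)
 (hp g (cut_at p al) +
 \sum_(r <- splits p.2) \sum_(g1 < g.+1) h g1 (nat_of_ord al :: r.1) * h (g - g1)%N (p.1 - al :: r.2)%N)).

Section RootedNumbers.
Variables (R : realType) (a : nat).
Hypothesis a0 : (0 < a)%N.

(* Hurwitz numbers whose points over infinity carry a choice of sheet each, which
 multiplies the usual number by the product of the ramification indices. *)
Definition hroot g (mu : seq nat) : R :=
let d := sumn mu in let m := (2 * g + size mu + d %/ a - 2)%N in
if (a %| d)%N then (rcount a d m mu)%:R / (2 ^ m * m`! * d`!)%:R else 0.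

Lemma hroot_perm g mu nu : perm_eq mu nu -> hroot g mu = hroot g nu.
Proof. by move=> E;rewrite /hroot (perm_sumn E) (perm_size E) (rcount_perm _ _ _ E). Qed.

Lemma hroot_dvd g mu : ~~ (a %| sumn mu)%N -> hroot g mu = 0.
Proof. by rewrite /hroot=> /negbTE ->. Qed.

Lemma hroot_mem0 g mu : 0%N \in mu -> hroot g mu = 0.
Proof.
move=> m0;rewrite /hroot;case: ifP=> // _.
by case: eqVneq (@rcount_neq0 a (sumn mu) (2 * g + size mu + sumn mu %/ a - 2) mu)=> [->|_ /(_ isT)[_]];rewrite ?mul0r ?m0.
Qed.

Lemma norm_neq0 m d : ((2 ^ m * m`! * d`!)%:R : R) != 0.
Proof. by rewrite pnatr_eq0 -lt0n !muln_gt0 expn_gt0 !fact_gt0. Qed.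

Lemma rcount_hroot g mu m : (a %| sumn mu)%N -> (m + 2 = 2 * g + size mu + sumn mu %/ a)%N ->
(rcount a (sumn mu) m mu)%:R = (2 ^ m * m`! * (sumn mu)`!)%:R * hroot g mu.
Proof. by move=> ad Em;rewrite /hroot ad -Em addnK mulrC divfK// norm_neq0. Qed.

Lemma hroot_base : hroot 0 [:: a] = 1.
Proof.
rewrite /hroot/= addn0 dvdnn divnn a0/= mul1n (rcount_cycle a0) divff//.
Qed.

Definition hroot_pred g mu : R := if g is g'.+1 then hroot g' mu else 0.

(** Riemann-Hurwitz ties the number [j] of transpositions in the first component to its genus [g1],
    and the other [j] contribute nothing. The two binomial coefficients are absorbed by the
    factorials in [hroot]. *)
Lemma hroot_split m d g k al (r1 r2 : seq nat) be : (0 < be)%N ->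
(d = al + be + sumn r1 + sumn r2)%N -> (a %| d)%N -> k = (al + sumn r1)%N ->
(m + 3 = 2 * g + (size r1 + size r2).+1 + d %/ a)%N ->
('C(d, k) * \sum_(j < m.+1) 'C(m, j) * (rcount a k j (al :: r1) * rcount a (d - k) (m - j) (be :: r2)))%:R =
(2 ^ m * m`! * d`!)%:R * \sum_(g1 < g.+1) hroot g1 (al :: r1) * hroot (g - g1) (be :: r2).
Proof.
move=> be0 Ed ad Ek Em.
have kd : (k <= d)%N by rewrite Ek Ed;lia.
have Edk : (d - k = sumn (be :: r2))%N by rewrite/= Ed Ek;lia.
have Ek' : k = sumn (al :: r1) by [].
have [al0|alp] := posnP al.
rewrite !big1 ?mulr0 ?muln0// => i _;first by rewrite hroot_mem0 ?mul0r// al0 mem_head.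
case: eqVneq (@rcount_neq0 a k i (al :: r1))=> [->|_ /(_ isT)[_]];first by rewrite muln0.
by rewrite al0 mem_head.
have [ak|nak] := boolP (a %| k)%N;last first.
rewrite !big1 ?mulr0 ?muln0// => i _;first by rewrite hroot_dvd ?mul0r// -Ek'.
by case: eqVneq (@rcount_genus a a0 k i (al :: r1))=> [->|_ /(_ isT)[H]];[rewrite muln0|rewrite H in nak].
have adk : (a %| d - k)%N by rewrite dvdn_sub.
have dd : (d %/ a = k %/ a + (d - k) %/ a)%N by rewrite -(divnDl _ ak) subnKC.
have k1 : (0 < k %/ a)%N by rewrite divn_gt0// dvdn_leq// Ek;lia.
have k2 : (0 < (d - k) %/ a)%N by rewrite divn_gt0// dvdn_leq// Edk/=;lia.
pose J (g1 : nat) := (2 * g1 + size r1 + k %/ a - 1)%N.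
have JE g1 : (J g1 + 2 = 2 * g1 + size (al :: r1) + k %/ a)%N by rewrite /J/=;move: k1;clear;lia.
have Jm g1 : (g1 < g.+1)%N -> (J g1 < m.+1)%N.
by move: Em;rewrite dd /J;move: k1 k2;clear;move: (size r1) (size r2) (k %/ a)%N ((d - k) %/ a)%N=> *;lia.
have JE2 g1 : (g1 < g.+1)%N -> (m - J g1 + 2 = 2 * (g - g1) + size (be :: r2) + (d - k) %/ a)%N.
move: Em;rewrite dd /J/=;move: k1 k2;clear;move: (size r1) (size r2) (k %/ a)%N ((d - k) %/ a)%N=> *;lia.
pose G j := ('C(m, j) * (rcount a k j (al :: r1) * rcount a (d - k) (m - j) (be :: r2)))%N.
(* A nonzero term has a genus on each side by [rcount_genus]; the first one is the [g1] that
   accounts for [j]. *)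
have EG (j : 'I_m.+1) : G j = (\sum_(g1 < g.+1) (nat_of_ord j == J g1) * G j)%N.
have [G0|] := eqVneq (G j) 0%N;first by rewrite G0 big1// => i _;rewrite muln0.
rewrite /G !muln_eq0 !negb_or=> /and3P[_ n1 n2].
have [_ [g1 E1]] := rcount_genus a0 n1;have [_ [g2 E2]] := rcount_genus a0 n2.
have g1g : (g1 < g.+1)%N.
 have := ltn_ord j;move: E1 E2 Em;rewrite dd/=;clear.
 by move: (size r1) (size r2) (k %/ a)%N ((d - k) %/ a)%N (nat_of_ord j)=> *;lia.
have Jg : nat_of_ord j = J g1 by move: E1 (JE g1);clear;move: (nat_of_ord j)=> *;lia.
rewrite (bigD1 (Ordinal g1g))//= Jg eqxx mul1n big1 ?addn0// => i /negP ni.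
case: eqP=> // Ei;case: ni;apply/eqP/val_inj=> /=.
by move: Ei (JE g1) (JE i)=> /= ;clear;lia.
have -> : (\sum_(j < m.+1) G j = \sum_(g1 < g.+1) G (J g1))%N.
rewrite (eq_bigr _ (fun j _=> EG j)) exchange_big/=;apply: eq_bigr=> g1 _.
rewrite (bigD1 (Ordinal (Jm g1 (ltn_ord g1))))//= eqxx mul1n big1 ?addn0// => j.
by rewrite -val_eqE/= => /negbTE ->.
rewrite natrM natr_sum !mulr_sumr;apply: eq_bigr=> g1 _.
have Jl := Jm g1 (ltn_ord g1);rewrite ltnS in Jl.
rewrite /G !natrM Ek' (rcount_hroot (g := g1)) -?Ek' ?ak// Edk (rcount_hroot (g := (g - g1)%N)) -?Edk ?JE2// !natrM.
have -> : (d`!%:R : R) = 'C(d, k)%:R * (k`!%:R * (d - k)`!%:R) by rewrite -!natrM bin_fact.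
have -> : (m`!%:R : R) = 'C(m, J g1)%:R * ((J g1)`!%:R * (m - J g1)`!%:R) by rewrite -!natrM bin_fact.
have -> : ((2 ^ m)%:R : R) = (2 ^ J g1)%:R * (2 ^ (m - J g1))%:R by rewrite -natrM -expnD subnKC.
ring.
Qed.

(** The coefficient on the left is twice the number of simple branch points: one step of the
    recursion lowers [2 ^ m] and [m!] in the normalization by the factors 2 and [m]. *)
Theorem hroot_cut_join g mu : (0 < size mu)%N -> 0%N \notin mu -> (a %| sumn mu)%N ->
2 * ((2 * g + size mu)%:R + (sumn mu)%:R / a%:R - 2) * hroot g mu =
cut_join_sum hroot_pred hroot g mu.
Proof.
move=> n0 mu0 ad;set d := sumn mu.
have d0 : (0 < d)%N.
by rewrite /d;case: (mu) n0 mu0=> [//|k s] _;rewrite seq.inE negb_or=> /andP[k0 _]/=;move: k0;lia.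
have da : (0 < d %/ a)%N by rewrite divn_gt0// dvdn_leq.
have aR : (a%:R : R) != 0 by rewrite pnatr_eq0 -lt0n.
have dE : (d%:R : R) / a%:R = (d %/ a)%:R by rewrite /d -{1}(divnK ad) natrM mulfK.
have [m Em] : exists m, (m + 2 = 2 * g + size mu + d %/ a)%N.
by exists (2 * g + size mu + d %/ a - 2)%N;move: n0 da;clear;lia.
have -> : (2 * g + size mu)%:R + d%:R / a%:R - 2 = m%:R :> R.
by rewrite dE -natrD -Em natrD addrK.
(* Without simple branch points only [mu = [:: a]] in genus 0 is possible, and both sides vanish: a
   cut of [a] has an entry 0 or an entry not divisible by [a]. *)
case: m Em=> [|m] Em.
have [g0 [n1 k1]] : g = 0%N /\ size mu = 1%N /\ (d %/ a = 1)%N.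
 by move: Em n0 da;clear;move: (size mu) (d %/ a)%N=> *;lia.
have {k1}da1 : d = a by rewrite /d -(divnK ad) -/d k1 mul1n.
have [k Ek] : exists k, mu = [:: k] by case: (mu) n1=> [|k [|]]//;exists k.
have ka : k = a by move: da1;rewrite /d Ek/= addn0.
rewrite Ek mulr0 mul0r !big_seq1/= big_nil add0r g0 ka big1 ?mulr0// => al _.
rewrite add0r big_seq1 big_ord1/=;have [al0|al0] := posnP al.
 by rewrite hroot_mem0 ?mul0r// al0 mem_head.
by rewrite hroot_dvd ?mul0r//= addn0 gtnNdvd.
have E1 := rcount_hroot ad Em.
have nz := norm_neq0 m d;apply: (mulfI nz).
have -> : (2 ^ m * m`! * d`!)%:R * (2 * m.+1%:R * hroot g mu) = (rcount a d m.+1 mu)%:R :> R.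
by rewrite /d E1 expnS factS !natrM;ring.
rewrite rcountS natrD mulrDr;congr (_ + _).
rewrite natr_sum mulr_sumr;apply: eq_big_seq=> p /sel_perm/[dup]/perm_sumn Ep /perm_size sp.
rewrite natr_sum mulr_sumr;apply: eq_big_seq=> q /sel_perm/[dup]/perm_sumn Eq /perm_size sq.
have sE : d = sumn (p.1 + q.1 :: q.2) by rewrite /d Ep/= Eq/= addnA.
rewrite sE !natrM (rcount_hroot (g := g)) -?sE//;first by rewrite !natrM;ring.
by move: Em sp sq=> /=;clear;move: (size mu) (size p.2) (size q.2) (d %/ a)%N=> *;lia.
rewrite natr_sum mulr_sumr;apply: eq_big_seq=> p /sel_perm/[dup]/perm_sumn Ep /perm_size sp.
rewrite natrM mulrCA;congr (_ * _);rewrite natr_sum mulr_sumr;apply: eq_bigr=> al _.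
have alp : (al < p.1)%N := ltn_ord al.
have sE : d = sumn (@nat_of_ord p.1 al :: p.1 - al :: p.2)%N by rewrite /d Ep/= addnA subnKC// ltnW.
rewrite natrD mulrDr;congr (_ + _).
case: g Em {E1} => [|g] Em/=.
 rewrite mulr0;have [->//|/(rcount_genus a0)[_ [g' E']]] := eqVneq (rcount a d m (@nat_of_ord p.1 al :: p.1 - al :: p.2)%N) 0%N.
 by exfalso;move: E' Em sp=> /=;clear;move: (size mu) (size p.2) (d %/ a)%N=> *;lia.
rewrite {1}sE (rcount_hroot (g := g)) -?sE//.
by move: Em sp=> /=;clear;move: (size mu) (size p.2) (d %/ a)%N=> *;lia.
have -> : (\sum_(k < d.+1) 'C(d, k) * (\sum_(j < m.+1) 'C(m, j) * (\sum_(r <- splits p.2)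
 rcount a k j (@nat_of_ord p.1 al :: r.1) * rcount a (d - k) (m - j) (p.1 - al :: r.2)%N)) =
\sum_(r <- splits p.2) \sum_(k < d.+1) 'C(d, k) * \sum_(j < m.+1) 'C(m, j) *
 (rcount a k j (@nat_of_ord p.1 al :: r.1) * rcount a (d - k) (m - j) (p.1 - al :: r.2)))%N.
rewrite exchange_big/=;apply: eq_bigr=> k _;rewrite -big_distrr/=;congr (_ * _)%N.
by rewrite exchange_big/=;apply: eq_bigr=> j _;rewrite big_distrr.
rewrite natr_sum mulr_sumr;apply: eq_big_seq=> r /splits_perm/[dup]/perm_sumn Er /perm_size sr.
rewrite sumn_cat size_cat in Er sr.
have kd : (al + sumn r.1 < d.+1)%N by rewrite sE/= Er;move: alp;move: (@nat_of_ord p.1 al)=> x;clear;move: (sumn r.1) (sumn r.2) (p.1)=> *;lia.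
(* The list of the first component determines its size [k]. *)
rewrite (bigD1 (Ordinal kd))//= [X in (_ + X)%N]big1 ?addn0;last first.
move=> k /negP nk;rewrite big1 ?muln0// => j _.
have [->|/rcount_neq0[Ek _]] := eqVneq (rcount a k j (@nat_of_ord p.1 al :: r.1)) 0%N;first by rewrite muln0.
by case: nk;apply/eqP/val_inj=> /=;rewrite -Ek.
apply: hroot_split=> //;first by rewrite subn_gt0.
by rewrite sE/= Er;move: alp;move: (@nat_of_ord p.1 al)=> x;clear;move: (sumn r.1) (sumn r.2) (p.1)=> *;lia.
by move: Em sp sr=> /=;clear;move: (size mu) (size p.2) (size r.1) (size r.2) (d %/ a)%N=> *;lia.
Qed.

(** Rooting multiplies the unrooted count by the number of automorphisms of [mu], already a factor
    of [hurwitzH], and by the product of the entries. *)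
Lemma hurwitzH_hroot (b : forall m : nat, m.-tuple (Cplx R)) g n (mu : n.-tuple nat) :
(forall m : nat, uniq (b m) /\ 0 \notin b m) -> (0 < n)%N -> (forall i, (0 < tnth mu i)%N) ->
hurwitzH b a g mu = hroot g mu / (\prod_(k <- mu) k)%:R.
Proof.
move=> hb n0 mu0;rewrite /hurwitzH;have [ad|nad] := boolP (a %| sumn mu)%N;last first.
by rewrite hroot_dvd// mul0r.
have mu0' : 0%N \notin (mu : seq nat).
by apply/negP=> /tnthP[i Ei];move: (mu0 i);rewrite -Ei.
have d0 : (0 < sumn mu)%N.
have : (0 < size mu)%N by rewrite size_tuple.
case: (tval mu) mu0'=> [//|k s];rewrite seq.inE negb_or=> /andP[k0 _] _/=;move: k0;clear;lia.
have da : (0 < sumn mu %/ a)%N by rewrite divn_gt0// dvdn_leq.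
have Em : (num_simple a g mu + 2 = 2 * g + size mu + sumn mu %/ a)%N.
by rewrite /num_simple size_tuple;move: n0 da;clear;move: (_ %/ a)%N=> *;lia.
set m := num_simple a g mu in Em *.
have [ub b0] := hb m.
have u0 : uniq (0 :: b m : seq (Cplx R)) by rewrite/= b0 ub.
have [lam [p [sp pP]]] := generic_order u0.
have [j0 pj0] : exists j0, p j0 = 0 by apply/pP;rewrite mem_head.
have wc := @hurwitz_count R (b m) a g mu a0 ub b0 d0 ad;rewrite size_tuple in wc.
have sz : (size (0 :: b m : seq (Cplx R))) = m.+1 by rewrite/= size_tuple.
have {wc} := wc Em _ _ _ j0 sz sp pP pj0.
set V := (valid_set _ _ _)=> wc.
(* The weighted count has only one possible value, so [xget] returns the one just found. *)
have -> : hurwitz_number b a g mu = #|V|%:R / (sumn mu)`!%:R.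
by apply: xget_subset1=> // x y;exact: weighted_count_unique.
rewrite card_tuple_aut.
have key : (autn mu * \prod_(k <- mu) k * 2 ^ m * #|V| = rcount a (sumn mu) m mu)%N.
move: j0 @V {pj0 p sp pP wc} ;rewrite sz=> j0 V;by rewrite (rcount_valid j0).
rewrite /hroot ad -Em addnK -key !natrM.
have P0 : ((\prod_(k <- mu) k)%:R : R) != 0.
rewrite pnatr_eq0 -lt0n big_seq;apply: prodn_cond_gt0=> k kmu.
by rewrite lt0n;apply: contraNneq mu0'=> <-.
have := norm_neq0 m (sumn mu);rewrite !natrM !mulf_eq0 !negb_or -andbA=> /and3P[N1 N2 N3].
by field;rewrite N1 N2 N3 P0.
Qed.
End RootedNumbers.

(** * Formal power series, Lagrange inversion and regularity at infinity *)

Record fps (R : realType) := Fps { coef : nat -> R }.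
Section Fps.
Variable R : realType.
Implicit Types (f g : fps R) (c : R) (n : nat).

Lemma fpsP f g : (forall n, coef f n = coef g n) -> f = g.
Proof. by case: f g=> [f] [g]/= /funext ->. Qed.

HB.instance Definition _ := gen_eqMixin (fps R).
HB.instance Definition _ := gen_choiceMixin (fps R).

Definition fps0 : fps R := Fps (fun=> 0).
Definition fps_opp f := Fps (fun n=> - coef f n).
Definition fps_add f g := Fps (fun n=> coef f n + coef g n).
Definition cst c : fps R := Fps (fun n=> if n == 0%N then c else 0).
Fact fps_mul_key : unit. Proof. by []. Qed.
Definition fps_mul f g := locked_with fps_mul_key (Fps (fun n=> \sum_(i < n.+1) coef f i * coef g (n - i))).
Lemma fps_mulE f g n : coef (fps_mul f g) n = \sum_(i < n.+1) coef f i * coef g (n - i).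
Proof. by rewrite /fps_mul unlock. Qed.

Lemma fps_addA : associative fps_add. Proof. by move=> f g k;apply: fpsP=> n/=;rewrite addrA. Qed.
Lemma fps_addC : commutative fps_add. Proof. by move=> f g;apply: fpsP=> n/=;rewrite addrC. Qed.
Lemma fps_add0 : left_id fps0 fps_add. Proof. by move=> f;apply: fpsP=> n/=;rewrite add0r. Qed.
Lemma fps_addN : left_inverse fps0 fps_opp fps_add. Proof. by move=> f;apply: fpsP=> n/=;rewrite addNr. Qed.

HB.instance Definition _ := GRing.isZmodule.Build (fps R) fps_addA fps_addC fps_add0 fps_addN.

(** The ring laws are checked one coefficient at a time on truncations, where they are those of
    polynomials. *)
Definition trunc n f : {poly R} := \poly_(i < n.+1) coef f i.

Lemma coef_trunc n f i : (i <= n)%N -> (trunc n f)`_i = coef f i.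
Proof. by move=> ni;rewrite coef_poly ltnS ni. Qed.

Lemma fps_mul_trunc n f g i : (i <= n)%N -> coef (fps_mul f g) i = (trunc n f * trunc n g)`_i.
Proof.
move=> ni;rewrite fps_mulE coefM;apply: eq_bigr=> j _.
by rewrite !coef_trunc// (leq_trans _ ni)// ?leq_subr// -ltnS.
Qed.

Lemma coefM_eq n (p q r s : {poly R}) : (forall i, (i <= n)%N -> p`_i = r`_i) ->
(forall i, (i <= n)%N -> q`_i = s`_i) -> (p * q)`_n = (r * s)`_n.
Proof.
move=> E1 E2;rewrite !coefM;apply: eq_bigr=> i _.
by rewrite E1 ?E2// ?leq_subr// -ltnS.
Qed.

Lemma fps_mulA : associative fps_mul.
Proof.
move=> f g k;apply: fpsP=> n;rewrite !(@fps_mul_trunc n)//.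
transitivity ((trunc n f * (trunc n g * trunc n k))`_n);last rewrite mulrA;apply: coefM_eq=> // i ni.
by rewrite coef_trunc// (fps_mul_trunc _ _ ni).
by rewrite coef_trunc// (fps_mul_trunc _ _ ni).
Qed.

Lemma fps_mulC : commutative fps_mul.
Proof. by move=> f g;apply: fpsP=> n;rewrite !(@fps_mul_trunc n)// mulrC. Qed.

Lemma coef_cstM c f n : coef (fps_mul (cst c) f) n = c * coef f n.
Proof. by rewrite fps_mulE big_ord_recl/= subn0 big1 ?addr0// => i _;rewrite mul0r. Qed.

Lemma fps_mul1 : left_id (cst 1) fps_mul.
Proof. by move=> f;apply: fpsP=> n;rewrite coef_cstM mul1r. Qed.

Lemma fps_mulDl : left_distributive fps_mul fps_add.
Proof. by move=> f g k;apply: fpsP=> n;rewrite/= !fps_mulE -big_split;apply: eq_bigr=> i _;rewrite mulrDl. Qed.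

Lemma fps_1neq0 : cst 1 != 0 :> fps R.
Proof. by apply/eqP=> /(congr1 (fun f=> coef f 0))/= /eqP;rewrite oner_eq0. Qed.

HB.instance Definition _ := GRing.Zmodule_isComNzRing.Build (fps R) fps_mulA fps_mulC fps_mul1 fps_mulDl fps_1neq0.

Lemma coefD f g n : coef (f + g) n = coef f n + coef g n. Proof. by []. Qed.
Lemma coefN f n : coef (- f) n = - coef f n. Proof. by []. Qed.
Lemma coef0 n : coef (0 : fps R) n = 0. Proof. by []. Qed.
Lemma coefM' f g n : coef (f * g) n = \sum_(i < n.+1) coef f i * coef g (n - i). Proof. exact: fps_mulE. Qed.
Lemma coefc c f n : coef (cst c * f) n = c * coef f n. Proof. exact: coef_cstM. Qed.
Lemma coef_sum (T : Type) (s : seq T) (F : T -> fps R) n : coef (\sum_(i <- s) F i) n = \sum_(i <- s) coef (F i) n.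
Proof. by elim/big_rec2: _=> // i x y _ <-. Qed.

Lemma cst_is_additive : zmod_morphism cst.
Proof. by move=> x y;apply: fpsP=> -[|n];rewrite coefD coefN/= ?subrr. Qed.
Lemma cst_is_multiplicative : monoid_morphism cst.
Proof. by split=> // x y;apply: fpsP=> -[|n];rewrite coefc//= mulr0. Qed.
HB.instance Definition _ := GRing.isZmodMorphism.Build R (fps R) cst cst_is_additive.
HB.instance Definition _ := GRing.isMonoidMorphism.Build R (fps R) cst cst_is_multiplicative.

Definition zz : fps R := Fps (fun n=> (n == 1%N)%:R).

Lemma coef_zz1M f n : coef (zz * f) n = if n is n'.+1 then coef f n' else 0.
Proof.
case: f=> F;rewrite coefM';case: n=> [|n];first by rewrite big_ord1/= mul0r.
by rewrite 2!big_ord_recl big1=> [|i _];rewrite/= ?mul0r// addr0 add0r mul1r subn1.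
Qed.

Lemma coef_zzM m f n : coef (zz ^+ m * f) n = if (n < m)%N then 0 else coef f (n - m).
Proof.
elim: m n=> [|m IH] n;first by rewrite expr0 mul1r subn0.
by rewrite exprS -mulrA coef_zz1M;case: n=> [//|n];rewrite IH.
Qed.

Lemma coef_zz m n : coef (zz ^+ m) n = (n == m)%:R.
Proof.
rewrite -[zz ^+ m]mulr1 coef_zzM;case: ltngtP=> //= [nm|->];last by rewrite subnn.
by rewrite subn_eq0 leqNgt nm.
Qed.

(** The Euler operator [z d/dz]. *)
Definition theta f := Fps (fun n=> n%:R * coef f n).

Lemma thetaD f g : theta (f + g) = theta f + theta g.
Proof. by apply: fpsP=> n/=;rewrite mulrDr. Qed.
Lemma thetaM f g : theta (f * g) = theta f * g + f * theta g.
Proof.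
apply: fpsP=> n;rewrite/= !coefM' mulr_sumr -big_split/=;apply: eq_bigr=> i _.
have {1}-> : n = (i + (n - i))%N by rewrite subnKC// -ltnS.
by rewrite natrD;ring.
Qed.
Lemma theta_cst c : theta (cst c) = 0.
Proof. by apply: fpsP=> -[|n]/=;rewrite ?mul0r ?mulr0. Qed.
Lemma theta_zz m : theta (zz ^+ m) = cst m%:R * zz ^+ m.
Proof. by apply: fpsP=> n;rewrite coefc/= coef_zz;case: eqP=> [->|];rewrite ?mulr0. Qed.
Lemma theta_cstM c f : theta (cst c * f) = cst c * theta f.
Proof. by rewrite thetaM theta_cst mul0r add0r. Qed.

Variable a : nat.
Hypothesis a0 : (0 < a)%N.

(** The series [exp(c z^a)]. *)
Definition ez c : fps R := Fps (fun n=> if (a %| n)%N then c ^+ (n %/ a) / (n %/ a)`!%:R else 0).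

Lemma ez0 c : coef (ez c) 0 = 1.
Proof. by rewrite/= dvdn0 div0n expr0 fact0 divr1. Qed.

Lemma theta_ez c : theta (ez c) = cst (a%:R * c) * zz ^+ a * ez c.
Proof.
apply: fpsP=> n;rewrite -mulrA coefc coef_zzM/=;case: ltnP=> na.
case: ifP=> [/(dvdn_leq)|];last by rewrite !mulr0.
by case: n na=> [|n] na;[rewrite mul0r mulr0|move=> /(_ isT);rewrite leqNgt na].
have [k kn] : exists k, (n - a)%N = k by eexists.
have {na kn}-> : n = (k + a)%N by rewrite -kn subnK.
rewrite addnK dvdn_addl//;case: ifP=> // [ak|];last by rewrite !mulr0.
rewrite divnDr// divnn a0 addn1 exprS factS natrM -(divnK ak) mulnC.
rewrite mulKn// (_ : (a * (k %/ a) + a)%:R = a%:R * (k %/ a).+1%:R :> R);last by rewrite -natrM mulnS addnC.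
have ? : ((k %/ a)`!%:R : R) != 0 by rewrite pnatr_eq0 -lt0n fact_gt0.
have ? : ((k %/ a).+1%:R : R) != 0 by rewrite pnatr_eq0.
by field;apply/andP;split.
Qed.

(** The differential equation determines each coefficient from the one [a] places before. The
    addition formula follows from it. *)
Lemma ez_unique c f : coef f 0 = 1 -> theta f = cst (a%:R * c) * zz ^+ a * f -> f = ez c.
Proof.
move=> f0 tf;apply: fpsP;elim/ltn_ind=> -[|n] IH;first by rewrite f0 ez0.
have nz : (n.+1%:R : R) != 0 by rewrite pnatr_eq0.
apply: (mulfI nz);rewrite -[LHS]/(coef (theta f) n.+1) -[RHS]/(coef (theta (ez c)) n.+1) tf theta_ez.
rewrite -!mulrA !coefc !coef_zzM;case: ltnP=> // na;congr (_ * _).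
by apply: IH;rewrite ltn_subrL a0.
Qed.

Lemma ezD c d : ez c * ez d = ez (c + d).
Proof.
apply: ez_unique;first by rewrite coefM' big_ord1 subn0 !ez0 mulr1.
by rewrite thetaM !theta_ez mulrDr !rmorphD/= !rmorphM/=;ring.
Qed.

Lemma ez00 : ez 0 = 1.
Proof. by apply/esym/ez_unique=> //;rewrite theta_cst mulr0 rmorph0 mul0r mul0r. Qed.

Lemma ez_exp c n : ez c ^+ n = ez (n%:R * c).
Proof. by elim: n=> [|n IH];[rewrite mul0r ez00|rewrite exprS IH ezD -{1}[c]mul1r -mulrDl mulrS]. Qed.

Definition xx : fps R := zz * ez (-1).

Lemma xx_exp n : xx ^+ n = zz ^+ n * ez (- n%:R).
Proof. by rewrite exprMn ez_exp mulrN1. Qed.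

(* Substitution of x = z e^(-z^a). *)
Definition subs (f : fps R) : fps R := Fps (fun k=> \sum_(i < k.+1) coef f i * coef (xx ^+ i) k).

Lemma coef_xx_small i k : (k < i)%N -> coef (xx ^+ i) k = 0.
Proof. by move=> ki;rewrite xx_exp coef_zzM ki. Qed.

(** [xx ^ i] starts in degree [i], so each coefficient of the substitution depends on a polynomial
    truncation only, for which substitution is evaluation. Multiplicativity of [subs] follows. *)
Lemma subs_horner f k (p : {poly R}) : (forall i, (i <= k)%N -> p`_i = coef f i) ->
coef (subs f) k = coef (map_poly cst p).[xx] k.
Proof.
move=> E;rewrite horner_coef coef_sum size_map_poly.
have c0 i : (k < i)%N -> coef ((map_poly cst p)`_i * xx ^+ i) k = 0 by move=> ki;rewrite coef_map/= coefc coef_xx_small// mulr0.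
have pE i : ((map_poly cst p)`_i * xx ^+ i) = cst p`_i * xx ^+ i by rewrite coef_map.
transitivity (\sum_(0 <= i < k.+1 + size p) coef ((map_poly cst p)`_i * xx ^+ i) k).
rewrite (big_cat_nat (n := k.+1)) ?leq_addr//= [X in _ + X]big_nat [X in _ + X]big1 ?addr0;last by move=> i /andP[ki _];exact: c0.
by rewrite big_mkord;apply: eq_bigr=> i _;rewrite pE coefc E// -ltnS.
rewrite (big_cat_nat (n := size p)) ?leq_addl//= [X in _ + X]big_nat [X in _ + X]big1 ?addr0 ?big_mkord//.
by move=> i /andP[si _];rewrite pE nth_default// rmorph0 mul0r.
Qed.

Lemma subs_is_additive : zmod_morphism subs.
Proof. by move=> f g;apply: fpsP=> n;rewrite coefD coefN/= -sumrB;apply: eq_bigr=> i _;rewrite mulrBl. Qed.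

Lemma subs_cst c : subs (cst c) = cst c.
Proof.
apply: fpsP=> k;rewrite/= big_ord_recl/= big1 ?addr0;last by move=> i _;rewrite mul0r.
by rewrite ?expr0/=;case: eqP;rewrite ?mulr1 ?mulr0.
Qed.

Lemma subs_is_multiplicative : monoid_morphism subs.
Proof.
split=> [|f g];first exact: subs_cst.
apply: fpsP=> k;rewrite (@subs_horner _ k (trunc k f * trunc k g));last by move=> i ik;rewrite -fps_mul_trunc.
rewrite rmorphM hornerM !coefM';apply: eq_bigr=> i _.
have ik : (i <= k)%N by rewrite -ltnS.
rewrite (@subs_horner f i (trunc k f));last by move=> j ji;rewrite coef_trunc// (leq_trans ji).
by rewrite (@subs_horner g (k - i) (trunc k g))// => j ji;rewrite coef_trunc// (leq_trans ji)// leq_subr.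
Qed.
HB.instance Definition _ := GRing.isZmodMorphism.Build (fps R) (fps R) subs subs_is_additive.
HB.instance Definition _ := GRing.isMonoidMorphism.Build (fps R) (fps R) subs subs_is_multiplicative.

(** The logarithmic Euler derivative of [x] with respect to [z]; it converts [z d/dz] into
    [x d/dx]. *)
Definition el : fps R := 1 - cst a%:R * zz ^+ a.

Lemma theta_xx i : theta (xx ^+ i) = cst i%:R * el * xx ^+ i.
Proof. by rewrite xx_exp thetaM theta_zz theta_ez /el mulrN rmorphN rmorphM/=;ring. Qed.

Lemma coef_elM f n : coef (el * f) n = coef f n - (if (n < a)%N then 0 else a%:R * coef f (n - a)).
Proof. by rewrite /el mulrBl mul1r -mulrA coefD coefN coefc coef_zzM;case: ifP;rewrite ?mulr0. Qed.

Lemma subs_bound f k n : (k < n)%N -> coef (subs f) k = \sum_(i < n) coef f i * coef (xx ^+ i) k.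
Proof.
move=> kn;rewrite -(big_mkord xpredT (fun i=> coef f i * coef (xx ^+ i) k)) (big_cat_nat (n := k.+1))//=.
rewrite [X in _ + X]big_nat [X in _ + X]big1 ?addr0 ?big_mkord// => i /andP[ki _].
by rewrite coef_xx_small ?mulr0.
Qed.

Lemma theta_subs f : theta (subs f) = el * subs (theta f).
Proof.
apply: fpsP=> k;rewrite coef_elM (@subs_bound (theta f) k k.+1)//.
have -> : (if (k < a)%N then 0 else a%:R * coef (subs (theta f)) (k - a)) =
\sum_(i < k.+1) i%:R * coef f i * (if (k < a)%N then 0 else a%:R * coef (xx ^+ i) (k - a)).
case: ltnP=> ka;first by rewrite big1// => i _;rewrite mulr0.
rewrite (@subs_bound (theta f) (k - a) k.+1) ?ltnS ?leq_subr// mulr_sumr;apply: eq_bigr=> i _.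
by rewrite/=;ring.
rewrite -sumrB/= mulr_sumr;apply: eq_bigr=> i _.
have := congr1 (fun h=> coef h k) (theta_xx i);rewrite -mulrA coefc coef_elM/= => E.
by rewrite mulrCA E;ring.
Qed.

(** A difference of step [a] lowers the degree in [k] by one; Pascal's rule writes the difference of
    order [n + 1] as one of order [n] applied to it. *)
Lemma finite_difference n (m : nat) (r : R) : (m <= n)%N ->
\sum_(k < n.+1) (-1) ^+ (n - k) * 'C(n, k)%:R * (a%:R * k%:R + r) ^+ m =
if m == n then a%:R ^+ n * n`!%:R else 0.
Proof.
elim: n m r=> [|n IH] m r mn.
by move: mn;rewrite leqn0=> /eqP ->;rewrite big_ord1/= bin0 !expr0 !mulr1.
pose F s k := (a%:R * k%:R + s : R) ^+ m.
have step : \sum_(k < n.+2) (-1) ^+ (n.+1 - k) * 'C(n.+1, k)%:R * F r k =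
 \sum_(k < n.+1) (-1) ^+ (n - k) * 'C(n, k)%:R * (F (r + a%:R) k - F r k).
have FS k : F (r + a%:R) k = F r k.+1 by rewrite /F -natr1;congr (_ ^+ _);ring.
under [RHS]eq_bigr=> k _ do rewrite FS mulrBr.
rewrite sumrB big_ord_recl/= bin0 mulr1 subn0.
under eq_bigr=> k _ do rewrite /bump/= add1n subSS binS natrD mulrDr mulrDl.
rewrite big_split/= addrA addrC;congr (_ + _).
rewrite big_ord_recr/= bin_small// mulr0 mul0r addr0.
rewrite [X in _ = - X]big_ord_recl/= bin0 mulr1 subn0 opprD exprS mulN1r mulNr;congr (_ + _).
rewrite -sumrN;apply: eq_bigr=> i _;rewrite /bump/= add1n.
by rewrite (_ : n - i = (n - i.+1).+1)%N ?exprS;[ring|rewrite -subnSK].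
rewrite [LHS]step.
have dF k : F (r + a%:R) k - F r k = \sum_(i < m) a%:R ^+ (m - i) * 'C(m, i)%:R * (a%:R * k%:R + r) ^+ i.
rewrite /F (_ : a%:R * k%:R + (r + a%:R) = a%:R + (a%:R * k%:R + r));last by ring.
rewrite exprDn big_ord_recr/= subnn expr0 mul1r binn mulr1n addrK.
by apply: eq_bigr=> i _;rewrite -mulr_natr;ring.
under eq_bigr=> k _ do rewrite dF mulr_sumr.
rewrite exchange_big/=.
transitivity (\sum_(i < m) a%:R ^+ (m - i) * 'C(m, i)%:R * (if (i : nat) == n then a%:R ^+ n * n`!%:R else 0) : R).
apply: eq_bigr=> i _;rewrite -(IH i r) ?mulr_sumr;first by apply: eq_bigr=> k _;ring.
by rewrite -ltnS (leq_trans (ltn_ord i)).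
case: eqP=> [->|/eqP nm].
rewrite big_ord_recr/= eqxx big1 ?add0r;first by rewrite subSnn binSn factS natrM expr1 [a%:R ^+ n.+1]exprS;ring.
by move=> i _;rewrite ltn_eqF ?mulr0.
rewrite big1// => i _;rewrite ltn_eqF ?mulr0//.
by rewrite (leq_trans (ltn_ord i))// -ltnS ltn_neqAle nm.
Qed.

(* Lagrange inversion for x = z e^(-z^a). *)
Definition base r : fps R := Fps (fun n=> if n == r %[mod a] then n%:R ^+ (n %/ a) / (n %/ a)`!%:R else 0).

(** The coefficient of [z^(a q + r)] is a finite difference of order [q] of a power of exponent [q],
    equal to [a^q], so the substituted series is [z^r / (1 - a z^a)]. *)
Lemma subs_base r : (r < a)%N -> el * subs (base r) = zz ^+ r.
Proof.
move=> ra;have aR : (a%:R : R) != 0 by rewrite pnatr_eq0 -lt0n.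
have key n : coef (subs (base r)) n = if n == r %[mod a] then a%:R ^+ (n %/ a) else 0.
rewrite (@subs_bound _ n n.+1)//.
under eq_bigr=> i _ do rewrite xx_exp coef_zzM ltnNge -ltnS ltn_ord/=.
case: ifP=> nr;last first.
 rewrite big1// => i _;case: ifP=> // ir;last by rewrite mul0r.
 case: ifP=> [ani|];last by rewrite mulr0.
 have ni : (i <= n)%N by rewrite -ltnS.
 by move: ani;rewrite -eqn_mod_dvd// => /eqP E;rewrite E ir in nr.
have En : n = (n %/ a * a + r)%N by rewrite {1}(divn_eq n a) (eqP nr) modn_small.
pose q := (n %/ a)%N;rewrite -/q.
pose G i : R := (if i == r %[mod a] then i%:R ^+ (i %/ a) / (i %/ a)`!%:R else 0) *
 (if (a %| n - i)%N then (- i%:R) ^+ ((n - i) %/ a) / ((n - i) %/ a)`!%:R else 0).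
have qn (k : 'I_q.+1) : (k * a + r < n.+1)%N by have kq : (k <= n %/ a)%N := ltn_ord k;rewrite ltnS [X in (_ <= X)%N]En leq_add2r leq_mul2r kq orbT.
have -> : \sum_(i < n.+1) G i = \sum_(k < q.+1) G (k * a + r)%N.
 rewrite (bigID (fun i : 'I_n.+1=> (i : nat) == r %[mod a]))/= [X in _ + X]big1 ?addr0;last first.
  by move=> i /negbTE ir;rewrite /G ir mul0r.
 rewrite (reindex (fun k : 'I_q.+1=> Ordinal (qn k)))/=.
  by apply: eq_bigl=> k;rewrite modnMDl eqxx.
 exists (fun i : 'I_n.+1=> inord (i %/ a))=> [k _|i].
  by apply: val_inj;rewrite/= divnMDl// divn_small// addn0 inordK.
 rewrite inE=> /eqP ir;apply: val_inj=> /=;rewrite inordK.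
  by rewrite [RHS](divn_eq i a) ir modn_small.
 by rewrite ltnS leq_div2r// -ltnS.
have fR m : (m`!%:R : R) != 0 by rewrite pnatr_eq0 -lt0n fact_gt0.
apply: (mulIf (fR q));rewrite mulr_suml.
(* The binomial coefficients come from the factorials of [base] and of the exponential series, after
   multiplication by [q!]. *)
have := @finite_difference q q r%:R (leqnn q);rewrite eqxx=> <-;apply: eq_bigr=> k _.
have kq : (k <= q)%N by rewrite -ltnS.
rewrite /G modnMDl eqxx divnMDl// divn_small// addn0.
have -> : (n - (k * a + r) = (q - k) * a)%N by rewrite {1}En subnDr mulnBl.
rewrite dvdn_mull// mulnK// natrD natrM -(bin_fact kq) !natrM.
rewrite [a%:R * _]mulrC;set X := (_ * _ + _).
have -> : X ^+ q = X ^+ k * X ^+ (q - k) by rewrite -exprD subnKC.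
rewrite [(- X) ^+ _]exprNn.
by have := fR k;have := fR (q - k)%N=> *;field;apply/andP;split.
apply: fpsP=> n;rewrite coef_elM !key coef_zz;case: ltnP=> na.
rewrite modn_small// (modn_small ra) divn_small// expr0 subr0.
by case: eqP.
rewrite -{1 2}(subnK na) modnDr;case: ifP=> _;last by rewrite mulr0 subr0 gtn_eqF// (leq_trans ra).
by rewrite divnDr// divnn a0 addn1 exprS subrr gtn_eqF// (leq_trans ra).
Qed.

(* z^(-J) f is a rational function with a pole only where a z^a = 1, regular at
 infinity with value e. *)
Definition reg (J : nat) f (e : R) := exists K,
(forall i, (a * K + J < i)%N -> coef (el ^+ K * f) i = 0) /\ coef (el ^+ K * f) (a * K + J) = (- a%:R) ^+ K * e.

(** At infinity [el] behaves like [- a z^a], which explains the power of [- a] in [reg]. *)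
Lemma reg_el J N f e : ((forall i, (N + J < i)%N -> coef f i = 0) /\ coef f (N + J) = e) ->
((forall i, (a + N + J < i)%N -> coef (el * f) i = 0) /\ coef (el * f) (a + N + J) = - a%:R * e).
Proof.
move=> [H E];split=> [i Hi|].
have ai : (i < a)%N = false by apply/negbTE;rewrite -leqNgt;lia.
by rewrite coef_elM ai !H ?mulr0 ?subr0//;lia.
have ai : (a + N + J < a)%N = false by apply/negbTE;rewrite -leqNgt;lia.
rewrite coef_elM ai H;last by lia.
by rewrite -addnA addKn E sub0r mulNr.
Qed.

Lemma reg_raise J f e K L : (K <= L)%N ->
(forall i, (a * K + J < i)%N -> coef (el ^+ K * f) i = 0) /\ coef (el ^+ K * f) (a * K + J) = (- a%:R) ^+ K * e ->
(forall i, (a * L + J < i)%N -> coef (el ^+ L * f) i = 0) /\ coef (el ^+ L * f) (a * L + J) = (- a%:R) ^+ L * e.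
Proof.
move=> /subnK <-;elim: (L - K)%N=> [//|n IH] H;move: (IH H)=> /reg_el[H1 H2].
by rewrite addSn mulnS !exprS -!mulrA.
Qed.

Lemma regD J f g d e : reg J f d -> reg J g e -> reg J (f + g) (d + e).
Proof.
move=> [K /(reg_raise (leq_maxl K _)) H] [L];move: (H L)=> {H}[Hf Ef] /(reg_raise (leq_maxr K L)) [Hg Eg].
by exists (maxn K L);split=> [i Hi|];[rewrite mulrDr coefD Hf// Hg// addr0|rewrite mulrDr coefD Ef Eg mulrDr].
Qed.

Lemma regM I J f g d e : reg I f d -> reg J g e -> reg (I + J) (f * g) (d * e).
Proof.
move=> [K [Hf Ef]] [L [Hg Eg]];exists (K + L)%N.
have -> : el ^+ (K + L) * (f * g) = (el ^+ K * f) * (el ^+ L * g) by rewrite exprD;ring.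
move: (el ^+ K * f) (el ^+ L * g) Hf Ef Hg Eg=> P Q HP EP HQ EQ.
split=> [i Hi|].
rewrite coefM' big1// => j _;have [Kj|jK] := ltnP (a * K + I) j;first by rewrite HP ?mul0r.
by rewrite HQ ?mulr0//;move: Hi jK;rewrite mulnDr;clear;lia.
have E : (a * (K + L) + (I + J) = (a * K + I) + (a * L + J))%N by rewrite mulnDr;lia.
rewrite E coefM'.
have jlt : (a * K + I < (a * K + I + (a * L + J)).+1)%N by rewrite ltnS leq_addr.
rewrite (bigD1 (Ordinal jlt))//= addKn EP EQ big1 ?addr0;first by rewrite exprD;ring.
move=> j;rewrite -val_eqE/= => jn;have [Kj|jK] := ltnP (a * K + I) j;first by rewrite HP ?mul0r.
by rewrite HQ ?mulr0//;move: jn jK;clear;move=> /eqP ? ?;lia.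
Qed.

Lemma reg_cst c : reg 0 (cst c) c.
Proof.
exists 0%N;rewrite muln0 expr0 !mul1r;split=> //;by case.
Qed.

Lemma regZ J c f e : reg J f e -> reg J (cst c * f) (c * e).
Proof. by move=> /(regM (reg_cst c)). Qed.

Lemma reg0 J : reg J 0 0.
Proof. by exists 0%N;rewrite mulr0;split=> //;rewrite mulr0. Qed.

Lemma reg_zz J : reg J (zz ^+ J) 1.
Proof.
exists 0%N;rewrite muln0 !expr0 !mul1r;split=> [i Ji|];rewrite coef_zz ?eqxx//.
by rewrite gtn_eqF.
Qed.

Lemma reg_sum J (T : eqType) (s : seq T) (F : T -> fps R) (G : T -> R) :
(forall i, i \in s -> reg J (F i) (G i)) -> reg J (\sum_(i <- s) F i) (\sum_(i <- s) G i).
Proof.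
elim: s=> [|i s IH] H;first by rewrite !big_nil;exact: reg0.
rewrite !big_cons;apply: regD;first by apply: H;rewrite mem_head.
by apply: IH=> j js;apply: H;rewrite seq.inE js orbT.
Qed.

Lemma reg_inj J f d e : reg J f d -> reg J f e -> d = e.
Proof.
move=> [K /(reg_raise (leq_maxl K _)) H] [L];move: (H L)=> {H}[_ Ef] /(reg_raise (leq_maxr K L)) [_].
rewrite Ef;apply: mulfI;rewrite expf_neq0// oppr_eq0 pnatr_eq0 -lt0n//.
Qed.

Lemma reg_low J f e : (forall i, (J < i)%N -> coef f i = 0) -> coef f J = e -> reg J f e.
Proof. by move=> H E;exists 0%N;rewrite muln0 !expr0 !mul1r. Qed.

Lemma theta_el_exp K f : el * theta (el ^+ K * f) = el ^+ K.+1 * theta f - cst (K%:R * a%:R ^+ 2) * zz ^+ a * (el ^+ K * f).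
Proof.
have te : theta el = - (cst (a%:R ^+ 2) * zz ^+ a).
rewrite /el thetaD (_ : theta 1 = 0) ?add0r;last exact: theta_cst.
have -> : - (cst a%:R * zz ^+ a) = cst (- a%:R) * zz ^+ a by rewrite rmorphN mulNr.
by rewrite theta_cstM theta_zz mulrA -rmorphM/= -mulNr -rmorphN/=;congr (cst _ * _);ring.
have tK : el * theta (el ^+ K) = - cst (K%:R * a%:R ^+ 2) * zz ^+ a * el ^+ K.
elim: K=> [|K IH];first by rewrite expr0 (_ : theta 1 = 0) ?mulr0 ?mul0r ?rmorph0 ?oppr0 ?mul0r//;exact: theta_cst.
rewrite exprS thetaM te mulrDr mulrCA IH -natr1 !rmorphM rmorphD rmorph1/=;ring.
by rewrite thetaM mulrDr mulrA tK [el ^+ K.+1]exprS;ring.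
Qed.

(** The Euler operator annihilates the value at infinity of a function regular there; with the
    factor [z^J] it becomes [theta - J]. *)
Lemma reg_theta J f e : reg J f e -> reg J (theta f - cst J%:R * f) 0.
Proof.
move=> [K [H E]];exists K.+1;rewrite mulr0.
have -> : el ^+ K.+1 * (theta f - cst J%:R * f) =
 el * theta (el ^+ K * f) + cst (K%:R * a%:R ^+ 2) * zz ^+ a * (el ^+ K * f) - cst J%:R * el * (el ^+ K * f).
by rewrite theta_el_exp exprS;ring.
move: (el ^+ K * f) H E=> P HP EP;rewrite mulnS.
have HT : (forall i, (a * K + J < i)%N -> coef (theta P) i = 0) /\ coef (theta P) (a * K + J) = (a * K + J)%:R * ((- a%:R) ^+ K * e).
by split=> [i Hi|];[rewrite/= HP ?mulr0|rewrite/= EP].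
have [T1 T2] := reg_el HT;have [P1 P2] := reg_el (conj HP EP).
have cE c i : coef (cst c * zz ^+ a * P) i = c * (if (i < a)%N then 0 else coef P (i - a)) by rewrite -mulrA coefc coef_zzM.
split=> [i Hi|].
have ai : (i < a)%N = false by apply/negbTE;rewrite -leqNgt;move: Hi;lia.
rewrite coefD coefN coefD -[cst J%:R * el * P]mulrA coefc T1// P1// cE ai HP ?mulr0 ?addr0 ?subr0//.
by move: Hi;clear;lia.
have ai : (a + a * K + J < a)%N = false by apply/negbTE;rewrite -leqNgt -addnA leq_addr.
rewrite coefD coefN coefD -[cst J%:R * el * P]mulrA coefc T2 P2 cE ai -addnA addKn EP natrD natrM;ring.
Qed.

(** Division by [el] only adds a pole where poles are allowed, and the numerator already has value 0
    at infinity by [reg_theta]. *)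
Lemma reg_div_el J f g e : reg J f e -> el * g = theta f - cst J%:R * f -> reg J g 0.
Proof.
move=> /reg_theta [K [H E]] Eg;exists K.+1;rewrite exprSr -mulrA Eg mulr0.
rewrite mulr0 in E;split=> [i Hi|];last first.
by rewrite H// mulnS;lia.
by rewrite H//;move: Hi;rewrite mulnS;lia.
Qed.
End Fps.

(** * Symmetries of sums over splittings *)

Section SelSplits.
Variable V : nmodType.
Implicit Types (s r : seq nat).

Lemma splits_sym s (F : seq nat -> seq nat -> V) :
\sum_(r <- splits s) F r.1 r.2 = \sum_(r <- splits s) F r.2 r.1.
Proof.
elim: s F=> [|k s IH] F/=;first by rewrite !big_seq1.
by rewrite !big_cat !big_map/= addrC (IH (fun x y=> F x (k :: y))) (IH (fun x y=> F (k :: x) y)).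
Qed.

Lemma sum_rev p (F : nat -> V) : F 0%N = 0 -> \sum_(b < p.+1) F b = \sum_(al < p) F (p - al)%N.
Proof.
move=> F0;rewrite big_ord_recl F0 add0r (reindex_inj rev_ord_inj)/=;apply: eq_bigr=> i _.
by rewrite /bump/= add1n subnSK.
Qed.

Lemma sum_genus g (F : nat -> nat -> V) : \sum_(g1 < g.+1) F g1 (g - g1)%N = \sum_(g1 < g.+1) F (g - g1)%N g1.
Proof.
rewrite (reindex_inj rev_ord_inj)/=;apply: eq_bigr=> i _.
by rewrite subSS subKn// -ltnS.
Qed.

Lemma sum_sym p (F : nat -> nat -> V) : (forall b, F 0%N b = 0) -> (forall b, F b 0%N = 0) ->
\sum_(al < p) F al (p - al)%N = \sum_(al < p) F (p - al)%N al.
Proof.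
move=> F1 F2;transitivity (\sum_(al < p.+1) F al (p - al)%N).
by rewrite big_ord_recr/= subnn F2 addr0.
rewrite (reindex_inj rev_ord_inj) big_ord_recr/= subnn subn0 F1 addr0.
by apply: eq_bigr=> i _;rewrite subSS subKn// ltnW.
Qed.

(** The two components are exchanged: part and complementary part, the two lists, the two genera.
    Vanishing at a part 0 makes the range of [al] symmetric. *)
Lemma cut_sym p s g (F : nat -> seq nat -> nat -> nat -> seq nat -> nat -> V) :
(forall r g1 b r2 g2, F 0%N r g1 b r2 g2 = 0) -> (forall r g1 b r2 g2, F b r2 g2 0%N r g1 = 0) ->
\sum_(al < p) \sum_(r <- splits s) \sum_(g1 < g.+1) F al r.1 g1 (p - al)%N r.2 (g - g1)%N =
\sum_(al < p) \sum_(r <- splits s) \sum_(g1 < g.+1) F (p - al)%N r.2 (g - g1)%N al r.1 g1.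
Proof.
move=> F1 F2.
rewrite (sum_sym _ (F := fun x y=> \sum_(r <- splits s) \sum_(g1 < g.+1) F x r.1 g1 y r.2 (g - g1)%N)).
- apply: eq_bigr=> al _;rewrite (splits_sym s (fun r1 r2=> \sum_(g1 < g.+1) F (p - al)%N r1 g1 al r2 (g - g1)%N)).
by apply: eq_bigr=> r _;exact: (sum_genus g (fun x y=> F (p - al)%N r.2 x al r.1 y)).
- by move=> b;rewrite big1// => r _;rewrite big1.
- by move=> b;rewrite big1// => r _;rewrite big1.
Qed.
End SelSplits.

(** The shape of the unstable terms: functions of a list that are special for at most one entry. *)
Definition match_short (T : Type) (A : T) (B : nat -> T) (C : T) (r : seq nat) : T :=
match r with [::]=> A | [:: q]=> B q | _=> C end.

Lemma sum_match_short (R : pzRingType) (s : seq nat) (A : R) (B : nat -> R) (Y : seq nat -> R) :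
\sum_(r <- splits s) match_short A B 0 r.1 * Y r.2 = A * Y s + \sum_(q <- sel s) B q.1 * Y q.2.
Proof.
elim: s A B Y=> [|k s IH] A B Y;first by rewrite big_seq1 big_nil addr0.
rewrite/= big_cat !big_map big_cons big_map/= (IH A B (fun r=> Y (k :: r))).
have -> : \sum_(r <- splits s) match_short A B 0 (k :: r.1) * Y r.2 = B k * Y s.
transitivity (B k * Y s + \sum_(q <- sel s) (fun=> 0) q.1 * Y q.2);last first.
 by rewrite [X in _ + X]big1 ?addr0// => q _;rewrite mul0r.
rewrite -(IH (B k) (fun=> 0) Y);apply: eq_bigr=> r _;congr (_ * _).
by case: (r.1)=> [|x [|y l]].
by rewrite addrCA.
Qed.

(** * Generating series in one distinguished point over infinity *)

Section Series.
Variables (R : realType) (a : nat) (h : nat -> seq nat -> R).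
Hypothesis a0 : (0 < a)%N.
Hypothesis h_perm : forall g mu nu, perm_eq mu nu -> h g mu = h g nu.
Hypothesis h_mem0 : forall g mu, 0%N \in mu -> h g mu = 0.
Hypothesis h_dvd : forall g mu, ~~ (a %| sumn mu)%N -> h g mu = 0.
Hypothesis h_base : h 0 [:: a] = 1.
Definition lower (T : nmodType) (f : nat -> seq nat -> T) g mu : T := if g is g'.+1 then f g' mu else 0.
Hypothesis cut_join_dvd : forall g mu, (0 < size mu)%N -> 0%N \notin mu -> (a %| sumn mu)%N ->
2 * ((2 * g + size mu)%:R + (sumn mu)%:R / a%:R - 2) * h g mu =
cut_join_sum (lower h) h g mu.

Local Notation z := (zz R).
Local Notation S := (subs a).
Local Notation E := (ez a).

Lemma aR0 : (a%:R : R) != 0. Proof. by rewrite pnatr_eq0 -lt0n. Qed.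

(** When [a] does not divide the degree both sides vanish: each term contains a factor of degree not
    divisible by [a]. *)
Lemma cut_join g mu : (0 < size mu)%N -> 0%N \notin mu ->
2 * ((2 * g + size mu)%:R + (sumn mu)%:R / a%:R - 2) * h g mu =
cut_join_sum (lower h) h g mu.
Proof.
move=> s0 mu0;have [|nd] := boolP (a %| sumn mu)%N;first exact: cut_join_dvd.
rewrite h_dvd// mulr0 !big1_seq ?addr0// => p/= /sel_perm/perm_sumn Ep.
rewrite big1 ?mulr0// => al _.
have alp : (al <= p.1)%N by rewrite ltnW.
have Es : sumn (cut_at p al) = sumn mu by rewrite Ep/= addnA subnKC.
rewrite (_ : lower h g _ = 0) ?add0r;last by case: g=> //= g;rewrite h_dvd ?Es.
rewrite big1_seq// => r/= /splits_perm/perm_sumn Er;rewrite big1// => g1 _.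
have [d1|d1] := boolP (a %| sumn (nat_of_ord al :: r.1))%N;last by rewrite (h_dvd _ d1) mul0r.
rewrite [X in _ * X]h_dvd ?mulr0//;apply: contra nd=> d2.
have ac (x y u v : nat) : (x + (y + (u + v)) = (x + u) + (y + v))%N by lia.
by rewrite -Es/= Er sumn_cat ac;exact: dvdn_add d1 d2.
rewrite big1_seq// => q/= /sel_perm/perm_sumn Eq.
by rewrite h_dvd ?mulr0//= -addnA -[(q.1 + _)%N]/(sumn (q.1 :: q.2)) -Eq -[(p.1 + _)%N]/(sumn (p.1 :: p.2)) -Ep.
Qed.

(** The variable [x] marks a distinguished point over infinity; dividing by [v] removes the choice
    of its root. *)
Definition U g mu : fps R := Fps (fun v=> h g (v :: mu) / v%:R).
Definition V g mu : fps R := Fps (fun v=> h g (v :: mu)).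
(** The distinguished point has been merged with an entry [q]. The coefficient at 0, a number
    without distinguished point, is left out. *)
Definition A g q mu : fps R := Fps (fun v=> if v == 0%N then 0 else h g (v + q :: mu)%N).
Definition Conv g mu : fps R := Fps (fun v=> \sum_(al < v) lower h g (nat_of_ord al :: v - al :: mu)%N).

Lemma h0 g mu : h g (0%N :: mu) = 0. Proof. by rewrite h_mem0// mem_head. Qed.

Lemma theta_U g mu : theta (U g mu) = V g mu.
Proof.
apply: fpsP=> -[|v]/=;first by rewrite mul0r h0.
by rewrite mulrC divfK// pnatr_eq0.
Qed.

(** For [v > 0], the coefficient of [x^v] times [v] is the equation for [v :: mu], sorted by the
    fate of the distinguished point: merged with an entry ([A]), cut ([Conv] and products of two
    [V]), or left alone ([U]). *)
Lemma cut_join_series g mu : 0%N \notin mu ->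
cst (2 * ((2 * g + size mu)%:R + (sumn mu)%:R / a%:R - 1)) * U g mu + cst (2 / a%:R) * V g mu =
\sum_(q <- sel mu) cst (2 * q.1%:R) * A g q.1 q.2 +
\sum_(p <- sel mu) \sum_(q <- sel p.2) cst (p.1%:R * q.1%:R) * U g (p.1 + q.1 :: q.2)%N +
Conv g mu + \sum_(r <- splits mu) \sum_(g1 < g.+1) V g1 r.1 * V (g - g1) r.2 +
\sum_(p <- sel mu) cst p.1%:R * \sum_(al < p.1)
 (lower U g (cut_at p al) +
 \sum_(r <- splits p.2) \sum_(g1 < g.+1) (cst (h (g - g1) (p.1 - al :: r.2)%N) * U g1 (nat_of_ord al :: r.1) +
  cst (h g1 (nat_of_ord al :: r.1)) * U (g - g1) (p.1 - al :: r.2)%N)).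
Proof.
move=> mu0;have U0 g' mu' : coef (U g' mu') 0 = 0 by rewrite/= h0 mul0r.
have L0 mu' n : coef (lower U g mu') n = if g is g'.+1 then coef (U g' mu') n else 0 by case: (g).
have cs n (T : Type) (s : seq T) (F : T -> fps R) := coef_sum s F n.
apply: fpsP=> -[|v].
rewrite !coefD !coefc U0/= h0 !mulr0 !addr0 !cs big_ord0 !big1 ?addr0// => p _.
- rewrite coefc cs big1 ?mulr0// => al _;rewrite coefD L0 cs big1 ?addr0;first by case: (g)=> // g';rewrite U0.
 by move=> r _;rewrite cs big1// => g1 _;rewrite coefD !coefc !U0 !mulr0 addr0.
- by rewrite cs big1// => g1 _;rewrite coefM' big_ord1/= !h0 mul0r.
- by rewrite cs big1// => q _;rewrite coefc U0 mulr0.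
- by rewrite coefc/= mulr0.
set n := v.+1;have nz : (n%:R : R) != 0 by rewrite pnatr_eq0.
have Un g' mu' : n%:R * coef (U g' mu') n = h g' (n :: mu') by rewrite/= mulrC divfK.
have swap g' x y s : h g' [:: x, y & s] = h g' [:: y, x & s].
by apply: h_perm;exact/permPl/(perm_catCA [:: x] [:: y]).
have swap2 g' x y w s : h g' [:: x, y, w & s] = h g' [:: w, x, y & s].
by apply: h_perm;exact/permPl/(perm_catCA [:: x;y] [:: w]).
have := @cut_join g (n :: mu) isT _;rewrite seq.inE negb_or mu0 andbT=> /(_ isT) CJ.
apply: (mulfI nz).
have -> : n%:R * coef (cst (2 * ((2 * g + size mu)%:R + (sumn mu)%:R / a%:R - 1)) * U g mu + cst (2 / a%:R) * V g mu) n =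
2 * ((2 * g + size (n :: mu))%:R + (sumn (n :: mu))%:R / a%:R - 2) * h g (n :: mu).
rewrite coefD !coefc mulrDr mulrCA Un/= addnS -natr1 !natrD;have := aR0=> ?;by field.
have {}CJ : 2 * ((2 * g + size (n :: mu))%:R + (sumn (n :: mu))%:R / a%:R - 2) * h g (n :: mu) =
 (\sum_(q <- sel mu) n%:R * q.1%:R * h g (n + q.1 :: q.2)%N +
 \sum_(p <- sel mu) (p.1%:R * n%:R * h g (p.1 + n :: p.2)%N +
  \sum_(q <- sel p.2) p.1%:R * q.1%:R * h g (p.1 + q.1 :: n :: q.2)%N)) +
 (n%:R * (\sum_(al < n) (lower h g (nat_of_ord al :: n - al :: mu)%N +
  \sum_(r <- splits mu) \sum_(g1 < g.+1) h g1 (nat_of_ord al :: r.1) * h (g - g1) (n - al :: r.2)%N)) +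
 \sum_(p <- sel mu) p.1%:R * \sum_(al < p.1)
  (lower h g (nat_of_ord al :: p.1 - al :: n :: p.2)%N +
  \sum_(r <- splits (n :: p.2)) \sum_(g1 < g.+1) h g1 (nat_of_ord al :: r.1) * h (g - g1) (p.1 - al :: r.2)%N)).
rewrite CJ (_ : sel (n :: mu) = (n, mu) :: [seq (x.1, n :: x.2) | x <- sel mu])// !big_cons !big_map;congr (_ + _ + _).
by apply: eq_bigr=> p _;rewrite [sel _]/= big_cons big_map.
rewrite {}CJ !coefD !mulrDr big_split [X in n%:R * X]big_split mulrDr.
have P3 : coef (Conv g mu) n = \sum_(al < n) lower h g (nat_of_ord al :: n - al :: mu)%N by [].
have P1 : n%:R * coef (\sum_(q <- sel mu) cst (2 * q.1%:R) * A g q.1 q.2) n =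
\sum_(q <- sel mu) n%:R * q.1%:R * h g (n + q.1 :: q.2)%N + \sum_(p <- sel mu) p.1%:R * n%:R * h g (p.1 + n :: p.2)%N.
by rewrite cs mulr_sumr -big_split;apply: eq_bigr=> q _;rewrite coefc/= (addnC q.1);ring.
have P2 : n%:R * coef (\sum_(p <- sel mu) \sum_(q <- sel p.2) cst (p.1%:R * q.1%:R) * U g (p.1 + q.1 :: q.2)%N) n =
\sum_(p <- sel mu) \sum_(q <- sel p.2) p.1%:R * q.1%:R * h g (p.1 + q.1 :: n :: q.2)%N.
rewrite cs mulr_sumr;apply: eq_bigr=> p _;rewrite cs mulr_sumr;apply: eq_bigr=> q _.
by rewrite coefc mulrCA Un swap.
have P4 : coef (\sum_(r <- splits mu) \sum_(g1 < g.+1) V g1 r.1 * V (g - g1) r.2) n =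
\sum_(al < n) \sum_(r <- splits mu) \sum_(g1 < g.+1) h g1 (nat_of_ord al :: r.1) * h (g - g1) (n - al :: r.2)%N.
rewrite cs exchange_big/=;apply: eq_bigr=> r _;rewrite cs exchange_big/=;apply: eq_bigr=> g1 _.
by rewrite coefM' big_ord_recr/= subnn h0 mulr0 addr0.
have P5 : n%:R * coef (\sum_(p <- sel mu) cst p.1%:R * \sum_(al < p.1)
 (lower U g (cut_at p al) +
 \sum_(r <- splits p.2) \sum_(g1 < g.+1) (cst (h (g - g1) (p.1 - al :: r.2)%N) * U g1 (nat_of_ord al :: r.1) +
  cst (h g1 (nat_of_ord al :: r.1)) * U (g - g1) (p.1 - al :: r.2)%N))) n =
\sum_(p <- sel mu) p.1%:R * \sum_(al < p.1)
 (lower h g (nat_of_ord al :: p.1 - al :: n :: p.2)%N +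
 \sum_(r <- splits (n :: p.2)) \sum_(g1 < g.+1) h g1 (nat_of_ord al :: r.1) * h (g - g1) (p.1 - al :: r.2)%N).
rewrite cs mulr_sumr;apply: eq_bigr=> p _;rewrite coefc mulrCA;congr (_ * _).
rewrite cs mulr_sumr;apply: eq_bigr=> al _;rewrite coefD mulrDr;congr (_ + _).
 by rewrite L0;case: (g)=> [|g']/=;[rewrite mulr0|rewrite -/n Un swap2].
rewrite cs mulr_sumr [splits (n :: _)]/= big_cat !big_map [RHS]/= -big_split;apply: eq_bigr=> r _.
rewrite cs mulr_sumr [RHS]/= -big_split;apply: eq_bigr=> g1 _;rewrite coefD !coefc mulrDr [RHS]/=.
by rewrite mulrCA Un [X in _ + X]mulrCA Un;congr (_ + _);[rewrite mulrC swap|rewrite swap].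
rewrite P1 P2 P3 P4 P5 !addrA.
by [].
Qed.

Implicit Types f : fps R.

Lemma subs_M f (g : fps R) : S (f * g) = S f * S g. Proof. by have [_ H] := subs_is_multiplicative R a0;exact: H. Qed.
Lemma subs_D f (g : fps R) : S (f + g) = S f + S g. Proof. exact: raddfD. Qed.
Lemma subs_X f n : S (f ^+ n) = S f ^+ n.
Proof. by elim: n=> [|n IH];rewrite ?expr0 ?(subs_cst _ 1) ?exprS ?subs_M ?IH//;exact: subs_cst. Qed.
Lemma subs_sum (T : Type) (s : seq T) (F : T -> fps R) : S (\sum_(i <- s) F i) = \sum_(i <- s) S (F i).
Proof. exact: raddf_sum. Qed.
Lemma subs_cstM c f : S (cst c * f) = cst c * S f. Proof. by rewrite subs_M subs_cst. Qed.
Lemma subs_zz : S z = xx R a.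
Proof.
by apply: fpsP=> k;rewrite (@subs_bound R a a0 z k k.+2)// 2!big_ord_recl big1 ?addr0=> [|i _];rewrite/= ?mul0r ?add0r ?mul1r ?expr1.
Qed.
Lemma subsE0 f k : (forall i, (i <= k)%N -> coef f i = 0) -> coef (S f) k = 0.
Proof. by move=> H;rewrite/= big1// => i _;rewrite H ?mul0r// -ltnS. Qed.

Lemma subs_inj f (g : fps R) : S f = S g -> f = g.
Proof.
move=> Efg;apply: fpsP;elim/ltn_ind=> n IH.
have := congr1 (fun k=> coef k n) Efg;rewrite/= !big_ord_recr/=.
rewrite (eq_bigr (fun i : 'I_n=> coef g i * coef (xx R a ^+ i) n))=> [/addrI|i _];last by rewrite IH.
by rewrite (xx_exp R a0) coef_zzM ltnn subnn ez0 !mulr1.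
Qed.

Lemma el_inj f (g : fps R) : el R a * f = el R a * g -> f = g.
Proof.
move=> Efg;apply: fpsP;elim/ltn_ind=> n IH.
have := congr1 (fun k=> coef k n) Efg;rewrite !coef_elM;case: ltnP=> na;first by rewrite !subr0.
rewrite (IH (n - a)%N);first exact: addIr.
by rewrite ltn_subrL a0 (leq_trans a0).
Qed.

(** The factor [z ^ |mu|] makes the equation homogeneous: merging and cutting preserve the total
    degree, and a shift of the distinguished exponent becomes an exponential factor. *)
Definition W g mu : fps R := z ^+ sumn mu * S (U g mu).
Definition Vh g mu : fps R := z ^+ sumn mu * S (V g mu).

Lemma el_Vh g mu : el R a * Vh g mu = theta (W g mu) - cst (sumn mu)%:R * W g mu.
Proof. by rewrite /Vh /W thetaM theta_zz (theta_subs a0) theta_U;move: (S (U g mu)) (S (V g mu))=> x y;ring. Qed.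

Lemma W_low g mu i : (i <= sumn mu)%N -> coef (W g mu) i = 0.
Proof.
move=> im;rewrite /W coef_zzM;case: ltnP=> // mi.
have -> : i = sumn mu by apply/eqP;rewrite eqn_leq im.
by rewrite subnn subsE0// => j;rewrite leqn0=> /eqP ->;rewrite/= h0 mul0r.
Qed.

Lemma W_mem0 g mu : 0%N \in mu -> W g mu = 0.
Proof.
move=> m0;have -> : W g mu = z ^+ sumn mu * S 0;last by rewrite raddf0 mulr0.
by congr (_ * S _);apply: fpsP=> v/=;rewrite h_mem0 ?mul0r// seq.inE m0 orbT.
Qed.

(** Merging with [q] divides the series by [x^q] once its terms of degree at most [q] are removed;
    [x^(-q)] is [z^(-q) exp(q z^a)], whence the factor [E q]. *)
Lemma join_series g q mu : z ^+ (q + sumn mu) * S (A g q mu) =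
E q%:R * Vh g mu - \sum_(b < q.+1) cst (h g (nat_of_ord b :: mu)) * z ^+ (b + sumn mu) * E (q - b)%:R.
Proof.
have EA : z ^+ q * A g q mu = V g mu - \sum_(b < q.+1) cst (h g (nat_of_ord b :: mu)) * z ^+ b.
apply: fpsP=> v;rewrite coef_zzM coefD coefN coef_sum.
under eq_bigr=> b _ do rewrite coefc coef_zz.
have [vq|qv] := ltnP v q.+1.
 rewrite (bigD1 (Ordinal vq))//= eqxx mulr1 big1 ?addr0 ?subrr=> [|b];last first.
  by rewrite -val_eqE/= eq_sym=> /negbTE ->;rewrite mulr0.
 by rewrite ltnS in vq;case: ltnP=> // qv;have -> : v = q by [apply/eqP;rewrite eqn_leq vq];rewrite subnn.
rewrite big1 ?subr0=> [|b _];last by rewrite gtn_eqF ?mulr0// (leq_trans (ltn_ord b)).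
by rewrite ltnNge (ltnW qv)/= subnK ?(ltnW qv)// subn_eq0 leqNgt qv.
have := congr1 (fun f=> E q%:R * z ^+ sumn mu * S f) EA.
rewrite subs_M subs_X subs_zz (xx_exp R a0) raddfB/= subs_sum=> EB.
transitivity (E q%:R * z ^+ sumn mu * (z ^+ q * E (- q%:R) * S (A g q mu))).
by rewrite exprD -[LHS]mul1r -(ez00 R a0) -(subrr q%:R) -(ezD a0);move: (S _)=> x;ring.
rewrite EB mulrBr /Vh;congr (_ - _);first by move: (S _)=> x;ring.
rewrite mulr_sumr;apply: eq_bigr=> b _;rewrite subs_cstM subs_X subs_zz (xx_exp R a0) natrB;last by rewrite -ltnS.
by rewrite -(ezD a0) exprD;ring.
Qed.

Definition Ch g mu : fps R := z ^+ sumn mu * S (Conv g mu).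

(** [cut_join_series] substituted and multiplied by [z ^ |mu|]. In the cuts of an entry either
    component may hold the distinguished point; [cut_sym] makes the two cases equal, whence the
    factor 2. *)
Lemma homogeneous_identity g mu : 0%N \notin mu ->
cst (2 * ((2 * g + size mu)%:R + (sumn mu)%:R / a%:R - 1)) * W g mu + cst (2 / a%:R) * Vh g mu =
\sum_(q <- sel mu) cst (2 * q.1%:R) * (E q.1%:R * Vh g q.2 -
 \sum_(al < q.1) cst (h g (q.1 - al :: q.2)%N) * z ^+ (q.1 - al + sumn q.2) * E (nat_of_ord al)%:R) +
\sum_(p <- sel mu) \sum_(q <- sel p.2) cst (p.1%:R * q.1%:R) * W g (p.1 + q.1 :: q.2)%N +
Ch g mu + \sum_(r <- splits mu) \sum_(g1 < g.+1) Vh g1 r.1 * Vh (g - g1) r.2 +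
\sum_(p <- sel mu) cst p.1%:R * (\sum_(al < p.1) lower W g (cut_at p al) +
 cst 2 * \sum_(al < p.1) \sum_(r <- splits p.2) \sum_(g1 < g.+1)
  cst (h (g - g1) (p.1 - al :: r.2)%N) * z ^+ (p.1 - al + sumn r.2) * W g1 (nat_of_ord al :: r.1)).
Proof.
move=> mu0;move: (cut_join_series g mu0);set c1 := 2 * (_ + _ - 1)=> /(congr1 (fun f=> z ^+ sumn mu * S f)).
rewrite !subs_D !subs_cstM !subs_sum !(mulrDr (z ^+ _))=> EI.
transitivity (z ^+ sumn mu * (cst c1 * S (U g mu)) +
 z ^+ sumn mu * (cst (2 / a%:R) * S (V g mu)));first by rewrite /W /Vh;move: (S _) (S _)=> x y;ring.
rewrite {}EI /Ch;congr (_ + _ + _ + _ + _).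
- rewrite mulr_sumr;apply: eq_big_seq=> q /sel_perm/perm_sumn/= Eq;rewrite subs_cstM mulrCA Eq join_series.
by rewrite (sum_rev q.1 (F := fun b=> cst (h g (b :: q.2)) * z ^+ (b + sumn q.2) * E (q.1 - b)%:R)) ?h0 ?rmorph0 ?mul0r//;
 congr (_ * (_ - _));apply: eq_bigr=> al _;rewrite subKn// ltnW.
- rewrite mulr_sumr;apply: eq_big_seq=> p /sel_perm/perm_sumn/= Ep;rewrite subs_sum mulr_sumr.
apply: eq_big_seq=> q /sel_perm/perm_sumn/= Eq;rewrite subs_cstM mulrCA /W/=.
by congr (_ * (z ^+ _ * _));rewrite Ep Eq addnA.
- rewrite mulr_sumr;apply: eq_big_seq=> r /splits_perm/perm_sumn;rewrite sumn_cat=> Er;rewrite subs_sum mulr_sumr.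
by apply: eq_bigr=> g1 _;rewrite subs_M /Vh Er exprD;move: (S _) (S _)=> x y;ring.
rewrite mulr_sumr;apply: eq_big_seq=> p /sel_perm/perm_sumn/= Ep;rewrite subs_cstM mulrCA;congr (_ * _).
rewrite subs_sum mulr_sumr.
pose F al r g1 b s g2 : fps R := cst (h g2 (b :: s)) * z ^+ (b + sumn s) * W g1 (al :: r).
have F1 r g1 b s g2 : F 0%N r g1 b s g2 = 0 by rewrite /F W_mem0 ?mulr0// mem_head.
have F2 r g1 b s g2 : F b s g2 0%N r g1 = 0 by rewrite /F h0 rmorph0 !mul0r.
have -> : cst 2 = 1 + 1 :> fps R by rewrite -(rmorph1 (@cst R)) -rmorphD.
rewrite mulrDl mul1r [X in _ + (_ + X)](cut_sym p.1 p.2 g F1 F2) -!big_split.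
apply: eq_bigr=> al _;rewrite raddfD mulrDr/=;have alp : (al <= p.1)%N by rewrite ltnW.
congr (_ + _);first by case: (g)=> [|g']/=;[rewrite raddf0 mulr0|rewrite /W/= addnA subnKC// -Ep].
rewrite subs_sum mulr_sumr -big_split;apply: eq_big_seq=> r /splits_perm/perm_sumn;rewrite sumn_cat=> Er.
rewrite subs_sum mulr_sumr -big_split;apply: eq_bigr=> g1 _/=.
rewrite raddfD/= !subs_cstM mulrDr /F /W/=.
have ac (x y u v : nat) : (x <= y)%N -> (y + (u + v) = (y - x + v) + (x + u))%N by lia.
have -> : sumn mu = ((p.1 - al + sumn r.2) + (al + sumn r.1))%N by rewrite Ep Er;exact: ac.
by rewrite !exprD;congr (_ + _);move: (S _)=> x;ring.
Qed.

(** The equation for the empty list becomes a quadratic differential equation for [V], solved by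
    [z^a]. The difference [d] to that solution vanishes by induction on the degree. *)
Lemma base_V : Vh 0 [::] = z ^+ a.
Proof.
have := homogeneous_identity 0 (isT : 0%N \notin [::]);rewrite/= !big_nil !big_seq1 big_ord1/= add0r addr0.
have -> : Ch 0 [::] = 0.
have -> : Ch 0 [::] = z ^+ 0 * S 0;last by rewrite raddf0 mulr0.
by congr (_ * S _);apply: fpsP=> v/=;rewrite big1.
rewrite !(add0r, addr0, mul0r, sub0r, subnn)=> EI.
have EV := el_Vh 0 [::];rewrite/= rmorph0 mul0r subr0 in EV.
(* In degree [a] the linear part of the equation for [d] degenerates, so this coefficient is taken
   from [h_base]. *)
have ya : coef (Vh 0 [::]) a = 1.
rewrite /Vh/= expr0 mul1r/= big_ord_recr/= h_base mul1r (xx_exp R a0) coef_zzM ltnn subnn ez0 big1 ?add0r//.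
move=> i _;have [i0|i0] := posnP i;first by rewrite i0 h0 mul0r.
by rewrite h_dvd ?mul0r//= addn0 gtnNdvd.
move: EI EV ya;move: (W 0 [::]) (Vh 0 [::])=> w y EI EV ya.
have := congr1 (@theta R) EI;rewrite thetaD !theta_cstM thetaM -EV.
move: ya;have -> : y = z ^+ a + (y - z ^+ a) by rewrite addrC subrK.
move: (y - z ^+ a)=> d;rewrite coefD coef_zz eqxx -[RHS]addr0=> /addrI da Ed.
have {}Ed : cst (2 / a%:R) * theta d - cst 2 * d = cst 2 * z ^+ a * theta d + cst 2 * (d * theta d).
move: Ed;rewrite thetaD theta_zz /el.
have -> : cst (2 * -1) = - cst 2 :> fps R by rewrite -rmorphN mulrN1.
have -> : cst (2 / a%:R) = cst 2 * cst (a%:R^-1) :> fps R by rewrite -rmorphM.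
have -> : cst 2 = 1 + 1 :> fps R by rewrite -(rmorph1 (@cst R)) -rmorphD.
have : cst a%:R * cst (a%:R^-1) = 1 :> fps R by rewrite -rmorphM divff ?rmorph1// aR0.
move: (cst a%:R) (cst a%:R^-1) (z ^+ a) (theta d)=> c c' x t cc Ed.
have cx : c' * (c * x + t) = x + c' * t by rewrite mulrDr mulrA (mulrC c') cc mul1r.
rewrite -[(1 + 1) * c' * _]mulrA cx in Ed.
have key (p q : fps R) : p = q -> p - q = 0 by move=> ->;rewrite subrr.
by apply/eqP;rewrite -subr_eq0 -(key _ _ Ed);apply/eqP;ring.
suff -> : d = 0 by rewrite addr0.
apply: fpsP;elim/ltn_ind=> k IH;rewrite coef0.
have := congr1 (fun f=> coef f k) Ed;rewrite !coefD coefN -[cst 2 * z ^+ a * _]mulrA !coefc coef_zzM coefM' big_ord_recr big1=> [|i _];last first.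
by have -> : coef d (widen_ord (leqnSn k) i) = 0 by [exact: (IH i (ltn_ord i))];rewrite mul0r.
rewrite subnn/= mul0r mulr0 add0r mulr0 addr0.
have -> : (if (k < a)%N then 0 else (k - a)%:R * coef d (k - a)) = 0.
by case: ltnP=> // ak;rewrite IH ?coef0 ?mulr0// ltn_subrL a0 (leq_trans a0).
rewrite mulr0 mulrA -mulrBl=> /eqP;rewrite mulf_eq0=> /orP[|/eqP//].
have [-> _|ka] := eqVneq k a;first exact: da.
have nz : (2 / a%:R : R) != 0 by rewrite mulf_neq0 ?invr_neq0 ?aR0 ?pnatr_eq0.
rewrite subr_eq0=> /eqP H;case/eqP: ka;apply/eqP;rewrite -(eqr_nat R);apply/eqP.
by apply: (mulfI nz);rewrite H divfK// aR0.
Qed.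

(** By induction on [q]: the Euler derivatives of the two series differ by terms built from smaller
    entries [al], which cancel in degrees above [q]. *)
Lemma W_one q : (forall i, (q < i)%N -> coef (W 0 [:: q]) i = coef (E q%:R) i).
Proof.
elim/ltn_ind: q=> q IH;have [q0|q0] := posnP q.
move=> i qi;rewrite W_mem0 ?q0 ?mem_head// coef0 (ez00 R a0)/=.
by rewrite gtn_eqF// (leq_ltn_trans (leq0n q)).
have q1 : 0%N \notin [:: q] by rewrite seq.inE eq_sym -lt0n.
have := homogeneous_identity 0 q1;rewrite/= !big_cons !big_nil !big_ord1/= !addr0 base_V.
have -> : Ch 0 [:: q] = 0.
have -> : Ch 0 [:: q] = z ^+ sumn [:: q] * S 0;last by rewrite raddf0 mulr0.
by congr (_ * S _);apply: fpsP=> v/=;rewrite big1.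
set X := \sum_(al < q) \sum_(r <- _) _;set Y := \sum_(al < q) cst _ * _ * _.
rewrite big1_eq !(add0r, addr0, addn0, muln0, add0n)=> ID.
have EX : X = \sum_(al < q) cst (h 0 [:: q - al]%N) * z ^+ (q - al) * W 0 [:: nat_of_ord al].
by apply: eq_bigr=> al _;rewrite big_seq1 big_ord1/= addn0.
have EY : Y = \sum_(al < q) cst (h 0 [:: q - al]%N) * z ^+ (q - al) * E (nat_of_ord al)%:R.
by apply: eq_bigr=> al _;rewrite addn0.
have EV := el_Vh 0 [:: q];rewrite/= addn0 in EV.
clearbody X Y;move: ID EV;move: (W 0 [:: q]) (Vh 0 [:: q])=> W1 V1 ID EV.
have := congr1 (fun f=> cst a%:R * f) ID;rewrite [LHS]mulrDr !mulrA -!rmorphM/=.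
have -> : a%:R * (2 * (1 + q%:R / a%:R - 1)) = 2 * q%:R :> R by have := aR0=> ?;field.
have -> : a%:R * (2 / a%:R) = 2 :> R by have := aR0=> ?;field.
move=> {}ID.
have key (p s : fps R) : p = s -> p - s = 0 by move=> ->;rewrite subrr.
have {}ID : cst 2 * (theta W1 - theta (E q%:R)) = cst (2 * (a%:R * q%:R)) * (X - Y).
have -> : theta W1 = el R a * V1 + cst q%:R * W1 by rewrite EV subrK.
apply/eqP;rewrite -subr_eq0 -(key _ _ ID) (theta_ez a0) /el !rmorphM/=;apply/eqP.
have -> : cst 2 = 1 + 1 :> fps R by rewrite -(rmorph1 (@cst R)) -rmorphD.
move: (E _)=> E1;clear;ring.
move=> i qi;have := congr1 (fun f=> coef f i) ID;rewrite !coefc.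
have -> : coef (X - Y) i = 0.
rewrite EX EY coefD coefN !coef_sum -sumrB big1// => al _.
have := IH al (ltn_ord al);move: (W 0 [:: nat_of_ord al])=> w IHw;rewrite -!mulrA !coefc !coef_zzM.
have -> : (i < q - al)%N = false by apply/negbTE;rewrite -leqNgt (leq_trans (leq_subr _ _))// ltnW.
by rewrite IHw ?subrr// ltn_subRL subnK// ltnW.
move/eqP;rewrite mulr0 mulf_eq0 coefD coefN subr_eq0=> /orP[|/eqP/= E1];first by rewrite pnatr_eq0.
by apply: (mulfI (_ : (i%:R : R) != 0))=> //;rewrite pnatr_eq0 -lt0n (leq_ltn_trans _ qi).
Qed.

(** Both sides are coefficients of [base R a 0]: its substitution is [1 / el], which by [base_V]
    equals 1 plus the substituted Euler derivative of the genus 0 series with one point. *)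
Lemma base_one q : (0 < q)%N -> coef (E q%:R) q = q%:R * h 0 [:: q].
Proof.
move=> q0.
have E1 : S (base R a 0) = 1 + S (theta (V 0 [::])).
apply: el_inj;rewrite (subs_base R a0 a0) expr0 mulrDr mulr1 -(theta_subs a0).
have := base_V;rewrite /Vh/= expr0 mul1r=> ->.
by rewrite theta_zz /el subrK.
have {}E1 : base R a 0 = 1 + theta (V 0 [::]).
by apply: subs_inj;rewrite E1 raddfD/= (subs_cst _ 1).
have <- : coef (base R a 0) q = q%:R * h 0 [:: q].
rewrite E1 coefD (_ : coef 1 q = 0) ?add0r//.
by rewrite -(rmorph1 (@cst R))/= gtn_eqF.
by rewrite/= mod0n.
Qed.

(** Parts singular at infinity of the unstable series, [exp(q z^a)] and [z^a], with the derivative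
    of the former. They obey the same relation as [W] and [Vh], so the differences do too. *)
Definition Zu g mu : fps R := if g == 0%N then match_short 0 (fun q=> E q%:R) 0 mu else 0.
Definition Zv g mu : fps R := if g == 0%N then match_short (z ^+ a) (fun q=> - cst q%:R * E q%:R) 0 mu else 0.
(** The expected value at infinity of [W - Zu]. The last term belongs to the single entry 0, where
    [W] vanishes and [Zu] is 1. *)
Definition evU g mu : R := - (sumn mu)%:R * h g mu - ((g == 0%N) && (mu == [:: 0%N]))%:R.

Lemma el_RV g mu : (0 < g)%N || (0 < size mu)%N ->
el R a * (Vh g mu - Zv g mu) = theta (W g mu - Zu g mu) - cst (sumn mu)%:R * (W g mu - Zu g mu).
Proof.
move=> st;have EZ : el R a * Zv g mu = theta (Zu g mu) - cst (sumn mu)%:R * Zu g mu.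
have t0 : theta (0 : fps R) = 0 by apply: fpsP=> n/=;rewrite mulr0.
move: st;rewrite /Zv /Zu;case: (g)=> [|g']/=;last by rewrite t0 !mulr0 subr0.
case: mu=> [//|q [|p mu]] _/=;last by rewrite t0 !mulr0 subr0.
by rewrite addn0 (theta_ez a0) /el rmorphM/=;ring.
have tB (p q : fps R) : theta (p - q) = theta p - theta q by apply: fpsP=> n/=;rewrite mulrBr.
by rewrite mulrBr EZ el_Vh tB;ring.
Qed.

Hypothesis stable_reg : forall g mu, 0%N \notin mu -> (0 < g)%N || (1 < size mu)%N ->
exists e, reg a 0 (S (U g mu)) e.
Hypothesis pair_reg : forall g mu, 0%N \notin mu -> (0 < size mu)%N -> reg a 0 (S (Conv g mu)) 0.

Lemma Zu_stable g mu : (0 < g)%N || (1 < size mu)%N -> Zu g mu = 0.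
Proof. by rewrite /Zu;case: g=> [|//]/=;case: mu=> [|q [|p mu]]. Qed.

Lemma reg_hat J f e : reg a 0 f e -> reg a J (z ^+ J * f) e.
Proof. by move=> H;have := regM a0 (reg_zz R a J) H;rewrite addn0 mul1r. Qed.

(** The cases in which quasi-polynomiality says nothing: an entry 0, and genus 0 with one entry [q].
    In the latter [W_one] leaves a polynomial of degree at most [q], whose top coefficient is given
    by [base_one]. *)
Lemma reg_RU_special g mu : (0 < size mu)%N -> (0%N \in mu) || ~~ ((0 < g)%N || (1 < size mu)%N) ->
reg a (sumn mu) (W g mu - Zu g mu) (evU g mu).
Proof.
move=> s0;have [m0 _|m0/= ust] := boolP (0%N \in mu).
rewrite W_mem0// /evU h_mem0// mulr0 !sub0r.
have [/andP[/eqP -> /eqP ->]|ns] := boolP ((g == 0%N) && (mu == [:: 0%N])).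
 by rewrite /Zu/= (ez00 R a0) -(rmorph1 (@cst R)) -rmorphN;exact: reg_cst.
rewrite (_ : Zu g mu = 0) ?oppr0 ?subr0;first exact: reg0.
move: ns m0;rewrite /Zu;case: eqP=> //= _;case: mu s0=> [|q [|p mu]]//= _;rewrite seq.inE.
by move=> ns /eqP q0;rewrite -q0 eqxx in ns.
case: g ust=> [|//];case: mu s0 m0=> [|q [|//]]//= _;rewrite seq.inE eq_sym=> q0 _.
rewrite /evU/= addn0 /Zu/= eqseq_cons andbT (negbTE q0) subr0 mulNr -base_one ?lt0n//.
apply: reg_low=> [i qi|];first by rewrite coefD coefN W_one// subrr.
by rewrite coefD coefN W_low ?sub0r//= addn0.
Qed.

Lemma reg_W g mu : 0%N \notin mu -> (0 < g)%N || (1 < size mu)%N -> exists e, reg a (sumn mu) (W g mu) e.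
Proof. by move=> m0 st;have [e He] := stable_reg m0 st;exists e;exact: reg_hat. Qed.

(** By [el_RV] this is a twisted Euler derivative divided by [el], so its value at infinity is 0.
    The empty list in genus 0 is settled by [base_V]. *)
Lemma reg_RV g mu : reg a (sumn mu) (Vh g mu - Zv g mu) 0.
Proof.
have [st|] := boolP ((0 < g)%N || (0 < size mu)%N);last first.
by case: g mu=> [|//] [|//] _;rewrite base_V /Zv/= subrr;exact: reg0.
have [e He] : exists e, reg a (sumn mu) (W g mu - Zu g mu) e.
have [m0|m0] := boolP (0%N \in mu).
 by exists (evU g mu);apply: reg_RU_special;rewrite ?m0//;case: (mu) m0.
have [st'|ust] := boolP ((0 < g)%N || (1 < size mu)%N).
 by rewrite (Zu_stable st') subr0;exact: reg_W.
exists (evU g mu);apply: reg_RU_special;rewrite ?ust ?orbT//.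
by move: st ust;rewrite negb_or;case: (0 < g)%N.
exact: (reg_div_el a0 He (el_RV st)).
Qed.

Lemma sum_Zv g mu (Y : nat -> seq nat -> fps R) :
\sum_(r <- splits mu) \sum_(g1 < g.+1) Zv g1 r.1 * Y (g - g1)%N r.2 =
z ^+ a * Y g mu + \sum_(q <- sel mu) - cst q.1%:R * E q.1%:R * Y g q.2.
Proof.
rewrite -(sum_match_short mu (z ^+ a) (fun q=> - cst q%:R * E q%:R) (Y g));apply: eq_bigr=> r _.
by rewrite big_ord_recl/= subn0 big1 ?addr0// => i _;rewrite /Zv/= mul0r.
Qed.

(** Products of singular parts of [Vh] reproduce the singular parts of the merging terms. Only genus
    0 with two entries gives a nonzero contribution, by the addition formula for [exp]. *)
Lemma sum_ZvZv g mu : (0 < size mu)%N -> (0 < g)%N || (1 < size mu)%N ->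
z ^+ a * Zv g mu + \sum_(q <- sel mu) - cst q.1%:R * E q.1%:R * Zv g q.2 =
\sum_(p <- sel mu) \sum_(q <- sel p.2) cst (p.1%:R * q.1%:R) * Zu g (p.1 + q.1 :: q.2)%N.
Proof.
move=> s0 st;rewrite /Zv /Zu;have [g0|g0] := eqVneq g 0%N;last first.
rewrite mulr0 add0r !big1// => p _;rewrite ?mulr0// big1// => q _;by rewrite mulr0.
rewrite g0/= in st;case: mu s0 st=> [|p [|q [|k mu]]]// _ _.
rewrite/= !big_cons !big_nil/= !addr0 mulr0 add0r [(q + p)%N]addnC natrD -(ezD a0) !rmorphM/=.
by ring.
have big_sel (s : seq nat) x : x \in sel s -> size s = (size x.2).+1 by move=> /sel_perm/perm_size.
rewrite [X in _ * X + _]/= mulr0 add0r [LHS]big1_seq;last first.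
move=> x;rewrite andTb=> xs;have/= := big_sel _ _ xs.
by case: (x.2)=> [|? [|? ?]]//= _;rewrite mulr0.
rewrite big1_seq// => x;rewrite andTb=> xs;rewrite big1_seq// => y;rewrite andTb=> ys.
have sx := big_sel _ _ xs;have sy := big_sel _ _ ys;rewrite/= in sx.
by case: (y.2) sy=> [|? ?]/= sy;rewrite ?mulr0//;move: sx;rewrite sy.
Qed.

(** Expanding the products of [Vh - Zv], the cross terms with [z^a] match the part [- 2 z^a Vh] of
    [(2 / a) el Vh], and those with [exp(q z^a)] cancel the terms where the distinguished point is
    merged. The truncations of the latter become the [Zu] subtracted in the last sum. *)
Lemma regular_identity g mu : 0%N \notin mu -> (0 < size mu)%N -> (0 < g)%N || (1 < size mu)%N ->
cst (2 * ((2 * g + size mu)%:R + (sumn mu)%:R / a%:R - 1)) * W g mu +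
 cst (2 / a%:R) * (theta (W g mu) - cst (sumn mu)%:R * W g mu) =
\sum_(p <- sel mu) \sum_(q <- sel p.2) cst (p.1%:R * q.1%:R) * (W g (p.1 + q.1 :: q.2)%N - Zu g (p.1 + q.1 :: q.2)%N) +
Ch g mu + \sum_(r <- splits mu) \sum_(g1 < g.+1) (Vh g1 r.1 - Zv g1 r.1) * (Vh (g - g1) r.2 - Zv (g - g1)%N r.2) +
\sum_(p <- sel mu) cst p.1%:R * (\sum_(al < p.1) lower W g (cut_at p al) +
 cst 2 * \sum_(al < p.1) \sum_(r <- splits p.2) \sum_(g1 < g.+1)
  cst (h (g - g1) (p.1 - al :: r.2)%N) * z ^+ (p.1 - al + sumn r.2) *
  (W g1 (nat_of_ord al :: r.1) - Zu g1 (nat_of_ord al :: r.1))).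
Proof.
move=> m0 s0 st;have ID := homogeneous_identity g m0.
have two : cst 2 = 1 + 1 :> fps R by rewrite -(rmorph1 (@cst R)) -rmorphD.
set VV := \sum_(r <- splits mu) \sum_(g1 < g.+1) Vh g1 r.1 * _ in ID.
set RR := \sum_(r <- splits mu) \sum_(g1 < g.+1) (Vh g1 r.1 - Zv g1 r.1) * _.
pose T1 := \sum_(q <- sel mu) cst q.1%:R * E q.1%:R * Vh g q.2.
pose ZZ := \sum_(p <- sel mu) \sum_(q <- sel p.2) cst (p.1%:R * q.1%:R) * Zu g (p.1 + q.1 :: q.2)%N.
have EVV : VV = RR + cst 2 * (z ^+ a * Vh g mu - T1) - ZZ.
have EZ1 := sum_Zv g mu Vh;have EZ2 := sum_Zv g mu Zv;rewrite (sum_ZvZv s0 st) -/ZZ in EZ2.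
have -> : T1 = - \sum_(q <- sel mu) - cst q.1%:R * E q.1%:R * Vh g q.2.
 by rewrite -sumrN;apply: eq_bigr=> q _;rewrite !mulNr opprK.
rewrite opprK -EZ1 -EZ2 two mulrDl mul1r.
rewrite [X in _ + (_ + X)](splits_sym mu (fun r1 r2=> \sum_(g1 < g.+1) Zv g1 r1 * Vh (g - g1)%N r2)).
rewrite /VV /RR -!big_split -sumrB;apply: eq_bigr=> r _/=.
rewrite (sum_genus g (fun x y=> Zv x r.2 * Vh y r.1)) -!big_split -sumrB.
apply: eq_bigr=> g1 _/=.
move: (Vh g1 r.1) (Vh (g - g1)%N r.2) (Zv g1 r.1) (Zv (g - g1)%N r.2)=> x1 x2 x3 x4.
ring.
pose T2 := \sum_(q <- sel mu) cst q.1%:R * \sum_(al < q.1) cst (h g (q.1 - al :: q.2)%N) * z ^+ (q.1 - al + sumn q.2) * E (nat_of_ord al)%:R.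
have ET : \sum_(q <- sel mu) cst (2 * q.1%:R) * (E q.1%:R * Vh g q.2 -
 \sum_(al < q.1) cst (h g (q.1 - al :: q.2)%N) * z ^+ (q.1 - al + sumn q.2) * E (nat_of_ord al)%:R) = cst 2 * (T1 - T2).
by rewrite /T1 /T2 -sumrB mulr_sumr;apply: eq_bigr=> q _;rewrite rmorphM/=;ring.
have EB : \sum_(p <- sel mu) \sum_(q <- sel p.2) cst (p.1%:R * q.1%:R) * (W g (p.1 + q.1 :: q.2)%N - Zu g (p.1 + q.1 :: q.2)%N) =
 \sum_(p <- sel mu) \sum_(q <- sel p.2) cst (p.1%:R * q.1%:R) * W g (p.1 + q.1 :: q.2)%N - ZZ.
by rewrite /ZZ -sumrB;apply: eq_bigr=> p _;rewrite -sumrB;apply: eq_bigr=> q _;rewrite mulrBr.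
have ED : \sum_(p <- sel mu) cst p.1%:R * (\sum_(al < p.1) lower W g (cut_at p al) +
 cst 2 * \sum_(al < p.1) \sum_(r <- splits p.2) \sum_(g1 < g.+1)
  cst (h (g - g1) (p.1 - al :: r.2)%N) * z ^+ (p.1 - al + sumn r.2) *
  (W g1 (nat_of_ord al :: r.1) - Zu g1 (nat_of_ord al :: r.1))) =
\sum_(p <- sel mu) cst p.1%:R * (\sum_(al < p.1) lower W g (cut_at p al) +
 cst 2 * \sum_(al < p.1) \sum_(r <- splits p.2) \sum_(g1 < g.+1)
  cst (h (g - g1) (p.1 - al :: r.2)%N) * z ^+ (p.1 - al + sumn r.2) * W g1 (nat_of_ord al :: r.1)) - cst 2 * T2.
rewrite /T2 mulr_sumr -sumrB;apply: eq_bigr=> p _;rewrite mulrCA -mulrBr -addrA -mulrBr.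
congr (_ * (_ + _ * _));rewrite -sumrB;apply: eq_bigr=> al _.
have := sum_match_short p.2 (E (nat_of_ord al)%:R) (fun=> 0) (fun s=> cst (h g (p.1 - al :: s)%N) * z ^+ (p.1 - al + sumn s)).
rewrite [X in _ + X]big1 ?addr0=> [EM|q _];last by rewrite mul0r.
rewrite [X in _ - X]mulrC -EM -sumrB;apply: eq_bigr=> r _.
rewrite [RHS](_ : _ = \sum_(g1 < g.+1) cst (h (g - g1) (p.1 - al :: r.2)%N) * z ^+ (p.1 - al + sumn r.2) * W g1 (nat_of_ord al :: r.1) -
 \sum_(g1 < g.+1) cst (h (g - g1) (p.1 - al :: r.2)%N) * z ^+ (p.1 - al + sumn r.2) * Zu g1 (nat_of_ord al :: r.1)).
 by rewrite -sumrB;apply: eq_bigr=> g1 _;rewrite mulrBr.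
congr (_ - _);rewrite big_ord_recl/= subn0 [X in _ + X]big1 ?addr0;last by move=> i _;rewrite /Zu/= mulr0.
by rewrite /Zu/= mulrC;congr (_ * _);case: (r.1)=> [|x [|y l]].
rewrite EB ED -el_Vh;move: ID;rewrite ET EVV=> ID.
have -> : cst (2 / a%:R) * (el R a * Vh g mu) = cst (2 / a%:R) * Vh g mu - cst 2 * z ^+ a * Vh g mu.
move: (Vh g mu)=> v;rewrite /el mulrBl mul1r mulrBr;congr (_ - _).
by rewrite !mulrA -rmorphM/= divfK// aR0.
rewrite addrA ID;ring.
Qed.

Lemma sum_sel mu : (\sum_(p <- sel mu) p.1)%N = sumn mu.
Proof. by elim: mu=> [|k s IH];rewrite ?big_nil//= big_cons big_map/= IH. Qed.

(** Both sides of [regular_identity] are evaluated at infinity. Products of regular parts and [Ch]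
    have value 0, and the induction hypothesis covers the other terms on the right, all with smaller
    [2 g + n + |mu|]. *)
Lemma regular_value g mu : 0%N \notin mu -> (0 < size mu)%N -> (0 < g)%N || (1 < size mu)%N ->
(forall g' nu, (2 * g' + size nu + sumn nu < 2 * g + size mu + sumn mu)%N -> (0 < size nu)%N ->
 reg a (sumn nu) (W g' nu - Zu g' nu) (evU g' nu)) ->
reg a (sumn mu) (W g mu) (- (sumn mu)%:R * h g mu).
Proof.
move=> m0 s0 st IH;have [e He] := reg_W m0 st.
set M := (2 * g + size mu)%:R + (sumn mu)%:R / a%:R - 1 : R.
have mu_pos p : p \in sel mu -> (0 < p.1)%N.
move=> /sel_perm/perm_mem/(_ p.1);rewrite mem_head lt0n=> pm.
by apply: contraNneq m0=> <-;rewrite pm.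
have HL : reg a (sumn mu) (cst (2 * M) * W g mu + cst (2 / a%:R) * (theta (W g mu) - cst (sumn mu)%:R * W g mu)) (2 * M * e + 2 / a%:R * 0).
by apply: (regD a0);apply: (regZ a0)=> //;exact: (reg_theta a0 He).
pose G (p1 : nat) (p2 : seq nat) := \sum_(al < p1) \sum_(r <- splits p2) \sum_(g1 < g.+1)
 h (g - g1) (p1 - al :: r.2)%N * evU g1 (nat_of_ord al :: r.1).
have HR : reg a (sumn mu) (cst (2 * M) * W g mu + cst (2 / a%:R) * (theta (W g mu) - cst (sumn mu)%:R * W g mu))
(\sum_(p <- sel mu) \sum_(q <- sel p.2) p.1%:R * q.1%:R * (- (sumn mu)%:R * h g (p.1 + q.1 :: q.2)%N) + 0 +
 \sum_(r <- splits mu) \sum_(g1 < g.+1) 0 +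
 \sum_(p <- sel mu) p.1%:R * (\sum_(al < p.1) - (sumn mu)%:R * lower h g (cut_at p al) + 2 * G p.1 p.2)).
rewrite /M (regular_identity m0 s0 st);apply: (regD a0);first apply: (regD a0);first apply: (regD a0).
- apply: (reg_sum a0)=> p pmu;apply: (reg_sum a0)=> q qp;apply: (regZ a0).
 have p0 := mu_pos p pmu.
 have /perm_sumn/= Ep := sel_perm pmu;have /perm_size/= sp := sel_perm pmu.
 have /perm_sumn/= Eq := sel_perm qp;have /perm_size/= sq := sel_perm qp.
 have Es : sumn (p.1 + q.1 :: q.2)%N = sumn mu by rewrite Ep Eq/= addnA.
 have := IH g (p.1 + q.1 :: q.2)%N;rewrite /evU Es eqseq_cons addn_eq0 (gtn_eqF p0)/= andbF subr0;apply=> //.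
 by rewrite ltn_add2r ltn_add2l sp sq.
- case: (g) m0 s0=> [|g'] m0 s0;last by apply: reg_hat;exact: pair_reg.
 by apply: reg_hat;exact: pair_reg.
- apply: (reg_sum a0)=> r /splits_perm/perm_sumn;rewrite sumn_cat=> ->;apply: (reg_sum a0)=> g1 _.
 by have := regM a0 (reg_RV g1 r.1) (reg_RV (g - g1)%N r.2);rewrite mulr0.
apply: (reg_sum a0)=> p pmu;apply: (regZ a0).
have p0 := mu_pos p pmu;have /perm_sumn/= Ep := sel_perm pmu;have /perm_size/= sp := sel_perm pmu.
apply: (regD a0).
 apply: (reg_sum a0)=> al _;have alp : (al <= p.1)%N by rewrite ltnW.
 have Es : sumn (cut_at p al) = sumn mu by rewrite Ep/= addnA subnKC.
 case: (g) IH=> [|g'] IH/=;first by rewrite mulr0;exact: reg0.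
 have := IH g' (cut_at p al);rewrite Zu_stable ?orbT// /evU Es eqseq_cons andbF andbF !subr0;apply=> //.
 by rewrite ltn_add2r/= sp;clear;lia.
apply: (regZ a0);apply: (reg_sum a0)=> al _;have alp : (al < p.1)%N by [].
apply: (reg_sum a0)=> r rp;have /perm_sumn := splits_perm rp;rewrite sumn_cat=> Er.
have /perm_size := splits_perm rp;rewrite size_cat=> sr.
apply: (reg_sum a0)=> g1 _.
have -> : sumn mu = ((p.1 - al + sumn r.2) + sumn (nat_of_ord al :: r.1))%N.
 have ac (x y u v : nat) : (x < y)%N -> (y + (u + v) = (y - x + v) + (x + u))%N by lia.
 by rewrite Ep Er/=;exact: ac.
apply: (regM a0);first by rewrite -[X in reg _ _ _ X]mulr1;apply: (regZ a0);exact: reg_zz.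
apply: IH=> //;rewrite Ep sp Er sr/=.
have ac (x y u v s1 s2 g1' g' : nat) : (x < y)%N -> (g1' < g'.+1)%N ->
 (2 * g1' + s1.+1 + (x + u) < 2 * g' + (s1 + s2).+1 + (y + (u + v)))%N by lia.
exact: ac.
have := reg_inj a0 HL HR;rewrite mulr0 !addr0 (big1 (splits mu)) ?addr0=> [|r _];last by rewrite big1.
(* Symmetrization: the degrees of the two components add up to [p1 + |p2|]. The extra term of [evU],
   at [al = 0] with an empty list, contributes [- 2 h g (p1 :: p2)]. *)
have EG p1 p2 : (0 < p1)%N -> 2 * G p1 p2 = - (p1 + sumn p2)%:R * (\sum_(al < p1) \sum_(r <- splits p2) \sum_(g1 < g.+1)
 h g1 (nat_of_ord al :: r.1) * h (g - g1) (p1 - al :: r.2)%N) - 2 * h g (p1 :: p2).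
move=> p10.
pose X := \sum_(al < p1) \sum_(r <- splits p2) \sum_(g1 < g.+1)
 (sumn (nat_of_ord al :: r.1))%:R * (h g1 (nat_of_ord al :: r.1) * h (g - g1) (p1 - al :: r.2)%N).
have -> : G p1 p2 = - X - h g (p1 :: p2).
 pose ind g1 al (r : seq nat) : R := ((g1 == 0%N) && (al :: r == [:: 0%N]))%:R.
 have -> : h g (p1 :: p2) = \sum_(al < p1) \sum_(r <- splits p2) \sum_(g1 < g.+1) ind g1 al r.1 * h (g - g1) (p1 - al :: r.2)%N.
  have inner al : \sum_(r <- splits p2) \sum_(g1 < g.+1) ind g1 al r.1 * h (g - g1) (p1 - al :: r.2)%N = (al == 0%N)%:R * h g (p1 - al :: p2)%N.
  have := sum_match_short p2 ((al == 0%N)%:R : R) (fun=> 0) (fun s=> h g (p1 - al :: s)%N).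
  rewrite [X in _ + X]big1 ?addr0=> [<-|q _];last by rewrite mul0r.
  apply: eq_bigr=> r _;rewrite big_ord_recl/= subn0 big1 ?addr0=> [|i _];last by rewrite /ind/= mul0r.
  by rewrite /ind eqseq_cons;case: (r.1)=> [|x [|y l]];rewrite/= ?andbT ?andbF.
  case: p1 p10 inner {X} => [//|p1] _ inner;rewrite big_ord_recl inner/= mul1r subn0 big1 ?addr0// => i _.
  by rewrite inner/= mul0r.
 rewrite -opprD -big_split -sumrN;apply: eq_bigr=> al _;rewrite -big_split -sumrN;apply: eq_bigr=> r _.
 by rewrite -big_split -sumrN;apply: eq_bigr=> g1 _;rewrite /evU /ind/=;ring.
pose F al r g1 b s g2 : R := (sumn (al :: r))%:R * (h g1 (al :: r) * h g2 (b :: s)).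
have F1 r g1 b s g2 : F 0%N r g1 b s g2 = 0 by rewrite /F h0 mul0r mulr0.
have F2 r g1 b s g2 : F b s g2 0%N r g1 = 0 by rewrite /F h0 !mulr0.
rewrite mulrBr;congr (_ - _).
rewrite mulrN -[2]/(1 + 1) mulrDl mul1r {2}/X (cut_sym p1 p2 g F1 F2) mulNr;congr (- _).
rewrite /X -big_split mulr_sumr;apply: eq_bigr=> al _;rewrite -big_split mulr_sumr;apply: eq_big_seq=> r /splits_perm/perm_sumn.
rewrite sumn_cat=> Er;rewrite -big_split mulr_sumr;apply: eq_bigr=> g1 _;rewrite /F/= Er.
have alp : (al < p1)%N by [].
rewrite !natrD;have -> : p1%:R = al%:R + (p1 - al)%:R :> R by rewrite -natrD subnKC// ltnW.
ring.
have M0 : M != 0.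
rewrite /M;have : (0 < 2 * g + size mu)%N by rewrite ltn_addl.
case: (2 * g + size mu)%N=> [//|k] _;rewrite -natr1 addrAC addrK gt_eqF// ltr_wpDl// divr_gt0 ?ltr0n//.
case: (mu) m0 s0=> [//|x l];rewrite seq.inE negb_or eq_sym -lt0n=> /andP[x0 _] _/=;exact: ltn_addr.
have -> : \sum_(p <- sel mu) p.1%:R * (\sum_(al < p.1) - (sumn mu)%:R * lower h g (cut_at p al) + 2 * G p.1 p.2) =
- (sumn mu)%:R * (\sum_(p <- sel mu) p.1%:R * \sum_(al < p.1)
 (lower h g (cut_at p al) +
 \sum_(r <- splits p.2) \sum_(g1 < g.+1) h g1 (nat_of_ord al :: r.1) * h (g - g1) (p.1 - al :: r.2)%N)) - 2 * (sumn mu)%:R * h g mu.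
rewrite -{3}(sum_sel mu) natr_sum [2 * _]mulr_sumr mulr_suml mulr_sumr -sumrB;apply: eq_big_seq=> p pmu.
rewrite (EG _ _ (mu_pos p pmu)) -(h_perm _ (sel_perm pmu)) -[(p.1 + sumn p.2)%N]/(sumn (p.1 :: p.2)) -(perm_sumn (sel_perm pmu)).
by rewrite -mulr_sumr big_split/=;ring.
have -> : \sum_(p <- sel mu) \sum_(q <- sel p.2) p.1%:R * q.1%:R * (- (sumn mu)%:R * h g (p.1 + q.1 :: q.2)%N) =
- (sumn mu)%:R * \sum_(p <- sel mu) \sum_(q <- sel p.2) p.1%:R * q.1%:R * h g (p.1 + q.1 :: q.2)%N.
by rewrite mulr_sumr;apply: eq_bigr=> p _;rewrite mulr_sumr;apply: eq_bigr=> q _;ring.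
rewrite addrA -mulrDr -(cut_join g s0 m0)=> Ee.
have -> : - (sumn mu)%:R * h g mu = e;last by [].
have n2 : (2 : R) != 0 by rewrite pnatr_eq0.
apply: (mulfI (mulf_neq0 n2 M0));rewrite Ee /M;ring.
Qed.

Theorem pole_value g mu e : 0%N \notin mu -> (0 < size mu)%N -> (0 < g)%N || (1 < size mu)%N ->
reg a 0 (S (U g mu)) e -> e = - (sumn mu)%:R * h g mu.
Proof.
move=> m0 s0 st He;have {}He := reg_hat (sumn mu) He;apply: (reg_inj a0 He).
have key N g' nu : (2 * g' + size nu + sumn nu < N)%N -> (0 < size nu)%N -> reg a (sumn nu) (W g' nu - Zu g' nu) (evU g' nu).
elim: N g' nu=> [//|N IHN] g' nu lN sn.
have [sp|] := boolP ((0%N \in nu) || ~~ ((0 < g')%N || (1 < size nu)%N));first exact: reg_RU_special.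
rewrite negb_or negbK=> /andP[n0 sn'].
rewrite (Zu_stable sn') subr0 /evU.
have -> : (g' == 0%N) && (nu == [:: 0%N]) = false.
 by apply/negbTE;apply: contraNN n0=> /andP[_ /eqP ->].
rewrite subr0;apply: regular_value=> // g2 nu2 l2;apply: IHN.
by rewrite (leq_trans l2).
by apply: regular_value=> // g' nu _;exact: (key _ g' nu (ltnSn _)).
Qed.
End Series.

(** * Series with quasi-polynomial coefficients *)

Lemma tnth_rcons_widen (T : Type) n (t : n.-tuple T) x (i : 'I_n) :
tnth (rcons_tuple t x) (widen_ord (leqnSn n) i) = tnth t i.
Proof. by rewrite (tnth_nth x) (tnth_nth x)/= nth_rcons size_tuple ltn_ord. Qed.

Lemma tnth_rcons_max (T : Type) n (t : n.-tuple T) x : tnth (rcons_tuple t x) ord_max = x.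
Proof. by rewrite (tnth_nth x)/= nth_rcons size_tuple ltnn eqxx. Qed.

Lemma map_rcons_tuple (T U : Type) (f : T -> U) n (t : n.-tuple T) x :
map_tuple f (rcons_tuple t x) = rcons_tuple (map_tuple f t) (f x).
Proof. by apply: val_inj;rewrite/= map_rcons. Qed.

Lemma meval_monomials (R : comNzRingType) n (p : mpoly.mpoly n R) :
exists s : seq (R * ('I_n -> nat)), forall v, mpoly.meval v p = \sum_(m <- s) m.1 * \prod_i v i ^+ m.2 i.
Proof.
exists [seq (mpoly.mcoeff m p, mpoly.fun_of_multinom m) | m <- mpoly.msupp p]=> v.
by rewrite big_map mpoly.mevalE.
Qed.

Lemma poly_on_line (R : comNzRingType) n (p : mpoly.mpoly n R) (v w : 'I_n -> R) :
exists q : {poly R}, forall t, q.[t] = mpoly.meval (fun i=> v i + t * w i) p.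
Proof.
have [s Es] := meval_monomials p.
exists (\sum_(m <- s) m.1 *: \prod_i ((v i)%:P + w i *: 'X) ^+ m.2 i)=> t.
rewrite Es horner_sum;apply: eq_bigr=> m _;rewrite hornerZ horner_prod;congr (_ * _).
by apply: eq_bigr=> i _;rewrite horner_exp hornerD hornerC hornerZ hornerX mulrC.
Qed.

Lemma poly_eq_large (R : numDomainType) (p q : {poly R}) (T : nat) :
(forall t : nat, (T <= t)%N -> p.[t%:R] = q.[t%:R]) -> p = q.
Proof.
move=> H;apply/eqP;rewrite -subr_eq0;apply/eqP.
apply: (@roots_geq_poly_eq0 R _ [seq (T + i)%:R | i <- iota 0 (size (p - q))]).
- by apply/allP=> _ /mapP[i _ ->];rewrite /root hornerD hornerN H ?subrr ?leq_addr.
- by rewrite map_inj_uniq ?iota_uniq// => i j /eqP;rewrite eqr_nat eqn_add2l=> /eqP.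
- by rewrite size_map size_iota.
Qed.

Section Monomials.
Variables (R : realType) (a : nat).
Hypothesis a0 : (0 < a)%N.

(** The series of [v^j C(v)] over positive [v] of residue [r]. Leaving out the term at 0 is the
    source of a value at infinity. *)
Definition monomial r j : fps R := Fps (fun v=> if v == 0%N then 0 else v%:R ^+ j * coef (base R a r) v).

Lemma mono0 r j : coef (monomial r j) 0 = 0. Proof. by []. Qed.

Lemma monoE r j v : coef (monomial r j) v = v%:R ^+ j * coef (monomial r 0) v.
Proof. by rewrite/=;case: eqP=> _;rewrite ?mulr0// expr0 mul1r. Qed.

(** By [subs_base] the series [base] becomes [z^r / el] with [r < a], of value 0 at infinity, and so
    do its Euler derivatives. For [r = j = 0] the constant term 1 is removed, which gives -1. *)
Lemma reg_mono r j : (r < a)%N -> reg a 0 (subs a (monomial r j)) (- ((r == 0%N) && (j == 0%N))%:R).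
Proof.
move=> ra;have H k : reg a 0 (subs a (iter k (@theta R) (base R a r))) 0.
elim: k=> [|k IH]/=.
 exists 1%N;rewrite mulr0 !expr1 (subs_base R a0 ra) muln1 addn0.
 by split=> [i ai|];rewrite coef_zz gtn_eqF// (ltn_trans ra).
by apply: (reg_div_el a0 IH);rewrite rmorph0 mul0r subr0 theta_subs.
have E k v : coef (iter k (@theta R) (base R a r)) v = v%:R ^+ k * coef (base R a r) v.
by elim: k=> [|k IH];rewrite ?expr0 ?mul1r//= IH exprS mulrA.
have -> : monomial r j = iter j (@theta R) (base R a r) + cst (- ((r == 0%N) && (j == 0%N))%:R).
apply: fpsP=> v;rewrite coefD E/=;case: eqP=> [->|_];last by rewrite addr0.
rewrite div0n fact0 divr1 expr0 !mod0n eq_sym modn_small// expr0n.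
by case: (r == 0%N);case: (j == 0%N);rewrite/= ?mulr0 ?mul1r ?mul0r ?subrr ?oppr0 ?addr0.
rewrite raddfD/= subs_cst -[X in reg _ _ _ X]add0r;apply: (regD a0);[exact: H|exact: reg_cst].
Qed.

Lemma mono_sum v j (F : nat -> R) : \sum_(r < a) F r * coef (monomial r j) v =
if v == 0%N then 0 else F (v %% a)%N * (v%:R ^+ j * hurwitzC R a v).
Proof.
have [v0|v0] := eqVneq v 0%N;first by rewrite big1// => r _;rewrite v0 mono0 mulr0.
rewrite (bigD1 (Ordinal (ltn_pmod v a0)))//= (negbTE v0) modn_mod eqxx big1 ?addr0;last first.
move=> r rv;rewrite ifN ?mulr0//;apply: contra rv=> /eqP rv;apply/eqP/val_inj=> /=.
by rewrite rv modn_small.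
by rewrite /hurwitzC natrX.
Qed.
End Monomials.

(** * Regularity of the Hurwitz series and the value of the quasi-polynomial at zero *)

Section Extension.
Variables (R : realType) (a : nat).
Hypothesis a0 : (0 < a)%N.
Variable b : forall m : nat, m.-tuple (Cplx R).
Hypothesis hb : forall m : nat, uniq (b m) /\ 0 \notin b m.
Variable Qbar : forall g n : nat, n.-tuple int -> R.
Hypothesis hQbar : forall g n : nat, (1 <= n)%N -> (2 < 2 * g + n)%N ->
 quasi_polynomial_extension a (@hurwitzQ R b a g n) (@Qbar g n).

Local Notation h := (hroot R a).
Local Notation C := (hurwitzC R a).
Definition res n (t : n.-tuple nat) := map_tuple (fun k=> k %% a)%N t.
(** The power of [a] in the normalization of [Q], used with the tuple of residues as argument. *)
Definition kap g n (t : n.-tuple nat) : R := a%:R `^ (1 - g%:R + \sum_(i < n) (tnth t i)%:R / a%:R).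

Lemma kap_neq0 g n (t : n.-tuple nat) : kap g t != 0.
Proof. by rewrite gt_eqF// powR_gt0// ltr0n. Qed.

Lemma C_neq0 k : (0 < k)%N -> C k != 0.
Proof. by move=> k0;rewrite /hurwitzC mulf_neq0 ?invr_neq0// pnatr_eq0 -lt0n ?expn_gt0 ?k0 ?fact_gt0. Qed.

Lemma h_hurwitzQ g n (t : n.-tuple nat) : (0 < n)%N -> (forall i, (0 < tnth t i)%N) ->
h g t = kap g (res t) * (\prod_i ((tnth t i)%:R * C (tnth t i))) * hurwitzQ b a g t.
Proof.
move=> n0 t0;rewrite /hurwitzQ (hurwitzH_hroot a0 g hb n0 t0) big_tuple natr_prod big_split/=.
have -> : a%:R `^ (1 - g%:R + \sum_(i < n) (tnth t i %% a)%:R / a%:R) = kap g (res t).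
by congr (_ `^ (_ + _));apply: eq_bigr=> i _;rewrite tnth_map.
have P1 : \prod_(i < n) (tnth t i)%:R != 0 :> R by apply/prodf_neq0=> i _;rewrite pnatr_eq0 -lt0n.
have P2 : \prod_(i < n) C (tnth t i) != 0 by apply/prodf_neq0=> i _;exact: C_neq0.
by have P3 := kap_neq0 g (res t);field;rewrite P1 P2 P3.
Qed.

(** One list of monomials for each tuple of residues serves both the extension and the rooted
    numbers. *)
Lemma Qbar_expand g n : (0 < n)%N -> (2 < 2 * g + n)%N ->
exists M : n.-tuple nat -> seq (R * ('I_n -> nat)),
(forall t, Qbar g (map_tuple Posz t) = \sum_(m <- M (res t)) m.1 * \prod_i (tnth t i)%:R ^+ m.2 i) /\
(forall t : n.-tuple nat, (forall i, (0 < tnth t i)%N) -> h g t = kap g (res t) * (\prod_i ((tnth t i)%:R * C (tnth t i))) *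
 \sum_(m <- M (res t)) m.1 * \prod_i (tnth t i)%:R ^+ m.2 i).
Proof.
move=> n0 st;have [[p Ep] HQ] := hQbar n0 st.
have [M HM] := choice (fun t : n.-tuple nat=> meval_monomials (p (map_tuple Posz t))).
have E1 t : Qbar g (map_tuple Posz t) = \sum_(m <- M (res t)) m.1 * \prod_i (tnth t i)%:R ^+ m.2 i.
rewrite Ep;have -> : map_tuple (fun k=> (k %% a%:Z)%Z) (map_tuple Posz t) = map_tuple Posz (res t).
 by apply: eq_from_tnth=> i;rewrite !tnth_map modz_nat.
rewrite HM;apply: eq_bigr=> m _;congr (_ * _);apply: eq_bigr=> i _.
by rewrite tnth_map.
exists M;split=> // t t0;by rewrite (h_hurwitzQ g n0 t0) -(HQ t t0) E1.
Qed.

(** In the distinguished variable [U] is a combination of the series [monomial r j], as the division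
    by [v] cancels the rooting factor. Only [r = j = 0] has a value at infinity; it selects the
    constant term for residue 0, that is, [Qbar] at 0. *)
Lemma reg_U g n (mu : n.-tuple nat) : (2 < 2 * g + n.+1)%N -> (forall i, (0 < tnth mu i)%N) ->
reg a 0 (subs a (U h g mu)) (- (kap g (res mu) * (\prod_i ((tnth mu i)%:R * C (tnth mu i))) *
 Qbar g (map_tuple Posz (rcons_tuple mu 0%N)))).
Proof.
move=> st mu0;have [M [E1 E2]] := Qbar_expand (ltn0Sn n) st.
pose K r (m : R * ('I_n.+1 -> nat)) := kap g (rcons_tuple (res mu) r) * (\prod_i ((tnth mu i)%:R * C (tnth mu i))) *
 (m.1 * \prod_(i < n) (tnth mu i)%:R ^+ m.2 (widen_ord (leqnSn n) i)).
have -> : U h g mu = \sum_(r < a) \sum_(m <- M (rcons_tuple (res mu) r)) cst (K r m) * monomial R a r (m.2 ord_max).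
apply: fpsP=> v;rewrite coef_sum.
under eq_bigr=> r _ do rewrite coef_sum.
under eq_bigr=> r _ do under eq_bigr=> m _ do rewrite coefc.
have [->|v0] := posnP v.
 by rewrite/= invr0 mulr0 big1// => r _;rewrite big1// => m _;rewrite mulr0.
pose F r := K r.
transitivity (h g (rcons_tuple mu v) / v%:R).
 by rewrite/=;congr (_ / _);apply: hroot_perm;rewrite perm_sym perm_rcons.
rewrite E2;last first.
 by move=> i;have [j ->|->] := unliftP ord_max i;rewrite ?tnth_rcons_max// -[lift _ _]/(lift _ _);
  rewrite (_ : lift ord_max j = widen_ord (leqnSn n) j) ?tnth_rcons_widen//;apply: val_inj;rewrite/= /bump leqNgt ltn_ord.
have -> : res (rcons_tuple mu v) = rcons_tuple (res mu) (v %% a)%N by rewrite /res map_rcons_tuple.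
have key (r : nat) : \sum_(m <- M (rcons_tuple (res mu) r)) K r m * coef (monomial R a r (m.2 ord_max)) v =
 (\sum_(m <- M (rcons_tuple (res mu) r)) K r m * v%:R ^+ m.2 ord_max) * coef (monomial R a r 0) v.
 by rewrite mulr_suml;apply: eq_bigr=> m _;rewrite/= gtn_eqF// expr0 mul1r mulrA.
rewrite [RHS](eq_bigr _ (fun (r : 'I_a) _=> key r)).
rewrite (mono_sum a0 v 0 (fun r=> \sum_(m <- M (rcons_tuple (res mu) r)) K r m * v%:R ^+ m.2 ord_max)) gtn_eqF// expr0 mul1r.
rewrite big_ord_recr/= tnth_rcons_max.
under eq_bigr=> i _ do rewrite tnth_rcons_widen.
rewrite mulr_sumr !mulr_suml;apply: eq_bigr=> m _;rewrite big_ord_recr/= tnth_rcons_max /K.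
rewrite [X in _ * (m.1 * (X * _))](_ : _ = \prod_(i < n) (tnth mu i)%:R ^+ m.2 (widen_ord (leqnSn n) i));last first.
 by apply: eq_bigr=> i _;rewrite tnth_rcons_widen.
have v1 : (v%:R : R) != 0 by rewrite pnatr_eq0 -lt0n.
by field.
rewrite raddf_sum/=.
have -> : - (kap g (res mu) * (\prod_i ((tnth mu i)%:R * C (tnth mu i))) * Qbar g (map_tuple Posz (rcons_tuple mu 0%N))) =
 \sum_(r < a) \sum_(m <- M (rcons_tuple (res mu) r)) K r m * - (((r : nat) == 0%N) && (m.2 ord_max == 0%N))%:R.
rewrite E1 (bigD1 (Ordinal a0))//= [X in _ = _ + X]big1 ?addr0;last first.
 by move=> r;rewrite -val_eqE/= => /negbTE r0;rewrite big1// => m _;rewrite r0 oppr0 mulr0.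
have -> : res (rcons_tuple mu 0%N) = rcons_tuple (res mu) 0%N by rewrite /res map_rcons_tuple mod0n.
rewrite mulr_sumr -sumrN;apply: eq_bigr=> m _;rewrite big_ord_recr/= tnth_rcons_max /K expr0n.
have -> : kap g (rcons_tuple (res mu) 0%N) = kap g (res mu).
 rewrite /kap big_ord_recr/= tnth_rcons_max mul0r addr0;congr (_ `^ (_ + _)).
 by apply: eq_bigr=> i _;rewrite tnth_rcons_widen.
rewrite [X in _ * (m.1 * (X * _))](_ : _ = \prod_(i < n) (tnth mu i)%:R ^+ m.2 (widen_ord (leqnSn n) i));first by ring.
by apply: eq_bigr=> i _;rewrite tnth_rcons_widen.
apply: (reg_sum a0)=> r _;rewrite raddf_sum/=;apply: (reg_sum a0)=> m _.
rewrite subs_cstM//;apply: (regZ a0);exact: reg_mono.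
Qed.

(** Two distinguished variables keep their rooting factors here, so all exponents are at least 1 and
    every product of two monomial series has value 0. *)
Lemma reg_Conv g (mu : seq nat) : 0%N \notin mu -> (0 < size mu)%N -> reg a 0 (subs a (Conv h g mu)) 0.
Proof.
case: g=> [|g] mu0 s0.
have -> : Conv h 0 mu = 0 by apply: fpsP=> v/=;rewrite big1.
by rewrite raddf0;exact: reg0.
pose n := size mu;pose t := in_tuple mu.
have t0 i : (0 < tnth t i)%N by rewrite lt0n;apply: contraNneq mu0=> <-;exact: mem_tnth.
have st : (2 < 2 * g + n.+2)%N by rewrite -addSnnS -addSnnS -[X in (X < _)%N]addn0 -addSn -/n;move: s0;rewrite -/n;lia.
have [M [_ E2]] := Qbar_expand (ltn0Sn n.+1) st.
pose W1 := widen_ord (leqnSn n.+1);pose W2 := widen_ord (leqnSn n).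
pose K r s (m : R * ('I_n.+2 -> nat)) := kap g (rcons_tuple (rcons_tuple (res t) r) s) *
 (\prod_i ((tnth t i)%:R * C (tnth t i))) * (m.1 * \prod_(i < n) (tnth t i)%:R ^+ m.2 (W1 (W2 i))).
pose MM r s := M (rcons_tuple (rcons_tuple (res t) r) s).
have key x y : h g [:: x, y & mu] = \sum_(r < a) \sum_(s < a) \sum_(m <- MM r s)
 K r s m * (coef (monomial R a r (m.2 (W1 ord_max)).+1) x * coef (monomial R a s (m.2 ord_max).+1) y).
have [->|x0] := posnP x.
 rewrite hroot_mem0 ?mem_head// big1// => r _;rewrite big1// => s _;rewrite big1// => m _.
 by rewrite mono0 mul0r mulr0.
have [->|y0] := posnP y.
 rewrite hroot_mem0 ?seq.inE ?eqxx ?orbT// big1// => r _;rewrite big1// => s _;rewrite big1// => m _.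
 by rewrite mono0 mulr0 mulr0.
transitivity (h g (rcons_tuple (rcons_tuple t x) y)).
 apply: hroot_perm;rewrite perm_sym/= perm_rcons -cat1s -[X in perm_eq _ X](cat1s x) perm_sym.
 by rewrite -[in X in perm_eq X _]cat1s;apply: perm_trans (permEl (perm_catCA [:: x] [:: y] mu)) _;rewrite perm_cat2l perm_sym perm_rcons.
have pos (l : nat) (u : l.-tuple nat) z : (0 < z)%N -> (forall i, (0 < tnth u i)%N) -> forall i, (0 < tnth (rcons_tuple u z) i)%N.
 move=> z0 u0 i;have [j ->|->] := unliftP ord_max i;last by rewrite tnth_rcons_max.
 by rewrite (_ : lift ord_max j = widen_ord (leqnSn l) j) ?tnth_rcons_widen//;apply: val_inj;rewrite/= /bump leqNgt ltn_ord.
rewrite (E2 _ (pos _ _ y y0 (pos _ _ x x0 t0))).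
have -> : res (rcons_tuple (rcons_tuple t x) y) = rcons_tuple (rcons_tuple (res t) (x %% a)%N) (y %% a)%N by rewrite /res !map_rcons_tuple.
have inner (r : nat) : \sum_(s < a) \sum_(m <- MM r s) K r s m * (coef (monomial R a r (m.2 (W1 ord_max)).+1) x * coef (monomial R a s (m.2 ord_max).+1) y) =
 (\sum_(m <- MM r (y %% a)%N) K r (y %% a)%N m * (x%:R ^+ (m.2 (W1 ord_max)).+1 * y%:R ^+ (m.2 ord_max).+1)) * C y * coef (monomial R a r 0) x.
 transitivity (\sum_(s < a) (\sum_(m <- MM r s) K r s m * (x%:R ^+ (m.2 (W1 ord_max)).+1 * y%:R ^+ (m.2 ord_max).+1)) * coef (monomial R a r 0) x * coef (monomial R a s 0) y).
  apply: eq_bigr=> s _;rewrite !mulr_suml;apply: eq_bigr=> m _.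
  rewrite (@monoE R a r (m.2 (W1 ord_max)).+1) (@monoE R a s (m.2 ord_max).+1);ring.
 rewrite (mono_sum a0 y 0 (fun s=> (\sum_(m <- MM r s) K r s m * (x%:R ^+ (m.2 (W1 ord_max)).+1 * y%:R ^+ (m.2 ord_max).+1)) * coef (monomial R a r 0) x)).
 rewrite gtn_eqF// expr0 mul1r;ring.
rewrite [RHS](eq_bigr _ (fun (r : 'I_a) _=> inner r)).
rewrite (mono_sum a0 x 0 (fun r=> (\sum_(m <- MM r (y %% a)%N) K r (y %% a)%N m * (x%:R ^+ (m.2 (W1 ord_max)).+1 * y%:R ^+ (m.2 ord_max).+1)) * C y)).
rewrite gtn_eqF// expr0 mul1r !big_ord_recr/= tnth_rcons_max -/W1 tnth_rcons_widen tnth_rcons_max.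
under eq_bigr=> i _ do rewrite !tnth_rcons_widen.
rewrite mulr_sumr !mulr_suml;apply: eq_bigr=> m _;rewrite !big_ord_recr/= tnth_rcons_max -/W1 tnth_rcons_widen tnth_rcons_max /K.
rewrite [X in _ * (m.1 * (X * _ * _))](_ : _ = \prod_(i < n) (tnth t i)%:R ^+ m.2 (W1 (W2 i)));last first.
 by apply: eq_bigr=> i _;rewrite !tnth_rcons_widen.
rewrite !exprS;ring.
have -> : Conv h g.+1 mu = \sum_(r < a) \sum_(s < a) \sum_(m <- MM r s)
 cst (K r s m) * (monomial R a r (m.2 (W1 ord_max)).+1 * monomial R a s (m.2 ord_max).+1).
apply: fpsP=> v;rewrite coef_sum.
have cv (r s : nat) i j : coef (monomial R a r i.+1 * monomial R a s j.+1) v =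
  \sum_(al < v) coef (monomial R a r i.+1) al * coef (monomial R a s j.+1) (v - al).
 have E0 : coef (monomial R a s j.+1) (v - @ord_max v)%N = 0 by rewrite (_ : (v - @ord_max v = 0)%N)//;exact: subnn.
 by rewrite coefM' big_ord_recr E0 mulr0;exact: addr0.
under eq_bigr=> r _ do rewrite coef_sum.
under eq_bigr=> r _ do under eq_bigr=> s _ do rewrite coef_sum.
under eq_bigr=> r _ do under eq_bigr=> s _ do under eq_bigr=> m _ do rewrite coefc cv.
rewrite [LHS]/=;under eq_bigr=> al _ do rewrite key.
rewrite exchange_big;apply: eq_bigr=> r _;rewrite exchange_big;apply: eq_bigr=> s _.
by rewrite exchange_big;apply: eq_bigr=> m _;rewrite mulr_sumr.
have sum0 (T : eqType) (s : seq T) (F : T -> fps R) : (forall i, reg a 0 (F i) 0) -> reg a 0 (\sum_(i <- s) F i) 0.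
by move=> HF;have := reg_sum a0 (s := s) (F := F) (G := fun=> 0) (fun i _=> HF i);rewrite big1_eq.
rewrite subs_sum;apply: (sum0)=> r;rewrite subs_sum;apply: (sum0)=> s;rewrite subs_sum;apply: (sum0)=> m.
rewrite/= subs_cstM// subs_M// -[X in reg _ _ _ X](mulr0 (K r s m)).
apply: (regZ a0);rewrite -[X in reg _ _ _ X](mulr0 0).
have H r' j : (r' < a)%N -> reg a 0 (subs a (monomial R a r' j.+1)) 0 by move=> ra;have := @reg_mono R a a0 r' j.+1 ra;rewrite andbF oppr0.
by apply: (@regM R a a0 0 0);exact: H.
Qed.

(** The value at infinity of one series is computed twice, from quasi-polynomiality by [reg_U] and
    from the cut-and-join equation by [pole_value]. *)
Lemma Qbar_zero g n (mu : n.-tuple nat) : (0 < n)%N -> (0 < g)%N || (1 < n)%N -> (forall i, (0 < tnth mu i)%N) ->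
Qbar g (map_tuple Posz (rcons_tuple mu 0%N)) = (\sum_(i < n) tnth mu i)%:R * hurwitzQ b a g mu.
Proof.
move=> n0 st mu0.
have st' : (2 < 2 * g + n.+1)%N by move: n0 st;lia.
have m0 : 0%N \notin (mu : seq nat) by apply/negP=> /tnthP[i Ei];move: (mu0 i);rewrite -Ei.
have sreg g' nu : 0%N \notin nu -> (0 < g')%N || (1 < size nu)%N -> exists e, reg a 0 (subs a (U h g' nu)) e.
move=> nu0 sn;have := @reg_U g' (size nu) (in_tuple nu);rewrite/= => H.
have st2 : (2 < 2 * g' + (size nu).+1)%N by move: sn;move: (size nu)=> k;lia.
eexists;apply: (H st2);by move=> i;rewrite lt0n;apply: contraNneq nu0=> <-;exact: mem_tnth.
have st1 : (0 < g)%N || (1 < size mu)%N by rewrite size_tuple.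
have s1 : (0 < size mu)%N by rewrite size_tuple.
have PV e : reg a 0 (subs a (U h g mu)) e -> e = - (sumn mu)%:R * h g mu.
by apply: (pole_value a0);first [exact: hroot_perm|exact: hroot_mem0|exact: hroot_dvd|exact: hroot_base
 |exact: hroot_cut_join|exact: sreg|exact: reg_Conv|exact: m0|exact: s1|exact: st1].
have := PV _ (reg_U st' mu0).
rewrite (h_hurwitzQ g n0 mu0) sumnE big_tuple=> E.
have P0 : kap g (res mu) * \prod_i ((tnth mu i)%:R * C (tnth mu i)) != 0.
rewrite mulf_neq0 ?kap_neq0//;apply/prodf_neq0=> i _;rewrite mulf_neq0 ?C_neq0//.
by rewrite pnatr_eq0 -lt0n.
apply: (mulfI P0);apply: oppr_inj;rewrite E;ring.
Qed.
End Extension.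

(** * From positive to arbitrary integer arguments *)

Theorem theorem19 (R : realType) (a : nat) (ha : (1 <= a)%N)
  (b : forall m : nat, m.-tuple (Cplx R))
  (hb : forall m : nat, uniq (b m) /\ 0 \notin b m)
  (Qbar : forall g n : nat, n.-tuple int -> R)
  (hQbar : forall g n : nat, (1 <= n)%N -> (2 < 2 * g + n)%N ->
     quasi_polynomial_extension a (@hurwitzQ R b a g n) (Qbar g n))
  (g n : nat) (hn : (1 <= n)%N) (hgn : (g, n) <> (0%N, 1%N)) :
  ((2 < 2 * g + n)%N -> forall mu : n.-tuple int,
     Qbar g n.+1 (rcons_tuple mu 0) =
       (\sum_(i < n) tnth mu i)%:~R * Qbar g n mu)
  /\
  ((g, n) = (0%N, 2%N) -> forall mu : n.-tuple nat,
     (forall i, (0 < tnth mu i)%N) ->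
     Qbar g n.+1 (rcons_tuple (map_tuple Posz mu) 0) =
       (\sum_(i < n) tnth mu i)%:R * hurwitzQ b a g mu).
Proof.
have st : (0 < g)%N || (1 < n)%N.
by case: g hgn=> //;case: n hn=> [//|[|]].
have pos (mu : n.-tuple nat) : (forall i, (0 < tnth mu i)%N) ->
 Qbar g n.+1 (rcons_tuple (map_tuple Posz mu) 0) = (\sum_(i < n) tnth mu i)%:R * hurwitzQ b a g mu.
by move=> mu0;rewrite -(Qbar_zero ha hb hQbar hn st mu0) map_rcons_tuple.
split=> [sgn mu|_ mu];last exact: pos.
have [[p Ep] HQ] := hQbar g n hn sgn.
have sgn' : (2 < 2 * g + n.+1)%N by rewrite addnS ltnS ltnW.
have [[p' Ep'] _] := hQbar g n.+1 (ltn0Sn n) sgn'.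
(* All entries move by [a t], which keeps the residues, so along this line both sides are
   polynomials in [t]. They agree for large [t], where the entries are positive, hence at
   [t = 0]. *)
pose shift (t : nat) : n.-tuple int := map_tuple (fun k=> k + (a * t)%:Z) mu.
have res_shift t : map_tuple (fun k=> (k %% a%:Z)%Z) (shift t) = map_tuple (fun k=> (k %% a%:Z)%Z) mu.
by apply: eq_from_tnth=> i;rewrite !tnth_map addrC PoszM mulrC modzMDl.
have [q Eq] := poly_on_line (p (map_tuple (fun k=> (k %% a%:Z)%Z) mu)) (fun i=> (tnth mu i)%:~R) (fun=> a%:R).
have [q' Eq'] := poly_on_line (p' (map_tuple (fun k=> (k %% a%:Z)%Z) (rcons_tuple mu 0)))
(fun i=> (tnth (rcons_tuple mu 0) i)%:~R) (fun i=> if (i < n)%N then a%:R else 0).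
have Q1 t : Qbar g n (shift t) = q.[t%:R].
rewrite Ep res_shift Eq;congr mpoly.meval;apply/funext=> i.
by rewrite tnth_map rmorphD/= -pmulrn natrM mulrC.
have Q2 t : Qbar g n.+1 (rcons_tuple (shift t) 0) = q'.[t%:R].
rewrite Ep' map_rcons_tuple res_shift -map_rcons_tuple Eq';congr mpoly.meval;apply/funext=> i.
have [j ->|->] := unliftP ord_max i;last by rewrite !tnth_rcons_max ltnn mulr0 addr0.
rewrite (_ : lift ord_max j = widen_ord (leqnSn n) j) ?tnth_rcons_widen/= ?ltn_ord;last by apply: val_inj;rewrite/= /bump leqNgt ltn_ord.
by rewrite tnth_map rmorphD/= -pmulrn natrM mulrC.
pose sm : {poly R} := (\sum_(i < n) tnth mu i)%:~R%:P + (n * a)%:R *: 'X.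
have Esm t : sm.[t%:R] = (\sum_(i < n) tnth (shift t) i)%:~R.
rewrite /sm hornerD hornerC hornerZ hornerX -!natrM.
under [in RHS]eq_bigr=> i _ do rewrite tnth_map.
rewrite big_split/= sumr_const card_ord rmorphD/=;congr (_ + _).
by rewrite pmulrn;congr (_%:~R);rewrite -mulr_natr natz -PoszM;congr Posz;rewrite -mulnA mulnC.
(* From this bound on, [a t] exceeds every entry in absolute value. *)
pose T := (\sum_(i < n) `|tnth mu i|).+1%N.
have E : q' = sm * q.
apply: (@poly_eq_large _ _ _ T)=> t Tt;rewrite hornerM -Q2 Esm -Q1.
have sp i : exists2 k : nat, (0 < k)%N & tnth (shift t) i = k%:Z.
 have lt : (`|tnth mu i| < t)%N.
  by rewrite (leq_trans _ Tt)// ltnS (bigD1 i)//= leq_addr.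
 have at_ : (t <= a * t)%N by rewrite leq_pmull.
 exists `|tnth (shift t) i|%N;rewrite tnth_map;move: at_ lt;clear;move: (a * t)%N (tnth mu i)=> s z;lia.
pose nu : n.-tuple nat := map_tuple (fun k : int=> `|k|%N) (shift t).
have Enu : shift t = map_tuple Posz nu.
 by apply: eq_from_tnth=> i;rewrite !tnth_map;have [k _] := sp i;rewrite tnth_map=> ->.
have nu0 i : (0 < tnth nu i)%N by rewrite tnth_map;have [k k0 ->] := sp i.
rewrite Enu pos// HQ//;congr (_ * _).
have -> : \sum_(i < n) tnth (map_tuple Posz nu) i = Posz (\sum_(i < n) tnth nu i).
 by elim/big_rec2: _=> // i x y _ ->;first [by rewrite tnth_map -PoszD|by rewrite tnth_map].
by rewrite -pmulrn.
have s0 : shift 0 = mu.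
by apply: eq_from_tnth=> i;rewrite tnth_map muln0 addr0.
by rewrite -{1}s0 Q2 E hornerM -Q1 Esm s0.
Qed.
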